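(* Fix any $\theta=(\beta,\sigma,\gamma)\in\Theta$. For each $u\in\mathbb{R}^3$ we have, under $P_\theta$, the stochastic expansion $$\ell_n(\theta+A_n(\beta)u)-\ell_n(\theta)=\mathcal{S}_n(\theta)[u]-\frac12\mathcal{I}(\theta)[u,u]+o_p(1)\qquad(n\to\infty),$$ where $\mathcal{S}_n(\theta)=A_n(\beta)\partial_\theta\ell_n(\theta)\xrightarrow{\mathcal{L}}N_3(0,\mathcal{I}(\theta))$ under $P_\theta$ with $$\mathcal{I}(\theta)=\begin{pmatrix}H_\beta/\beta^4&H_\beta/(\sigma\beta^2)&0\\H_\beta/(\sigma\beta^2)&H_\beta/\sigma^2&0\\0&0&M_\beta/\sigma^2\end{pmatrix},$$ $$H_\beta=\int\{\phi_\beta(y)+y\,\partial\phi_\beta(y)\}^2\phi_\beta(y)^{-1}dy,\qquad M_\beta=\int\{\partial\phi_\beta(y)\}^2\phi_\beta(y)^{-1}dy,$$ both $H_\beta$ and $M_\beta$ being finite. In particular, the Fisher information matrix $\mathcal{I}(\theta)$ is singular for any $\theta\in\Theta$.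
   Context: $\Theta\subset\mathbb{R}^3$ is a convex domain with compact closure contained in $\{(\beta,\sigma,\gamma):\beta\in(0,2),\ \sigma>0,\ \gamma\in\mathbb{R}\}$. Under $P_\theta$, $X=(X_t)_{t\ge0}$ is the symmetric $\beta$-stable L\'evy process with drift: $E_\theta(e^{iuX_t})=\exp\{-t\sigma^\beta|u|^\beta+it\gamma u\}$. $X$ is observed at times $jh_n$, $j=0,\dots,n$, where $h_n>0$, $h_n\to0$ and $\liminf_{n}nh_n>0$; $\Delta^n_jX=X_{jh_n}-X_{(j-1)h_n}$. $\phi_\beta$ denotes the Lebesgue density of the law with characteristic function $u\mapsto\exp(-|u|^\beta)$, and $\partial\phi_\beta(y)$ its derivative in $y$. The log-likelihood is $$\ell_n(\theta)=\sum_{j=1}^n\Big\{-\log\sigma+\beta^{-1}\log(1/h_n)+\log\phi_\beta\big(\sigma^{-1}h_n^{-1/\beta}(\Delta^n_jX-\gamma h_n)\big)\Big\},$$ and $$A_n(\beta)=\mathrm{diag}\Big\{\frac1{\sqrt n\log(1/h_n)},\ \frac1{\sqrt n},\ \frac1{\sqrt n\,h_n^{1-1/\beta}}\Big\}.$$ Notation: $v[u]=\sum_iv^{(i)}u^{(i)}$, $M[u,v]=\sum_{i,j}M^{(ij)}u^{(i)}v^{(j)}$. *)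

(* Defs.v *)
From HB Require Import structures.
From mathcomp Require Import all_boot all_order all_algebra complex.
From mathcomp Require Import all_classical all_reals all_analysis.

Set Implicit Arguments.
Unset Strict Implicit.
Unset Printing Implicit Defensive.

Import Order.TTheory GRing.Theory Num.Theory.
Import numFieldNormedType.Exports.

Local Open Scope classical_set_scope.
Local Open Scope ring_scope.
Local Open Scope complex_scope.

Definition dotv (R : realType) (m : nat) (v u : 'cV[R]_m) : R :=
  \sum_(i < m) v i 0 * u i 0.

Definition quadf (R : realType) (m : nat) (M : 'M[R]_m) (u v : 'cV[R]_m) : R :=
  \sum_(i < m) \sum_(j < m) M i j * u i 0 * v j 0.

Definition mx3 (R : realType) (rows : seq (seq R)) : 'M[R]_3 :=
  \matrix_(i < 3, j < 3) (nth [::] rows i)`_j.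

(* E(exp(i u Y)), computed through its real and imaginary parts. *)
Definition charfun d (T : measurableType d) (R : realType)
    (P : probability T R) (Y : T -> R) (u : R) : R[i] :=
  (\int[P]_w cos (u * Y w)) +i* (\int[P]_w sin (u * Y w)).

(* exp(a + i b) *)
Definition expc (R : realType) (a b : R) : R[i] :=
  (expR a * cos b) +i* (expR a * sin b).

(* f is the Lebesgue density of the law with characteristic function
   u |-> exp(-|u|^beta).  A density is only determined almost everywhere;
   continuity singles out the version to which pointwise expressions such as
   log f(y) and f'(y) refer. *)
Definition stable_density (R : realType) (beta : R) (f : R -> R) : Prop :=
  [/\ continuous f, (forall y, 0 <= f y) &
   exists mu : probability (measurableTypeR R) R,
     (forall A : set R, measurable A ->
        mu A = (\int[lebesgue_measure]_(y in A) (f y)%:E)%E) /\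
     (forall u : R, charfun mu idfun u = expc (- (`|u| `^ beta)) 0)].

Section Levy.
Context d (T : measurableType d) (R : realType) (P : probability T R).
Implicit Type X : R -> T -> R.

Definition independent_increments X : Prop :=
  forall (m : nat) (t : nat -> R) (B : nat -> set R),
    0 <= t 0%N ->
    (forall i, (i < m)%N -> t i <= t i.+1) ->
    (forall i, measurable (B i)) ->
    P [set w | forall i, (i < m)%N -> B i (X (t i.+1) w - X (t i) w)] =
    (\prod_(i < m) fine (P [set w | B i (X (t i.+1) w - X (t i) w)]))%:E.

Definition stationary_increments X : Prop :=
  forall (s t : R) (B : set R), 0 <= s -> 0 <= t -> measurable B ->
    P [set w | B (X (s + t) w - X s w)] = P [set w | B (X t w - X 0 w)].

Definition cadlag (x : R -> R) : Prop :=
  (forall t, 0 <= t -> x s @[s --> t^'+] --> x t) /\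
  (forall t, 0 < t -> cvg (x s @[s --> t^'-])).

(* Only the values X t with 0 <= t are meaningful. *)
Definition levy_process X : Prop :=
  [/\ (forall t, 0 <= t -> measurable_fun [set: T] (X t)),
      {ae P, forall w, X 0 w = 0},
      independent_increments X,
      stationary_increments X &
      {ae P, forall w, cadlag (fun t => X t w)}].

Definition stable_levy_with_drift (beta sigma gamma : R) X : Prop :=
  levy_process X /\
  forall t u : R, 0 <= t ->
    charfun P (X t) u =
    expc (- (t * sigma `^ beta * `|u| `^ beta)) (t * gamma * u).

(* Measurability is only required for large n: the variables below involve
   parameters which lie in the parameter space for large n only. *)
Definition little_op1 (Z : nat -> T -> R) : Prop :=
  (\forall n \near \oo, measurable_fun [set: T] (Z n)) /\
  forall e : R, 0 < e -> P [set w | e < `|Z n w|] @[n --> \oo] --> 0%E.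

(* N_m(mu, Sigma), possibly degenerate, through its characteristic function. *)
Definition normal_vector (m : nat) (mu : 'cV[R]_m) (Sigma : 'M[R]_m)
    (Z : T -> 'cV[R]_m) : Prop :=
  (forall i, measurable_fun [set: T] (fun w => Z w i 0)) /\
  forall u : 'cV[R]_m,
    charfun P (fun w => dotv u (Z w)) 1 =
    expc (- (2^-1 * quadf Sigma u u)) (dotv mu u).

End Levy.

Definition cvg_in_law d (T : measurableType d) d' (T' : measurableType d')
    (R : realType) (P : probability T R) (Q : probability T' R) (m : nat)
    (S : nat -> T -> 'cV[R]_m.+1) (Z : T' -> 'cV[R]_m.+1) : Prop :=
  (\forall n \near \oo,
     forall i, measurable_fun [set: T] (fun w => S n w i 0)) /\
  forall f : 'cV[R]_m.+1 -> R, continuous f ->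
    (exists C : R, forall x, `|f x| <= C) ->
    \int[P]_w f (S n w) @[n --> \oo] --> \int[Q]_z f (Z z).

(* S n converges in law under P to N_m(mu, Sigma). *)
Definition cvg_in_law_normal d (T : measurableType d) (R : realType)
    (P : probability T R) (m : nat) (S : nat -> T -> 'cV[R]_m.+1)
    (mu : 'cV[R]_m.+1) (Sigma : 'M[R]_m.+1) : Prop :=
  exists (d' : measure_display) (T' : measurableType d')
         (Q : probability T' R) (Z : T' -> 'cV[R]_m.+1),
    normal_vector Q mu Sigma Z /\ cvg_in_law P Q S Z.

(* A parameter is the column vector (beta, sigma, gamma)^T. *)
Definition pbeta (R : realType) (theta : 'cV[R]_3) : R := theta 0 0.
Definition psigma (R : realType) (theta : 'cV[R]_3) : R := theta 1 0.
Definition pgamma (R : realType) (theta : 'cV[R]_3) : R := theta 2%:R 0.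

Definition parameter_space (R : realType) (Theta : set 'cV[R]_3) : Prop :=
  [/\ open Theta, convex_set Theta, compact (closure Theta) &
      closure Theta `<=`
        [set theta | 0 < pbeta theta < 2 /\ 0 < psigma theta]].

Section Likelihood.
Context d (T : measurableType d) (R : realType).
Variables (phi : R -> R -> R) (h : nat -> R) (X : R -> T -> R).

(* Delta^n_j X *)
Definition increment (n j : nat) (w : T) : R :=
  X (j%:R * h n) w - X (j.-1%:R * h n) w.

Definition loglik (n : nat) (w : T) (theta : 'cV[R]_3) : R :=
  \sum_(1 <= j < n.+1)
    (- ln (psigma theta) + (pbeta theta)^-1 * ln (1 / h n)
     + ln (phi (pbeta theta)
             ((psigma theta)^-1 * h n `^ (- (pbeta theta)^-1)
              * (increment n j w - pgamma theta * h n)))).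

Definition gradient (f : 'cV[R]_3 -> R) (theta : 'cV[R]_3) : 'cV[R]_3 :=
  \col_(i < 3) 'D_(delta_mx i 0) f theta.

Definition rate (beta : R) (n : nat) : 'M[R]_3 :=
  mx3 [:: [:: (Num.sqrt n%:R * ln (1 / h n))^-1; 0; 0];
          [:: 0; (Num.sqrt n%:R)^-1; 0];
          [:: 0; 0; (Num.sqrt n%:R * h n `^ (1 - beta^-1))^-1]].

Definition score (theta : 'cV[R]_3) (n : nat) (w : T) : 'cV[R]_3 :=
  rate (pbeta theta) n *m gradient (loglik n w) theta.

Definition Hphi (beta : R) : \bar R :=
  (\int[lebesgue_measure]_y
     ((phi beta y + y * derive1 (phi beta) y) ^+ 2 / phi beta y)%:E)%E.

Definition Mphi (beta : R) : \bar R :=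
  (\int[lebesgue_measure]_y ((derive1 (phi beta) y) ^+ 2 / phi beta y)%:E)%E.

Definition fisher (theta : 'cV[R]_3) : 'M[R]_3 :=
  let b := pbeta theta in let s := psigma theta in
  let H := fine (Hphi b) in let M := fine (Mphi b) in
  mx3 [:: [:: H / b ^+ 4; H / (s * b ^+ 2); 0];
          [:: H / (s * b ^+ 2); H / s ^+ 2; 0];
          [:: 0; 0; M / s ^+ 2]].

End Likelihood.

(* Main.v *)
(* Set Y_j = sigma^-1 h_n^(-1/beta) (Delta_j X - gamma h_n).  Under P_theta the Y_j are
   i.i.d. with density phi_beta, and the log-likelihood ratio is the sum over j of
   log (f_n / phi_beta) (Y_j), where f_n is the density of c_n + e^(s_n) Z with Z of
   density phi_(beta_n); moreover sqrt n (beta_n - beta) -> 0,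
   sqrt n s_n -> u_1 / beta^2 + u_2 / sigma and sqrt n c_n -> u_3 / sigma.  Hence only
   scale and location survive in the limit, and the information is singular.
   Differentiability in quadratic mean of this family gives the expansion.  The score is
   a normalized sum of bounded i.i.d. variables, up to a term of order 1 / log (1 / h_n),
   and its limit follows from the central limit theorem and Levy's continuity theorem.

   The stable densities are cosine transforms.  Integrating by parts three times bounds
   them and their derivatives in y and beta by |y|^-(1 + beta), up to |y|^epsilon for the
   derivative in beta, locally uniformly in beta.  The matching lower bound holds because
   (1 + beta) phi + y phi' decays faster, so that y^(1 + beta) phi(y) is almost constant
   for large y, and because this constant cannot be small: 1 - e^(-|u|^beta) is not
   O(u^2). *)

Require Import Defs.
From mathcomp Require Import all_boot all_order all_algebra.
From mathcomp Require Import all_classical all_reals all_analysis.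
From mathcomp Require Import measurable_realfun.
From mathcomp Require Import ring lra.

Set Implicit Arguments.
Unset Strict Implicit.
Unset Printing Implicit Defensive.

Import Order.TTheory GRing.Theory Num.Theory.
Import numFieldNormedType.Exports.
Local Open Scope classical_set_scope.
Local Open Scope ring_scope.

(** * Integrals of real-valued functions *)

(** Differentiability in quadratic mean asks for first derivatives of the density only, where a
    Taylor expansion of the likelihood would ask for uniform control of second ones. The obstacle is
    the score in [beta]: it contains [stab_b / stab], which is only bounded by a small power of |y|.
    That quotient never enters the limit, because it comes divided by [ln (1 / h n)], and square
    integrability suffices for it. The scale and location scores are bounded, since numerator and
    density have the same polynomial tail.

    Sums and limits are handled through [cos (x + ...)] with a free phase [x], so that one real
    statement contains the real and the imaginary part of a characteristic function. Weak
    convergence is tested on triangle functions, whose transform is nonnegative and integrable: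
    their expectations are integrals of characteristic functions. This one device gives uniqueness
    of laws and, on grids, the continuity theorem. Some objects take a default value for small [n],
    so that measurability and integrability hold for every [n]. *)

Section real_integrals.
Context d (T : measurableType d) (R : realType) (mu : {measure set T -> \bar R}).
Implicit Types (D : set T) (f g : T -> R).

Lemma Rintegrable_le D f g : measurable D -> measurable_fun D f ->
  (forall x, D x -> `|f x| <= g x) -> mu.-integrable D (EFin \o g) ->
  mu.-integrable D (EFin \o f).
Proof.
move=> mD mf fg ig; apply: le_integrable ig => //; first exact/measurable_EFinP.
by move=> x Dx /=; rewrite lee_fin (le_trans (fg _ Dx))// ler_norm.
Qed.

Lemma RintegrableZ D f (c : R) : measurable D -> mu.-integrable D (EFin \o f) ->
  mu.-integrable D (EFin \o (fun x => c * f x)).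
Proof.
by move=> mD /(integrableZl mD c); apply: eq_integrable.
Qed.

Lemma RintegrableD D f g : measurable D -> mu.-integrable D (EFin \o f) ->
  mu.-integrable D (EFin \o g) -> mu.-integrable D (EFin \o (fun x => f x + g x)).
Proof. by move=> mD f1 g1; have := integrableD mD f1 g1; apply: eq_integrable. Qed.

Lemma RintegrableB D f g : measurable D -> mu.-integrable D (EFin \o f) ->
  mu.-integrable D (EFin \o g) -> mu.-integrable D (EFin \o (fun x => f x - g x)).
Proof. by move=> mD f1 g1; have := integrableB mD f1 g1; apply: eq_integrable. Qed.

Lemma Rintegrable_meas D f : mu.-integrable D (EFin \o f) -> measurable_fun D f.
Proof. by move/measurable_int/measurable_EFinP. Qed.

Lemma Rintegrable_norm D f : measurable D -> mu.-integrable D (EFin \o f) ->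
  mu.-integrable D (EFin \o (fun x => `|f x|)).
Proof.
move=> mD intf; apply: (@Rintegrable_le D _ (fun x => `|f x|)) => //.
- by apply: measurableT_comp => //; exact: Rintegrable_meas intf.
- by move=> x _; rewrite normr_id.
- by have := integrable_abse intf; apply: eq_integrable.
Qed.

Lemma Rintegrable_restrict D f : measurable D ->
  mu.-integrable D (EFin \o f) <-> mu.-integrable setT (EFin \o (f \_ D)).
Proof. by move=> mD; rewrite -restrict_EFin; exact: integrable_mkcond. Qed.

Lemma Rintegral_dominated_cvg D (f_ : nat -> T -> R) f g : measurable D ->
  (forall n, measurable_fun D (f_ n)) ->
  (forall x, D x -> f_ n x @[n --> \oo] --> f x) ->
  mu.-integrable D (EFin \o g) ->
  (forall n x, D x -> `|f_ n x| <= g x) ->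
  \int[mu]_(x in D) f_ n x @[n --> \oo] --> \int[mu]_(x in D) f x.
Proof.
move=> mD mf_ f_f ig f_g.
have mf : measurable_fun D f by apply: measurable_fun_cvg f_f.
have [|||||i _] := @dominated_convergence _ _ _ mu _ mD (fun n => EFin \o f_ n)
  (EFin \o f) (EFin \o g).
- by move=> n; exact/measurable_EFinP.
- exact/measurable_EFinP.
- by apply: aeW => x Dx; apply: cvg_EFin; [exact: nearW|exact: f_f].
- exact: ig.
- by apply: aeW => x n Dx; rewrite /= lee_fin; exact: f_g.
move=> c; apply: fine_cvg; rewrite fineK//.
exact: integrable_fin_num.
Qed.

End real_integrals.

Section real_fubini.
Context d1 d2 (T1 : measurableType d1) (T2 : measurableType d2) (R : realType).
Variables (m1 : {sigma_finite_measure set T1 -> \bar R})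
  (m2 : {sigma_finite_measure set T2 -> \bar R}).
Variables (f : T1 -> T2 -> R) (a : T1 -> R) (b : T2 -> R).
Hypotheses (mf : measurable_fun setT (fun z : T1 * T2 => f z.1 z.2))
  (ia : m1.-integrable setT (EFin \o a)) (ib : m2.-integrable setT (EFin \o b))
  (fab : forall x y, `|f x y| <= a x * b y).

Let imf : (m1 \x m2)%E.-integrable setT (fun z : T1 * T2 => (f z.1 z.2)%:E).
Proof.
apply/integrable12ltyP; first exact/measurable_EFinP.
have ma : measurable_fun setT a := Rintegrable_meas ia.
have mb : measurable_fun setT b := Rintegrable_meas ib.
have ab : (\int[m1]_x \int[m2]_y (`|(b y)%:E| * `|(a x)%:E|) < +oo)%E.
  have bfin : (\int[m2]_y `|(b y)%:E|)%E \is a fin_num.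
    by move/integrableP : ib => -[_ h]; rewrite ge0_fin_numE// integral_ge0.
  have -> : (\int[m1]_x \int[m2]_y (`|(b y)%:E| * `|(a x)%:E|) =
      \int[m1]_x ((\int[m2]_y `|(b y)%:E|) * `|(a x)%:E|))%E.
    apply: eq_integral => x _.
    rewrite -(@ge0_integralZr _ _ _ m2 setT measurableT (fun y => `|(b y)%:E|%E))//.
    by apply/measurable_EFinP; exact: measurableT_comp.
  rewrite ge0_integralZl//; last 2 first.
    by apply/measurable_EFinP; exact: measurableT_comp.
    by rewrite integral_ge0.
  move/integrableP : ia => -[_ h].
  rewrite -(fineK bfin) lte_mul_pinfty ?lee_fin//.
  by rewrite fine_ge0// integral_ge0.
have mabs : measurable_fun setT (fun z : T1 * T2 => (`|f z.1 z.2|)%:E).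
  by apply/measurable_EFinP; exact: measurableT_comp.
apply: le_lt_trans ab; apply: ge0_le_integral => //.
- by move=> x _; exact: integral_ge0.
- exact: (measurable_fun_fubini_tonelli_F _ mabs).
- have : measurable_fun setT (fun z : T1 * T2 => (`|b z.2|)%:E * (`|a z.1|)%:E)%E.
    apply: emeasurable_funM; apply/measurable_EFinP; apply: measurableT_comp => //.
      exact: measurableT_comp.
    exact: measurableT_comp.
  by move/measurable_fun_fubini_tonelli_F; apply.
- move=> x _; apply: ge0_le_integral => //.
  + by apply: measurableT_comp mabs _ => //; exact: measurable_pair1.
  + apply: emeasurable_funM => //; apply/measurable_EFinP.
    exact: measurableT_comp.
  + move=> y _; rewrite -EFinM lee_fin (le_trans (fab x y))// mulrC -normrM.
    exact: ler_norm.
Qed.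

(** A product bound [a x * b y] makes the kernel integrable for the product measure by Tonelli.
    Every exchange of integrals below has this shape: a trigonometric factor times a function of
    each variable. *)
Lemma Rfubini_dominated :
  \int[m1]_x \int[m2]_y f x y = \int[m2]_y \int[m1]_x f x y.
Proof.
rewrite /Rintegral.
have := Fubini imf; rewrite /=.
have ma : measurable_fun setT a := Rintegrable_meas ia.
have mb : measurable_fun setT b := Rintegrable_meas ib.
have i1 x : m2.-integrable setT (EFin \o f x).
  apply: (@Rintegrable_le _ _ _ _ _ _ (fun y => a x * b y)) => //.
    exact: (measurableT_comp mf (pair1_measurable x)).
  by apply: RintegrableZ.
have i2 y : m1.-integrable setT (EFin \o f ^~ y).
  apply: (@Rintegrable_le _ _ _ _ _ _ (fun x => b y * a x)) => //.
    exact: (measurableT_comp mf (pair2_measurable y)).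
    by move=> x _; rewrite mulrC.
  by apply: RintegrableZ.
move=> E; congr fine.
transitivity (\int[m1]_x \int[m2]_y (f x y)%:E)%E.
  apply: eq_integral => x _; rewrite fineK//.
  exact: (integrable_fin_num _ (i1 x)).
rewrite E; apply: eq_integral => y _; rewrite fineK//.
exact: (integrable_fin_num _ (i2 y)).
Qed.

End real_fubini.

Section lebesgue_real.
Context (R : realType).
Notation mu := (@lebesgue_measure R).

Let mopp0 : measurable_fun [set: measurableTypeR R] (-%R : R -> R).
Proof. by apply: measurable_funN; exact: measurable_id. Qed.

Let mopp : measurable_fun [set: measurableTypeR R]
  (-%R : measurableTypeR R -> measurableTypeR R).
Proof. exact: mopp0. Qed.

(** The image measure under negation agrees with the Lebesgue measure on half-open intervals, and
    uniqueness does the rest. *)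
Lemma lebesgue_measure_opp (A : set R) : measurable A ->
  mu (-%R @^-1` A) = mu A.
Proof.
move=> mA.
rewrite -[LHS]/(pushforward mu (-%R : measurableTypeR R -> measurableTypeR R) A).
symmetry; apply: (lebesgue_measure_unique
  (mu := pushforward mu (-%R : measurableTypeR R -> measurableTypeR R))) => //.
move=> X [[a b]] /= _ <-.
rewrite /pushforward.
have -> : -%R @^-1` [set` Interval (BRight a) (BRight b)] = `[- b, - a[%classic.
  by apply/seteqP; split => x; rewrite /= !in_itv/= => /andP[? ?]; apply/andP; split; lra.
rewrite !lebesgue_measure_itv/= !lte_fin ltrN2.
by case: ifPn => // _; rewrite -!EFinD opprK addrC.
Qed.

Lemma ge0_integral_opp (f : R -> \bar R) : (forall x, 0 <= f x)%E ->
  measurable_fun setT f -> (\int[mu]_x f x = \int[mu]_x f (- (x : R))%R)%E.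
Proof.
move=> f0 mf.
transitivity (\int[pushforward mu (-%R : measurableTypeR R -> measurableTypeR R)]_x (f x))%E.
  apply: eq_measure_integral => A mA _ /=.
  by rewrite /pushforward lebesgue_measure_opp.
by rewrite ge0_integral_pushforward.
Qed.

Lemma Rintegral_opp (f : R -> R) : mu.-integrable setT (EFin \o f) ->
  \int[mu]_x f x = \int[mu]_x f (- (x : R)).
Proof.
move=> intf; rewrite /Rintegral; congr fine.
rewrite [LHS]integralE [RHS]integralE.
have mf := measurable_int _ intf.
rewrite (ge0_integral_opp (f := ((EFin \o f)^\+)%E))//; last exact: measurable_funepos.
rewrite (ge0_integral_opp (f := ((EFin \o f)^\-)%E))//; last exact: measurable_funeneg.
by congr (_ - _)%E; apply: eq_integral => x _; rewrite ?funeposE ?funenegE.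
Qed.

Lemma Rintegral_even (f : R -> R) : mu.-integrable setT (EFin \o f) ->
  (forall x, f (- x) = f x) ->
  \int[mu]_x f x = 2 * \int[mu]_(x in `[0, +oo[) f x.
Proof.
move=> intf ef.
have i1 : mu.-integrable `]-oo, 0[ (EFin \o f) by apply: integrableS intf.
have i2 : mu.-integrable `[0, +oo[ (EFin \o f) by apply: integrableS intf.
have U : [set: R] = `]-oo, 0[%classic `|` `[0, +oo[%classic.
  by apply/seteqP; split=> // x _; rewrite /= !in_itv/= andbT; case: ltP; [left|right].
rewrite {1}U Rintegral_setU//; [|by rewrite -U|]; last first.
  by apply/disj_setPLR => x /=; rewrite !in_itv/= andbT; case: ltP.
rewrite mulr_natl mulr2n; congr (_ + _).
rewrite Rintegral_itv_bndo_bndc//.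
rewrite Rintegral_mkcond Rintegral_opp; last first.
  have : mu.-integrable `]-oo, 0%R] (EFin \o f) by apply: integrableS intf.
  by move/Rintegrable_restrict; apply; exact: measurable_itv.
rewrite [RHS]Rintegral_mkcond; apply: eq_Rintegral => x _.
rewrite !patchE !mem_setE !in_itv/= andbT oppr_le0 ef//.
Qed.

(** Integrability takes the place of a sign condition, because the integrands oscillate. Only a
    one-sided limit is asked at [a]: the functions of [ln u] to which this is applied are not
    differentiable at 0. Compact intervals exhaust the half-line and dominated convergence
    concludes. *)
Lemma integrable_FTC2y (f F : R -> R) (a l0 l : R) :
  (forall x, a < x -> is_derive x 1 F (f x)) ->
  (forall x, a < x -> {for x, continuous f}) ->
  mu.-integrable `]a, +oo[ (EFin \o f) ->
  F x @[x --> a^'+] --> l0 -> F x @[x --> +oo] --> l ->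
  \int[mu]_(x in `]a, +oo[) f x = l - l0.
Proof.
move=> dF cf intf Fa Fy.
(* The shift by 2 keeps [u n < v n] at [n = 0], where [u 0 = a + 1]. *)
pose u n : R := a + (n.+1%:R)^-1; pose v n : R := a + n.+2%:R.
have au n : a < u n by rewrite /u ltrDl invr_gt0 ltr0n.
have uv n : u n < v n.
  by rewrite /u /v ltrD2l (@le_lt_trans _ _ 1)// ?invf_le1 ?ltr0n ?ler1n ?ltr1n.
have E n : \int[mu]_(x in `[u n, v n]) f x = F (v n) - F (u n).
  rewrite /Rintegral (@continuous_FTC2 _ f F)//.
  - apply: continuous_in_subspaceT => x; rewrite inE/= in_itv/= => /andP[ux _].
    by apply: cf; exact: lt_le_trans ux.
  - have dFx x : u n <= x -> derivable F x 1.
      by move=> ux; have [] := dF x (lt_le_trans (au n) ux).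
    have cF x : u n <= x -> {for x, continuous F}.
      by move=> ux; apply/differentiable_continuous/derivable1_diffP/dFx.
    split.
    + by move=> x; rewrite in_itv/= => /andP[/ltW ux _]; exact: dFx.
    + by apply: cvg_at_right_filter; apply: cF.
    + by apply: cvg_at_left_filter; apply: cF; exact/ltW/uv.
  - move=> x; rewrite in_itv/= => /andP[ux _].
    by rewrite derive1E; have [_ ->] := dF x (lt_trans (au n) ux).
have u0 : u n @[n --> \oo] --> a.
  rewrite -[X in _ --> X]addr0; apply: cvgD; first exact: cvg_cst.
  exact: cvg_harmonic.
have voo : v n @[n --> \oo] --> +oo.
  apply/cvgryPge => A; near=> n.
  rewrite /v -lerBlDl; apply: (@le_trans _ _ n%:R); last by rewrite ler_nat -addn2 leq_addr.
  by near: n; exact: nbhs_infty_ger.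
have c1 : F (v n) - F (u n) @[n --> \oo] --> l - l0.
  apply: cvgB; first exact: (cvg_comp _ _ voo).
  by move/cvg_at_rightP : Fa; apply.
have c2 : \int[mu]_(x in `]a, +oo[) (f \_ `[u n, v n]) x @[n --> \oo] -->
    \int[mu]_(x in `]a, +oo[) f x.
  apply: (@Rintegral_dominated_cvg _ _ _ mu `]a, +oo[%classic _ _ (fun x => `|f x|)) => //.
  - move=> n; apply/measurable_restrict => //.
    by apply: measurable_funS (Rintegrable_meas intf) => // x [].
  - move=> x; rewrite /= in_itv/= andbT => ax.
    apply: cvg_near_cst; near=> n.
    rewrite patchE mem_set//= in_itv/=; apply/andP; split.
      near: n; apply: (cvgr_le _ u0); exact: ax.
    near: n; move/cvgryPge : voo; exact.
  - exact: Rintegrable_norm.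
  - by move=> n x _; rewrite patchE; case: ifPn => // _; rewrite normr0.
have c3 : F (v n) - F (u n) @[n --> \oo] --> \int[mu]_(x in `]a, +oo[) f x.
  rewrite (_ : (fun n => _) = fun n => \int[mu]_(x in `]a, +oo[) (f \_ `[u n, v n]) x)//.
  apply/funext => n; rewrite -E [RHS]Rintegral_mkcond [LHS]Rintegral_mkcond.
  apply: eq_Rintegral => x _; rewrite !patchE.
  have [|_] := boolP (x \in `[u n, v n]%classic); last by case: ifP.
  rewrite inE/= in_itv/= => /andP[ux _].
  by rewrite mem_set//= in_itv/= (lt_le_trans (au n)).
exact: cvg_unique c3 c1.
Unshelve. all: by end_near. Qed.

End lebesgue_real.

(** * Derivatives, measurability and polynomial weights *)

Section derivative_rules.
Context (R : realType).
Implicit Types (f g : R -> R) (x a b c : R).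

Lemma der_eq f x a b : is_derive x 1 f a -> a = b -> is_derive x 1 f b.
Proof. by move=> + <-. Qed.

Lemma der_cst x c : is_derive x 1 (fun _ : R => c) 0.
Proof. exact: is_derive_cst. Qed.

Lemma der_id x : is_derive x 1 (fun y : R => y) 1.
Proof. exact: is_derive_id. Qed.

Lemma derD f g x a b : is_derive x 1 f a -> is_derive x 1 g b ->
  is_derive x 1 (fun y => f y + g y) (a + b).
Proof. by move=> ? ?; exact: is_deriveD. Qed.

Lemma derN f x a : is_derive x 1 f a -> is_derive x 1 (fun y => - f y) (- a).
Proof. by move=> ?; exact: is_deriveN. Qed.

Lemma derM f g x a b : is_derive x 1 f a -> is_derive x 1 g b ->
  is_derive x 1 (fun y => f y * g y) (a * g x + f x * b).
Proof.
move=> df dg; have h := is_deriveM df dg; apply: (der_eq h).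
by rewrite /GRing.scale/=; ring.
Qed.

Lemma derX f n x a : is_derive x 1 f a ->
  is_derive x 1 (fun y => f y ^+ n.+1) (n.+1%:R * f x ^+ n * a).
Proof.
move=> df; have h := @is_deriveX _ _ f n.+1 x 1 a df.
have -> : (fun y => f y ^+ n.+1) = f ^+ n.+1 by apply/funext => y; rewrite exprfctE.
by apply: (der_eq h).
Qed.

Lemma der_comp f g x a b : is_derive (g x) 1 f a -> is_derive x 1 g b ->
  is_derive x 1 (fun y => f (g y)) (a * b).
Proof. by move=> df dg; exact: is_derive1_comp. Qed.

Lemma der_exp f x a : is_derive x 1 f a ->
  is_derive x 1 (fun y => expR (f y)) (expR (f x) * a).
Proof. by move=> df; apply: der_comp df; exact: is_derive_expR. Qed.

Lemma der_sin f x a : is_derive x 1 f a ->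
  is_derive x 1 (fun y => sin (f y)) (cos (f x) * a).
Proof. by move=> df; apply: der_comp df; exact: is_derive_sin. Qed.

Lemma der_cos f x a : is_derive x 1 f a ->
  is_derive x 1 (fun y => cos (f y)) (- sin (f x) * a).
Proof. by move=> df; apply: der_comp df; exact: is_derive_cos. Qed.

Lemma der_ln f x a : 0 < f x -> is_derive x 1 f a ->
  is_derive x 1 (fun y => ln (f y)) ((f x)^-1 * a).
Proof. by move=> f0 df; apply: der_comp df; exact: is_derive1_ln. Qed.

Lemma der_inv f x a : f x != 0 -> is_derive x 1 f a ->
  is_derive x 1 (fun y => (f y)^-1) (- (f x) ^- 2 * a).
Proof. by move=> f0 df; have h := is_deriveV f0 df; apply: (der_eq h). Qed.

Lemma der_sqrt f x a : 0 < f x -> is_derive x 1 f a ->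
  is_derive x 1 (fun y => Num.sqrt (f y)) ((2 * Num.sqrt (f x))^-1 * a).
Proof. by move=> f0 df; apply: der_comp df; exact: is_derive1_sqrt. Qed.

Lemma der_continuous f x a : is_derive x 1 f a -> {for x, continuous f}.
Proof. by move=> [df _]; apply/differentiable_continuous/derivable1_diffP. Qed.

Lemma der_derive1 f x a : is_derive x 1 f a -> derive1 f x = a.
Proof. by move=> [_ <-]; rewrite derive1E. Qed.

End derivative_rules.

(** Syntax-directed differentiation. Hypotheses are tried first, so the derivative of an abstract
    function enters through the context; [der] leaves the equation between the computed and the
    claimed value. Since [is_derive] is a class, [notypeclasses] keeps instance search out. *)
Ltac der_rules R := first
  [ eassumption
  | notypeclasses refine (@der_cst R _ _)
  | notypeclasses refine (@der_id R _)
  | notypeclasses refine (@derD R _ _ _ _ _ _ _); [der_rules R|der_rules R]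
  | notypeclasses refine (@derN R _ _ _ _); der_rules R
  | notypeclasses refine (@derX R _ _ _ _ _); der_rules R
  | notypeclasses refine (@derM R _ _ _ _ _ _ _); [der_rules R|der_rules R]
  | notypeclasses refine (@der_exp R _ _ _ _); der_rules R
  | notypeclasses refine (@der_sin R _ _ _ _); der_rules R
  | notypeclasses refine (@der_cos R _ _ _ _); der_rules R
  | notypeclasses refine (@der_ln R _ _ _ _ _); [try done|der_rules R]
  | notypeclasses refine (@der_sqrt R _ _ _ _ _); [try done|der_rules R]
  | notypeclasses refine (@der_inv R _ _ _ _ _); [try done|der_rules R] ].
Ltac der := match goal with R : realType |- _ =>
  notypeclasses refine (@der_eq R _ _ _ _ _ _); [der_rules R|cbv beta delta [Datatypes.id]] end.

Section measurability_rules.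
Context d (T : measurableType d) (R : realType) (D : set T).
Implicit Types (f g : T -> R).

Lemma meas_cst (c : R) : measurable_fun D (fun _ => c).
Proof. exact: measurable_cst. Qed.

Lemma measD f g : measurable_fun D f -> measurable_fun D g ->
  measurable_fun D (fun x => f x + g x).
Proof. exact: measurable_funD. Qed.

Lemma measN f : measurable_fun D f -> measurable_fun D (fun x => - f x).
Proof. exact: measurable_funN. Qed.

Lemma measM f g : measurable_fun D f -> measurable_fun D g ->
  measurable_fun D (fun x => f x * g x).
Proof. exact: measurable_funM. Qed.

Lemma measX f n : measurable_fun D f -> measurable_fun D (fun x => f x ^+ n).
Proof. exact: measurable_funX. Qed.

Lemma meas_comp (h : R -> R) f : measurable_fun setT h -> measurable_fun D f ->
  measurable_fun D (fun x => h (f x)).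
Proof. exact: measurableT_comp. Qed.

Lemma meas_continuous (h : R -> R) f : continuous h -> measurable_fun D f ->
  measurable_fun D (fun x => h (f x)).
Proof. by move=> ch; apply: meas_comp; exact: continuous_measurable_fun. Qed.

Lemma meas_expR f : measurable_fun D f -> measurable_fun D (fun x => expR (f x)).
Proof. by apply: meas_continuous; exact: continuous_expR. Qed.

Lemma meas_sin f : measurable_fun D f -> measurable_fun D (fun x => sin (f x)).
Proof. by apply: meas_continuous; exact: continuous_sin. Qed.

Lemma meas_cos f : measurable_fun D f -> measurable_fun D (fun x => cos (f x)).
Proof. by apply: meas_continuous; exact: continuous_cos. Qed.

Lemma meas_ln f : measurable_fun D f -> measurable_fun D (fun x => ln (f x)).
Proof. by apply: meas_comp; exact: measurable_ln. Qed.

Lemma meas_norm f : measurable_fun D f -> measurable_fun D (fun x => `|f x|).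
Proof. by apply: meas_continuous; exact: norm_continuous. Qed.

Lemma meas_sqrt f : measurable_fun D f -> measurable_fun D (fun x => Num.sqrt (f x)).
Proof. by apply: meas_continuous; exact: sqrt_continuous. Qed.

(** Inversion is discontinuous at 0, but it is the pointwise limit of the continuous functions x /
    (x^2 + 1 / (n + 1)), which also gives the convention that the inverse of 0 is 0. *)
Lemma measV f : measurable_fun D f -> measurable_fun D (fun x => (f x)^-1).
Proof.
apply: (meas_comp (h := fun x => x^-1)).
apply: (@measurable_fun_cvg _ _ _ _ (fun n (x : R) => x * (x ^+ 2 + n.+1%:R^-1)^-1)).
  move=> n; apply: measurable_funM; first exact: measurable_id.
  apply: continuous_measurable_fun => x.
  apply: cvgV; first by rewrite gt_eqF// ltr_wpDl ?sqr_ge0// invr_gt0 ltr0n.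
  by apply: cvgD; [exact: exprn_continuous|exact: cvg_cst].
move=> x _; have [->|x0] := eqVneq x 0.
  by rewrite invr0; apply: cvg_near_cst; apply: nearW => n; rewrite mul0r.
rewrite [X in _ --> X](_ : _ = x * (x ^+ 2 + 0)^-1); last by field.
apply: cvgM; first exact: cvg_cst.
apply: cvgV; first by rewrite addr0 sqrf_eq0.
by apply: cvgD; [exact: cvg_cst|exact: cvg_harmonic].
Qed.

Lemma meas_powR f (a : R) : measurable_fun D f -> measurable_fun D (fun x => f x `^ a).
Proof. by apply: (meas_comp (h := fun x => x `^ a)); exact: measurable_powR. Qed.

End measurability_rules.

Ltac meas_step := match goal with
  | H : measurable_fun ?D ?f |- measurable_fun ?D ?f => exact H
  | |- measurable_fun _ (fun _ => ?c) => exact: meas_cst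
  | |- measurable_fun _ (fun x => x) => exact: measurable_id
  | |- measurable_fun _ (fun x => (_ + _)%R) => apply: measD
  | |- measurable_fun _ (fun x => (- _)%R) => apply: measN
  | |- measurable_fun _ (fun x => (_ ^+ _)%R) => apply: measX
  | |- measurable_fun _ (fun x => (_ * _)%R) => apply: measM
  | |- measurable_fun _ (fun x => expR _) => apply: meas_expR
  | |- measurable_fun _ (fun x => sin _) => apply: meas_sin
  | |- measurable_fun _ (fun x => cos _) => apply: meas_cos
  | |- measurable_fun _ (fun x => ln _) => apply: meas_ln
  | |- measurable_fun _ (fun x => `|_|%R) => apply: meas_norm
  | |- measurable_fun _ (fun x => Num.sqrt _) => apply: meas_sqrt
  | |- measurable_fun _ (fun x => (_^-1)%R) => apply: measV
  | |- measurable_fun _ (fun x => (_ `^ _)%R) => apply: meas_powR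
  | |- _ => first [ assumption | exact: measurable_fst | exact: measurable_snd
                  | apply: meas_expR | apply: meas_sin | apply: meas_cos | apply: meas_ln ]
  end.

Ltac meas := repeat meas_step.

Ltac by_der_cont := match goal with R : realType |- _ =>
  move=> ?; notypeclasses refine (@der_continuous R _ _ _ _); der_rules R end.

Section weights.
Context (R : realType).
Notation mu := (@lebesgue_measure R).

Definition wt (a y : R) : R := (1 + `|y|) `^ (- a).

Lemma wtE a y : wt a y = expR (- a * ln (1 + `|y|)).
Proof. by rewrite /wt /powR gt_eqF// ltr_pwDl. Qed.

Lemma wt_gt0 a y : 0 < wt a y. Proof. by rewrite wtE expR_gt0. Qed.

Lemma wt_ge0 a y : 0 <= wt a y. Proof. exact/ltW/wt_gt0. Qed.

Lemma ln1Dnorm_ge0 (y : R) : 0 <= ln (1 + `|y|).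
Proof. by rewrite ln_ge0// lerDl. Qed.

Lemma wtM a b y : wt a y * wt b y = wt (a + b) y.
Proof. by rewrite !wtE -expRD; congr expR; ring. Qed.

Lemma wt_le a b y : a <= b -> wt b y <= wt a y.
Proof.
by move=> ab; rewrite !wtE ler_expR ler_wpM2r ?ln1Dnorm_ge0// lerN2.
Qed.

Lemma wt0 y : wt 0 y = 1. Proof. by rewrite wtE oppr0 mul0r expR0. Qed.

Lemma wt_le1 a y : 0 <= a -> wt a y <= 1.
Proof. by move=> a0; rewrite -(wt0 y); exact: wt_le. Qed.

Lemma wtN a y : wt a (- y) = wt a y. Proof. by rewrite /wt normrN. Qed.

Lemma wtX a n y : wt a y ^+ n = wt (n%:R * a) y.
Proof. by rewrite !wtE -expRM_natl; congr expR; ring. Qed.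

Lemma wt_sqrt a y : Num.sqrt (wt a y) = wt (a / 2) y.
Proof.
have -> : a = 2%:R * (a / 2) by lra.
by rewrite -wtX sqrtr_sqr ger0_norm ?wt_ge0//; congr wt; lra.
Qed.

Lemma meas_wt a : measurable_fun [set: R] (wt a).
Proof. by rewrite /wt; meas. Qed.

(** By evenness only the half-line matters, where (1 + x)^(1 - a) / (1 - a) is an antiderivative
    that vanishes at infinity. *)
Lemma integrable_wt a : 1 < a -> mu.-integrable setT (EFin \o wt a).
Proof.
move=> a1.
apply/integrableP; split; first by apply/measurable_EFinP; exact: meas_wt.
under eq_integral do rewrite /= ger0_norm ?wt_ge0//.
rewrite ge0_symfun_integralT//; last 3 first.
- exact: wt_ge0.
- rewrite (_ : wt a = fun y => expR (- a * ln (1 + `|y|))); last by apply/funext=> y; rewrite wtE.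
  move=> y; apply: continuous_comp; last exact: continuous_expR.
  apply: cvgM; first exact: cvg_cst.
  apply: (@continuous_comp _ _ _ (fun y : R => 1 + `|y|) (@ln R)).
    by apply: cvgD; [exact: cvg_cst|exact: norm_continuous].
  by apply: continuous_ln; rewrite ltr_pwDl.
- by move=> y; rewrite /= wtN.
rewrite -set_itvcy.
have -> : (\int[mu]_(x in `[0%R, +oo[) (wt a x)%:E =
   \int[mu]_(x in `[0%R, +oo[) (expR (- a * ln (1 + x)))%:E)%E.
  by apply: eq_integral => y; rewrite inE/= in_itv/= andbT wtE => y0; rewrite ger0_norm.
have dF (x : R) : 0 <= x -> is_derive x 1 (fun x : R => (1 - a)^-1 * expR ((1 - a) * ln (1 + x)))
    (expR (- a * ln (1 + x))).
  move=> x0; der; first lra.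
  have x1 : 1 + x = expR (ln (1 + x)) by rewrite lnK// posrE; lra.
  have -> : (1 - a) * ln (1 + x) = - a * ln (1 + x) + ln (1 + x) by ring.
  rewrite expRD lnK ?posrE; last lra.
  by field; apply/andP; split; lra.
pose F (x : R) := (1 - a)^-1 * expR ((1 - a) * ln (1 + x)).
have -> : (\int[mu]_(x in `[0%R, +oo[) (expR (- a * ln (1 + x)))%:E = 0%:E - (F 0)%:E)%E.
  apply: ge0_continuous_FTC2y.
  - by move=> x _; exact: expR_ge0.
- apply: derivable_within_continuous => x; rewrite in_itv/= andbT => x0.
  suff : exists l, is_derive x 1 (fun x : R => expR (- a * ln (1 + x))) l by case=> l [].
  by eexists; der => //; lra.
- rewrite -[X in _ --> X](mulr0 (1 - a)^-1); apply: cvgM; first exact: cvg_cst.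
  rewrite (_ : (fun x => expR _) = (fun x => expR (- ((a - 1) * ln (1 + x))))); last first.
    by apply/funext => x; congr expR; ring.
  apply: (cvg_comp _ (fun x : R => expR (- x))); last exact: cvgr_expR.
  apply: gt0_cvgMry; [lra|].
  apply/cvgryPge => A; near=> x.
  rewrite -ler_expR lnK ?posrE.
    by rewrite ler_wpDl//; near: x; apply: nbhs_pinfty_ge; exact: num_real.
  by rewrite ltr_wpDr//; near: x; apply: nbhs_pinfty_ge; exact: num_real.
- by move=> x x0; have [] := dF x (ltW x0).
- by apply: cvg_at_right_filter; exact: (der_continuous (dF 0 _)).
- by move=> x; rewrite in_itv/= andbT => x0; apply: der_derive1; exact/dF/ltW.
by rewrite sub0e lte_mul_pinfty//= ltry.
Unshelve. all: by end_near. Qed.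

End weights.

(** * Gaussian smoothing and Fourier inversion *)

(** The domination is local in the parameter, within distance [e] of [a]: this is how bounds that
    are only locally uniform in [beta] get used. *)
Lemma der_under_integral d (T : measurableType d) (R : realType)
    (mu : {measure set T -> \bar R}) (D : set T) (f df : R -> T -> R) (G : T -> R)
    (a e : R) : measurable D -> 0 < e ->
  (forall x, `|x - a| < e -> mu.-integrable D (EFin \o f x)) ->
  (forall x y, `|x - a| < e -> D y -> is_derive x 1 (f ^~ y) (df x y)) ->
  mu.-integrable D (EFin \o G) ->
  (forall x y, `|x - a| < e -> D y -> `|df x y| <= G y) ->
  is_derive a 1 (fun x => \int[mu]_(y in D) f x y) (\int[mu]_(y in D) df a y).
Proof.
move=> mD e0 intf der intG dfG.
have Ie x : `]a - e, a + e[%classic x -> `|x - a| < e.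
  by rewrite /= in_itv/= => /andP[? ?]; rewrite ltr_norml; apply/andP; split; lra.
have Ia : `]a - e, a + e[%classic a by rewrite /= in_itv/= ltrDl ltrBlDr ltrDl e0.
have E x y : `]a - e, a + e[%classic x -> D y -> partial1of2 f x y = df x y.
  by move=> /Ie xa Dy; rewrite partial1of2E; have [_] := der x y xa Dy.
have dfx x y : `]a - e, a + e[%classic x -> D y -> derivable (f ^~ y) x 1.
  by move=> /Ie xa Dy; have [] := der x y xa Dy.
have Gub x y : `]a - e, a + e[%classic x -> D y -> `|partial1of2 f x y| <= `|G y|.
  by move=> xa Dy; rewrite E// (le_trans (dfG _ _ (Ie _ xa) Dy))// ler_norm.
have iG := Rintegrable_norm mD intG.
have int x : `]a - e, a + e[%classic x -> mu.-integrable D (EFin \o f x).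
  by move=> /Ie; exact: intf.
have G0 y : 0 <= `|G y| by [].
apply: DeriveDef; first exact: (derivable_under_integral mD Ia int dfx G0 iG Gub).
rewrite -derive1E (differentiation_under_integral mD Ia int dfx G0 iG Gub).
by apply: eq_Rintegral => y; rewrite inE => Dy; rewrite E.
Qed.

Lemma der0_const (R : realType) (f : R -> R) : (forall x : R, is_derive x 1 f 0) ->
  forall x y, f x = f y.
Proof. by move=> df x y; exact: is_derive_0_is_cst. Qed.

Lemma cvg0_le (R : realType) (T : Type) (F : set_system T) {FF : Filter F} (f g : T -> R) :
  (\forall x \near F, `|f x| <= g x) -> g x @[x --> F] --> 0 -> f x @[x --> F] --> 0.
Proof.
move=> fg g0; apply: (@squeeze_cvgr _ _ _ _ (fun x => - g x) g) => //.
  by apply: filterS fg => x; rewrite ler_norml.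
by rewrite -oppr0; exact: cvgN.
Qed.

Section gaussian.
Context (R : realType).
Notation mu := (@lebesgue_measure R).
Notation gau s := (normal_pdf (0 : R) s).

Lemma leb_le (f g : R -> R) : measurable_fun setT f -> (forall x, `|f x| <= g x) ->
  mu.-integrable setT (EFin \o g) -> mu.-integrable setT (EFin \o f).
Proof. by move=> mf fg; apply: Rintegrable_le => // x _; exact: fg. Qed.

Lemma gauE (s : R) x : 0 < s -> gau s x = normal_peak s * expR (- (x ^+ 2 / (2 * s ^+ 2))).
Proof.
move=> s0; rewrite normal_pdfE ?gt_eqF// /normal_fun subr0; congr (_ * expR _).
by rewrite mulNr mulr_natl.
Qed.

Lemma gau_even (s x : R) : 0 < s -> gau s (- x) = gau s x.
Proof. by move=> s0; rewrite !gauE// sqrrN. Qed.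

Lemma integrable_gau (s : R) : mu.-integrable setT (EFin \o gau s).
Proof. exact: integrable_normal_pdf. Qed.

Lemma Rintegral_gau (m s : R) : \int[mu]_x normal_pdf m s x = 1.
Proof. by rewrite /Rintegral integral_normal_pdf. Qed.

(** Doubling the width absorbs the factor x. With t = x^2 / (8 s^2) the two exponents are -4 t and
    -t, and |x| <= s (1 + 2 t) <= s e^(2 t). *)
Lemma norm_mul_gau_le (s x : R) : 0 < s ->
  `|x * gau s x| <= s * normal_peak s / normal_peak (2 * s) * gau (2 * s) x.
Proof.
move=> s0; have s20 : 0 < 2 * s by lra.
have p0 := normal_peak_gt0 (lt0r_neq0 s0); have p20 := normal_peak_gt0 (lt0r_neq0 s20).
rewrite !gauE// normrM [`|_ * expR _|]ger0_norm; last by rewrite mulr_ge0 ?expR_ge0// ltW.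
rewrite [leRHS](_ : _ = normal_peak s * (s * expR (- (x ^+ 2 / (2 * (2 * s) ^+ 2))))); last first.
  by field; rewrite gt_eqF.
rewrite mulrCA ler_pM2l//.
set t := x ^+ 2 / (2 * (2 * s) ^+ 2).
have -> : x ^+ 2 / (2 * s ^+ 2) = t *+ 2 + t *+ 2.
  by rewrite /t; field; rewrite gt_eqF.
have t0 : 0 <= t by rewrite /t divr_ge0 ?sqr_ge0// mulr_ge0 ?sqr_ge0.
have xt : `|x| <= s * (1 + t *+ 2).
  have : 0 <= (`|x| - 2 * s) ^+ 2 by exact: sqr_ge0.
  rewrite /t -[x ^+ 2]real_normK ?num_real// => h.
  have -> : s * (1 + (`|x| ^+ 2 / (2 * (2 * s) ^+ 2)) *+ 2) = `|x| + (`|x| - 2 * s) ^+ 2 / (4 * s).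
    by field; rewrite gt_eqF.
  by rewrite lerDl divr_ge0// mulr_ge0// ltW.
apply: (le_trans (ler_wpM2r (expR_ge0 _) xt)).
rewrite -mulrA ler_pM2l//.
apply: (@le_trans _ _ (expR (t *+ 2) * expR (- (t *+ 2 + t *+ 2)))).
  by rewrite ler_wpM2r ?expR_ge0// expR_ge1Dx.
by rewrite -expRD ler_expR !mulr2n; lra.
Qed.

Lemma integrable_mul_gau (s : R) : 0 < s -> mu.-integrable setT (EFin \o (fun x => x * gau s x)).
Proof.
move=> s0; apply: (leb_le (g := fun x => s * normal_peak s / normal_peak (2 * s) * gau (2 * s) x)) => //.
- by apply: measM; [exact: measurable_id|exact: measurable_normal_pdf].
- by move=> x; exact: norm_mul_gau_le.
- by apply: RintegrableZ => //; exact: integrable_gau.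
Qed.

Lemma norm_trig_le (a b : R) : `|a| <= 1 -> `|a * b| <= `|b|.
Proof. by move=> h; rewrite normrM ler_piMl. Qed.

Lemma norm_cos_le1 (x : R) : `|cos x| <= 1.
Proof. by rewrite ler_norml cos_geN1 cos_le1. Qed.

Lemma norm_sin_le1 (x : R) : `|sin x| <= 1.
Proof. by rewrite ler_norml sin_geN1 sin_le1. Qed.

Lemma integrable_cosM (f : R -> R) (u : R) : mu.-integrable setT (EFin \o f) ->
  mu.-integrable setT (EFin \o (fun x => cos (u * x) * f x)).
Proof.
move=> intf; have mf := Rintegrable_meas intf.
apply: (leb_le (g := fun x => `|f x|)) => //.
- by meas.
- by move=> x; exact/norm_trig_le/norm_cos_le1.
- exact: Rintegrable_norm.
Qed.

Lemma integrable_sinM (f : R -> R) (u : R) : mu.-integrable setT (EFin \o f) ->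
  mu.-integrable setT (EFin \o (fun x => sin (u * x) * f x)).
Proof.
move=> intf; have mf := Rintegrable_meas intf.
apply: (leb_le (g := fun x => `|f x|)) => //.
- by meas.
- by move=> x; exact/norm_trig_le/norm_sin_le1.
- exact: Rintegrable_norm.
Qed.

Lemma der_gau (s x : R) : 0 < s -> is_derive x 1 (gau s) (- (x / s ^+ 2) * gau s x).
Proof.
move=> s0.
have -> : gau s = fun x => normal_peak s * expR (- (x ^+ 2 * (2 * s ^+ 2)^-1)).
  by apply/funext => y; rewrite gauE.
by der; field; rewrite gt_eqF.
Qed.

Lemma cvg_gau_pinfty (s : R) : 0 < s -> gau s x @[x --> +oo] --> 0.
Proof.
move=> s0; have -> : gau s = fun x => normal_peak s * expR (- (x ^+ 2 * (2 * s ^+ 2)^-1)).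
  by apply/funext => y; rewrite gauE.
rewrite -[X in _ --> X](mulr0 (normal_peak s)); apply: cvgM; first exact: cvg_cst.
apply: (cvg_comp (fun x : R => x ^+ 2 * (2 * s ^+ 2)^-1) (fun x : R => expR (- x))); last exact: cvgr_expR.
apply: gt0_cvgMly; last exact: cvgr_expr2.
by rewrite invr_gt0 mulr_gt0// exprn_gt0.
Qed.

(** The difference of the two sides is, up to a constant, the integral of the derivative of sin(u x)
    times the Gaussian, which vanishes at 0 and at infinity. *)
Lemma gau_sin_by_parts (s u : R) : 0 < s ->
  \int[mu]_x (sin (u * x) * (x * gau s x)) = s ^+ 2 * u * \int[mu]_x (cos (u * x) * gau s x).
Proof.
move=> s0.
have i1 := integrable_cosM u (integrable_gau s).
have i2 := integrable_sinM u (integrable_mul_gau s0).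
pose f x := u * (cos (u * x) * gau s x) - s ^- 2 * (sin (u * x) * (x * gau s x)).
have intf : mu.-integrable setT (EFin \o f).
  by apply: RintegrableB => //; apply: RintegrableZ.
have f0 : \int[mu]_x f x = 0.
  rewrite Rintegral_even//; last first.
    by move=> x; rewrite /f !mulrN cosN sinN gau_even//; ring.
  rewrite -Rintegral_itv_obnd_cbnd; last by apply: integrableS intf.
  have -> : \int[mu]_(x in `]0, +oo[) f x = 0 - 0; last by rewrite subrr mulr0.
  apply: (@integrable_FTC2y _ f (fun x => sin (u * x) * gau s x)).
  - move=> x _; have dg := der_gau x s0.
    by der; rewrite /f; field; rewrite gt_eqF.
  - move=> x _; have dg := der_gau x s0; move: x dg; rewrite /f.
    by move=> x dg; eapply der_continuous; der_rules R.
  - by apply: integrableS intf.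
  - have dg := der_gau 0 s0.
    apply: cvg_at_right_filter; rewrite [X in _ --> X](_ : _ = sin (u * 0) * gau s 0).
      suff: {for 0, continuous (fun x : R => sin (u * x) * gau s x)} by [].
      by eapply der_continuous; der_rules R.
    by rewrite mulr0 sin0 mul0r.
  - apply: (cvg0_le (g := gau s)); last exact: cvg_gau_pinfty.
    apply: nearW => x; rewrite (le_trans (norm_trig_le _ (norm_sin_le1 _)))//.
    by rewrite ger0_norm// normal_pdf_ge0.
move: f0; rewrite RintegralB//; [|exact: RintegrableZ..].
rewrite !RintegralZl// => /eqP; rewrite subr_eq0 => /eqP E.
by rewrite -mulrA E mulrA divff ?mul1r// expf_neq0// gt_eqF.
Qed.

(** Differentiation under the integral and [gau_sin_by_parts] give F' = - s^2 v F for the transform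
    F, so F(v) e^(s^2 v^2 / 2) is constant. *)
Lemma gau_cos (s u : R) : 0 < s ->
  \int[mu]_x (cos (u * x) * gau s x) = expR (- (s ^+ 2 * u ^+ 2 / 2)).
Proof.
move=> s0.
pose F v := \int[mu]_x (cos (v * x) * gau s x).
have dF (v : R) : is_derive v 1 F (- (s ^+ 2 * v * F v)).
  have h : is_derive v 1 F (\int[mu]_x (- sin (v * x) * x * gau s x)).
    apply: (@der_under_integral _ _ R mu setT (fun v x => cos (v * x) * gau s x)
      (fun v x => - sin (v * x) * x * gau s x) (fun x => `|x * gau s x|) v 1) => //.
    - by move=> x _; exact/integrable_cosM/integrable_gau.
    - by move=> x y _ _; der; ring.
    - exact/Rintegrable_norm/integrable_mul_gau.
    - by move=> x y _ _; rewrite -mulrA norm_trig_le// normrN norm_sin_le1.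
  apply: (der_eq h); rewrite -gau_sin_by_parts// -mulN1r -RintegralZl//.
    by apply: eq_Rintegral => x _; ring.
  exact/integrable_sinM/integrable_mul_gau.
have cst v : F v * expR (s ^+ 2 * v ^+ 2 / 2) = F 0 * expR (s ^+ 2 * 0 ^+ 2 / 2).
  apply: (der0_const (f := fun v => F v * expR (s ^+ 2 * v ^+ 2 / 2))) => w.
  by have dFw := dF w; der; field.
have F0 : F 0 = 1.
  rewrite /F -(Rintegral_gau 0 s); apply: eq_Rintegral => x _.
  by rewrite mul0r cos0 mul1r.
rewrite -/(F u); have := cst u.
rewrite F0 expr0n/= mulr0 mul0r expR0 mulr1 => /(congr1 (fun z => z * expR (- (s ^+ 2 * u ^+ 2 / 2)))).
by rewrite mul1r => <-; rewrite -[RHS](mulrA (F u)) -expRD subrr expR0 mulr1.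
Qed.

Lemma gau_kernel (s z : R) : 0 < s ->
  gau s z = (2 * pi)^-1 * \int[mu]_u (cos (u * z) * expR (- (s ^+ 2 * u ^+ 2 / 2))).
Proof.
move=> s0; have si0 : 0 < s^-1 by rewrite invr_gt0.
have pi0 : 0 < pi :> R by exact: pi_gt0.
have := gau_cos z si0.
have E u : cos (z * u) * gau s^-1 u =
    normal_peak s^-1 * (cos (u * z) * expR (- (s ^+ 2 * u ^+ 2 / 2))).
  rewrite gauE// mulrCA (mulrC z); congr (_ * (_ * expR (- _))).
  by field; rewrite gt_eqF.
under eq_Rintegral do rewrite E.
have p0 := normal_peak_gt0 (lt0r_neq0 si0).
rewrite RintegralZl//; last first.
  have : mu.-integrable setT (EFin \o (fun u => (normal_peak s^-1)^-1 * (cos (z * u) * gau s^-1 u))).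
    by apply: RintegrableZ => //; exact/integrable_cosM/integrable_gau.
  by apply: eq_integrable => // u _; rewrite /= E mulKf// gt_eqF.
move=> /(congr1 (fun t => (normal_peak s^-1)^-1 * t)); rewrite mulKf ?gt_eqF// => ->.
rewrite gauE// [RHS]mulrA; congr (_ * expR (- _)); last by field; rewrite gt_eqF.
have peakE (t : R) : 0 < t -> normal_peak t = (t * Num.sqrt (pi *+ 2))^-1.
  by move=> t0; rewrite /normal_peak -mulrnAr sqrtrM ?sqr_ge0// sqrtr_sqr gtr0_norm.
have tp : 0 < pi *+ 2 :> R by rewrite mulrn_wgt0.
have qq : Num.sqrt (pi *+ 2) ^+ 2 = 2 * pi :> R by rewrite sqr_sqrtr ?ltW// mulr_natl.
rewrite !peakE// -qq.
have : Num.sqrt (pi *+ 2) != 0 :> R by rewrite sqrtr_eq0 -ltNge.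
by move: (Num.sqrt _) => q q0; field; rewrite q0 gt_eqF.
Qed.

Lemma integrable_gauexp (s : R) : 0 < s ->
  mu.-integrable setT (EFin \o (fun u => expR (- (s ^+ 2 * u ^+ 2 / 2)))).
Proof.
move=> s0; have si0 : 0 < s^-1 by rewrite invr_gt0.
have : mu.-integrable setT (EFin \o (fun u => (normal_peak s^-1)^-1 * gau s^-1 u)).
  by apply: RintegrableZ => //; exact: integrable_gau.
apply: eq_integrable => // u _; rewrite /= gauE// mulKf; last first.
  by rewrite gt_eqF// normal_peak_gt0// gt_eqF.
by congr (expR (- _))%:E; field; rewrite gt_eqF.
Qed.

End gaussian.

Section inversion.
Context (R : realType).
Notation mu := (@lebesgue_measure R).
Notation gau s := (normal_pdf (0 : R) s).
Variables (f : R -> R) (cf : continuous f) (intf : mu.-integrable setT (EFin \o f)).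
Let C u := \int[mu]_y (cos (u * y) * f y).
Hypothesis sf0 : forall u, \int[mu]_y (sin (u * y) * f y) = 0.
Hypothesis intC : mu.-integrable setT (EFin \o C).

Let mf : measurable_fun setT f. Proof. exact: continuous_measurable_fun. Qed.

Lemma integrable_gau_shift (s x : R) : 0 < s ->
  mu.-integrable setT (EFin \o (fun y => gau s (x - y))).
Proof.
move=> s0; have := integrable_normal_pdf x s; apply: eq_integrable => // y _.
by rewrite /= !normal_pdfE ?gt_eqF// /normal_fun subr0 -sqrrN opprB.
Qed.

Lemma integrable_gau_conv (s x : R) : 0 < s ->
  mu.-integrable setT (EFin \o (fun y => f y * gau s (x - y))).
Proof.
move=> s0; apply: (leb_le (g := fun y => normal_peak s * `|f y|)).
- apply: measM => //; exact: Rintegrable_meas (integrable_gau_shift x s0).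
- move=> y; rewrite normrM mulrC ler_wpM2r// ger0_norm ?normal_pdf_ge0//.
  by apply: normal_pdf_ub; rewrite gt_eqF.
- by apply: RintegrableZ => //; exact: Rintegrable_norm.
Qed.

(** The Gaussian is written as a cosine integral by [gau_kernel] and the integrals are exchanged.
    The addition formula then leaves the cosine transform of [f]; the sine part vanishes by
    [sf0]. *)
Lemma gau_smoothing (s x : R) : 0 < s ->
  \int[mu]_y (f y * gau s (x - y)) =
  (2 * pi)^-1 * \int[mu]_u (expR (- (s ^+ 2 * u ^+ 2 / 2)) * (cos (u * x) * C u)).
Proof.
move=> s0; pose e u := expR (- (s ^+ 2 * u ^+ 2 / 2)).
have ie : mu.-integrable setT (EFin \o e) by exact: integrable_gauexp.
have me : measurable_fun setT e by exact: Rintegrable_meas ie.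
have cosz z : mu.-integrable setT (EFin \o (fun u => cos (u * z) * e u)).
  have := integrable_cosM z ie; apply: eq_integrable => // u _.
  by rewrite /= (mulrC z).
have pi0 : 2 * pi != 0 :> R by rewrite mulf_neq0// gt_eqF// pi_gt0.
have E y : \int[mu]_u (f y * (cos (u * (x - y)) * e u)) = 2 * pi * (f y * gau s (x - y)).
  rewrite RintegralZl// gau_kernel//; move: (\int[mu]_u _) => I.
  by rewrite [f y * ((2 * pi)^-1 * I)]mulrCA [RHS]mulrA divff// mul1r.
transitivity ((2 * pi)^-1 * \int[mu]_y \int[mu]_u (f y * (cos (u * (x - y)) * e u))).
  have -> : \int[mu]_y \int[mu]_u (f y * (cos (u * (x - y)) * e u)) =
    \int[mu]_y (2 * pi * (f y * gau s (x - y))) by apply: eq_Rintegral => y _; exact: E.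
  by rewrite RintegralZl ?mulKf//; exact: integrable_gau_conv.
have mK : measurable_fun setT (fun z : R * R => f z.1 * (cos (z.2 * (x - z.1)) * e z.2)).
  have m1 := measurableT_comp mf (@measurable_fst _ _ R R).
  have m2 := measurableT_comp me (@measurable_snd _ _ R R).
  by meas.
have dom y u : `|f y * (cos (u * (x - y)) * e u)| <= `|f y| * e u.
  rewrite normrM ler_wpM2l// (le_trans (norm_trig_le _ (norm_cos_le1 _)))//.
  by rewrite ger0_norm// expR_ge0.
have inf := Rintegrable_norm measurableT intf.
rewrite (@Rfubini_dominated _ _ _ _ _ mu mu (fun y u => f y * (cos (u * (x - y)) * e u))
  (fun y => `|f y|) e)//.
congr (_ * _); apply: eq_Rintegral => u _.
have -> : \int[mu]_y (f y * (cos (u * (x - y)) * e u)) =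
    \int[mu]_y (e u * cos (u * x) * (cos (u * y) * f y) + e u * sin (u * x) * (sin (u * y) * f y)).
  by apply: eq_Rintegral => y _; rewrite mulrBr cosB; ring.
rewrite RintegralD//; [|by apply: RintegrableZ => //; apply: integrable_cosM
  |by apply: RintegrableZ => //; apply: integrable_sinM].
rewrite !RintegralZl//; [|exact: integrable_sinM|exact: integrable_cosM].
by rewrite sf0 mulr0 addr0 mulrA.
Qed.

Let gk (k : nat) : R := k.+1%:R^-1.
Let gk0 k : 0 < gk k. Proof. by rewrite invr_gt0 ltr0n. Qed.

Lemma gau_smoothing_cvg_fourier x :
  \int[mu]_y (f y * gau (gk k) (x - y)) @[k --> \oo] -->
  (2 * pi)^-1 * \int[mu]_u (cos (u * x) * C u).
Proof.
rewrite (_ : (fun k => _) = fun k =>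
  (2 * pi)^-1 * \int[mu]_u (expR (- (gk k ^+ 2 * u ^+ 2 / 2)) * (cos (u * x) * C u))); last first.
  by apply/funext => k; exact: gau_smoothing.
apply: cvgM; first exact: cvg_cst.
have mC := Rintegrable_meas intC.
apply: (@Rintegral_dominated_cvg _ _ _ mu setT _ _ (fun u => `|C u|)) => //.
- by move=> k; meas.
- move=> u _; rewrite -[X in _ --> X]mul1r; apply: cvgM; last exact: cvg_cst.
  have : expR (- (gk k ^+ 2 * u ^+ 2 / 2)) @[k --> \oo] --> expR (- (0 ^+ 2 * u ^+ 2 / 2)).
    apply: (cvg_comp _ expR); last exact: continuous_expR.
    apply: cvgN; apply: cvgM; last exact: cvg_cst; apply: cvgM; last exact: cvg_cst.
    by apply: (cvg_comp _ (fun t : R => t ^+ 2)); [exact: cvg_harmonic|exact: exprn_continuous].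
  by rewrite expr0n/= !mul0r oppr0 expR0.
- exact: Rintegrable_norm.
- move=> k u _; rewrite normrM ger0_norm ?expR_ge0//.
  rewrite -[leRHS]mul1r ler_pM ?expR_ge0//.
    by rewrite -expR0 ler_expR oppr_le0 divr_ge0// mulr_ge0 ?sqr_ge0.
  exact/norm_trig_le/norm_cos_le1.
Qed.

(** Away from 0 a narrow Gaussian is at most O(1/k) times the unit one, which is bounded and
    integrable. Hence the far part of the convolution is controlled by the integral of |f| and by
    f(x), with no bound on [f] at infinity. The index [k.+1] keeps the width strictly below 1; at
    width 1 there is no gain. *)
Lemma gau_away (d z : R) (k : nat) : 0 < d -> d <= `|z| ->
  gau (gk k.+1) z <= 2 / (d ^+ 2 * k.+1%:R) * gau 1 z.
Proof.
move=> d0 dz; have k0 : 0 < k.+1%:R :> R by rewrite ltr0n.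
have peakE (t : R) : 0 < t -> normal_peak t = t^-1 * (Num.sqrt (pi *+ 2))^-1.
  by move=> t0; rewrite /normal_peak -mulrnAr sqrtrM ?sqr_ge0// sqrtr_sqr gtr0_norm// invfM.
rewrite !gauE// !peakE//; set q := (Num.sqrt _)^-1.
have q0 : 0 < q by rewrite invr_gt0 sqrtr_gt0 mulrn_wgt0// pi_gt0.
rewrite [leLHS]mulrAC [leRHS](_ : _ = 2 / (d ^+ 2 * k.+1%:R) * expR (- (z ^+ 2 / (2 * 1 ^+ 2))) * q); last by rewrite invr1; ring.
rewrite ler_pM2r//.
set t := z ^+ 2 / 2.
(* The inverse width is k + 2, so the exponent exceeds that of the unit Gaussian by a factor (k +
   2)^2. The surplus t ((k + 2)^2 - 1) = t (k + 1) (k + 3) beats the peak k + 2 by [expR_ge1Dx]. *)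
have tE : - (z ^+ 2 / (2 * gk k.+1 ^+ 2)) = - t - t * (k.+2%:R ^+ 2 - 1).
  have : k.+2%:R != 0 :> R by rewrite pnatr_eq0.
  by rewrite /gk /t; move: (k.+2%:R) => a a0; field.
have -> : z ^+ 2 / (2 * 1 ^+ 2) = t by rewrite expr1n mulr1.
rewrite tE expRD mulrCA [leRHS]mulrC ler_pM2l ?expR_gt0// /gk invrK expRN.
have td : d ^+ 2 / 2 <= t.
  by rewrite /t ler_pM2r// -[z ^+ 2]real_normK ?num_real// ler_sqr ?nnegrE// ltW.
have kE : k.+2%:R ^+ 2 - 1 = k.+1%:R * (k.+2%:R + 1) :> R.
  by rewrite -[in LHS]natr1 -[in RHS]natr1; ring.
rewrite ler_pdivrMr ?expR_gt0//.
apply: (@le_trans _ _ (2 / (d ^+ 2 * k.+1%:R) * (d ^+ 2 / 2 * (k.+1%:R * (k.+2%:R + 1))))).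
  rewrite [leRHS](_ : _ = k.+2%:R + 1); first by rewrite lerDl.
  by field; rewrite !gt_eqF//.
rewrite ler_wpM2l ?divr_ge0 ?mulr_ge0 ?sqr_ge0 ?(ltW d0)//.
rewrite kE; apply: le_trans (expR_ge1Dx _) .
rewrite -[leLHS]add0r lerD// ler_wpM2r// mulr_ge0//.
Qed.

Lemma Rintegral_gau_shift (s x : R) : 0 < s -> \int[mu]_y gau s (x - y) = 1.
Proof.
move=> s0; rewrite -(Rintegral_gau x s); apply: eq_Rintegral => y _.
by rewrite !normal_pdfE ?gt_eqF// /normal_fun subr0 -sqrrN opprB.
Qed.

Lemma gau_smoothing_cvg x :
  \int[mu]_y (f y * gau (gk k) (x - y)) @[k --> \oo] --> f x.
Proof.
rewrite -(cvg_shiftS _); apply/cvgrPdist_le => e e0.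
have e20 : 0 < e / 2 by lra.
move/cvgrPdist_le : (@cf x) => /(_ _ e20)[d /= d0 fd].
pose K := normal_peak (1 : R) * \int[mu]_y `|f y| + `|f x|.
have K0 : 0 <= K.
  by rewrite addr_ge0// mulr_ge0 ?normal_peak_ge0// Rintegral_ge0.
pose r (k : nat) : R := 2 / (d ^+ 2 * k.+1%:R).
have r0 k : 0 <= r k by rewrite divr_ge0// mulr_ge0 ?sqr_ge0.
have rK : r k * K @[k --> \oo] --> 0.
  rewrite (_ : (fun k => _) = fun k => 2 / d ^+ 2 * K * k.+1%:R^-1).
    by rewrite -[X in _ --> X](mulr0 (2 / d ^+ 2 * K)); apply: cvgM; [exact: cvg_cst|exact: cvg_harmonic].
  apply/funext => k; have : k.+1%:R != 0 :> R by rewrite pnatr_eq0.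
  by rewrite /r; move: (k.+1%:R) => a a0; field; rewrite a0 gt_eqF.
near=> k.
have rke : r k * K <= e / 2.
  near: k; move/cvgrPdist_le : rK => /(_ _ e20); apply: filterS => k.
  by rewrite sub0r normrN; apply: le_trans; exact: ler_norm.
set s := gk k.+1; have s0 : 0 < s := gk0 _.
have ig := integrable_gau_shift x s0; have igf := integrable_gau_conv x s0.
have inf := Rintegrable_norm measurableT intf.
have -> : f x = \int[mu]_y (f x * gau s (x - y)).
  by rewrite RintegralZl// Rintegral_gau_shift// mulr1.
rewrite -RintegralB//; last exact: RintegrableZ.
apply: (le_trans (le_normr_Rintegral _ _)) => //.
  by apply: RintegrableB => //; exact: RintegrableZ.
have i1 : mu.-integrable setT (EFin \o (fun y => e / 2 * gau s (x - y))) by exact: RintegrableZ.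
have i2 : mu.-integrable setT (EFin \o (fun y => r k * (normal_peak 1 * `|f y| + `|f x| * gau 1 (x - y)))).
  apply: RintegrableZ => //; apply: RintegrableD => //; apply: RintegrableZ => //.
  exact: integrable_gau_shift.
apply: (@le_trans _ _ (\int[mu]_y (e / 2 * gau s (x - y) +
    r k * (normal_peak 1 * `|f y| + `|f x| * gau 1 (x - y))))).
  apply: le_Rintegral => //.
  - by apply: Rintegrable_norm => //; apply: RintegrableB => //; exact: RintegrableZ.
  - exact: RintegrableD.
  - move=> y _; rewrite -mulrBl normrM [`|gau _ _|]ger0_norm ?normal_pdf_ge0//.
    have [xyd|xyd] := ltP `|x - y| d.
      rewrite ler_wpDr//; last first.
        by rewrite ler_wpM2r ?normal_pdf_ge0//; exact: fd.
      by rewrite mulr_ge0// addr_ge0// mulr_ge0 ?normal_peak_ge0 ?normal_pdf_ge0.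
    rewrite ler_wpDl//; first by rewrite mulr_ge0 ?normal_pdf_ge0// ltW.
    apply: (@le_trans _ _ ((`|f x| + `|f y|) * (r k * gau 1 (x - y)))).
      by rewrite ler_pM ?normal_pdf_ge0// ?ler_normB//; exact: gau_away.
    rewrite mulrCA ler_wpM2l// mulrDl addrC lerD2r mulrC ler_wpM2r//.
    by apply: normal_pdf_ub; rewrite oner_eq0.
rewrite RintegralD// !RintegralZl//; last first.
  apply: RintegrableD => //; apply: RintegrableZ => //; exact: integrable_gau_shift.
rewrite RintegralD//; [|exact: RintegrableZ|by apply: RintegrableZ => //; exact: integrable_gau_shift].
rewrite !RintegralZl//; last exact: integrable_gau_shift.
rewrite !Rintegral_gau_shift// !mulr1 -/K.
by have := rke; lra.
Unshelve. all: by end_near. Qed.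

(** Both sides are the limit of one sequence of Gaussian smoothings, computed once in space and once
    in frequency. *)
Theorem cos_inversion x : f x = (2 * pi)^-1 * \int[mu]_u (cos (u * x) * C u).
Proof.
exact: cvg_unique (gau_smoothing_cvg (x := x)) (gau_smoothing_cvg_fourier (x := x)).
Qed.

End inversion.

(** * Laws are determined by their characteristic functions *)

Section trigonometric_bounds.
Context (R : realType).

(** Iterating this from sine to cosine and back gives the alternating Taylor bounds below. *)
Lemma der_ge0_ge0 (g dg : R -> R) : (forall x : R, is_derive x 1 g (dg x)) ->
  g 0 = 0 -> (forall x, 0 <= x -> 0 <= dg x) -> forall x, 0 <= x -> 0 <= g x.
Proof.
move=> dgE g0 dg0 x x0.
have [|c /andP[c0 _]] := @MVT_segment _ g dg 0 x x0 (fun y _ => dgE y).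
  by apply: derivable_within_continuous => y _; have [] := dgE y.
rewrite g0 !subr0 => ->; rewrite mulr_ge0 ?dg0//.
Qed.

Lemma sin_le (x : R) : 0 <= x -> sin x <= x.
Proof.
move=> x0; rewrite -subr_ge0.
apply: (@der_ge0_ge0 (fun x => x - sin x) (fun x => 1 - cos x)) => //.
- by rewrite sin0 subrr.
Qed.

Lemma one_sub_cos_le (x : R) : 1 - cos x <= x ^+ 2 / 2.
Proof.
wlog x0 : x / 0 <= x.
  move=> H; have [/H//|/ltW x0] := leP 0 x.
  by have := H (- x); rewrite oppr_ge0 cosN sqrrN; exact.
rewrite -subr_ge0.
apply: (@der_ge0_ge0 (fun x => x ^+ 2 / 2 - (1 - cos x)) (fun x => x - sin x)) => //.
- by move=> y; der; field.
- by rewrite cos0 expr0n/= mul0r; ring.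
- by move=> y y0; rewrite subr_ge0 sin_le.
Qed.

Lemma sin_ge (x : R) : 0 <= x -> x - x ^+ 3 / 6 <= sin x.
Proof.
move=> x0; rewrite -subr_ge0.
apply: (@der_ge0_ge0 (fun x => sin x - (x - x ^+ 3 / 6)) (fun x => cos x - (1 - x ^+ 2 / 2))) => //.
- by move=> y; der; field.
- by rewrite sin0 expr0n/= mul0r; ring.
- by move=> y y0; have := one_sub_cos_le y; lra.
Qed.

Lemma cos_le (x : R) : cos x <= 1 - x ^+ 2 / 2 + x ^+ 4 / 24.
Proof.
wlog x0 : x / 0 <= x.
  move=> H; have [/H//|/ltW x0] := leP 0 x.
  have := H (- x); rewrite oppr_ge0 cosN sqrrN -[(- x) ^+ 4]mul1r.
  by rewrite exprNn (_ : (-1) ^+ 4 = 1 :> R) ?mul1r; [exact|ring].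
rewrite -subr_ge0.
apply: (@der_ge0_ge0 (fun x => 1 - x ^+ 2 / 2 + x ^+ 4 / 24 - cos x)
  (fun x => sin x - (x - x ^+ 3 / 6))) => //.
- by move=> y; der; field.
- by rewrite cos0 expr0n/= mul0r; ring.
- by move=> y y0; rewrite subr_ge0 sin_ge.
Qed.

End trigonometric_bounds.

(** * The triangle function, its Fourier transform, and trapezoids *)

Section hat.
Context (R : realType).
Notation mu := (@lebesgue_measure R).

(** The triangle function is the basic test function: its transform is nonnegative and integrable,
    and its integer translates add up to 1. *)
Definition hat (x : R) : R := Num.max 0 (1 - `|x|).

Lemma hat_ge0 x : 0 <= hat x. Proof. by rewrite /hat le_max lexx. Qed.

Lemma hat_le1 x : hat x <= 1.
Proof. by rewrite /hat ge_max ler01/= lerBlDr lerDl. Qed.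

Lemma hat_even x : hat (- x) = hat x. Proof. by rewrite /hat normrN. Qed.

Lemma hat_eq0 x : 1 <= `|x| -> hat x = 0.
Proof. by move=> h; apply/max_idPl; rewrite subr_le0. Qed.

Lemma hat_continuous : continuous hat.
Proof.
move=> x; apply: (@continuous_max _ _ (fun _ : R => 0) (fun y : R => 1 - `|y|)).
  exact: cvg_cst.
by apply: cvgB; [exact: cvg_cst|exact: norm_continuous].
Qed.

Lemma hat_wt x : `|hat x| <= 4 * wt 2 x.
Proof.
rewrite ger0_norm ?hat_ge0//; have [h|h] := leP 1 `|x|.
  by rewrite hat_eq0// mulr_ge0// wt_ge0.
rewrite (le_trans (hat_le1 _))// /wt powRN powR_mulrn ?addr_ge0//.
rewrite ler_pdivlMr ?exprn_gt0 ?ltr_pwDl// mul1r.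
by rewrite (_ : 4 = 2 ^+ 2 :> R) ?ler_sqr ?nnegrE ?addr_ge0//; [lra|ring].
Qed.

Lemma integrable_hat : mu.-integrable setT (EFin \o hat).
Proof.
apply: (leb_le (g := fun x => 4 * wt 2 x)).
- by apply: continuous_measurable_fun; exact: hat_continuous.
- exact: hat_wt.
- by apply: RintegrableZ => //; apply: integrable_wt; lra.
Qed.

(** The Fejér kernel (sin(u / 2) / (u / 2))^2, continued by 1 at the origin. *)
Definition hat_hat (u : R) : R := if u == 0 then 1 else 2 * (1 - cos u) / u ^+ 2.

Lemma hat_fourier_cos u : \int[mu]_y (cos (u * y) * hat y) = hat_hat u.
Proof.
have ih := integrable_cosM u integrable_hat.
rewrite Rintegral_even//; last by move=> x; rewrite mulrN cosN hat_even.
have -> : \int[mu]_(x in `[0, +oo[) (cos (u * x) * hat x) =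
    \int[mu]_(x in `[0, 1]) (cos (u * x) * (1 - x)).
  rewrite Rintegral_mkcond [RHS]Rintegral_mkcond; apply: eq_Rintegral => x _.
  rewrite !patchE; have [x0|x0] := leP 0 x; last first.
    by rewrite !memNset//= in_itv/=; move: x0; case: leP.
  rewrite mem_set/= ?in_itv/= ?x0//; have [x1|x1] := leP x 1.
    rewrite mem_set/= ?in_itv/= ?x0// /hat ger0_norm//.
    by congr (_ * _); apply/max_idPr; rewrite subr_ge0.
  rewrite memNset/= ?in_itv/= ?x0//=; last by rewrite leNgt x1.
  by rewrite hat_eq0 ?mulr0// ger0_norm// ltW.
have FTC (F : R -> R) : (forall x : R, is_derive x 1 F (cos (u * x) * (1 - x))) ->
    \int[mu]_(x in `[0, 1]) (cos (u * x) * (1 - x)) = F 1 - F 0.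
  move=> dF; have cF x : {for x, continuous F} by exact: der_continuous (dF x).
  rewrite /Rintegral (@continuous_FTC2 _ (fun x => cos (u * x) * (1 - x)) F)//.
  - apply: continuous_subspaceT; by_der_cont.
  - split.
    + by move=> x _; have [] := dF x.
    + by apply: cvg_at_right_filter; exact: cF.
    + by apply: cvg_at_left_filter; exact: cF.
  - by move=> x _; exact: der_derive1.
rewrite /hat_hat; have [u0|u0] := eqVneq u 0.
  have dF (x : R) : is_derive x 1 (fun x => x - x ^+ 2 / 2) (cos (u * x) * (1 - x)).
    by der; rewrite u0 mul0r cos0; field.
  by rewrite (FTC _ dF) expr0n/=; field.
have dF (x : R) : is_derive x 1 (fun x => sin (u * x) / u * (1 - x) - cos (u * x) / u ^+ 2)
    (cos (u * x) * (1 - x)).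
  by der; field.
by rewrite (FTC _ dF) !mulr1 !mulr0 sin0 cos0 subrr; field.
Qed.

Lemma hat_fourier_sin u : \int[mu]_y (sin (u * y) * hat y) = 0.
Proof.
have ih := integrable_sinM u integrable_hat.
have := Rintegral_opp ih.
under [X in _ = X -> _]eq_Rintegral do rewrite hat_even mulrN sinN mulNr -mulN1r.
by rewrite RintegralZl// mulN1r; lra.
Qed.

Lemma hat_hat_ge0 u : 0 <= hat_hat u.
Proof.
rewrite /hat_hat; case: ifP => // _.
by rewrite divr_ge0 ?sqr_ge0// mulr_ge0// subr_ge0 cos_le1.
Qed.

Lemma meas_hat_hat : measurable_fun setT hat_hat.
Proof.
apply: measurable_fun_ifT; last 2 first.
- exact: measurable_cst.
- by meas.
apply: measurable_fun_eqr; [exact: measurable_id|exact: measurable_cst].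
Qed.

Lemma integrable_hat_hat : mu.-integrable setT (EFin \o hat_hat).
Proof.
apply: (leb_le (g := fun x => 16 * wt 2 x)).
- exact: meas_hat_hat.
- move=> x; rewrite ger0_norm ?hat_hat_ge0// /wt powRN powR_mulrn ?addr_ge0//.
  rewrite ler_pdivlMr ?exprn_gt0 ?ltr_pwDl//.
  have [x1|x1] := leP `|x| 1.
    have : hat_hat x <= 1.
      rewrite /hat_hat; case: eqVneq => // x0.
      rewrite ler_pdivrMr ?mul1r; first by have := one_sub_cos_le x; lra.
      by rewrite lt_def sqrf_eq0 x0 sqr_ge0.
    move=> h; apply: (@le_trans _ _ (1 * 2 ^+ 2)); last by rewrite mul1r; lra.
    by rewrite ler_pM ?hat_hat_ge0 ?exprn_ge0 ?addr_ge0// ler_sqr ?nnegrE ?addr_ge0//; lra.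
  have x0 : x != 0 by rewrite -normr_gt0 (lt_trans _ x1).
  have x2 : 0 < x ^+ 2 by rewrite lt_def sqrf_eq0 x0 sqr_ge0.
  have h1 : hat_hat x * x ^+ 2 <= 4.
    rewrite /hat_hat (negbTE x0) divfK ?gt_eqF//.
    by have := cos_geN1 x; lra.
  have h2 : (1 + `|x|) ^+ 2 <= 4 * x ^+ 2.
    rewrite -[x ^+ 2]real_normK ?num_real// (_ : 4 * _ = (2 * `|x|) ^+ 2); last by ring.
    by rewrite ler_sqr ?nnegrE ?addr_ge0 ?mulr_ge0//; lra.
  apply: (le_trans (ler_wpM2l (hat_hat_ge0 x) h2)).
  by rewrite mulrCA (_ : 16 = 4 * 4) ?ler_wpM2l//; ring.
- by apply: RintegrableZ => //; apply: integrable_wt; lra.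
Qed.

Lemma hatE x : hat x = (2 * pi)^-1 * \int[mu]_u (cos (u * x) * hat_hat u).
Proof.
rewrite (cos_inversion hat_continuous integrable_hat hat_fourier_sin).
  by congr (_ * _); apply: eq_Rintegral => u _; rewrite hat_fourier_cos.
by have := integrable_hat_hat; apply: eq_integrable => // u _; rewrite /= hat_fourier_cos.
Qed.

(* The ramps telescope, so that a block of consecutive hats is a trapezoid. *)
Definition ramp (x : R) : R := Num.max 0 x.

Definition trapezoid (N : nat) (x : R) : R := \sum_(k < N.*2.+1) hat (x + N%:R - k%:R).

Lemma hat_ramp x : hat x = ramp (x + 1) - 2 * ramp x + ramp (x - 1).
Proof.
rewrite /hat /ramp; have [x0|x0] := leP 0 x.
  by rewrite ger0_norm//; do 3 (case: (leP 0) => ?); lra.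
by rewrite ltr0_norm//; do 3 (case: (leP 0) => ?); lra.
Qed.

Lemma trapezoidE N x : trapezoid N x = ramp (x + N%:R + 1) - ramp (x + N%:R)
  - ramp (x - N%:R) + ramp (x - N%:R - 1).
Proof.
have -> : trapezoid N x = \sum_(0 <= k < N.*2.+1) hat (x + N%:R - k%:R).
  by rewrite big_mkord.
have E m : \sum_(0 <= k < m.+1) hat (x + N%:R - k%:R) =
    ramp (x + N%:R + 1) - ramp (x + N%:R) - ramp (x + N%:R - m%:R)
    + ramp (x + N%:R - m%:R - 1).
  elim: m => [|m IH]; first by rewrite big_nat1 subr0 hat_ramp; ring.
  rewrite big_nat_recr//= IH hat_ramp -natr1.
  have -> : x + N%:R - (m%:R + 1) + 1 = x + N%:R - m%:R by ring.
  have -> : x + N%:R - (m%:R + 1) = x + N%:R - m%:R - 1 by ring.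
  by ring.
by rewrite E -addnn natrD; congr (_ - ramp _ + ramp _); ring.
Qed.

Lemma trapezoid_ge0 N x : 0 <= trapezoid N x.
Proof. by apply: sumr_ge0 => k _; exact: hat_ge0. Qed.

Lemma trapezoid_le1 N x : trapezoid N x <= 1.
Proof.
rewrite trapezoidE /ramp; have : 0 <= N%:R :> R by [].
by move: (N%:R : R) => n n0; do 4 (case: (leP 0) => ?); lra.
Qed.

Lemma trapezoid1 N x : `|x| <= N%:R -> trapezoid N x = 1.
Proof.
rewrite ler_norml trapezoidE /ramp; have : 0 <= N%:R :> R by [].
by move: (N%:R : R) => n n0 /andP[? ?]; do 4 (case: (leP 0) => ?); lra.
Qed.

Lemma trapezoid0 N x : N%:R + 1 <= `|x| -> trapezoid N x = 0.
Proof.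
rewrite trapezoidE /ramp; have : 0 <= N%:R :> R by [].
rewrite ler_normr; move: (N%:R : R) => n n0 /orP[] ?.
  by do 4 (case: (leP 0) => ?); lra.
by do 4 (case: (leP 0) => ?); lra.
Qed.

Lemma meas_trapezoid N : measurable_fun setT (trapezoid N).
Proof.
have cramp : continuous ramp.
  move=> x; apply: (@continuous_max _ _ (fun _ : R => 0) (fun y : R => y)); first exact: cvg_cst.
  exact: cvg_id.
rewrite (_ : trapezoid N = fun x => ramp (x + (N%:R + 1)) - ramp (x + N%:R)
  - ramp (x + - N%:R) + ramp (x + (- N%:R - 1))); last first.
  by apply/funext => x; rewrite trapezoidE !addrA.
have cr (a : R) : measurable_fun setT (fun x : R => ramp (x + a)).
  by apply: (meas_continuous cramp); meas.
by apply: measD; [apply: measD; [apply: measD|]|]; try apply: measN; exact: cr.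
Qed.

End hat.

Section finite_sums.
Context d (T : measurableType d) (R : realType) (m : {measure set T -> \bar R}).

Lemma Rintegrable_sum (I : Type) (s : seq I) (D : set T) (f : I -> T -> R) : measurable D ->
  (forall i, m.-integrable D (EFin \o f i)) ->
  m.-integrable D (EFin \o (fun x => \sum_(i <- s) f i x)).
Proof.
move=> mD intf; elim: s => [|i s IH].
  by have := integrable0 m D; apply: eq_integrable => // x _; rewrite /= big_nil.
by have := RintegrableD mD (intf i) IH; apply: eq_integrable => // x _; rewrite /= big_cons.
Qed.

Lemma Rintegral_sum (I : Type) (s : seq I) (D : set T) (f : I -> T -> R) : measurable D ->
  (forall i, m.-integrable D (EFin \o f i)) ->
  \int[m]_(x in D) (\sum_(i <- s) f i x) = \sum_(i <- s) \int[m]_(x in D) f i x.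
Proof.
move=> mD intf; elim: s => [|i s IH].
  rewrite big_nil (_ : (fun x => _) = (fun=> 0)); last by apply/funext => x; rewrite big_nil.
  by rewrite Rintegral_cst// mul0r.
rewrite big_cons -IH -RintegralD//; last exact: Rintegrable_sum.
by apply: eq_Rintegral => x _; rewrite big_cons.
Qed.

End finite_sums.

Section hat_expectation.
Context d (T : measurableType d) (R : realType) (P : probability T R).
Notation mu := (@lebesgue_measure R).

Lemma bounded_integrable (f : T -> R) (M : R) : measurable_fun setT f ->
  (forall w, `|f w| <= M) -> P.-integrable setT (EFin \o f).
Proof.
move=> mf fM; apply: (Rintegrable_le (g := fun=> M)) => //.
by apply: (finite_measure_integrable_cst P M).
Qed.

Lemma Rintegral_cst1 (c : R) : \int[P]_w c = c.
Proof. rewrite Rintegral_cst//.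
have e : fine (P setT) = 1 by rewrite probability_setT.
by rewrite -[RHS]mulr1; congr (_ * _); exact: e. Qed.

Lemma norm_Rintegral_le (f : T -> R) (M : R) : measurable_fun setT f ->
  (forall w, `|f w| <= M) -> `|\int[P]_w f w| <= M.
Proof.
move=> mf fM; have i := bounded_integrable mf fM.
rewrite (le_trans (le_normr_Rintegral _ i))//.
rewrite -[leRHS]Rintegral_cst1; apply: le_Rintegral => //.
- exact: Rintegrable_norm.
- exact: (finite_measure_integrable_cst P M).
Qed.

(** Insert the inversion formula for the triangle and exchange the integrals. The bounded factor [Z]
    allows one coordinate to be treated at a time: it is 1 for laws on the line, and a product of
    the other triangles in the multivariate case. *)
Lemma hat_expectation (Z Y : T -> R) (M a b : R) :
  measurable_fun setT Z -> measurable_fun setT Y -> (forall w, `|Z w| <= M) ->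
  \int[P]_w (Z w * hat (a * Y w + b)) = (2 * pi)^-1 * \int[mu]_u (hat_hat u *
    (cos (u * b) * \int[P]_w (Z w * cos (u * a * Y w))
     - sin (u * b) * \int[P]_w (Z w * sin (u * a * Y w)))).
Proof.
move=> mZ mY ZM.
have mZh : measurable_fun setT (fun w => Z w * hat (a * Y w + b)).
  apply: measM => //; apply: (meas_continuous (@hat_continuous R)).
  by meas.
have ic u : P.-integrable setT (EFin \o (fun w => Z w * cos (u * a * Y w))).
  apply: (bounded_integrable (M := M)); first by meas.
  by move=> w; rewrite mulrC (le_trans (norm_trig_le _ (norm_cos_le1 _))).
have isn u : P.-integrable setT (EFin \o (fun w => Z w * sin (u * a * Y w))).
  apply: (bounded_integrable (M := M)); first by meas.
  by move=> w; rewrite mulrC (le_trans (norm_trig_le _ (norm_sin_le1 _))).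
pose K w u := Z w * (cos (u * (a * Y w + b)) * hat_hat u).
have ih := @integrable_hat_hat R.
have E w : Z w * hat (a * Y w + b) = (2 * pi)^-1 * \int[mu]_u K w u.
  rewrite hatE mulrCA; congr (_ * _); rewrite RintegralZl//.
  have := integrable_cosM (a * Y w + b) ih; apply: eq_integrable => // u _.
  by rewrite /= (mulrC u).
have pi0 : 2 * pi != 0 :> R by rewrite mulf_neq0// gt_eqF// pi_gt0.
have -> : \int[P]_w (Z w * hat (a * Y w + b)) = (2 * pi)^-1 * \int[P]_w \int[mu]_u K w u.
  transitivity (\int[P]_w ((2 * pi)^-1 * \int[mu]_u K w u)).
    by apply: eq_Rintegral => w _; exact: E.
  rewrite RintegralZl//; apply: (bounded_integrable (M := `|2 * pi| * M)).
    have -> : (fun w => \int[mu]_u K w u) = (fun w => 2 * pi * (Z w * hat (a * Y w + b))).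
      by apply/funext => w; rewrite E [RHS]mulrA divff// mul1r.
    by apply: measM => //; exact: meas_cst.
  move=> w; have -> : \int[mu]_u K w u = 2 * pi * (Z w * hat (a * Y w + b)).
    by rewrite E [RHS]mulrA divff// mul1r.
  rewrite normrM ler_wpM2l// normrM -[leRHS]mulr1 ler_pM//.
  by rewrite ger0_norm ?hat_ge0// hat_le1.
rewrite (@Rfubini_dominated _ _ _ _ _ P mu K (fun=> M) (@hat_hat R))//; last 3 first.
- have m1 := measurableT_comp mZ (@measurable_fst _ _ T R).
  have m2 := measurableT_comp mY (@measurable_fst _ _ T R).
  have m3 := measurableT_comp (@meas_hat_hat R) (@measurable_snd _ _ T R).
  by rewrite /K; meas.
- exact: (finite_measure_integrable_cst P M).
- move=> w u; rewrite /K normrM ler_pM// (le_trans (norm_trig_le _ (norm_cos_le1 _)))//.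
  by rewrite ger0_norm// hat_hat_ge0.
congr (_ * _); apply: eq_Rintegral => u _.
have -> : \int[P]_w K w u = \int[P]_w (hat_hat u * cos (u * b) * (Z w * cos (u * a * Y w)) -
    hat_hat u * sin (u * b) * (Z w * sin (u * a * Y w))).
  apply: eq_Rintegral => w _; rewrite /K mulrDr cosD [u * (a * _)]mulrA; ring.
rewrite RintegralB//; [|exact: RintegrableZ..].
by rewrite !RintegralZl//; ring.
Qed.

End hat_expectation.

Section law_uniqueness.
Context (R : realType) (P Q : probability (measurableTypeR R) R).
Hypotheses (Ecos : forall u : R, \int[P]_y cos (u * y) = \int[Q]_y cos (u * y))
  (Esin : forall u : R, \int[P]_y sin (u * y) = \int[Q]_y sin (u * y)).

Let hat_eq (a b : R) : \int[P]_y hat (a * y + b) = \int[Q]_y hat (a * y + b).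
Proof.
have h (m : probability (measurableTypeR R) R) : \int[m]_y hat (a * y + b) =
    \int[m]_y (1 * hat (a * y + b)) by apply: eq_Rintegral => y _; rewrite mul1r.
have c (m : probability (measurableTypeR R) R) u : \int[m]_y (1 * cos (u * a * y)) =
    \int[m]_y cos (u * a * y) by apply: eq_Rintegral => y _; rewrite mul1r.
have s (m : probability (measurableTypeR R) R) u : \int[m]_y (1 * sin (u * a * y)) =
    \int[m]_y sin (u * a * y) by apply: eq_Rintegral => y _; rewrite mul1r.
have hE (m : probability (measurableTypeR R) R) : \int[m]_y (1 * hat (a * y + b)) =
    (2 * pi)^-1 * \int[@lebesgue_measure R]_u (hat_hat u *
    (cos (u * b) * \int[m]_y (1 * cos (u * a * y)) - sin (u * b) * \int[m]_y (1 * sin (u * a * y)))).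
  apply: (@hat_expectation _ _ R m (fun=> 1) (fun y => y) 1 a b) => //.
  by move=> _; rewrite normr1.
rewrite !h !hE; congr (_ * _); apply: eq_Rintegral => u _.
by rewrite !c !s Ecos Esin.
Qed.

Let trap_eq N (a b : R) : \int[P]_y trapezoid N (a * y + b) = \int[Q]_y trapezoid N (a * y + b).
Proof.
have h (m : probability (measurableTypeR R) R) : \int[m]_y trapezoid N (a * y + b) =
    \sum_(k < N.*2.+1) \int[m]_y hat (a * y + (b + N%:R - k%:R)).
  transitivity (\int[m]_y (\sum_(k < N.*2.+1) hat (a * y + (b + N%:R - k%:R)))).
    by apply: eq_Rintegral => y _; apply: eq_bigr => k _; congr hat; ring.
  rewrite Rintegral_sum// => k; apply: (@bounded_integrable _ _ _ m _ 1).
    by apply: (meas_continuous (@hat_continuous R)); meas.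
  by move=> y; rewrite ger0_norm ?hat_ge0 ?hat_le1.
by rewrite !h; apply: eq_bigr => k _; exact: hat_eq.
Qed.

Let oo_eq (a b : R) : a < b -> \int[P]_y \1_`]a, b[ y = \int[Q]_y \1_`]a, b[ y.
Proof.
move=> ab.
(* The affine map sends []a, b[] onto ]-(N + 1), N + 1[, outside which the trapezoid is 0. A fixed
   point of []a, b[] eventually falls on the plateau [-N, N]. *)
pose f (N : nat) (y : R) := trapezoid N (2 * N.+1%:R / (b - a) * y + - (N.+1%:R * (a + b) / (b - a))).
have cvgf (m : probability (measurableTypeR R) R) :
    \int[m]_y f N y @[N --> \oo] --> \int[m]_y \1_`]a, b[ y.
  apply: (@Rintegral_dominated_cvg _ _ _ m setT _ _ (fun=> 1)) => //.
  - by move=> n; apply: (meas_comp (@meas_trapezoid R n)); meas.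
  - move=> y _; pose t := (2 * y - (a + b)) / (b - a).
    have fE N : f N y = trapezoid N (N.+1%:R * t).
      by rewrite /f /t; congr (trapezoid N _); ring.
    apply: cvg_near_cst; have [yab|yab] := boolP (y \in `]a, b[%classic); last first.
      apply: nearW => N; rewrite fE indicE (negbTE yab) trapezoid0//.
      rewrite natr1 normrM [`|_.+1%:R|]ger0_norm// ler_pMr ?ltr0n//.
      rewrite /t normrM normfV [`|b - a|]gtr0_norm ?subr_gt0// ler_pdivlMr ?subr_gt0// mul1r.
      apply: contraR yab; rewrite -ltNge ltr_norml inE/= in_itv/= => /andP[? ?].
      by apply/andP; split; lra.
    have t1 : `|t| < 1.
      rewrite /t normrM normfV [`|b - a|]gtr0_norm ?subr_gt0// ltr_pdivrMr ?subr_gt0// mul1r.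
      by move: yab; rewrite inE/= in_itv/= ltr_norml => /andP[? ?]; apply/andP; split; lra.
    near=> N; rewrite fE indicE yab trapezoid1// normrM [`|_.+1%:R|]ger0_norm// -natr1.
    have : `|t| / (1 - `|t|) <= N%:R by near: N; exact: nbhs_infty_ger.
    rewrite ler_pdivrMr ?subr_gt0//; nra.
  - exact: (finite_measure_integrable_cst m 1).
  - by move=> n y _; rewrite ger0_norm ?trapezoid_ge0// trapezoid_le1.
have e : (fun N => \int[P]_y f N y) = (fun N => \int[Q]_y f N y).
  by apply/funext => N; exact: trap_eq.
have c := cvgf P; rewrite e in c.
exact: cvg_unique c (cvgf Q).
Unshelve. all: by end_near. Qed.

Let oc_eq (a b : R) : a < b -> P `]a, b]%classic = Q `]a, b]%classic.
Proof.
move=> ab.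
have indic_int (m : probability (measurableTypeR R) R) (A : set (measurableTypeR R)) :
    measurable A -> \int[m]_y \1_A y = fine (m A).
  by move=> mA; rewrite /Rintegral integral_indic// setIT.
rewrite -(fineK (fin_num_measure P _ _))// -[RHS](fineK (fin_num_measure Q _ _))//.
congr EFin; rewrite -!indic_int//.
have cvgf (m : probability (measurableTypeR R) R) :
    \int[m]_y \1_`]a, (b + N.+1%:R^-1)[ y @[N --> \oo] --> \int[m]_y \1_`]a, b] y.
  apply: (@Rintegral_dominated_cvg _ _ _ m setT _ _ (fun=> 1)) => //.
  - by move=> n; exact: measurable_indic.
  - move=> y _; apply: cvg_near_cst.
    have [yb|yb] := leP y b.
      apply: nearW => N; rewrite !indicE !mem_setE !in_itv/= yb.
      by rewrite (le_lt_trans yb)// ltrDl invr_gt0 ltr0n.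
    near=> N; rewrite !indicE !mem_setE !in_itv/= (leNgt y b) yb andbF.
    suff -> : (y < b + N.+1%:R^-1) = false by rewrite andbF.
    apply/negbTE; rewrite -leNgt -lerBrDl.
    rewrite -[leRHS]invrK lef_pV2 ?posrE ?ltr0n ?invr_gt0 ?subr_gt0//.
    apply: (@le_trans _ _ N%:R); last by rewrite ler_nat.
    by near: N; exact: nbhs_infty_ger.
  - exact: (finite_measure_integrable_cst m 1).
  - by move=> n y _; rewrite indicE ger0_norm//; case: (_ \in _).
have e : (fun N => \int[P]_y \1_`]a, (b + N.+1%:R^-1)[ y) =
    (fun N => \int[Q]_y \1_`]a, (b + N.+1%:R^-1)[ y).
  by apply/funext => N; apply: oo_eq; rewrite (lt_trans ab)// ltrDl invr_gt0 ltr0n.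
have c := cvgf P; rewrite e in c.
exact: cvg_unique c (cvgf Q).
Unshelve. all: by end_near. Qed.

(** Equality passes from triangles to trapezoids by summation, to open intervals and then to
    half-open ones by dominated convergence, and to all Borel sets because half-open intervals are
    closed under intersection and generate them. *)
Theorem law_unique (A : set (measurableTypeR R)) : measurable A -> P A = Q A.
Proof.
move=> mA; refine (@measure_unique _ R (measurableTypeR R) (@ocitv R)
  (fun k => `](- k%:R), k%:R]%classic) _ _ _ _ P Q _ _ A mA).
- by [].
- exact: ocitvI.
- by move=> k; exact: is_ocitv.
- apply/seteqP; split=> // x _; exists (Num.truncn `|x|).+1 => //.
  have := truncnS_gt `|x|; rewrite /= in_itv/= ltr_norml => /andP[-> /ltW ->].
  by [].
- move=> _ [[a b] _ <-] /=; have [ab|ba] := ltP a b; first exact: oc_eq.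
  by rewrite set_itv_ge ?measure0// bnd_simp -leNgt.
- by move=> k; rewrite ltey_eq fin_num_measure.
Qed.

End law_uniqueness.

(** * Cosine transforms *)

Section symbols.
Context (R : realType).
Implicit Types (b x : R) (k : nat).

(* With u = e^x this is u^(k b) e^(-u^b). *)
Definition sx k b x : R := expR (k%:R * b * x - expR (b * x)).

Lemma sx_ge0 k b x : 0 <= sx k b x. Proof. exact: expR_ge0. Qed.

Lemma sxS k b x : sx k.+1 b x = expR (b * x) * sx k b x.
Proof. by rewrite /sx -expRD; congr expR; rewrite -natr1; ring. Qed.

(** The family [sx] is closed under differentiation, in [x] as well as in [b]. This makes repeated
    integrations by parts explicit, with constants uniform in [b]. *)
Lemma der_sx k b x : is_derive x 1 (sx k b) (b * (k%:R * sx k b x - sx k.+1 b x)).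
Proof. by rewrite sxS /sx; der; ring. Qed.

Lemma der_sx_b k b x :
  is_derive b 1 (fun b => sx k b x) (x * (k%:R * sx k b x - sx k.+1 b x)).
Proof. by rewrite sxS /sx; der; ring. Qed.

Lemma expr_le_expR (m : nat) (t : R) : 0 <= t -> t ^+ m <= m%:R ^+ m * expR t.
Proof.
case: m => [|m] t0; first by rewrite !expr0 mul1r -[leLHS]expR0 ler_expR.
have m0 : m.+1%:R != 0 :> R by rewrite pnatr_eq0.
have -> : t ^+ m.+1 = m.+1%:R ^+ m.+1 * (t / m.+1%:R) ^+ m.+1.
  by rewrite -exprMn; congr (_ ^+ _); field.
rewrite ler_wpM2l ?exprn_ge0//.
have -> : expR t = expR (t / m.+1%:R) ^+ m.+1.
  by rewrite -expRM_natl; congr expR; field.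
rewrite ler_pXn2r ?nnegrE ?expR_ge0 ?divr_ge0//.
by rewrite (le_trans _ (expR_ge1Dx _))// lerDr.
Qed.

(** The constant of [sx_decay], where N b >= 5: (1 + e^x)^5 <= 2^5 e^(N b x) for x >= 0 gives the
    first factor, and t^m <= m^m e^t at t = e^(b x), m = k + N, gives the second. *)
Definition sxM k (N : nat) : R := 2 ^+ 5 * (k + N)%:R ^+ (k + N).

Lemma natpow_ge1 (m : nat) : 1 <= m%:R ^+ m :> R.
Proof. by case: m => [|m]; rewrite ?expr0// exprn_ege1// ler1n. Qed.

Lemma sxM_ge k N : 2 ^+ 5 <= sxM k N.
Proof. by rewrite /sxM ler_peMr ?exprn_ge0// natpow_ge1. Qed.

Lemma sxM_ge0 k N : 0 <= sxM k N.
Proof. by apply: le_trans (sxM_ge _ _); rewrite exprn_ge0. Qed.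

Lemma sx_decay k (N : nat) b x : 5 <= N%:R * b -> 0 <= x ->
  sx k b x * (1 + expR x) ^+ 5 <= sxM k N.
Proof.
move=> Nb x0.
have h1 : (1 + expR x) ^+ 5 <= 2 ^+ 5 * expR (N%:R * b * x).
  apply: (@le_trans _ _ ((2 * expR x) ^+ 5)).
    rewrite ler_pXn2r ?nnegrE ?addr_ge0 ?mulr_ge0 ?expR_ge0//.
    have : 1 <= expR x by rewrite -expR0 ler_expR.
    lra.
  rewrite exprMn ler_pM2l ?exprn_gt0// -expRM_natl ler_expR -mulrA.
  by rewrite mulrA ler_wpM2r.
apply: (le_trans (ler_wpM2l (sx_ge0 _ _ _) h1)).
rewrite /sxM mulrCA ler_pM2l ?exprn_gt0//.
have := expr_le_expR (k + N) (expR_ge0 (b * x)).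
rewrite -ler_pdivrMr ?expR_gt0//; apply: le_trans.
rewrite -expRN -expRM_natl -expRD /sx -expRD ler_expR natrD.
by rewrite [leLHS](_ : _ = (k%:R + N%:R) * (b * x) - expR (b * x))//; ring.
Qed.

(* A weight of order [u^a] near [u = 0] and [u^(a - 4)] at infinity, at [x = ln u]. *)
Definition dw (a x : R) : R := expR (a * x) / (1 + expR x) ^+ 4.

Lemma one_expR_gt0 x : 0 < 1 + expR x. Proof. by rewrite addr_gt0 ?expR_gt0. Qed.

Lemma dw_ge0 a x : 0 <= dw a x.
Proof. by rewrite divr_ge0 ?expR_ge0// exprn_ge0// ltW// one_expR_gt0. Qed.

Lemma dw_neg a x : x <= 0 -> expR (a * x) <= 2 ^+ 5 * dw a x.
Proof.
move=> x0; rewrite /dw mulrA ler_pdivlMr ?exprn_gt0 ?one_expR_gt0//.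
rewrite [leRHS]mulrC ler_pM2l ?expR_gt0//.
apply: (@le_trans _ _ (2 ^+ 4)); last by rewrite ler_eXn2l// ltr1n.
rewrite ler_pXn2r ?nnegrE ?(ltW (one_expR_gt0 x))//.
have : expR x <= 1 by rewrite -expR0 ler_expR.
lra.
Qed.

(** Of the five powers of decay in [sx_decay], four form the denominator of [dw] and the fifth
    absorbs 1 + |x|, that is, the logarithm coming from derivatives in [b]. *)
Lemma sx_pos_le k (N : nat) a b x : 0 <= a -> 5 <= N%:R * b -> 0 <= x ->
  (1 + `|x|) * sx k b x <= 2 * sxM k N * dw a x.
Proof.
move=> a0 Nb x0; rewrite ger0_norm//.
have e1 : 1 <= expR (a * x) by rewrite -expR0 ler_expR mulr_ge0.
have x1 : 1 + x <= 2 * (1 + expR x).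
  by have := expR_ge1Dx x; lra.
rewrite /dw mulrA ler_pdivlMr ?exprn_gt0 ?one_expR_gt0//.
apply: (@le_trans _ _ (2 * (sx k b x * (1 + expR x) ^+ 5))).
  have -> : 2 * (sx k b x * (1 + expR x) ^+ 5) = 2 * (1 + expR x) * (sx k b x * (1 + expR x) ^+ 4).
    by ring.
  rewrite -[leLHS]mulrA ler_wpM2r// mulr_ge0 ?sx_ge0 ?exprn_ge0// ltW// one_expR_gt0.
apply: (le_trans (ler_wpM2l _ (sx_decay k Nb x0))) => //.
by rewrite ler_peMr// mulr_ge0// sxM_ge0.
Qed.

Lemma sx_le k (N : nat) a b x : 0 <= a -> a <= k%:R * b -> 5 <= N%:R * b ->
  sx k b x <= 2 * sxM k N * dw a x.
Proof.
move=> a0 ak Nb; have [x0|x0] := leP 0 x.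
  apply: le_trans (sx_pos_le k a0 Nb x0).
  by rewrite ler_peMl ?sx_ge0// lerDl.
apply: (@le_trans _ _ (expR (a * x))).
  rewrite /sx ler_expR lerBlDr ler_wpDr ?expR_ge0//.
  by rewrite ler_wnM2r// ltW.
apply: (le_trans (dw_neg _ (ltW x0))); rewrite ler_wpM2r ?dw_ge0//.
by rewrite (le_trans (sxM_ge k N))// ler_peMl ?sxM_ge0// ler1n.
Qed.

(** For x < 0 the factor |x| costs [e] in the exponent and 1 / e in the constant, because - e x e^(e
    x) <= 1. *)
Lemma xsx_le k (N : nat) a e b x : 0 <= a -> 0 < e -> a + e <= k%:R * b -> 5 <= N%:R * b ->
  `|x| * sx k b x <= (2 + e^-1) * sxM k N * dw a x.
Proof.
move=> a0 e0 ak Nb; have ei : 0 < e^-1 by rewrite invr_gt0.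
have [x0|x0] := leP 0 x.
  apply: (@le_trans _ _ (2 * sxM k N * dw a x)).
    apply: le_trans (sx_pos_le k a0 Nb x0).
    by rewrite ler_wpM2r ?sx_ge0// lerDr.
  by rewrite ler_wpM2r ?dw_ge0// ler_wpM2r ?sxM_ge0// lerDl ltW.
apply: (@le_trans _ _ (e^-1 * expR (a * x))).
  rewrite ltr0_norm//.
  apply: (@le_trans _ _ (- x * (expR (a * x) * expR (e * x)))).
    rewrite ler_wpM2l ?oppr_ge0 ?(ltW x0)// -expRD /sx ler_expR lerBlDr ler_wpDr ?expR_ge0//.
    by rewrite -mulrDl ler_wnM2r// ltW.
  have h : - (e * x) * expR (e * x) <= 1.
    rewrite -ler_pdivlMr ?expR_gt0// div1r -expRN.
    by have := expR_ge1Dx (- (e * x)); lra.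
  rewrite [leLHS](_ : _ = e^-1 * expR (a * x) * (- (e * x) * expR (e * x))); last first.
    by field; rewrite gt_eqF.
  by rewrite ler_piMr// mulr_ge0 ?expR_ge0// ltW.
apply: (le_trans (ler_wpM2l (ltW ei) (dw_neg _ (ltW x0)))).
rewrite mulrA ler_wpM2r ?dw_ge0// mulrDl.
by rewrite -[leLHS]add0r lerD ?mulr_ge0 ?sxM_ge0// ler_wpM2l ?(ltW ei)// sxM_ge.
Qed.

End symbols.

Section fourier_cosine.
Context (R : realType).
Notation mu := (@lebesgue_measure R).

(* Functions of [u > 0] are written [g (ln u)]: differentiating in [x = ln u] does not
   worsen their behaviour at [0]. *)
Definition Fc (g : R -> R) (y : R) : R := \int[mu]_u (cos (u * y) * g (ln `|u|)).
Definition Fs (g : R -> R) (y : R) : R := \int[mu]_u (u * sin (u * y) * g (ln `|u|)).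

Lemma expR_ln_norm (u : R) : `|u| <= expR (ln `|u|).
Proof.
have [->|u0] := eqVneq u 0; first by rewrite normr0 expR_ge0.
by rewrite lnK// posrE normr_gt0.
Qed.

Lemma inv_pow_wt (n : nat) (x u : R) : `|u| <= expR x -> ((1 + expR x) ^+ n)^-1 <= wt n%:R u.
Proof.
move=> ux; rewrite /wt powRN powR_mulrn ?addr_ge0//.
rewrite lef_pV2 ?posrE ?exprn_gt0 ?one_expR_gt0// ?ltr_pwDl//.
by apply: lerXn2r; rewrite ?nnegrE ?addr_ge0 ?expR_ge0// lerD2l.
Qed.

(** Only |u| <= e^x is assumed, not equality: the case x = ln |u| then includes u = 0, where the
    logarithm has a default value. *)
Lemma dw_le (a x u : R) : 0 <= a -> a <= 2 -> `|u| <= expR x -> dw a x <= wt 2 u.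
Proof.
move=> a0 a2 ux; apply: (le_trans _ (inv_pow_wt 2 ux)).
rewrite /dw ler_pdivrMr ?exprn_gt0 ?one_expR_gt0//.
rewrite (_ : 4%N = (2 + 2)%N)// exprD mulrA mulVf ?mul1r; last first.
  by rewrite expf_neq0// gt_eqF// one_expR_gt0.
have [x0|x0] := leP 0 x.
  apply: (@le_trans _ _ (expR (2%:R * x))); first by rewrite ler_expR ler_wpM2r.
  rewrite expRM_natl ler_pXn2r ?nnegrE ?expR_ge0 ?(ltW (one_expR_gt0 x))//.
  by rewrite lerDr.
apply: (@le_trans _ _ 1); first by rewrite -expR0 ler_expR mulr_ge0_le0// ltW.
by rewrite exprn_ege1// lerDl expR_ge0.
Qed.

Lemma dw_le_id (a x u : R) : 0 <= a -> a <= 1 -> `|u| <= expR x -> `|u| * dw a x <= wt 2 u.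
Proof.
move=> a0 a1 ux; have o0 := one_expR_gt0 x.
apply: le_trans (dw_le (a := a + 1) _ _ ux); [|lra|lra].
rewrite /dw mulrA ler_pM2r ?invr_gt0 ?exprn_gt0// mulrDl expRD mul1r mulrC.
by rewrite ler_wpM2l ?expR_ge0.
Qed.

Section decaying.
Variables (g : R -> R) (C a : R).
Hypotheses (mg : measurable_fun setT g) (C0 : 0 <= C) (a0 : 0 <= a) (a2 : a <= 2)
  (gC : forall x, `|g x| <= C * dw a x).

Let mgl : measurable_fun setT (fun u : R => g (ln `|u|)).
Proof. by apply: (meas_comp mg); meas. Qed.

Lemma integrable_Fc y : mu.-integrable setT (EFin \o (fun u => cos (u * y) * g (ln `|u|))).
Proof.
apply: (leb_le (g := fun u => C * wt 2 u)); first by meas.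
- move=> u; rewrite (le_trans (norm_trig_le _ (norm_cos_le1 _)))//.
  by rewrite (le_trans (gC _))// ler_wpM2l// dw_le// expR_ln_norm.
- by apply: RintegrableZ => //; apply: integrable_wt; lra.
Qed.

Definition wt2I : R := \int[mu]_u wt 2 u.

Lemma Fc_le y : `|Fc g y| <= C * wt2I.
Proof.
rewrite (le_trans (le_normr_Rintegral _ (integrable_Fc y)))//.
have iw : mu.-integrable setT (EFin \o (fun u => wt 2 u)) by apply: integrable_wt; lra.
rewrite -RintegralZl//; apply: le_Rintegral => //.
- exact: Rintegrable_norm (integrable_Fc y).
- exact: RintegrableZ.
- move=> u _; rewrite (le_trans (norm_trig_le _ (norm_cos_le1 _)))//.
  by rewrite (le_trans (gC _))// ler_wpM2l// dw_le// expR_ln_norm.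
Qed.

Lemma Fc_even y : Fc g (- y) = Fc g y.
Proof. by apply: eq_Rintegral => u _; rewrite mulrN cosN. Qed.

Lemma Fc_half y : Fc g y = 2 * \int[mu]_(u in `]0, +oo[) (cos (u * y) * g (ln u)).
Proof.
rewrite /Fc Rintegral_even; [|exact: integrable_Fc|]; last first.
  by move=> u; rewrite mulNr cosN normrN.
rewrite -Rintegral_itv_obnd_cbnd; last by apply: integrableS (integrable_Fc y).
congr (_ * _); apply: eq_Rintegral => u; rewrite inE/= in_itv/= andbT => u0.
by rewrite gtr0_norm.
Qed.

End decaying.

Lemma cvg_wt_pinfty (a : R) : 1 <= a -> wt a x @[x --> +oo] --> 0.
Proof.
move=> a1; apply/cvgrPdist_le => e e0; near=> x.
rewrite sub0r normrN ger0_norm ?wt_ge0// (le_trans (wt_le _ a1))//.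
rewrite /wt powRN powRr1 ?addr_ge0// -[leRHS]invrK lef_pV2 ?posrE ?invr_gt0 ?ltr_pwDl//.
apply: (@le_trans _ _ `|x|); last by rewrite lerDr.
by rewrite (le_trans _ (ler_norm _))//; near: x; apply: nbhs_pinfty_ge; exact: num_real.
Unshelve. all: by end_near. Qed.

(* The transform is split at [u = y^-1]; three integrations by parts on the far part
   gain the decay [y^-(1 + a)]. *)
Section oscillatory.
Variables (g0 g1 g2 g3 : R -> R) (C a : R).
Hypotheses (C0 : 0 <= C) (a0 : 0 < a) (a2 : a < 2)
  (d0 : forall x : R, is_derive x 1 g0 (g1 x)) (d1 : forall x : R, is_derive x 1 g1 (g2 x))
  (d2 : forall x : R, is_derive x 1 g2 (g3 x)) (c3 : continuous g3)
  (C_0 : forall x, `|g0 x| <= C * dw a x) (C_1 : forall x, `|g1 x| <= C * dw a x)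
  (C_2 : forall x, `|g2 x| <= C * dw a x) (C_3 : forall x, `|g3 x| <= C * dw a x).

Let mg0 : measurable_fun setT g0.
Proof. by apply: continuous_measurable_fun => x; exact: der_continuous (d0 x). Qed.

Let dw_pow (g : R -> R) u : 0 < u -> (forall x, `|g x| <= C * dw a x) ->
  `|g (ln u)| <= C * expR (a * ln u).
Proof.
move=> u0 gC; apply: (le_trans (gC _)); rewrite ler_wpM2l// /dw ler_pdivrMr ?exprn_gt0 ?one_expR_gt0//.
by rewrite ler_peMr ?expR_ge0// exprn_ege1// lerDl expR_ge0.
Qed.

Variable y : R.
Hypothesis y0 : 0 < y.
Let p := y^-1.
Let p0 : 0 < p. Proof. by rewrite invr_gt0. Qed.

Let head_part : `|\int[mu]_(u in `]0, p]) (cos (u * y) * g0 (ln u))| <= C * (expR (a * ln p) * p).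
Proof.
have ia : mu.-integrable `]0%R, p] (EFin \o (fun u => cos (u * y) * g0 (ln u))).
  have h : mu.-integrable `]0%R, p] (EFin \o (fun u => cos (u * y) * g0 (ln `|u|))).
    by apply: integrableS (integrable_Fc mg0 C0 (ltW a0) (ltW a2) C_0 y).
  by apply: eq_integrable h => // u; rewrite inE/= in_itv/= => /andP[u0 _]; rewrite gtr0_norm.
rewrite (le_trans (le_normr_Rintegral _ ia))//.
apply: (@le_trans _ _ (\int[mu]_(u in `]0, p]) (C * expR (a * ln p)))).
  apply: le_Rintegral => //.
  - exact: Rintegrable_norm.
  - apply: measurable_bounded_integrable => //.
      by rewrite /= lebesgue_measure_itv/= lte_fin p0 -EFinB ltry.
    exact: bounded_cst.
  - move=> u; rewrite /= in_itv/= => /andP[u0 up].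
    rewrite (le_trans (norm_trig_le _ (norm_cos_le1 _)))//.
    rewrite (le_trans (dw_pow u0 C_0))// ler_wpM2l// ler_expR ler_pM2l// ler_ln//.
rewrite Rintegral_cst//= lebesgue_measure_itv/= lte_fin p0 -EFinB/= subr0 mulrA//.
Qed.

Let pw (u : R) := expR ((a - 3) * ln u).

Let FTCpw : (\int[mu]_(u in `[p, +oo[) (pw u)%:E = (expR ((a - 2) * ln p) / (2 - a))%:E)%E.
Proof.
have a20 : a - 2 != 0 by rewrite subr_eq0 lt_eqF.
have a20' : 2 - a != 0 by rewrite subr_eq0 gt_eqF.
pose F (u : R) := expR ((a - 2) * ln u) / (a - 2).
have dF (u : R) : 0 < u -> is_derive u 1 F (pw u).
  move=> u0; der; rewrite /pw.
  have -> : (a - 2) * ln u = (a - 3) * ln u + ln u by ring.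
  have un0 : u != 0 by rewrite gt_eqF.
  by rewrite expRD lnK ?posrE//; field; rewrite un0 a20.
rewrite (@ge0_continuous_FTC2y _ pw F p 0).
- by rewrite sub0e /F -EFinN; congr EFin; field; rewrite a20 a20'.
- by move=> u _; exact: expR_ge0.
- apply: derivable_within_continuous => u; rewrite in_itv/= andbT => pu.
  suff : exists l, is_derive u 1 pw l by case=> l [].
  by have u0 := lt_le_trans p0 pu; eexists; rewrite /pw; der.
- rewrite /F -[X in _ --> X](mul0r (a - 2)^-1); apply: cvgM; last exact: cvg_cst.
  rewrite (_ : (fun u => _) = (fun u => expR (- ((2 - a) * ln u)))); last first.
    by apply/funext => u; congr expR; ring.
  apply: (cvg_comp _ (fun x : R => expR (- x))); last exact: cvgr_expR.
  apply: gt0_cvgMry; first by rewrite subr_gt0.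
  apply/cvgryPge => A; near=> x.
  rewrite -ler_expR lnK ?posrE; near: x; [apply: nbhs_pinfty_ge|apply: nbhs_pinfty_gt]; exact: num_real.
- by move=> u pu; have [] := dF u (lt_trans p0 pu).
- by apply: cvg_at_right_filter; exact: (der_continuous (dF p p0)).
- by move=> u; rewrite in_itv/= andbT => pu; apply: der_derive1; exact: dF (lt_trans p0 pu).
Unshelve. all: by end_near. Qed.

Let ipw : mu.-integrable `]p, +oo[ (EFin \o pw).
Proof.
have : mu.-integrable `[p, +oo[ (EFin \o pw).
  apply/integrableP; split.
    by apply/measurable_EFinP; apply: measurable_funTS; rewrite /pw; meas.
  under eq_integral do rewrite /= ger0_norm ?expR_ge0//.
  by rewrite FTCpw ltry.
by apply: integrableS => // u; rewrite /= !in_itv/= !andbT; exact: ltW.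
Qed.

Let pwI : \int[mu]_(u in `]p, +oo[) pw u = expR ((a - 2) * ln p) / (2 - a).
Proof. by rewrite Rintegral_itv_obnd_cbnd// /Rintegral FTCpw. Qed.

(** The third derivative of u -> g0(ln u) is [third u / u ^+ 3]. *)
Let third u := g3 (ln u) - 3 * g2 (ln u) + 2 * g1 (ln u).

Let third_le u : 0 < u -> `|third u| <= 6 * C * expR (a * ln u).
Proof.
move=> u0; have h1 := dw_pow u0 C_1; have h2 := dw_pow u0 C_2; have h3 := dw_pow u0 C_3.
rewrite /third; move: h1 h2 h3; rewrite !ler_norml => /andP[? ?] /andP[? ?] /andP[? ?].
by apply/andP; split; lra.
Qed.

(** Three integrations by parts, written as one antiderivative: [tail_A] collects the boundary
    terms, and [tail_f] is the original integrand minus the one that remains at the end. *)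
Let tail_f u := cos (u * y) * g0 (ln u) - y ^- 3 * (sin (u * y) * (third u / u ^+ 3)).

Let tail_A u := sin (u * y) / y * g0 (ln u) + cos (u * y) / y ^+ 2 * (g1 (ln u) / u)
  - sin (u * y) / y ^+ 3 * ((g2 (ln u) - g1 (ln u)) / u ^+ 2).

Let dA (u : R) : 0 < u -> is_derive u 1 tail_A (tail_f u).
Proof.
move=> u0; have dl : is_derive u 1 (@ln R) u^-1 by exact: is_derive1_ln.
have e0 : is_derive u 1 (fun u => g0 (ln u)) (g1 (ln u) * u^-1) by exact: der_comp (d0 _) dl.
have e1 : is_derive u 1 (fun u => g1 (ln u)) (g2 (ln u) * u^-1) by exact: der_comp (d1 _) dl.
have e2 : is_derive u 1 (fun u => g2 (ln u)) (g3 (ln u) * u^-1) by exact: der_comp (d2 _) dl.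
have un0 : u != 0 by rewrite gt_eqF.
have u20 : u ^+ 2 != 0 by rewrite expf_neq0.
by rewrite /tail_A; der; rewrite /tail_f /third; field; rewrite un0 gt_eqF.
Qed.

Let A_le u : 0 < u -> 1 <= u * y -> `|tail_A u| <= 4 * C * dw a (ln u) / y.
Proof.
move=> u0 uy; pose w := (u * y)^-1; set D := C * dw a (ln u).
have w0 : 0 <= w by rewrite invr_ge0 ltW// mulr_gt0.
have w1 : w <= 1 by rewrite invf_le1// mulr_gt0.
have D0 : 0 <= D by rewrite mulr_ge0// dw_ge0.
have -> : tail_A u = (sin (u * y) * g0 (ln u) + cos (u * y) * (w * g1 (ln u))
    - sin (u * y) * (w ^+ 2 * (g2 (ln u) - g1 (ln u)))) / y.
  by rewrite /tail_A /w; field; rewrite !gt_eqF.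
rewrite normrM normfV (gtr0_norm y0) ler_pM2r ?invr_gt0// -mulrA -/D.
have h0 := C_0 (ln u); have h1 := C_1 (ln u); have h2 := C_2 (ln u).
have t0 : `|sin (u * y) * g0 (ln u)| <= D by exact: le_trans (norm_trig_le _ (norm_sin_le1 _)) h0.
have t1 : `|cos (u * y) * (w * g1 (ln u))| <= D.
  apply: (le_trans (norm_trig_le _ (norm_cos_le1 _))).
  by rewrite normrM (ger0_norm w0) (le_trans _ h1)// ler_piMl.
have t2 : `|sin (u * y) * (w ^+ 2 * (g2 (ln u) - g1 (ln u)))| <= 2 * D.
  apply: (le_trans (norm_trig_le _ (norm_sin_le1 _))).
  rewrite normrM (ger0_norm (exprn_ge0 _ w0)).
  apply: (@le_trans _ _ (`|g2 (ln u) - g1 (ln u)|)); first by rewrite ler_piMl// exprn_ile1.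
  rewrite (le_trans (ler_normB _ _))//.
  by move: h1 h2; rewrite -/D; lra.
move: t0 t1 t2; rewrite !ler_norml => /andP[? ?] /andP[? ?] /andP[? ?].
by apply/andP; split; lra.
Qed.

Let dw_le_pow u : dw a (ln u) <= expR (a * ln u).
Proof.
by rewrite /dw ler_pdivrMr ?exprn_gt0 ?one_expR_gt0// ler_peMr ?expR_ge0// exprn_ege1// lerDl expR_ge0.
Qed.

Let icos : mu.-integrable `]p, +oo[ (EFin \o (fun u => cos (u * y) * g0 (ln u))).
Proof.
have h : mu.-integrable `]p, +oo[ (EFin \o (fun u => cos (u * y) * g0 (ln `|u|))).
  by apply: integrableS (integrable_Fc mg0 C0 (ltW a0) (ltW a2) C_0 y).
apply: eq_integrable h => // u; rewrite inE/= in_itv/= andbT => pu.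
by rewrite gtr0_norm// (lt_trans p0).
Qed.

Let rem u := sin (u * y) * (third u / u ^+ 3).

Let rem_le u : p < u -> `|rem u| <= 6 * C * pw u.
Proof.
move=> pu; have u0 := lt_trans p0 pu.
rewrite (le_trans (norm_trig_le _ (norm_sin_le1 _)))// normrM normfV.
rewrite [`|u ^+ 3|]ger0_norm ?exprn_ge0 ?(ltW u0)// ler_pdivrMr ?exprn_gt0//.
apply: (le_trans (third_le u0)); rewrite -[leRHS]mulrA ler_wpM2l ?mulr_ge0//.
rewrite (_ : u ^+ 3 = expR (3%:R * ln u)); last by rewrite expRM_natl lnK.
rewrite /pw -expRD ler_expR.
by rewrite [leLHS](_ : _ = (a - 3) * ln u + 3 * ln u)//; ring.
Qed.

Let irem : mu.-integrable `]p, +oo[ (EFin \o rem).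
Proof.
apply: (@Rintegrable_le _ _ _ mu `]p, +oo[%classic rem (fun u => 6 * C * pw u)) => //; last exact: RintegrableZ.
  have mc (g : R -> R) : continuous g -> measurable_fun setT (fun u : R => g (ln u)).
    by move=> cg; apply: meas_continuous => //; exact: measurable_ln.
  have cd (g dg : R -> R) : (forall x : R, is_derive x 1 g (dg x)) -> continuous g.
    by move=> h x; exact: der_continuous (h x).
  have m1 := mc _ (cd _ _ d1); have m2 := mc _ (cd _ _ d2); have m3 := mc _ c3.
  by apply: measurable_funTS; rewrite /rem /third; meas.
by move=> u; rewrite /= in_itv/= andbT; exact: rem_le.
Qed.

Let tail_part : `|\int[mu]_(u in `]p, +oo[) (cos (u * y) * g0 (ln u))| <=
  (4 + 6 / (2 - a)) * C * (expR (a * ln p) * p).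
Proof.
have if_ : mu.-integrable `]p, +oo[ (EFin \o tail_f).
  by apply: RintegrableB => //; exact: RintegrableZ.
have E : \int[mu]_(u in `]p, +oo[) tail_f u = 0 - tail_A p.
  apply: (@integrable_FTC2y _ tail_f tail_A p) => //.
  - by move=> u pu; exact: dA (lt_trans p0 pu).
  - move=> u pu; have u0 := lt_trans p0 pu.
    have cl (g : R -> R) : continuous g -> {for u, continuous (fun u => g (ln u))}.
      move=> cg; apply: (@continuous_comp _ _ _ (@ln R) g); last exact: cg.
      exact: continuous_ln.
    have cd (g dg : R -> R) : (forall x : R, is_derive x 1 g (dg x)) -> continuous g.
      by move=> h x; exact: der_continuous (h x).
    have c0 := cl _ (cd _ _ d0); have c1 := cl _ (cd _ _ d1).
    have c2 := cl _ (cd _ _ d2); have c3' := cl _ c3.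
    have ctr (f df : R -> R) : (forall x : R, is_derive x 1 f (df x)) -> {for u, continuous f}.
      by move=> h; exact: der_continuous (h u).
    rewrite /tail_f /third.
    have cc : {for u, continuous (fun x : R => cos (x * y))} by eapply der_continuous; der_rules R.
    have cs : {for u, continuous (fun x : R => sin (x * y))} by eapply der_continuous; der_rules R.
    apply: cvgB; first by apply: cvgM.
    apply: cvgM; first exact: cvg_cst.
    apply: cvgM; first exact: cs.
    apply: cvgM.
      apply: cvgD; last by apply: cvgM => //; exact: cvg_cst.
      by apply: cvgB => //; apply: cvgM => //; exact: cvg_cst.
    apply: cvgV; first by rewrite expf_neq0// gt_eqF.
    exact: exprn_continuous.
  - by apply: cvg_at_right_filter; exact: (der_continuous (dA p0)).
  - apply: (cvg0_le (g := fun u => 4 * C / y * wt 2 u)).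
      near=> u; have u0 : 0 < u by near: u; apply: nbhs_pinfty_gt; exact: num_real.
      have pu : p <= u by near: u; apply: nbhs_pinfty_ge; exact: num_real.
      have uy : 1 <= u * y by rewrite -ler_pdivrMr// div1r.
      rewrite (le_trans (A_le u0 uy))// mulrAC ler_wpM2l//.
        by rewrite divr_ge0 ?mulr_ge0// ltW.
      by apply: dw_le; [exact: ltW|exact: ltW|]; rewrite lnK ?posrE// gtr0_norm.
    rewrite -[X in _ --> X](mulr0 (4 * C / y)); apply: cvgM; first exact: cvg_cst.
    by apply: cvg_wt_pinfty; lra.
move: E; rewrite sub0r RintegralB//; last exact: RintegrableZ.
rewrite RintegralZl// => /eqP; rewrite subr_eq => /eqP ->.
rewrite (le_trans (ler_normD _ _))// normrN.
have hA : `|tail_A p| <= 4 * C * (expR (a * ln p) * p).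
  rewrite mulrA -[X in _ <= _ * X]/(y^-1); apply: (le_trans (A_le p0 _)).
    by rewrite /p mulVf// gt_eqF.
  by rewrite ler_pM2r ?invr_gt0// ler_wpM2l ?mulr_ge0 ?dw_le_pow.
have hR : `|y ^- 3 * \int[mu]_(u in `]p, +oo[) rem u| <= 6 / (2 - a) * C * (expR (a * ln p) * p).
  rewrite normrM ger0_norm ?invr_ge0 ?exprn_ge0 ?(ltW y0)//.
  rewrite -exprVn -/p.
  apply: (@le_trans _ _ (p ^+ 3 * (6 * C * (expR ((a - 2) * ln p) / (2 - a))))).
    rewrite ler_wpM2l ?exprn_ge0 ?(ltW p0)//.
    rewrite (le_trans (le_normr_Rintegral _ irem))// -pwI -RintegralZl//.
    apply: le_Rintegral => //; [exact: Rintegrable_norm|exact: RintegrableZ|].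
    by move=> u; rewrite /= in_itv/= andbT; exact: rem_le.
  have -> : a * ln p = (a - 2) * ln p + 2%:R * ln p by ring.
  rewrite expRD expRM_natl lnK//.
  by rewrite [leLHS](_ : _ = 6 / (2 - a) * C * (expR ((a - 2) * ln p) * p ^+ 2 * p))//; field; rewrite subr_eq0 gt_eqF.
by apply: (le_trans (lerD hA hR)); rewrite -mulrDl -mulrDl.
Unshelve. all: by end_near. Qed.

(** In the constant, 5 is 1 for the head ]0, 1/y] plus 4 for the boundary terms, 6 / (2 - a) comes
    from integrating the remainder u^(a - 3) over the tail, and 2 from evenness. *)
Lemma oscillatory_pos : `|Fc g0 y| <= 2 * (5 + 6 / (2 - a)) * C * (expR (- a * ln y) / y).
Proof.
rewrite (Fc_half mg0 C0 (ltW a0) (ltW a2) C_0) normrM ger0_norm// -!mulrA ler_wpM2l//.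
have U : `]0, +oo[%classic = `]0, p]%classic `|` `]p, +oo[%classic :> set R.
  apply/seteqP; split => u /=; rewrite !in_itv/= !andbT.
    by move=> ->; case: (leP u p); [left|right].
  by case=> [/andP[]//|]; exact: lt_trans.
rewrite U Rintegral_setU//; [|rewrite -U|]; last 2 first.
- have h : mu.-integrable `]0%R, +oo[ (EFin \o (fun u => cos (u * y) * g0 (ln `|u|))).
    by apply: integrableS (integrable_Fc mg0 C0 (ltW a0) (ltW a2) C_0 y).
  by apply: eq_integrable h => // u; rewrite inE/= in_itv/= andbT => u0; rewrite gtr0_norm.
- apply/disj_setPS => u [/=]; rewrite !in_itv/= andbT => /andP[_ up] pu.
  by move: (lt_le_trans pu up); rewrite ltxx.
rewrite (le_trans (ler_normD _ _))// (le_trans (lerD head_part tail_part))//.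
have -> : - a * ln y = a * ln p by rewrite /p lnV ?posrE//; ring.
by rewrite -/p -mulrDl mulrA ler_wpM2r ?mulr_ge0 ?expR_ge0 ?(ltW p0)//; lra.
Qed.

End oscillatory.

Lemma Fs_le (g : R -> R) (C a y : R) : measurable_fun setT g -> 0 <= C -> 0 <= a -> a <= 1 ->
  (forall x, `|g x| <= C * dw a x) -> `|Fs g y| <= C * wt2I.
Proof.
move=> mg C0 a0 a1 gC.
have mgl : measurable_fun setT (fun u : R => g (ln `|u|)) by apply: (meas_comp mg); meas.
have ub u : `|u * sin (u * y) * g (ln `|u|)| <= C * wt 2 u.
  rewrite mulrAC mulrC (le_trans (norm_trig_le _ (norm_sin_le1 _)))// normrM.
  apply: (le_trans (ler_wpM2l (normr_ge0 _) (gC _))).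
  by rewrite mulrCA ler_wpM2l// dw_le_id// expR_ln_norm.
have iw : mu.-integrable setT (EFin \o (fun u => C * wt 2 u)).
  by apply: RintegrableZ => //; apply: integrable_wt; lra.
have ig : mu.-integrable setT (EFin \o (fun u => u * sin (u * y) * g (ln `|u|))).
  by apply: (leb_le (g := fun u => C * wt 2 u)) => //; meas.
rewrite (le_trans (le_normr_Rintegral _ ig))// -RintegralZl//; last by apply: integrable_wt; lra.
by apply: le_Rintegral => //; exact: Rintegrable_norm.
Qed.

(** The constant of [Fc_bound]: [wt2I] serves |y| < 1 and the second summand |y| >= 1. The factor 8
    = 2^3 pays for replacing |y| by 1 + |y| under a power 1 + a < 3. *)
Definition FcK (a : R) : R := 8 * (wt2I + 2 * (5 + 6 / (2 - a))).

Lemma wt2I_ge0 : 0 <= wt2I.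
Proof. by apply: Rintegral_ge0 => x _; exact: wt_ge0. Qed.

Lemma Fc_bound (g0 g1 g2 g3 : R -> R) (C a y : R) : 0 <= C -> 0 < a -> a < 2 ->
  (forall x : R, is_derive x 1 g0 (g1 x)) -> (forall x : R, is_derive x 1 g1 (g2 x)) ->
  (forall x : R, is_derive x 1 g2 (g3 x)) -> continuous g3 ->
  (forall x, `|g0 x| <= C * dw a x) -> (forall x, `|g1 x| <= C * dw a x) ->
  (forall x, `|g2 x| <= C * dw a x) -> (forall x, `|g3 x| <= C * dw a x) ->
  `|Fc g0 y| <= C * FcK a * wt (1 + a) y.
Proof.
move=> C0 a0 a2 d0 d1 d2 c3 C_0 C_1 C_2 C_3.
have mg0 : measurable_fun setT g0.
  by apply: continuous_measurable_fun => x; exact: der_continuous (d0 x).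
wlog y0 : y / 0 <= y.
  move=> H; have [/H//|/ltW y0] := leP 0 y.
  by have := H (- y); rewrite oppr_ge0 Fc_even wtN; exact.
have q0 : 0 <= 6 / (2 - a) by rewrite divr_ge0// subr_ge0 ltW.
have w0 := wt2I_ge0.
have [y1|y1] := leP 1 y.
  have yp : 0 < y by lra.
  apply: (le_trans (oscillatory_pos C0 a0 a2 d0 d1 d2 c3 C_0 C_1 C_2 C_3 yp)).
  rewrite (mulrC _ C) -!mulrA ler_wpM2l//.
  have h : expR (- a * ln y) / y <= 8 * wt (1 + a) y.
    have -> : expR (- a * ln y) / y = expR (- (1 + a) * ln y).
      by rewrite -{2}(lnK yp) -expRN -expRD; congr expR; ring.
    rewrite wtE ger0_norm//.
    have l2 : ln (1 + y) <= ln y + ln 2.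
      rewrite -lnM ?posrE// ler_ln ?posrE; [|lra|by rewrite mulr_gt0].
      lra.
    apply: (@le_trans _ _ (expR ((1 + a) * ln 2) * expR (- (1 + a) * ln (1 + y)))).
      by rewrite -expRD ler_expR; nra.
    rewrite ler_wpM2r ?expR_ge0//.
    apply: (@le_trans _ _ (expR (3%:R * ln 2))).
      by rewrite ler_expR ler_wpM2r ?ln_ge0//; lra.
    by rewrite expRM_natl lnK ?posrE// (_ : 2 ^+ 3 = 8)//; ring.
  rewrite /FcK [leRHS](_ : _ = (wt2I + 2 * (5 + 6 / (2 - a))) * (8 * wt (1 + a) y)); last by ring.
  rewrite mulrA ler_pM ?mulr_ge0 ?expR_ge0 ?invr_ge0//; lra.
apply: (le_trans (Fc_le mg0 C0 (ltW a0) (ltW a2) C_0 y)).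
rewrite -mulrA ler_wpM2l// /FcK.
have h : 1 <= 8 * wt (1 + a) y.
  rewrite wtE ger0_norm//.
  apply: (@le_trans _ _ (8 * expR (- (3%:R * ln 2)))).
    by rewrite expRN expRM_natl lnK ?posrE// ler_pdivlMr ?exprn_gt0//; lra.
  rewrite ler_pM2l// ler_expR mulNr lerN2.
  have l2 : ln (1 + y) <= ln 2 by rewrite ler_ln ?posrE; lra.
  have l0 : 0 <= ln (1 + y) by rewrite ln_ge0 ?lerDl.
  rewrite ler_pM//; lra.
rewrite [leRHS](_ : _ = (wt2I + 2 * (5 + 6 / (2 - a))) * (8 * wt (1 + a) y)); last by ring.
by rewrite -[leLHS]mulr1 ler_pM//; lra.
Qed.

Lemma der_Fc (g : R -> R) (C a y : R) : measurable_fun setT g -> 0 <= C -> 0 <= a -> a <= 1 ->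
  (forall x, `|g x| <= C * dw a x) -> is_derive y 1 (Fc g) (- Fs g y).
Proof.
move=> mg C0 a0 a1 gC.
have mgl : measurable_fun setT (fun u : R => g (ln `|u|)) by apply: (meas_comp mg); meas.
have ub u v : `|u * sin (u * v) * g (ln `|u|)| <= C * wt 2 u.
  rewrite mulrAC mulrC (le_trans (norm_trig_le _ (norm_sin_le1 _)))// normrM.
  apply: (le_trans (ler_wpM2l (normr_ge0 _) (gC _))).
  by rewrite mulrCA ler_wpM2l// dw_le_id// expR_ln_norm.
have iw : mu.-integrable setT (EFin \o (fun u => C * wt 2 u)).
  by apply: RintegrableZ => //; apply: integrable_wt; lra.
have := @der_under_integral _ _ R mu setT (fun y u => cos (u * y) * g (ln `|u|))
  (fun y u => - (u * sin (u * y) * g (ln `|u|))) (fun u => C * wt 2 u) y 1 measurableT ltr01.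
have a2 : a <= 2 by lra.
move=> /(_ (fun v _ => integrable_Fc mg C0 a0 a2 gC v)) h.
have {h} := h _ iw _; rewrite -/(Fc g) => h.
apply: (der_eq (h _ _)).
- by move=> v u _ _; der; ring.
- by move=> v u _ _; rewrite normrN; exact: ub.
rewrite /Fs -mulN1r -RintegralZl//; first by apply: eq_Rintegral => u _; rewrite mulN1r.
by apply: (leb_le (g := fun u => C * wt 2 u)) => //; meas.
Qed.

(** The left side is the derivative of y -> y Fc(g0)(y): a dilation in [y] corresponds to a
    translation in ln u. The proof integrates the derivative of u cos(u y) g0(ln u), whose boundary
    values vanish. *)
Lemma Fc_by_parts (g0 g1 : R -> R) (C a a' y : R) : 0 <= C -> 0 <= a -> a <= 1 -> 0 <= a' -> a' <= 2 ->
  (forall x : R, is_derive x 1 g0 (g1 x)) -> continuous g1 ->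
  (forall x, `|g0 x| <= C * dw a x) -> (forall x, `|g1 x| <= C * dw a' x) ->
  Fc g0 y - y * Fs g0 y = - Fc g1 y.
Proof.
move=> C0 a0 a1 a0' a2' d0 c1 C_0 C_1.
have mg0 : measurable_fun setT g0.
  by apply: continuous_measurable_fun => x; exact: der_continuous (d0 x).
have mg1 : measurable_fun setT g1 by exact: continuous_measurable_fun.
have mgl : measurable_fun setT (fun u : R => g0 (ln `|u|)) by apply: (meas_comp mg0); meas.
have a2 : a <= 2 by lra.
have i0 := integrable_Fc mg0 C0 a0 a2 C_0 y.
have i1 := integrable_Fc mg1 C0 a0' a2' C_1 y.
have is0 : mu.-integrable setT (EFin \o (fun u => u * sin (u * y) * g0 (ln `|u|))).
  apply: (leb_le (g := fun u => C * wt 2 u)); first by meas.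
    move=> u; rewrite mulrAC mulrC (le_trans (norm_trig_le _ (norm_sin_le1 _)))// normrM.
    apply: (le_trans (ler_wpM2l (normr_ge0 _) (C_0 _))).
    by rewrite mulrCA ler_wpM2l// dw_le_id// expR_ln_norm.
  by apply: RintegrableZ => //; apply: integrable_wt; lra.
pose f u := cos (u * y) * g0 (ln `|u|) - y * (u * sin (u * y) * g0 (ln `|u|)) + cos (u * y) * g1 (ln `|u|).
have if_ : mu.-integrable setT (EFin \o f).
  by apply: RintegrableD => //; apply: RintegrableB => //; exact: RintegrableZ.
have f0 : \int[mu]_u f u = 0.
  rewrite Rintegral_even//; last by move=> u; rewrite /f normrN !mulNr cosN sinN; ring.
  rewrite -Rintegral_itv_obnd_cbnd; last by apply: integrableS if_.
  have -> : \int[mu]_(u in `]0, +oo[) f u = 0 - 0; last by rewrite subrr mulr0.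
  have fE u : 0 < u -> f u = cos (u * y) * g0 (ln u) - y * (u * sin (u * y) * g0 (ln u)) + cos (u * y) * g1 (ln u).
    by move=> u0; rewrite /f gtr0_norm.
  apply: (@integrable_FTC2y _ f (fun u => u * cos (u * y) * g0 (ln u))).
  - move=> u u0; have dl : is_derive u 1 (@ln R) u^-1 by exact: is_derive1_ln.
    have e0 : is_derive u 1 (fun u => g0 (ln u)) (g1 (ln u) * u^-1) by exact: der_comp (d0 _) dl.
    by der; rewrite fE//; field; rewrite gt_eqF.
  - move=> u u0.
    have cl (g : R -> R) : continuous g -> {for u, continuous (fun u => g (ln `|u|))}.
      move=> cg; apply: (@continuous_comp _ _ _ (fun u => ln `|u|) g); last exact: cg.
      apply: (@continuous_comp _ _ _ (fun u : R => `|u|) (@ln R)); first exact: norm_continuous.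
      by apply: continuous_ln; rewrite normr_gt0 gt_eqF.
    have cg0 : continuous g0 by move=> x; exact: der_continuous (d0 x).
    have cc : {for u, continuous (fun x : R => cos (x * y))} by eapply der_continuous; der_rules R.
    have cs : {for u, continuous (fun x : R => x * sin (x * y))} by eapply der_continuous; der_rules R.
    apply: cvgD; last by apply: cvgM; [exact: cc|exact: (cl g1 c1)].
    apply: cvgB; first by apply: cvgM; [exact: cc|exact: (cl g0 cg0)].
    by apply: cvgM; [exact: cvg_cst|apply: cvgM; [exact: cs|exact: (cl g0 cg0)]].
  - by apply: integrableS if_.
  - have b0 u : 0 < u -> `|u * cos (u * y) * g0 (ln u)| <= C * u.
      move=> u0; rewrite mulrAC mulrC (le_trans (norm_trig_le _ (norm_cos_le1 _)))//.
      rewrite normrM gtr0_norm// mulrC ler_wpM2r ?(ltW u0)// (le_trans (C_0 _))// ler_piMr//.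
      have := @dw_le a (ln u) u a0 a2; rewrite lnK ?posrE// gtr0_norm// => /(_ (lexx _)) h.
      by rewrite (le_trans h)// wt_le1.
    apply: (cvg0_le (g := fun u => C * u)).
      by near=> u; apply: b0.
    rewrite -[X in _ --> X](mulr0 C); apply: cvgM; first exact: cvg_cst.
    exact: cvg_at_right_filter.
  - apply: (cvg0_le (g := fun u => C * wt 2 u)).
      near=> u; have u0 : 0 < u by near: u; apply: nbhs_pinfty_gt; exact: num_real.
      rewrite mulrAC mulrC (le_trans (norm_trig_le _ (norm_cos_le1 _)))// normrM.
      apply: (le_trans (ler_wpM2l (normr_ge0 _) (C_0 _))).
      rewrite mulrCA ler_wpM2l// dw_le_id//.
      by rewrite lnK ?posrE// gtr0_norm.
    rewrite -[X in _ --> X](mulr0 C); apply: cvgM; first exact: cvg_cst.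
    by apply: cvg_wt_pinfty; lra.
move: f0; rewrite /f RintegralD//; last by apply: RintegrableB => //; exact: RintegrableZ.
rewrite RintegralB//; last exact: RintegrableZ.
rewrite RintegralZl// -/(Fc g0 y) -/(Fs g0 y) -/(Fc g1 y) => /eqP.
by rewrite addr_eq0 => /eqP.
Unshelve. all: by end_near. Qed.

Lemma der_Fc_param (g dg : R -> R -> R) (C a b e y : R) : 0 < e -> 0 <= C -> 0 <= a -> a <= 2 ->
  (forall b', `|b' - b| < e -> measurable_fun setT (g b')) ->
  (forall b' x, `|b' - b| < e -> is_derive b' 1 (g ^~ x) (dg b' x)) ->
  (forall b' x, `|b' - b| < e -> `|g b' x| <= C * dw a x) ->
  (forall b' x, `|b' - b| < e -> `|dg b' x| <= C * dw a x) ->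
  is_derive b 1 (fun b' => Fc (g b') y) (Fc (dg b) y).
Proof.
move=> e0 C0 a0 a2 mg dgE gC dgC.
apply: (@der_under_integral _ _ R mu setT (fun b u => cos (u * y) * g b (ln `|u|))
  (fun b u => cos (u * y) * dg b (ln `|u|)) (fun u => C * wt 2 u) b e) => //.
- move=> b' hb; apply: (integrable_Fc (mg _ hb) C0 a0 a2) => x; exact: gC.
- by move=> b' u hb _; have h := dgE b' (ln `|u|) hb; der; ring.
- by apply: RintegrableZ => //; apply: integrable_wt; lra.
- move=> b' u hb _; rewrite (le_trans (norm_trig_le _ (norm_cos_le1 _)))//.
  by rewrite (le_trans (dgC _ _ hb))// ler_wpM2l// dw_le// expR_ln_norm.
Qed.

Lemma cvg_Fc (g_ : nat -> R -> R) (g : R -> R) (y_ : nat -> R) (C a y : R) :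
  0 <= C -> 0 <= a -> a <= 2 -> (forall n, measurable_fun setT (g_ n)) ->
  (forall n x, `|g_ n x| <= C * dw a x) ->
  (forall x, g_ n x @[n --> \oo] --> g x) -> y_ n @[n --> \oo] --> y ->
  Fc (g_ n) (y_ n) @[n --> \oo] --> Fc g y.
Proof.
move=> C0 a0 a2 mg gC gg yy.
have mgl n : measurable_fun setT (fun u : R => g_ n (ln `|u|)) by apply: (meas_comp (mg n)); meas.
apply: (@Rintegral_dominated_cvg _ _ _ mu setT _ _ (fun u => C * wt 2 u)) => //.
- by move=> n; have m := mgl n; meas.
- move=> u _; apply: cvgM => //.
  apply: (cvg_comp _ cos); last exact: continuous_cos.
  by apply: cvgM => //; exact: cvg_cst.
- by apply: RintegrableZ => //; apply: integrable_wt; lra.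
- move=> n u _; rewrite (le_trans (norm_trig_le _ (norm_cos_le1 _)))//.
  by rewrite (le_trans (gC _ _))// ler_wpM2l// dw_le// expR_ln_norm.
Qed.

Lemma cvg_Fs (g_ : nat -> R -> R) (g : R -> R) (y_ : nat -> R) (C a y : R) :
  0 <= C -> 0 <= a -> a <= 1 -> (forall n, measurable_fun setT (g_ n)) ->
  (forall n x, `|g_ n x| <= C * dw a x) ->
  (forall x, g_ n x @[n --> \oo] --> g x) -> y_ n @[n --> \oo] --> y ->
  Fs (g_ n) (y_ n) @[n --> \oo] --> Fs g y.
Proof.
move=> C0 a0 a1 mg gC gg yy.
have mgl n : measurable_fun setT (fun u : R => g_ n (ln `|u|)) by apply: (meas_comp (mg n)); meas.
apply: (@Rintegral_dominated_cvg _ _ _ mu setT _ _ (fun u => C * wt 2 u)) => //.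
- by move=> n; have m := mgl n; meas.
- move=> u _; apply: cvgM => //; apply: cvgM; first exact: cvg_cst.
  apply: (cvg_comp _ sin); last exact: continuous_sin.
  by apply: cvgM => //; exact: cvg_cst.
- by apply: RintegrableZ => //; apply: integrable_wt; lra.
- move=> n u _; rewrite mulrAC mulrC (le_trans (norm_trig_le _ (norm_sin_le1 _)))// normrM.
  apply: (le_trans (ler_wpM2l (normr_ge0 _) (gC _ _))).
  by rewrite mulrCA ler_wpM2l// dw_le_id// expR_ln_norm.
Qed.

End fourier_cosine.

(** * Stable densities and their derivatives *)

Section stable_functions.
Context (R : realType).
Notation mu := (@lebesgue_measure R).
Notation gau s := (normal_pdf (0 : R) s).
Implicit Types (b x y : R).

(** The inverse Fourier transform of e^(-|u|^b). The next two functions are the formal derivatives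
    under the integral sign; [der_stab_y] and [der_stab_b] justify them. *)
Definition stab b y : R := (2 * pi)^-1 * Fc (sx 0 b) y.
Definition stab_y b y : R := - ((2 * pi)^-1 * Fs (sx 0 b) y).
Definition stab_b b y : R := (2 * pi)^-1 * Fc (fun x => - (x * sx 1 b x)) y.
(* Minus the derivative at [s = 0] of the density of [e^s Z], where [Z] has density
   [stab b]. *)
Definition stab_s b y : R := stab b y + y * stab_y b y.

Lemma continuous_sx k b : continuous (@sx R k b).
Proof. by move=> x; exact: der_continuous (der_sx k b x). Qed.

Lemma meas_sx k b : measurable_fun setT (@sx R k b).
Proof. by apply: continuous_measurable_fun; exact: continuous_sx. Qed.

Lemma twopi_gt0 : 0 < 2 * pi :> R.
Proof. by rewrite mulr_gt0// pi_gt0. Qed.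

Lemma stab_even b y : stab b (- y) = stab b y.
Proof. by rewrite /stab Fc_even. Qed.

Lemma FcZ (g : R -> R) c y :
  mu.-integrable setT (EFin \o (fun u => cos (u * y) * g (ln `|u|))) ->
  Fc (fun x => c * g x) y = c * Fc g y.
Proof.
by move=> ig; rewrite /Fc -RintegralZl//; apply: eq_Rintegral => u _; rewrite mulrCA.
Qed.

Lemma FcD (f g : R -> R) y :
  mu.-integrable setT (EFin \o (fun u => cos (u * y) * f (ln `|u|))) ->
  mu.-integrable setT (EFin \o (fun u => cos (u * y) * g (ln `|u|))) ->
  Fc (fun x => f x + g x) y = Fc f y + Fc g y.
Proof.
by move=> jf ig; rewrite /Fc -RintegralD//; apply: eq_Rintegral => u _; rewrite mulrDr.
Qed.

Lemma natM_ge0 (n : nat) x : 0 <= x -> 0 <= n%:R * x.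
Proof. by move=> x0; rewrite mulr_ge0. Qed.

Lemma twopiV_ge0 : 0 <= (2 * pi)^-1 :> R.
Proof. by rewrite invr_ge0 ltW// twopi_gt0. Qed.

(** One integer N above 5 / b0 serves every b >= b0, and the sum of six constants serves every k <=
    5. Uniformity is essential because the exponent of the local alternatives moves with n. *)
Lemma sx_uniform b0 : 0 < b0 -> exists M : R, [/\ 0 <= M,
  forall k a b x, (k <= 5)%N -> 0 <= a -> b0 <= b -> a <= k%:R * b -> `|sx k b x| <= 2 * M * dw a x,
  forall k a e b x, (k <= 5)%N -> 0 <= a -> 0 < e -> b0 <= b -> a + e <= k%:R * b ->
    `|x * sx k b x| <= (2 + e^-1) * M * dw a x &
  forall k a b x, (k <= 5)%N -> 0 <= a -> b0 <= b -> 0 <= x -> `|sx k b x| <= 2 * M * dw a x].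
Proof.
move=> b00; pose N : nat := (Num.truncn (5 / b0)).+1.
have Nb b : b0 <= b -> 5 <= N%:R * b.
  move=> h; have := truncnS_gt (5 / b0); rewrite -/N ltr_pdivrMr// => /ltW h1.
  by rewrite (le_trans h1)// ler_wpM2l.
have sxM0 k : 0 <= sxM R k N := sxM_ge0 R k N.
clearbody N.
exists (sxM R 0 N + sxM R 1 N + sxM R 2 N + sxM R 3 N + sxM R 4 N + sxM R 5 N).
have Mk k : (k <= 5)%N -> sxM R k N <= sxM R 0 N + sxM R 1 N + sxM R 2 N + sxM R 3 N + sxM R 4 N + sxM R 5 N.
  move: (sxM0 0%N) (sxM0 1%N) (sxM0 2%N) (sxM0 3%N) (sxM0 4%N) (sxM0 5%N).
  by move: k => [|[|[|[|[|[|]]]]]]//= *; lra.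
split; first exact: le_trans (sxM0 0%N) (Mk 0%N isT).
  move=> k a b x k5 a0 h ak; rewrite ger0_norm ?sx_ge0//.
  apply: (le_trans (sx_le x a0 ak (Nb _ h))).
  by rewrite ler_wpM2r ?dw_ge0// ler_wpM2l// Mk.
  move=> k a e b x k5 a0 e0 h ak; rewrite normrM (ger0_norm (sx_ge0 _ _ _)).
  apply: (le_trans (xsx_le x a0 e0 ak (Nb _ h))).
  have : 0 < e^-1 by rewrite invr_gt0.
  by move=> ?; rewrite ler_wpM2r ?dw_ge0// ler_wpM2l ?Mk//; lra.
move=> k a b x k5 a0 h x0; rewrite ger0_norm ?sx_ge0//.
apply: (@le_trans _ _ ((1 + `|x|) * sx k b x)); first by rewrite ler_peMl ?sx_ge0// lerDl.
apply: (le_trans (sx_pos_le k a0 (Nb _ h) x0)).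
by rewrite ler_wpM2r ?dw_ge0// ler_wpM2l// Mk.
Qed.

Lemma sxE k b x : sx k b x = expR (k%:R * b * x - expR (b * x)).
Proof. by []. Qed.

Lemma FcK_le a a' : a <= a' -> a' < 2 -> FcK a <= FcK a' :> R.
Proof.
move=> aa a2; rewrite /FcK ler_pM2l// lerD2l ler_pM2l// lerD2l ler_pM2l// lef_pV2 ?posrE; lra.
Qed.

Lemma FcK_ge0 a : a < 2 -> 0 <= FcK a :> R.
Proof.
move=> a2; have := wt2I_ge0 R; have : 0 <= 6 / (2 - a) by rewrite divr_ge0// subr_ge0 ltW.
by rewrite /FcK; lra.
Qed.

Opaque sx dw FcK Fc.

(** The derivative of (1 + u^b) e^(-u^b) in x = ln u is -b u^(2 b) e^(-u^b): the terms of order u^b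
    cancel, and they stay absent from the later derivatives. *)
Lemma der_symbol_diff1 b x : is_derive x 1 (fun x => sx 0 b x + sx 1 b x - sx 0 2 x)
  (b * - sx 2 b x + 2 * sx 1 2 x).
Proof.
have d0b := der_sx 0 b x; have d1b := der_sx 1 b x; have d02 := der_sx 0 2 x.
by der; move: (sx 0 b x) (sx 1 b x) (sx 2 b x) (sx 0 2 x) (sx 1 2 x) => p q r s t; ring.
Qed.

Lemma der_symbol_diff2 b x : is_derive x 1 (fun x => b * - sx 2 b x + 2 * sx 1 2 x)
  (b ^+ 2 * - (2 * sx 2 b x - sx 3 b x) + 4 * (1 * sx 1 2 x - sx 2 2 x)).
Proof.
have d2b := der_sx 2 b x; have d12 := der_sx 1 2 x.
by der; move: (sx 2 b x) (sx 3 b x) (sx 1 2 x) (sx 2 2 x) => p q r s; ring.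
Qed.

Lemma der_symbol_diff3 b x :
  is_derive x 1 (fun x => b ^+ 2 * - (2 * sx 2 b x - sx 3 b x) + 4 * (1 * sx 1 2 x - sx 2 2 x))
  (b ^+ 3 * - (4 * sx 2 b x - 5 * sx 3 b x + sx 4 b x)
    + 8 * (1 * sx 1 2 x - 3 * sx 2 2 x + sx 3 2 x)).
Proof.
have d2b := der_sx 2 b x; have d3b := der_sx 3 b x.
have d12 := der_sx 1 2 x; have d22 := der_sx 2 2 x.
by der; move: (sx 2 b x) (sx 3 b x) (sx 4 b x) (sx 1 2 x) (sx 2 2 x) (sx 3 2 x) => p q r s t u; ring.
Qed.

Lemma norm_lc2 (p a b B : R) : 0 <= p -> `|a| <= B -> `|b| <= B -> `|p * a - b| <= (p + 1) * B.
Proof. by rewrite !ler_norml => p0 /andP[? ?] /andP[? ?]; apply/andP; split; nra. Qed.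

Lemma norm_lc3 (p q a b c B : R) : 0 <= p -> 0 <= q -> `|a| <= B -> `|b| <= B -> `|c| <= B ->
  `|p * a - q * b + c| <= (p + q + 1) * B.
Proof.
by rewrite !ler_norml => p0 q0 /andP[? ?] /andP[? ?] /andP[? ?]; apply/andP; split; nra.
Qed.

Lemma pow23_le b : 0 < b -> b < 2 -> 0 <= b ^+ 2 <= 4 /\ 0 <= b ^+ 3 <= 8.
Proof.
move=> b0 b2; have h2 : 0 <= b ^+ 2 <= 4 by apply/andP; split; nra.
by split=> //; move/andP: h2 => [? ?]; apply/andP; split; rewrite (exprS b 2); nra.
Qed.

Lemma norm_sum2 (p q a b A B : R) : 0 <= p -> 0 <= q -> `|a| <= A -> `|b| <= B ->
  `|p * a + q * b| <= p * A + q * B.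
Proof.
move=> p0 q0 aA bB; apply: (le_trans (ler_normD _ _)).
by rewrite !normrM (ger0_norm p0) (ger0_norm q0) lerD// ler_wpM2l.
Qed.

(** * Decay of stable densities, uniformly for exponents in [b0, b1] *)

Section uniform.
Variables (b0 b1 : R).
Hypotheses (b00 : 0 < b0) (b01 : b0 <= b1) (b12 : b1 < 2).

Let Mspec : {M : R | [/\ 0 <= M,
  forall k a b x, (k <= 5)%N -> 0 <= a -> b0 <= b -> a <= k%:R * b -> `|sx k b x| <= 2 * M * dw a x,
  forall k a e b x, (k <= 5)%N -> 0 <= a -> 0 < e -> b0 <= b -> a + e <= k%:R * b ->
    `|x * sx k b x| <= (2 + e^-1) * M * dw a x &
  forall k a b x, (k <= 5)%N -> 0 <= a -> b0 <= b -> 0 <= x -> `|sx k b x| <= 2 * M * dw a x]}.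
Proof. by apply: cid; exact: sx_uniform. Qed.

Let M : R := sval Mspec.

Let M0 : 0 <= M. Proof. by have [] := svalP Mspec. Qed.

Let sxb k a b x : (k <= 5)%N -> 0 <= a -> b0 <= b -> a <= k%:R * b -> `|sx k b x| <= 2 * M * dw a x.
Proof. by have [_ + _ _] := svalP Mspec; apply. Qed.

Let xsxb k a e b x : (k <= 5)%N -> 0 <= a -> 0 < e -> b0 <= b -> a + e <= k%:R * b ->
  `|x * sx k b x| <= (2 + e^-1) * M * dw a x.
Proof. by have [_ _ + _] := svalP Mspec; apply. Qed.

Let sxp k a b x : (k <= 5)%N -> 0 <= a -> b0 <= b -> 0 <= x -> `|sx k b x| <= 2 * M * dw a x.
Proof. by have [_ _ _] := svalP Mspec; apply. Qed.

Lemma sx0_bound : exists2 C, 0 <= C & forall b x, b0 <= b -> `|sx 0 b x| <= C * dw 0 x.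
Proof. by exists (2 * M) => [|b x h]; [rewrite mulr_ge0|apply: sxb => //; rewrite mul0r]. Qed.

Lemma xsx1_bound (a e : R) : 0 <= a -> 0 < e -> a + e <= b0 -> exists2 C, 0 <= C &
  forall b x, b0 <= b -> `|- (x * sx 1 b x)| <= C * dw a x.
Proof.
move=> a0 e0 eb; exists ((2 + e^-1) * M).
  by rewrite mulr_ge0// addr_ge0// invr_ge0 ltW.
by move=> b x h; rewrite normrN; apply: xsxb => //; rewrite mul1r (le_trans eb).
Qed.

(** By [Fc_by_parts] the scale derivative has symbol b u^b e^(-u^b). This vanishes to order b at u =
    0, so that [Fc_bound] applies with a = b. *)
Lemma stab_sE b y : b0 <= b -> b <= b1 -> stab_s b y = (2 * pi)^-1 * (b * Fc (sx 1 b) y).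
Proof.
move=> h h1; rewrite /stab_s /stab /stab_y mulrN mulrCA -mulrBr; congr (_ * _).
have bp : 0 < b := lt_le_trans b00 h.
have s1 x : `|sx 1 b x| <= 2 * M * dw b x by apply: sxb; rewrite ?mul1r// ltW.
have E : Fc (fun x => - b * sx 1 b x) y = - (b * Fc (sx 1 b) y).
  rewrite FcZ ?mulNr//; apply: (integrable_Fc (meas_sx 1 b) (C := 2 * M) (a := b)) => //.
  - by rewrite mulr_ge0.
  - exact: ltW.
  - exact: ltW (le_lt_trans h1 b12).
have d0 x : is_derive x 1 (sx 0 b) (- b * sx 1 b x).
  by have d := der_sx 0 b x; apply: (der_eq d); ring.
rewrite (Fc_by_parts (C := 4 * M) (a := 0) (a' := b) y _ _ _ _ _ d0) ?E ?opprK//.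
- by rewrite mulr_ge0.
- exact: ltW.
- exact: ltW (le_lt_trans h1 b12).
- by move=> x; apply: cvgM; [exact: cvg_cst|exact: continuous_sx].
- move=> x; apply: (@le_trans _ _ (2 * M * dw 0 x)); first by apply: sxb => //; rewrite mul0r.
  by rewrite ler_wpM2r ?dw_ge0// ler_wpM2r//; lra.
- move=> x; rewrite normrM normrN (gtr0_norm bp).
  apply: (@le_trans _ _ (2 * (2 * M * dw b x))); last by rewrite !mulrA; lra.
  by apply: ler_pM => //; [exact: ltW|exact: ltW (le_lt_trans h1 b12)].
Qed.

Lemma stab_s_bound : exists2 K, 0 <= K &
  forall b y, b0 <= b -> b <= b1 -> `|stab_s b y| <= K * wt (1 + b) y.
Proof.
(* 240 = 8 * 30: b^3 <= 8, and the coefficients 1, 7, 6, 1 of the third derivative add up to 15,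
   each [sx] being at most 2 M times the weight. The outer 2 bounds the factor b. *)
exists ((2 * pi)^-1 * (2 * (240 * M * FcK b1))).
  apply: mulr_ge0; first exact: twopiV_ge0.
  apply: natM_ge0; apply: mulr_ge0; [exact: natM_ge0 M0|exact: FcK_ge0 b12].
move=> b y h h1; rewrite stab_sE// normrM gtr0_norm ?invr_gt0 ?twopi_gt0// -[leRHS]mulrA.
rewrite ler_pM2l ?invr_gt0 ?twopi_gt0// normrM.
have bp : 0 < b := lt_le_trans b00 h.
have b2 : b < 2 := le_lt_trans h1 b12.
rewrite (gtr0_norm bp) -[leRHS]mulrA ler_pM// ?(ltW bp)//; first lra.
have K1 : FcK b <= FcK b1 := FcK_le h1 b12.
have Kb := FcK_ge0 b2.
apply: (@le_trans _ _ (240 * M * FcK b * wt (1 + b) y)); last first.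
  by apply: ler_wpM2r; [exact: wt_ge0|apply: ler_wpM2l; [exact: natM_ge0 M0|exact: K1]].
have e1 x := @sxb 1 b b x isT (ltW bp) h (ltac:(rewrite mul1r//)).
have e2 x := @sxb 2 b b x isT (ltW bp) h (ltac:(lra)).
have e3 x := @sxb 3 b b x isT (ltW bp) h (ltac:(lra)).
have e4 x := @sxb 4 b b x isT (ltW bp) h (ltac:(lra)).
have D x : 0 <= M * dw b x by rewrite mulr_ge0// dw_ge0.
have [bb bbb] := pow23_le bp b2.
(* Up to sign the coefficients are Stirling numbers of the second kind, since each derivative in x
   acts as b v d/dv on functions of v = u^b. *)
refine (@Fc_bound R (sx 1 b) (fun x => b * (sx 1 b x - sx 2 b x))
  (fun x => b ^+ 2 * (sx 1 b x - 3 * sx 2 b x + sx 3 b x))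
  (fun x => b ^+ 3 * (sx 1 b x - 7 * sx 2 b x + 6 * sx 3 b x - sx 4 b x)) _ _ _ _ _ _ _ _ _ _ _ _ _ _).
- exact: natM_ge0 M0.
- exact: bp.
- exact: b2.
- by move=> x; have d1 := der_sx 1 b x; apply: (der_eq d1); ring.
- by move=> x; have d1 := der_sx 1 b x; have d2 := der_sx 2 b x; der; ring.
- move=> x; have d1 := der_sx 1 b x; have d2 := der_sx 2 b x; have d3 := der_sx 3 b x.
  by der; ring.
- move=> x; have d1 := der_sx 1 b x; have d2 := der_sx 2 b x; have d3 := der_sx 3 b x.
  by have d4 := der_sx 4 b x; eapply der_continuous; der_rules R.
- by move=> x; apply: (le_trans (e1 x)); have := D x; lra.
- move=> x; rewrite normrM (gtr0_norm bp); move: (e1 x) (e2 x) (D x) => h1' h2' d.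
  apply: (@le_trans _ _ (2 * (4 * (M * dw b x)))); last lra.
  rewrite ler_pM ?(ltW bp)//; first lra.
  by rewrite (le_trans (ler_normB _ _))//; lra.
- move=> x; rewrite normrM (ger0_norm (proj1 (andP bb))).
  move: (e1 x) (e2 x) (e3 x) (D x) => h1' h2' h3' d.
  apply: (@le_trans _ _ (4 * (10 * (M * dw b x)))); last lra.
  rewrite ler_pM ?(proj1 (andP bb)) ?(proj2 (andP bb))//.
  by move: h1' h2' h3'; rewrite !ler_norml => /andP[? ?] /andP[? ?] /andP[? ?]; apply/andP; split; lra.
- move=> x; rewrite normrM (ger0_norm (proj1 (andP bbb))).
  move: (e1 x) (e2 x) (e3 x) (e4 x) (D x) => h1' h2' h3' h4' d.
  apply: (@le_trans _ _ (8 * (30 * (M * dw b x)))); last lra.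
  rewrite ler_pM ?(proj1 (andP bbb)) ?(proj2 (andP bbb))//.
  by move: h1' h2' h3' h4'; rewrite !ler_norml => /andP[? ?] /andP[? ?] /andP[? ?] /andP[? ?]; apply/andP; split; lra.
Qed.

(** The symbol - u^b ln u e^(-u^b) is O(u^(b - e)) at 0, whence the loss [e]. The constant [L] is
    the one of [xsx_le]; the third derivative needs 3 * 4 * 5 + 8 * 15 = 180 times [L], and 300
    leaves room. *)
Lemma stab_b_bound (e : R) : 0 < e -> e < b0 -> exists2 K, 0 <= K &
  forall b y, b0 <= b -> b <= b1 -> `|stab_b b y| <= K * wt (1 + b - e) y.
Proof.
move=> e0 eb; set L := (2 + e^-1) * M.
have ei : 0 < e^-1 by rewrite invr_gt0.
have L0 : 0 <= L by rewrite mulr_ge0//; lra.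
have ML : 2 * M <= L by rewrite ler_wpM2r//; lra.
exists ((2 * pi)^-1 * (300 * L * FcK b1)).
  apply: mulr_ge0; first exact: twopiV_ge0.
  apply: mulr_ge0; [exact: natM_ge0 L0|exact: FcK_ge0 b12].
move=> b y h h1; rewrite /stab_b normrM gtr0_norm ?invr_gt0 ?twopi_gt0// -[leRHS]mulrA.
rewrite ler_pM2l ?invr_gt0 ?twopi_gt0//.
have bp : 0 < b := lt_le_trans b00 h.
have b2 : b < 2 := le_lt_trans h1 b12.
have K1 : FcK (b - e) <= FcK b1 by apply: FcK_le => //; lra.
apply: (@le_trans _ _ (300 * L * FcK (b - e) * wt (1 + (b - e)) y)); last first.
  by rewrite addrA; apply: ler_wpM2r; [exact: wt_ge0|apply: ler_wpM2l; [exact: natM_ge0 L0|exact: K1]].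
have be0 : 0 <= b - e by lra.
have S k x : (1 <= k <= 5)%N -> `|sx k b x| <= L * dw (b - e) x.
  move=> /andP[k1 k5]; have kb : b - e <= k%:R * b.
    by have : 1 <= k%:R :> R; [rewrite ler1n|nra].
  by rewrite (le_trans (sxb x k5 be0 h kb))// ler_wpM2r ?dw_ge0.
have X k x : (1 <= k <= 5)%N -> `|x * sx k b x| <= L * dw (b - e) x.
  move=> /andP[k1 k5]; apply: xsxb => //.
  have : 1 <= k%:R :> R by rewrite ler1n.
  nra.
have D x : 0 <= L * dw (b - e) x by rewrite mulr_ge0// dw_ge0.
have [bb bbb] := pow23_le bp b2.
refine (@Fc_bound R (fun x => - (x * sx 1 b x))
  (fun x => - (sx 1 b x + b * (x * sx 1 b x - x * sx 2 b x)))
  (fun x => - (2 * b * (sx 1 b x - sx 2 b x) + b ^+ 2 * (x * sx 1 b x - 3 * (x * sx 2 b x) + x * sx 3 b x)))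
  (fun x => - (3 * (b ^+ 2 * (sx 1 b x - 3 * sx 2 b x + sx 3 b x)) +
    b ^+ 3 * (x * sx 1 b x - 7 * (x * sx 2 b x) + 6 * (x * sx 3 b x) - x * sx 4 b x))) _ _ _ _ _ _ _ _ _ _ _ _ _ _).
- exact: natM_ge0 L0.
- lra.
- lra.
- by move=> x; have d1 := der_sx 1 b x; der; ring.
- by move=> x; have d1 := der_sx 1 b x; have d2 := der_sx 2 b x; der; ring.
- move=> x; have d1 := der_sx 1 b x; have d2 := der_sx 2 b x; have d3 := der_sx 3 b x.
  by der; ring.
- move=> x; have d1 := der_sx 1 b x; have d2 := der_sx 2 b x; have d3 := der_sx 3 b x.
  by have d4 := der_sx 4 b x; eapply der_continuous; der_rules R.
- by move=> x; rewrite normrN (le_trans (X 1%N x isT))//; have := D x; lra.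
- move=> x; rewrite normrN; move: (S 1%N x isT) (X 1%N x isT) (X 2%N x isT) (D x) => s1 t1 t2 d.
  apply: (le_trans (ler_normD _ _)); rewrite normrM (gtr0_norm bp).
  apply: (@le_trans _ _ (L * dw (b - e) x + 2 * (2 * (L * dw (b - e) x)))); last lra.
  rewrite lerD// ler_pM ?(ltW bp)//; first lra.
  by rewrite (le_trans (ler_normB _ _))//; lra.
- move=> x; rewrite normrN; move: (S 1%N x isT) (S 2%N x isT) (X 1%N x isT) (X 2%N x isT) (X 3%N x isT) (D x).
  move=> s1 s2 t1 t2 t3 d.
  apply: (le_trans (ler_normD _ _)).
  rewrite (normrM (2 * b)) (normrM 2 b) (normrM (b ^+ 2)) (ger0_norm (proj1 (andP bb))) (gtr0_norm bp) normr_nat.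
  apply: (@le_trans _ _ (2 * 2 * (2 * (L * dw (b - e) x)) + 4 * (5 * (L * dw (b - e) x)))); last lra.
  rewrite lerD// ler_pM ?mulr_ge0 ?(ltW bp) ?(proj1 (andP bb)) ?(proj2 (andP bb))//.
  + lra.
  + by rewrite (le_trans (ler_normB _ _))//; lra.
  + move: t1 t2 t3; move: (x * sx 1 b x) (x * sx 2 b x) (x * sx 3 b x) (L * dw (b - e) x) => p1 p2 p3 p0.
    by rewrite !ler_norml => /andP[? ?] /andP[? ?] /andP[? ?]; apply/andP; split; lra.
- move=> x; rewrite normrN; move: (S 1%N x isT) (S 2%N x isT) (S 3%N x isT) (X 1%N x isT) (X 2%N x isT) (X 3%N x isT) (X 4%N x isT) (D x).
  move=> s1 s2 s3 t1 t2 t3 t4 d.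
  apply: (le_trans (ler_normD _ _)).
  rewrite (normrM 3) (normrM (b ^+ 2)) (normrM (b ^+ 3)) (ger0_norm (proj1 (andP bb))) (ger0_norm (proj1 (andP bbb))) normr_nat.
  apply: (@le_trans _ _ (3 * (4 * (5 * (L * dw (b - e) x))) + 8 * (15 * (L * dw (b - e) x)))); last lra.
  rewrite lerD//.
    rewrite ler_pM2l// ler_pM ?(proj1 (andP bb)) ?(proj2 (andP bb))//.
    move: s1 s2 s3; move: (sx 1 b x) (sx 2 b x) (sx 3 b x) (L * dw (b - e) x) => p1 p2 p3 p0.
    by rewrite !ler_norml => /andP[? ?] /andP[? ?] /andP[? ?]; apply/andP; split; lra.
  rewrite ler_pM ?(proj1 (andP bbb)) ?(proj2 (andP bbb))//.
  move: t1 t2 t3 t4; move: (x * sx 1 b x) (x * sx 2 b x) (x * sx 3 b x) (x * sx 4 b x) (L * dw (b - e) x)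
    => p1 p2 p3 p4 p0.
  by rewrite !ler_norml => /andP[? ?] /andP[? ?] /andP[? ?] /andP[? ?]; apply/andP; split; lra.
Qed.

Lemma stab_gauss_rel b y : b0 <= b -> b <= b1 ->
  (1 + b) * stab b y + y * stab_y b y =
  (2 * pi)^-1 * b * (Fc (fun x => sx 0 b x + sx 1 b x - sx 0 2 x) y + Fc (sx 0 2) y).
Proof.
move=> h h1; have bp : 0 < b := lt_le_trans b00 h; have b2 : b < 2 := le_lt_trans h1 b12.
have i0 : mu.-integrable setT (EFin \o (fun u => cos (u * y) * sx 0 b (ln `|u|))).
  apply: (integrable_Fc (meas_sx 0 b) (C := 2 * M) (a := 0)) => //; first by rewrite mulr_ge0.
  by move=> x; apply: sxb => //; rewrite mul0r.
have i1 : mu.-integrable setT (EFin \o (fun u => cos (u * y) * sx 1 b (ln `|u|))).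
  apply: (integrable_Fc (meas_sx 1 b) (C := 2 * M) (a := 0)) => //; first by rewrite mulr_ge0.
  by move=> x; apply: sxb => //; rewrite mul1r ltW.
have i2 : mu.-integrable setT (EFin \o (fun u => cos (u * y) * sx 0 2 (ln `|u|))).
  apply: (integrable_Fc (meas_sx 0 2) (C := 2 * M) (a := 0)) => //; first by rewrite mulr_ge0.
  by move=> x; apply: sxb; rewrite ?mul0r//; exact: ltW (le_lt_trans (le_trans h h1) b12).
have i01 : mu.-integrable setT (EFin \o (fun u => cos (u * y) * (sx 0 b (ln `|u|) + sx 1 b (ln `|u|)))).
  by have := RintegrableD measurableT i0 i1; apply: eq_integrable => // u _; rewrite /= mulrDr.
have i3 : mu.-integrable setT (EFin \o (fun u => cos (u * y) * (- 1 * sx 0 2 (ln `|u|)))).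
  have := RintegrableZ (-1) measurableT i2; apply: eq_integrable => // u _.
  by rewrite /= mulrCA.
have -> : (fun x => sx 0 b x + sx 1 b x - sx 0 2 x) = (fun x => sx 0 b x + sx 1 b x + -1 * sx 0 2 x).
  by apply/funext => x; rewrite mulN1r.
rewrite (FcD (f := fun x => sx 0 b x + sx 1 b x))// FcD// (FcZ _ i2).
have := stab_sE y h h1; rewrite /stab_s /stab => E.
transitivity (((2 * pi)^-1 * Fc (sx 0 b) y + y * stab_y b y) + b * ((2 * pi)^-1 * Fc (sx 0 b) y)); first by rewrite /stab; ring.
move: E; generalize (Fc (sx 0 b) y) (Fc (sx 1 b) y) (Fc (sx 0 2) y) (stab_y b y) => p q r s E.
by rewrite E; ring.
Qed.

(** e^(-u^2) is the square root of pi times the centred normal density of variance 1/2. *)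
Lemma Fc_gauss y : Fc (sx 0 2) y = Num.sqrt pi * expR (- (y ^+ 2 / 4)).
Proof.
pose s : R := (Num.sqrt 2)^-1.
have s0 : 0 < s by rewrite invr_gt0 sqrtr_gt0.
have ss : s ^+ 2 = 2^-1 by rewrite exprVn sqr_sqrtr.
have pk : normal_peak s = (Num.sqrt pi)^-1.
  by rewrite /normal_peak ss; congr (Num.sqrt _)^-1; rewrite mulr2n; field.
have sp : 0 < Num.sqrt (pi : R) by rewrite sqrtr_gt0 pi_gt0.
have gE x : gau s x = (Num.sqrt pi)^-1 * expR (- x ^+ 2).
  by rewrite gauE// pk ss; congr (_ * expR (- _)); field.
have := gau_cos y s0; rewrite ss => E.
have [B B0 hB] := sx0_bound.
rewrite (Fc_half (C := B) (a := 0)) ?lexx//; last first.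
- by move=> x; apply: hB; move: b01 b12; lra.
- exact: meas_sx.
have ev : forall x, cos (y * - x) * gau s (- x) = cos (y * x) * gau s x.
  by move=> x; rewrite gau_even// mulrN cosN.
have ic : mu.-integrable setT (EFin \o (fun x => cos (y * x) * gau s x)).
  by apply: integrable_cosM; exact: integrable_gau.
rewrite (Rintegral_even ic ev) -Rintegral_itv_obnd_cbnd in E; last by apply: integrableS ic.
have -> : expR (- (y ^+ 2 / 4)) = expR (- (2^-1 * y ^+ 2 / 2)).
  by congr (expR (- _)); field.
rewrite -E mulrCA; congr (2 * _).
rewrite -RintegralZl//; last exact: integrableS ic.
apply: eq_Rintegral => u; rewrite inE/= in_itv/= andbT => u0.
rewrite gE sxE !mul0r add0r (mulrC 2) expRM_natr lnK ?posrE// (mulrC u y).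
by rewrite [RHS]mulrCA mulVKf// gt_eqF.
Qed.

(** The gain in decay. It keeps b + delta below 2 b, the order of 1 - (1 + u^b) e^(-u^b), and below
    2, which is both the order of 1 - e^(-u^2) and the limit of [Fc_bound]. *)
Let delta : R := Num.min b0 (2 - b1) / 2.

Let delta_b : 0 < delta /\ delta <= b0 /\ b1 + delta < 2.
Proof.
rewrite /delta; split; first by rewrite divr_gt0// lt_min b00 subr_gt0.
move: b00 b01 b12 => h1 h2 h3.
have m1 : Num.min b0 (2 - b1) <= b0 by rewrite ge_min lexx.
have m2 : Num.min b0 (2 - b1) <= 2 - b1 by rewrite ge_min lexx orbT.
by split; lra.
Qed.

Lemma gauss_wt y : expR (- (y ^+ 2 / 4)) <= 64 * wt 3 y.
Proof.
have -> : wt 3 y = ((1 + `|y|) ^+ 3)^-1.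
  have -> : wt 3 y = wt 1 y ^+ 3 by rewrite wtX mulr1.
  by rewrite /wt powR_inv1 ?exprVn// addr_ge0.
have y0 : 0 <= `|y| := normr_ge0 y.
have p0 : 0 < 1 + `|y| by lra.
rewrite expRN -[leLHS]mul1r ler_pdivrMr ?expR_gt0// mulrAC ler_pdivlMr ?exprn_gt0// mul1r.
have -> : y ^+ 2 / 4 = 2 * (`|y| ^+ 2 / 8) by rewrite real_normK ?num_real//; field.
rewrite expRM_natl; move: y0; set t := `|y| => t0.
have h1 := expR_ge1Dx (t ^+ 2 / 8).
have h2 : 0 <= 1 + t ^+ 2 / 8 by have := sqr_ge0 t; lra.
apply: (@le_trans _ _ (64 * (1 + t ^+ 2 / 8) ^+ 2)).
  have := sqr_ge0 (t * (t - 2)); have := sqr_ge0 (t - 3).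
  rewrite !expr2 !exprS expr0; nra.
by rewrite ler_pM2l// ler_pXn2r ?nnegrE// expR_ge0.
Qed.

(** For x < 0 the constants cancel: with p = u^b and q = u^2, 1 - p^2 <= (1 + p) e^(-p) <= 1 and 1 -
    q <= e^(-q) <= 1. For x >= 0 the three terms are bounded separately. *)
Lemma symbol_diff_bound b x : b0 <= b -> b <= b1 ->
  `|sx 0 b x + sx 1 b x - sx 0 2 x| <= 64 * (1 + M) * dw (b + delta) x.
Proof.
move=> h h1; have [d0 [db d2]] := delta_b.
have bp : 0 < b := lt_le_trans b00 h.
have bd0 : 0 <= b + delta by lra.
have D0 := dw_ge0 (b + delta) x; have MD : 0 <= M * dw (b + delta) x by apply: mulr_ge0.
have b02 : b0 <= 2 by move: b01 b12; lra.
have [x0|x0] := leP 0 x.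
  have t := lerD (lerD (@sxp 0 (b + delta) b x isT bd0 h x0) (@sxp 1 (b + delta) b x isT bd0 h x0))
    (@sxp 0 (b + delta) 2 x isT bd0 b02 x0).
  apply: (le_trans (ler_normB _ _)); apply: (le_trans (lerD (ler_normD _ _) (lexx _))).
  by apply: (le_trans t); rewrite -!mulrDl; apply: ler_wpM2r => //; move: M0; lra.
have dn := dw_neg (b + delta) (ltW x0).
have E2 : expR (b * x) ^+ 2 <= expR ((b + delta) * x).
  by rewrite -expRM_natl ler_expR mulrA; nra.
have F1 : expR (2 * x) <= expR ((b + delta) * x) by rewrite ler_expR; nra.
have E0 := expR_gt0 (b * x); have F0 := expR_gt0 (2 * x).
rewrite sxS !sxE !mul0r !add0r.
have e1 := expR_ge1Dx (- expR (b * x)); have e2 := expR_ge1Dx (- expR (2 * x)).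
have e3 : (1 + expR (b * x)) * expR (- expR (b * x)) <= 1.
  by rewrite expRN ler_pdivrMr ?expR_gt0// mul1r expR_ge1Dx.
have e4 : expR (- expR (2 * x)) <= 1 by rewrite expR_le1 oppr_le0 ltW.
have e5 : 1 - expR (b * x) ^+ 2 <= (1 + expR (b * x)) * expR (- expR (b * x)).
  by rewrite expr2; nra.
move: dn D0 MD E2 F1 E0 F0 e1 e2 e3 e4 e5.
generalize (expR (- expR (b * x))) (expR (- expR (2 * x))).
generalize (expR (b * x)) (expR (2 * x)) (expR ((b + delta) * x)) (dw (b + delta) x).
move=> p q r D u v *; rewrite ler_norml; apply/andP; split; lra.
Qed.

(* The left-hand side is [b / (2 pi)] times the transform of
   [(1 + u^b) e^(-u^b) = 1 + O(u^(2 b))]; subtracting [e^(-u^2)], whose transform is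
   explicit, removes the constant. *)
Lemma stab_tail_bound : exists2 K, 0 <= K & exists2 e, 0 < e &
  forall b y, b0 <= b -> b <= b1 -> `|(1 + b) * stab b y + y * stab_y b y| <= K * wt (1 + b + e) y.
Proof.
have [d0 [db d2]] := delta_b.
pose L := 64 * (1 + M).
have ML : M <= L by rewrite /L; have := M0; lra.
have L0 : 0 <= L by apply: le_trans ML.
have F0 : 0 <= FcK (b1 + delta) by exact: FcK_ge0.
have t0 : 0 <= (2 * pi)^-1 :> R by rewrite invr_ge0 ltW// twopi_gt0.
pose K := (2 * pi)^-1 * 2 * (300 * L * FcK (b1 + delta) + Num.sqrt pi * 64).
exists K.
  apply: mulr_ge0; first by apply: mulr_ge0; [exact: t0|exact: ler0n].
  apply: addr_ge0; last by apply: mulr_ge0; [exact: sqrtr_ge0|exact: ler0n].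
  by apply: mulr_ge0; [exact: natM_ge0 L0|exact: F0].
exists delta => // b y h h1; rewrite stab_gauss_rel// normrM.
have bp : 0 < b := lt_le_trans b00 h.
have b2 : b + delta < 2 by lra.
have K1 : FcK (b + delta) <= FcK (b1 + delta) by apply: FcK_le => //; lra.
have -> : K * wt (1 + b + delta) y = (2 * pi)^-1 * 2 *
  (300 * L * FcK (b1 + delta) * wt (1 + b + delta) y + Num.sqrt pi * 64 * wt (1 + b + delta) y).
  by rewrite /K; ring.
apply: ler_pM => //.
  by rewrite normrM (gtr0_norm bp) ger0_norm// ler_wpM2l//; lra.
apply: (le_trans (ler_normD _ _)); apply: lerD; last first.
  rewrite Fc_gauss ger0_norm; last by apply: mulr_ge0; [exact: sqrtr_ge0|exact: expR_ge0].
  rewrite -mulrA ler_wpM2l ?sqrtr_ge0//; apply: (le_trans (gauss_wt y)).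
  by rewrite ler_pM2l//; apply: wt_le; lra.
apply: (@le_trans _ _ (300 * L * FcK (b + delta) * wt (1 + (b + delta)) y)); last first.
  by rewrite addrA; apply: ler_wpM2r; [exact: wt_ge0|apply: ler_wpM2l; [exact: natM_ge0 L0|exact: K1]].
have a2 k : (1 < k)%N -> b + delta <= k%:R * b.
  by move=> k1; have : 2 <= k%:R :> R; [rewrite ler_nat|nra].
pose B x := 2 * M * dw (b + delta) x.
have e2 x : `|sx 2 b x| <= B x by apply: sxb => //; [lra|exact: a2].
have e3 x : `|sx 3 b x| <= B x by apply: sxb => //; [lra|exact: a2].
have e4 x : `|sx 4 b x| <= B x by apply: sxb => //; [lra|exact: a2].
have b02 : b0 <= 2 := ltW (le_lt_trans (le_trans h h1) b12).
have g k (x : R) : (0 < k <= 5)%N -> `|sx k 2 x| <= B x.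
  move=> /andP[k0 k5]; apply: sxb => //; first lra.
  by have : 1 <= k%:R :> R; [rewrite ler1n|lra].
have final c x : 0 <= c -> c <= 150 -> c * B x <= 300 * L * dw (b + delta) x.
  move=> c0 c1; have -> : 300 * L * dw (b + delta) x = 150 * (2 * L * dw (b + delta) x) by ring.
  have B0 : 0 <= B x by apply: mulr_ge0; [exact: natM_ge0 M0|exact: dw_ge0].
  apply: ler_pM => //; apply: ler_wpM2r; first exact: dw_ge0.
  by rewrite ler_pM2l.
have bl : b < 2 := le_lt_trans h1 b12.
have [bb bbb] := pow23_le bp bl.
have B0 x : 0 <= B x by apply: mulr_ge0; [exact: natM_ge0 M0|exact: dw_ge0].
have step p (q u v U V : R) x : 0 <= p <= 8 -> 0 <= q <= 8 -> `|u| <= U * B x -> `|v| <= V * B x ->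
    0 <= U -> 0 <= V -> 8 * U + 8 * V <= 150 -> `|p * u + q * v| <= 300 * L * dw (b + delta) x.
  move=> /andP[p0 p8] /andP[q0 q8] uU vV U0 V0 UV.
  apply: (le_trans (norm_sum2 p0 q0 uU vV)).
  apply: (@le_trans _ _ ((8 * U + 8 * V) * B x)); last by apply: final; [lra|].
  rewrite mulrDl -!mulrA; apply: lerD; apply: ler_wpM2r => //; exact: mulr_ge0.
refine (@Fc_bound R (fun x => sx 0 b x + sx 1 b x - sx 0 2 x)
  (fun x => b * - sx 2 b x + 2 * sx 1 2 x)
  (fun x => b ^+ 2 * - (2 * sx 2 b x - sx 3 b x) + 4 * (1 * sx 1 2 x - sx 2 2 x))
  (fun x => b ^+ 3 * - (4 * sx 2 b x - 5 * sx 3 b x + sx 4 b x)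
    + 8 * (1 * sx 1 2 x - 3 * sx 2 2 x + sx 3 2 x)) _ _ _ _ _ _ _ _ _ _ _ _ _ _).
- exact: natM_ge0 L0.
- lra.
- exact: b2.
- by move=> x; exact: (der_symbol_diff1 b x).
- by move=> x; exact: (der_symbol_diff2 b x).
- by move=> x; exact: (der_symbol_diff3 b x).
- move=> x; have d2b := der_sx 2 b x; have d3b := der_sx 3 b x; have d4b := der_sx 4 b x.
  have d12 := der_sx 1 2 x; have d22 := der_sx 2 2 x; have d32 := der_sx 3 2 x.
  move: d2b d3b d4b d12 d22 d32; generalize (sx 2 b) (sx 3 b) (sx 4 b) (@sx R 1 2) (@sx R 2 2) (@sx R 3 2).
  by move=> *; notypeclasses refine (@der_continuous R _ _ _ _); der_rules R.
- move=> x; apply: (le_trans (symbol_diff_bound x h h1)); rewrite -/L.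
  apply: ler_wpM2r; first exact: dw_ge0.
  by rewrite -[leLHS]mul1r; apply: ler_wpM2r => //; rewrite ler1n.
- move=> x; apply: (@step b 2 _ _ 1 1) => //; rewrite ?normrN ?mul1r//; try exact: g.
  + by rewrite (ltW bp)/=; lra.
  + by rewrite ler0n ler_nat.
  + lra.
- move=> x; apply: (@step (b ^+ 2) 4 _ _ 3 2) => //; rewrite ?normrN.
  + by move/andP: bb => [-> ?]/=; lra.
  + by rewrite ler0n ler_nat.
  + by rewrite (_ : 3 = 2 + 1 :> R); [exact: norm_lc2|ring].
  + by rewrite [X in X * B x](_ : 2 = 1 + 1 :> R); [apply: norm_lc2 => //; exact: g|ring].
  + lra.
- move=> x; apply: (@step (b ^+ 3) 8 _ _ 10 5) => //; rewrite ?normrN.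
  + by rewrite ler0n ler_nat.
  + by rewrite (_ : 10 = 4 + 5 + 1 :> R); [exact: norm_lc3|ring].
  + by rewrite [X in X * B x](_ : 5 = 1 + 3 + 1 :> R); [apply: norm_lc3 => //; exact: g|ring].
  + lra.
Qed.

(** The symbol e^(-u^b) does not vanish at u = 0, which puts it out of reach of [Fc_bound]. Instead
    b times the density is the combination of [stab_tail_bound] minus [stab_s], both of which
    decay. *)
Lemma stab_bound : exists2 K, 0 <= K &
  forall b y, b0 <= b -> b <= b1 -> `|stab b y| <= K * wt (1 + b) y.
Proof.
have [K1 K10 h1] := stab_s_bound; have [K2 K20 [e e0 h2]] := stab_tail_bound.
exists ((K1 + K2) / b0); first by rewrite divr_ge0 ?addr_ge0 ?(ltW b00).
move=> b y hb hb1; have bp : 0 < b := lt_le_trans b00 hb.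
rewrite mulrAC ler_pdivlMr//.
apply: (@le_trans _ _ (`|b * stab b y|)).
  by rewrite (normrM b) [leRHS]mulrC (gtr0_norm bp) ler_wpM2l.
have -> : b * stab b y = ((1 + b) * stab b y + y * stab_y b y) - stab_s b y.
  by rewrite /stab_s; ring.
rewrite (le_trans (ler_normB _ _))// [leRHS]mulrDl addrC lerD ?h1//.
by rewrite (le_trans (h2 _ _ hb hb1))// ler_wpM2l// wt_le//; lra.
Qed.

Lemma stab_y_bound : exists2 K, 0 <= K &
  forall b y, b0 <= b -> b <= b1 -> `|stab_y b y| <= K * wt (1 + b) y.
Proof.
have [K1 K10 h1] := stab_s_bound; have [K2 K20 h2] := stab_bound.
have t0 : 0 <= (2 * pi)^-1 :> R by rewrite invr_ge0 ltW// twopi_gt0.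
pose K3 := (2 * pi)^-1 * (2 * M * wt2I R) * 8.
have K30 : 0 <= K3.
  by apply: mulr_ge0 => //; apply: mulr_ge0 => //; apply: mulr_ge0; [exact: mulr_ge0|exact: wt2I_ge0].
exists (K1 + K2 + K3); first by rewrite !addr_ge0.
move=> b y hb hb1; have bp : 0 < b := lt_le_trans b00 hb.
have w0 := wt_ge0 (1 + b) y.
have [y1|y1] := leP 1 `|y|.
  apply: (@le_trans _ _ (`|y * stab_y b y|)); first by rewrite normrM ler_peMl.
  have -> : y * stab_y b y = stab_s b y - stab b y by rewrite /stab_s; ring.
  rewrite (le_trans (ler_normB _ _))//.
  apply: (@le_trans _ _ (K1 * wt (1 + b) y + K2 * wt (1 + b) y)); first by rewrite lerD ?h1 ?h2.
  by rewrite -mulrDl ler_wpM2r// lerDl.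
apply: (@le_trans _ _ (K3 * wt (1 + b) y)); last by rewrite ler_wpM2r// lerDr addr_ge0.
rewrite /stab_y normrN normrM ger0_norm// /K3 -!mulrA ler_wpM2l//.
apply: (@le_trans _ _ (2 * M * wt2I R)).
  apply: (@Fs_le R (sx 0 b) (2 * M) 0 y (meas_sx 0 b)) => //; first exact: mulr_ge0.
  by move=> x; apply: sxb => //; rewrite mul0r.
rewrite 2!mulrA ler_peMr//; first by apply: mulr_ge0; [exact: mulr_ge0|exact: wt2I_ge0].
rewrite wtE.
apply: (@le_trans _ _ (8 * expR (- (3%:R * ln 2)))).
  by rewrite expRN expRM_natl lnK ?posrE// ler_pdivlMr ?exprn_gt0//; lra.
rewrite ler_pM2l// ler_expR mulNr lerN2.
have l2 : ln (1 + `|y|) <= ln 2 by rewrite ler_ln ?posrE ?ltr_pwDl//; lra.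
have l0 := ln1Dnorm_ge0 y.
by have := le_lt_trans hb1 b12; move=> ?; apply: ler_pM => //; lra.
Qed.

End uniform.

Lemma sx0_bound_at b0 : 0 < b0 -> b0 < 2 -> exists2 C, 0 <= C &
  forall b x, b0 <= b -> `|sx 0 b x| <= C * dw 0 x.
Proof. by move=> h1 h2; exact: sx0_bound h1. Qed.

Lemma der_stab_y b y : 0 < b -> b < 2 -> is_derive y 1 (stab b) (stab_y b y).
Proof.
move=> b0 b2; have [C C0 h] := sx0_bound_at b0 b2.
have d := der_Fc y (meas_sx 0 b) C0 (lexx 0) ler01 (fun x => h b x (lexx b)).
by rewrite /stab; der; rewrite /stab_y; ring.
Qed.

Lemma stab_y_odd b y : 0 < b -> b < 2 -> stab_y b (- y) = - stab_y b y.
Proof.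
move=> b0 b2; have d1 := der_stab_y y b0 b2; have d2 := der_stab_y (- y) b0 b2.
have d3 : is_derive y 1 (fun y => stab b (- y)) (- stab_y b (- y)).
  by apply: (der_eq (der_comp d2 (derN (der_id y)))); rewrite mulrN1.
have E : (fun y => stab b (- y)) = stab b by apply/funext => z; exact: stab_even.
rewrite E in d3; rewrite -(der_derive1 d1) (der_derive1 d3) opprK//.
Qed.

Lemma der_stab_b b y : 0 < b -> b < 2 -> is_derive b 1 (stab ^~ y) (stab_b b y).
Proof.
move=> b0 b2; have hb0 : 0 < b / 2 by lra.
have [C C0 h] := sx0_bound_at (b0 := b / 2) hb0 ltac:(lra).
have e0 : 0 < b / 4 by lra.
have [C' C0' h'] := xsx1_bound hb0 (lexx 0) hb0 ltac:(lra).
have near_b b' : `|b' - b| < b / 4 -> b / 2 <= b' by rewrite ltr_norml => /andP[? ?]; lra.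
have d : is_derive b 1 (fun b => Fc (sx 0 b) y) (Fc (fun x => - (x * sx 1 b x)) y).
  apply: (@der_Fc_param R (sx 0) (fun b x => - (x * sx 1 b x)) (C + C') 0 b (b / 4) y) => //.
  - exact: addr_ge0.
  - by move=> b' _; exact: meas_sx.
  - by move=> b' x _; have d' := der_sx_b 0 b' x; apply: (der_eq d'); ring.
  - by move=> b' x /near_b hb; rewrite (le_trans (h _ x hb))// ler_wpM2r ?dw_ge0// lerDl.
  - by move=> b' x /near_b hb; rewrite (le_trans (h' _ x hb))// ler_wpM2r ?dw_ge0// lerDr.
by rewrite /stab; der; rewrite /stab_b; ring.
Qed.

Lemma cvg_stab (b_ y_ : nat -> R) b0 b y : 0 < b0 -> b0 < 2 -> (forall n, b0 <= b_ n) ->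
  b_ n @[n --> \oo] --> b -> y_ n @[n --> \oo] --> y ->
  stab (b_ n) (y_ n) @[n --> \oo] --> stab b y.
Proof.
move=> b00 b02 hb bb yy; have [C C0 h] := sx0_bound_at b00 b02.
apply: cvgM; first exact: cvg_cst.
apply: (cvg_Fc C0 (lexx 0)) => //; [by move=> n; exact: meas_sx|by move=> n x; exact: h|].
move=> x; exact: (@continuous_cvg _ _ _ _ _ b_ (fun b => sx 0 b x) b (der_continuous (der_sx_b 0 b x)) bb).
Qed.

Lemma cvg_stab_y (b_ y_ : nat -> R) b0 b y : 0 < b0 -> b0 < 2 -> (forall n, b0 <= b_ n) ->
  b_ n @[n --> \oo] --> b -> y_ n @[n --> \oo] --> y ->
  stab_y (b_ n) (y_ n) @[n --> \oo] --> stab_y b y.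
Proof.
move=> b00 b02 hb bb yy; have [C C0 h] := sx0_bound_at b00 b02.
apply: cvgN; apply: cvgM; first exact: cvg_cst.
apply: (cvg_Fs C0 (lexx 0)) => //; [by move=> n; exact: meas_sx|by move=> n x; exact: h|].
move=> x; exact: (@continuous_cvg _ _ _ _ _ b_ (fun b => sx 0 b x) b (der_continuous (der_sx_b 0 b x)) bb).
Qed.

Lemma cvg_stab_b (b_ y_ : nat -> R) b0 b y : 0 < b0 -> b0 < 2 -> (forall n, b0 <= b_ n) ->
  b_ n @[n --> \oo] --> b -> y_ n @[n --> \oo] --> y ->
  stab_b (b_ n) (y_ n) @[n --> \oo] --> stab_b b y.
Proof.
move=> b00 b02 hb bb yy.
have [C C0 h] := xsx1_bound b00 (a := b0 / 2) (e := b0 / 2) ltac:(lra) ltac:(lra) ltac:(lra).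
apply: cvgM; first exact: cvg_cst.
apply: (cvg_Fc C0 (a := b0 / 2)) => //; [lra|lra| | by move=> n x; exact: h|].
  by move=> n; have m := meas_sx 1 (b_ n); meas.
move=> x; apply: cvgN; apply: cvgM; first exact: cvg_cst.
exact: (@continuous_cvg _ _ _ _ _ b_ (fun b => sx 1 b x) b (der_continuous (der_sx_b 1 b x)) bb).
Qed.

End stable_functions.

(** * A uniform lower bound for stable densities *)

Definition affine_map (R : realType) (c a : R) (x : measurableTypeR R) : measurableTypeR R :=
  c * x + a.

Lemma meas_affine_map (R : realType) (c a : R) : measurable_fun setT (affine_map c a).
Proof. by apply: continuous_measurable_fun; rewrite /affine_map; by_der_cont. Qed.

Section affine.
Context (R : realType).
Notation mu := (@lebesgue_measure R).
Variables (c a : R) (c0 : 0 < c).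
Notation F := (affine_map c a).

Let nu : {measure set (measurableTypeR R) -> \bar R} :=
  measure_function_pushforward__canonical__measure_function_Measure mu (meas_affine_map c a).

Let k : {nonneg R} := NngNum (ltW c0).

Lemma lebesgue_measure_affine (A : set R) : measurable A ->
  (c%:E * mu (F @^-1` A))%E = mu A.
Proof.
move=> mA; rewrite -[LHS]/(mscale k nu A).
symmetry; apply: (lebesgue_measure_unique (mu := mscale k nu)) => //.
move=> X [[p q]] /= _ <-.
rewrite /mscale/= /pushforward.
have -> : F @^-1` [set` Interval (BRight p) (BRight q)] = `](p - a) / c, (q - a) / c]%classic.
  apply/seteqP; split => x; rewrite /= !in_itv/= /affine_map ltr_pdivrMr// ler_pdivlMr// (mulrC c).
    by move=> /andP[? ?]; apply/andP; split; lra.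
  by move=> /andP[? ?]; apply/andP; split; lra.
rewrite !lebesgue_measure_itv/= !lte_fin ltr_pM2r ?invr_gt0// ltrD2r.
case: ifPn => // _; last by rewrite mule0.
by rewrite -!EFinD -EFinM; congr EFin; field; rewrite gt_eqF.
Qed.

Lemma ge0_integral_affine (f : R -> \bar R) : (forall x, 0 <= f x)%E ->
  measurable_fun setT f -> (\int[mu]_x f x = c%:E * \int[mu]_x f (c * x + a)%R)%E.
Proof.
move=> f0 mf; transitivity (\int[mscale k nu]_x (f x))%E.
  by apply: eq_measure_integral => A mA _ /=; rewrite -[LHS]lebesgue_measure_affine.
by rewrite ge0_integral_mscale// ge0_integral_pushforward//; exact: meas_affine_map.
Qed.

Lemma integrable_affine (f : R -> R) : mu.-integrable setT (EFin \o f) ->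
  mu.-integrable setT (EFin \o (fun x => f (c * x + a))).
Proof.
move=> intf; have mf := Rintegrable_meas intf; have /integrableP[_ fin] := intf.
apply/integrableP; split; first by apply/measurable_EFinP; exact: (measurableT_comp mf (meas_affine_map c a)).
move: fin; rewrite (ge0_integral_affine (f := fun x => `|(f x)%:E|%E))//; last first.
  by apply/measurable_EFinP; exact: measurableT_comp.
set I := (\int[mu]_x `|_|)%E => h; rewrite -/I.
have I0 : (0 <= I)%E by apply: integral_ge0.
move: h I0; case: I => [r _ _|h _|//]; first exact: ltry.
move: h; by rewrite gt0_muley// lte_fin.
Qed.

Lemma Rintegral_affine (f : R -> R) : mu.-integrable setT (EFin \o f) ->
  \int[mu]_x f x = c * \int[mu]_x f (c * (x : R) + a).
Proof.
have ge0 (g : R -> R) : (forall x, 0 <= g x) -> mu.-integrable setT (EFin \o g) ->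
    \int[mu]_x g x = c * \int[mu]_x g (c * (x : R) + a).
  move=> g0 ig; have ig' := integrable_affine ig.
  rewrite /Rintegral (ge0_integral_affine (f := EFin \o g)); last 2 first.
  - by move=> x; rewrite lee_fin.
  - exact: measurable_int ig.
  by rewrite fineM//; exact: integrable_fin_num ig'.
move=> jf; have jn := Rintegrable_norm measurableT jf; have js := RintegrableD measurableT jf jn.
have jf' := integrable_affine jf; have jn' := Rintegrable_norm measurableT jf'.
have E (g : R -> R) : mu.-integrable setT (EFin \o g) ->
    \int[mu]_x g x = \int[mu]_x (g x + `|g x|) - \int[mu]_x `|g x|.
  by move=> ig; rewrite RintegralD ?addrK//; exact: Rintegrable_norm.
rewrite E// [in RHS]E// mulrBr (ge0 _ _ js)//; last first.
  by move=> x; have := ler_norm (- f x); rewrite normrN; lra.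
by rewrite (ge0 (fun x => `|f x|)).
Qed.

End affine.

(* [lra] compares all arithmetic hypotheses up to conversion, local definitions included. *)
Ltac clra :=
  repeat match goal with H : ?T |- _ =>
    lazymatch type of T with
    | Prop => lazymatch T with
              | is_true (_ <= _)%R => fail
              | is_true (_ < _)%R => fail
              | is_true (_ && _) => fail
              | _ = _ => fail
              | _ => clear H
              end
    end
  end;
  repeat match goal with H := _ |- _ => clearbody H end; lra.

Section stable_lower_bound.
Context (R : realType).
Notation mu := (@lebesgue_measure R).
Implicit Types (b x y u : R).

Definition sym b u : R := expR (- (`|u| `^ b)).

Lemma sym_sx b u : u != 0 -> sym b u = sx 0 b (ln `|u|).
Proof.
by move=> u0; rewrite sxE !mul0r add0r /sym /powR normr_eq0 (negbTE u0).
Qed.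

Lemma sym_even b u : sym b (- u) = sym b u.
Proof. by rewrite /sym normrN. Qed.

Lemma sym0 b : 0 < b -> sym b 0 = 1.
Proof. by move=> b0; rewrite /sym normr0 powR0 ?oppr0 ?expR0// gt_eqF. Qed.

Lemma meas_sym b : measurable_fun setT (sym b).
Proof.
have m : measurable_fun setT (fun u : R => `|u| `^ b) by apply: meas_powR; meas.
by rewrite /sym; meas.
Qed.

Lemma sym_wt b : 0 < b -> b < 2 -> exists2 C, 0 <= C & forall u, `|sym b u| <= C * wt 2 u.
Proof.
move=> b0 b2; have [C C0 h] := sx0_bound_at b0 b2.
exists (C + 1); first clra.
move=> u; have w0 := wt_ge0 2 u; have [->|u0] := eqVneq u 0.
  rewrite ger0_norm ?expR_ge0// sym0// /wt normr0 addr0 powR1; clra.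
rewrite sym_sx//; apply: (le_trans (h b (ln `|u|) (lexx b))).
apply: (@le_trans _ _ (C * wt 2 u)); last by rewrite ler_wpM2r// lerDl.
by rewrite ler_wpM2l// dw_le// expR_ln_norm.
Qed.

Lemma integrable_sym b : 0 < b -> b < 2 -> mu.-integrable setT (EFin \o sym b).
Proof.
move=> b0 b2; have [C C0 h] := sym_wt b0 b2.
apply: (leb_le (g := fun u => C * wt 2 u)) => //; first exact: meas_sym.
by apply: RintegrableZ => //; apply: integrable_wt; clra.
Qed.

Lemma stab_sym b y : 0 < b -> b < 2 ->
  stab b y = (2 * pi)^-1 * \int[mu]_u (cos (u * y) * sym b u).
Proof.
move=> b0 b2; congr (_ * _); have [C C0 h] := sx0_bound_at b0 b2.
rewrite (Fc_half (C := C) (a := 0)) ?lexx//; last first.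
- by move=> x; exact: h.
- exact: meas_sx.
have ic : mu.-integrable setT (EFin \o (fun u => cos (u * y) * sym b u)).
  have := integrable_cosM y (integrable_sym b0 b2).
  by apply: eq_integrable => // u _; rewrite /= (mulrC u).
rewrite (Rintegral_even ic); last by move=> u; rewrite mulNr cosN sym_even.
rewrite -Rintegral_itv_obnd_cbnd; last by apply: integrableS ic.
congr (_ * _); apply: eq_Rintegral => u; rewrite inE/= in_itv/= andbT => u0.
by rewrite sym_sx; [rewrite gtr0_norm|rewrite gt_eqF].
Qed.

Lemma der_le0_noninc (g dg : R -> R) : (forall x : R, is_derive x 1 g (dg x)) ->
  (forall x, dg x <= 0) -> forall x y, x <= y -> g y <= g x.
Proof.
move=> dgE dg0 x y xy.
have [|c _] := @MVT_segment _ g dg x y xy (fun z _ => dgE z).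
  by apply: derivable_within_continuous => z _; have [] := dgE z.
by move=> E; rewrite -subr_le0 E mulr_le0_ge0// subr_ge0.
Qed.

Lemma Rintegral_split (f : R -> R) (c : R) : 0 <= c -> mu.-integrable `]0, +oo[ (EFin \o f) ->
  \int[mu]_(x in `]0, +oo[) f x = \int[mu]_(x in `]0, c]) f x + \int[mu]_(x in `]c, +oo[) f x.
Proof.
move=> c0 intf.
have E : `]0, +oo[%classic = `]0, c]%classic `|` `]c, +oo[%classic.
  apply/seteqP; split => x; rewrite /= !in_itv/= ?andbT.
    by move=> x0; case: (leP x c) => h; [left; rewrite x0|right].
  by case=> [/andP[]//|]; exact: le_lt_trans.
rewrite {1}E Rintegral_setU//; first by rewrite -E.
apply/disj_setPS => x [] /=; rewrite !in_itv/= andbT => /andP[_ h1] h2.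
by move: (le_lt_trans h1 h2); rewrite ltxx.
Qed.

Lemma Rintegral_wt_tail b c : 0 < b -> 0 <= c ->
  \int[mu]_(x in `]c, +oo[) wt (1 + b) x = wt b c / b.
Proof.
move=> b0 c0.
pose F x : R := - (b^-1 * expR (- (b * ln (1 + x)))).
have dF x : c <= x -> is_derive x 1 F (wt (1 + b) x).
  move=> cx; have x1 : 0 < 1 + x by clra.
  rewrite /F wtE (_ : `|x| = x); last by rewrite ger0_norm//; clra.
  have -> : - (1 + b) * ln (1 + x) = - ln (1 + x) - b * ln (1 + x) by ring.
  have e1 : expR (ln (1 + x)) = 1 + x by apply: lnK; rewrite posrE.
  rewrite expRD expRN e1.
  have n1 : 1 + x != 0 by rewrite gt_eqF.
  have n2 : b != 0 by rewrite gt_eqF.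
  by der; field; rewrite n1 n2.
have iw : mu.-integrable setT (EFin \o wt (1 + b)) by apply: integrable_wt; clra.
transitivity (0 - F c); last first.
  by rewrite sub0r /F opprK wtE ger0_norm// mulrC; congr (expR _ * _); ring.
apply: integrable_FTC2y.
- by move=> x cx; exact: dF (ltW cx).
- move=> x cx; rewrite (_ : wt (1 + b) = fun x : R => expR (- (1 + b) * ln (1 + `|x|))); last first.
    by apply/funext => z; rewrite wtE.
  apply: continuous_comp; last exact: continuous_expR.
  apply: continuousM; first exact: cst_continuous.
  apply: (@continuous_comp R R R (fun x : R => 1 + `|x|) (@ln R)).
    by apply: continuousD; [exact: cst_continuous|exact: norm_continuous].
  by apply: continuous_ln; rewrite ltr_pwDl.
- by apply: integrableS iw.
- by apply: cvg_at_right_filter; exact: der_continuous (dF c (lexx c)).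
- rewrite -[X in _ --> X]oppr0; apply: cvgN.
  rewrite -[X in _ --> X](mulr0 b^-1); apply: cvgM; first exact: cvg_cst.
  apply/cvgrPdist_le => e e0; near=> x.
  rewrite sub0r normrN ger0_norm ?expR_ge0// -[leRHS]lnK ?posrE// ler_expR.
  have x0 : expR (- (ln e / b)) <= x by near: x; apply: nbhs_pinfty_ge; exact: num_real.
  have l : - (ln e / b) <= ln (1 + x).
    rewrite -[leLHS]expRK ler_ln ?posrE ?expR_gt0//; last by have := expR_gt0 (- (ln e / b)); clra.
    by rewrite (le_trans x0)// lerDr.
  by rewrite lerNl (le_trans _ (ler_wpM2l (ltW b0) l))// mulrN mulrCA divff ?mulr1// gt_eqF.
Unshelve. all: by end_near. Qed.

Lemma continuous_pow_head b x : 0 <= x -> {for x, continuous (fun x : R => expR ((1 - b) * ln (1 + x)))}.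
Proof. by move=> x0; have x1 : 0 < 1 + x by [clra]; eapply der_continuous; der_rules R. Qed.

Lemma integrable_pow_head b c : 0 <= c ->
  mu.-integrable `[0, c] (EFin \o (fun x : R => expR ((1 - b) * ln (1 + x)))).
Proof.
move=> c0; apply: continuous_compact_integrable; first exact: segment_compact.
apply: continuous_in_subspaceT => x; rewrite inE/= in_itv/= => /andP[x0 _].
exact: continuous_pow_head.
Qed.

Lemma Rintegral_pow_head b c : b < 2 -> 0 <= c ->
  \int[mu]_(x in `]0, c]) expR ((1 - b) * ln (1 + x)) = (expR ((2 - b) * ln (1 + c)) - 1) / (2 - b).
Proof.
move=> b2 c0; have h2 : 0 < 2 - b by clra.
pose F x : R := (2 - b)^-1 * expR ((2 - b) * ln (1 + x)).
have dF x : 0 <= x -> is_derive x 1 F (expR ((1 - b) * ln (1 + x))).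
  move=> x0; have x1 : 0 < 1 + x by clra.
  have e1 : expR (ln (1 + x)) = 1 + x by apply: lnK; rewrite posrE.
  rewrite /F.
  have n1 : 1 + x != 0 by rewrite gt_eqF.
  have n2 : 2 - b != 0 by rewrite gt_eqF.
  der; have -> : (2 - b) * ln (1 + x) = ln (1 + x) + (1 - b) * ln (1 + x) by ring.
  by rewrite expRD e1; field; rewrite n1 n2.
have cf x : 0 <= x -> {for x, continuous (fun x : R => expR ((1 - b) * ln (1 + x)))} := @continuous_pow_head b x.
have cF x : 0 <= x -> {for x, continuous F} by move=> x0; exact: der_continuous (dF x x0).
have ic := integrable_pow_head b c0.
have [c00|c00] := eqVneq c 0.
  rewrite c00 set_itvoc0 Rintegral_set0 addr0 ln1 mulr0 expR0 subrr mul0r//.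
have c1 : 0 < c by rewrite lt_neqAle eq_sym c00.
rewrite Rintegral_itv_obnd_cbnd; last by apply: integrableS ic => //; exact: subset_itv_oc_cc.
rewrite /Rintegral (@continuous_FTC2 _ (fun x => expR ((1 - b) * ln (1 + x))) F)//=.
- by rewrite /F addr0 ln1 mulr0 expR0; field; rewrite gt_eqF.
- by apply: continuous_in_subspaceT => x; rewrite inE/= in_itv/= => /andP[x0 _]; exact: cf.
- split.
  + by move=> x; rewrite in_itv/= => /andP[x0 _]; have [] := dF x (ltW x0).
  + by apply: cvg_at_right_filter; exact: cF.
  + by apply: cvg_at_left_filter; exact: cF.
- by move=> x; rewrite in_itv/= => /andP[x0 _]; exact: der_derive1 (dF x (ltW x0)).
Qed.

Lemma Rintegral_odd (f : R -> R) : mu.-integrable setT (EFin \o f) ->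
  (forall x, f (- x) = - f x) -> \int[mu]_x f x = 0.
Proof.
move=> jf of_; have := Rintegral_opp jf.
under [X in _ = X -> _]eq_Rintegral do rewrite of_ -mulN1r.
by rewrite RintegralZl// mulN1r; clra.
Qed.

Lemma continuous_stab b : 0 < b -> b < 2 -> continuous (stab b).
Proof. by move=> b0 b2 y; exact: der_continuous (der_stab_y y b0 b2). Qed.

Lemma meas_stab b : 0 < b -> b < 2 -> measurable_fun setT (stab b).
Proof. by move=> b0 b2; apply: continuous_measurable_fun; exact: continuous_stab. Qed.

Lemma integrable_stab b : 0 < b -> b < 2 -> mu.-integrable setT (EFin \o stab b).
Proof.
move=> b0 b2; have [K K0 h] := stab_bound b0 (lexx b) b2.
apply: (leb_le (g := fun y => K * wt (1 + b) y)); first exact: meas_stab.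
  by move=> y; exact: h.
by apply: RintegrableZ => //; apply: integrable_wt; clra.
Qed.

(* Strict stability: [Z1 + Z2] has the law of [2^(1 / b) Z]. *)
Lemma stab_conv b y : 0 < b -> b < 2 ->
  (forall u, \int[mu]_z (cos (u * z) * stab b z) = sym b u) ->
  let k := expR (ln 2 / b) in
  stab b y = k * \int[mu]_z (stab b z * stab b (k * y - z)).
Proof.
move=> b0 b2 cf k; have k0 : 0 < k := expR_gt0 _.
have js := integrable_stab b0 b2; have ms := meas_stab b0 b2.
have jy := integrable_sym b0 b2; have my := @meas_sym b.
have inner w u : \int[mu]_z (stab b z * (cos (u * (w - z)) * sym b u)) =
    cos (u * w) * sym b u ^+ 2.
  have E z : stab b z * (cos (u * (w - z)) * sym b u) =
      (cos (u * w) * sym b u) * (cos (u * z) * stab b z) +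
      (sin (u * w) * sym b u) * (sin (u * z) * stab b z).
    by rewrite mulrBr cosB; ring.
  under eq_Rintegral do rewrite E.
  have j1 := integrable_cosM u js; have j2 := integrable_sinM u js.
  rewrite RintegralD//; [|exact: RintegrableZ|exact: RintegrableZ].
  rewrite !RintegralZl// cf (Rintegral_odd j2) ?mulr0 ?addr0 -?mulrA//.
  by move=> z; rewrite mulrN sinN stab_even mulNr.
have [M M0 hM] := stab_bound b0 (lexx b) b2.
have jss w : mu.-integrable setT (EFin \o (fun z => stab b z * stab b (w - z))).
  apply: (leb_le (g := fun z => M * `|stab b z|)).
  - have mw := meas_comp ms (measD (measurable_cst w) (measN (@measurable_id _ R setT))).
    exact: measM ms mw.
  - move=> z; rewrite normrM mulrC ler_wpM2r// (le_trans (hM b (w - z) (lexx _) (lexx _)))//.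
    by rewrite ler_piMr// wt_le1//; clra.
  - by apply: RintegrableZ => //; exact: Rintegrable_norm.
have conv w : \int[mu]_z (stab b z * stab b (w - z)) =
    (2 * pi)^-1 * \int[mu]_u (cos (u * w) * sym b u ^+ 2).
  have E z : \int[mu]_u (stab b z * (cos (u * (w - z)) * sym b u)) =
      2 * pi * (stab b z * stab b (w - z)).
    rewrite RintegralZl//; last first.
      have := integrable_cosM (w - z) jy; apply: eq_integrable => // u _.
      by rewrite /= (mulrC u).
    by rewrite [RHS]mulrCA [stab b (w - z)]stab_sym// mulVKf// gt_eqF// twopi_gt0.
  have -> : \int[mu]_z (stab b z * stab b (w - z)) =
      (2 * pi)^-1 * \int[mu]_z \int[mu]_u (stab b z * (cos (u * (w - z)) * sym b u)).
    under [in RHS]eq_Rintegral do rewrite E.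
    by rewrite RintegralZl// mulKf// gt_eqF// twopi_gt0.
  congr (_ * _).
  rewrite (@Rfubini_dominated _ _ _ _ _ mu mu (fun z u => stab b z * (cos (u * (w - z)) * sym b u))
    (fun z => `|stab b z|) (sym b))//.
  - by apply: eq_Rintegral => u _; rewrite inner.
  - have m1 := measurableT_comp ms (@measurable_fst _ _ R R).
    have m2 := measurableT_comp my (@measurable_snd _ _ R R).
    by meas.
  - exact: Rintegrable_norm.
  - move=> z u; rewrite normrM ler_wpM2l// (le_trans (norm_trig_le _ (norm_cos_le1 _)))//.
    by rewrite ger0_norm// expR_ge0.
rewrite conv stab_sym// mulrCA; congr (_ * _).
have jc : mu.-integrable setT (EFin \o (fun u => cos (u * y) * sym b u)).
  have := integrable_cosM y jy; apply: eq_integrable => // u _.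
  by rewrite /= (mulrC u).
(* Replacing u by k u squares [sym b], because k^b = 2. *)
rewrite (Rintegral_affine 0 k0 jc); congr (_ * _); apply: eq_Rintegral => u _.
rewrite addr0; have -> : k * u * y = u * (k * y) by ring.
congr (_ * _).
rewrite /sym normrM (gtr0_norm k0) (powRM _ (ltW k0) (normr_ge0 _)) -[RHS]expRM_natl; congr expR.
by rewrite /k -expRM divfK ?gt_eqF// lnK ?posrE// mulrN.
Qed.

(* [e^((1 + b) x) stab b (e^x) + K / e e^(-e x)] is nonincreasing in [x]. *)
Lemma stab_tail_dom (K e b y1 y2 : R) : 0 < e -> 0 < b -> b < 2 ->
  (forall y, `|(1 + b) * stab b y + y * stab_y b y| <= K * wt (1 + b + e) y) ->
  0 < y1 -> y1 <= y2 ->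
  stab b y2 <= (expR ((1 + b) * ln y1) * stab b y1 + K / e * expR (- (e * ln y1))) *
    expR (- ((1 + b) * ln y2)).
Proof.
move=> e0 b0 b2 hK y10 y12; have y20 : 0 < y2 := lt_le_trans y10 y12.
have K0 : 0 <= K by have := le_trans (normr_ge0 _) (hK 0); rewrite pmulr_lge0// wt_gt0.
pose H x : R := expR ((1 + b) * x) * stab b (expR x) + K / e * expR (- (e * x)).
pose dH x : R := expR ((1 + b) * x) * ((1 + b) * stab b (expR x) + expR x * stab_y b (expR x))
  - K * expR (- (e * x)).
have dHE (x : R) : is_derive x 1 H (dH x).
  have ds := der_comp (der_stab_y (expR x) b0 b2) (der_exp (der_id x)).
  have e1 : e != 0 by rewrite gt_eqF.
  by rewrite /H /dH; der; move: (stab b _) (stab_y b _) => p q; field.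
have dH0 x : dH x <= 0.
  rewrite /dH subr_le0.
  apply: (@le_trans _ _ (expR ((1 + b) * x) * (K * wt (1 + b + e) (expR x)))).
    by rewrite ler_pM2l ?expR_gt0// (le_trans (ler_norm _))// hK.
  rewrite mulrCA ler_wpM2l// wtE -expRD ler_expR.
  have : x <= ln (1 + `|expR x|).
    have x0 := expR_gt0 x; rewrite -[leLHS]expRK (ger0_norm (ltW x0)).
    by rewrite ler_ln ?posrE//; clra.
  by move: (ln _) => l xl; nra.
have := der_le0_noninc dHE dH0 (x := ln y1) (y := ln y2).
rewrite ler_ln ?posrE// => /(_ y12); rewrite /H !lnK ?posrE// => h.
rewrite (expRN ((1 + b) * ln y2)) ler_pdivlMr ?expR_gt0// mulrC (le_trans _ h)// lerDl.
by rewrite mulr_ge0 ?expR_ge0// divr_ge0// ltW.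
Qed.

(** The left side is the integral of (1 - cos(u z)) against the density. Up to y1 it is bounded
    through 1 - cos x <= x^2 / 2 and the global bound [K], beyond y1 through 1 - cos x <= 2 and the
    tail coefficient [n]. *)
Lemma cos_tail_ub (K n b y1 u : R) : 0 < b -> b < 2 -> 0 <= K -> 1 <= y1 -> 0 <= n ->
  (forall y, 0 <= stab b y) -> (forall y, `|stab b y| <= K * wt (1 + b) y) ->
  (forall y, y1 <= y -> stab b y <= n * expR (- ((1 + b) * ln y))) ->
  (forall u, \int[mu]_z (cos (u * z) * stab b z) = sym b u) ->
  1 - sym b u <= 4 * u ^+ 2 * K * expR ((2 - b) * ln y1) / (2 - b) + 32 * n * expR (- (b * ln y1)) / b.
Proof.
move=> b0 b2 K0 y11 n0 s0 sK sn cf.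
have y10 : 0 < y1 by clra.
have js := integrable_stab b0 b2; have ms := meas_stab b0 b2.
have jc := integrable_cosM u js.
have l0 : 0 <= ln y1 by rewrite ln_ge0.
have l1 : ln (1 + y1) <= ln 2 + ln y1.
  by rewrite -lnM ?posrE// ler_ln ?posrE ?mulr_gt0//; clra.
have l2 : ln y1 <= ln (1 + y1) by rewrite ler_ln ?posrE//; clra.
have one : \int[mu]_z stab b z = 1.
  rewrite -(sym0 b0) -cf; apply: eq_Rintegral => z _.
  by rewrite mul0r cos0 mul1r.
pose f z := (1 - cos (u * z)) * stab b z.
have fE z : f z = stab b z - cos (u * z) * stab b z by rewrite /f mulrBl mul1r.
have jf : mu.-integrable setT (EFin \o f).
  have := RintegrableB measurableT js jc; apply: eq_integrable => // z _.
  by rewrite /= fE.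
have -> : 1 - sym b u = \int[mu]_z f z.
  under eq_Rintegral do rewrite fE.
  by rewrite RintegralB// cf one.
rewrite (Rintegral_even jf); last by move=> z; rewrite /f mulrN cosN stab_even.
rewrite -Rintegral_itv_obnd_cbnd; last by apply: integrableS jf.
rewrite (Rintegral_split (ltW y10)); last by apply: integrableS jf.
have I1 : \int[mu]_(z in `]0, y1]) f z <= 2 * u ^+ 2 * K * expR ((2 - b) * ln y1) / (2 - b).
  have jp : mu.-integrable `]0, y1] (EFin \o (fun x : R => expR ((1 - b) * ln (1 + x)))).
    by apply: integrableS (integrable_pow_head b (ltW y10)) => //; exact: subset_itv_oc_cc.
  apply: (@le_trans _ _ (\int[mu]_(z in `]0, y1]) (u ^+ 2 / 2 * K * expR ((1 - b) * ln (1 + z))))).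
    apply: le_Rintegral => //; [by apply: integrableS jf|exact: RintegrableZ|].
    move=> z; rewrite /= in_itv/= => /andP[z0 _]; rewrite /f.
    have z1 : 0 < 1 + z by clra.
    apply: (@le_trans _ _ ((u * z) ^+ 2 / 2 * (K * wt (1 + b) z))).
      apply: ler_pM; [by rewrite subr_ge0 cos_le1|exact: s0|exact: one_sub_cos_le|].
      exact: le_trans (ler_norm _) (sK z).
    have -> : (u * z) ^+ 2 / 2 * (K * wt (1 + b) z) = u ^+ 2 / 2 * K * (z ^+ 2 * wt (1 + b) z) by ring.
    apply: ler_wpM2l; first by rewrite mulr_ge0// divr_ge0// sqr_ge0.
    have -> : (1 - b) * ln (1 + z) = 2 * ln (1 + z) - (1 + b) * ln (1 + z) by ring.
    have e1 : expR (ln (1 + z)) = 1 + z by apply: lnK; rewrite posrE.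
    rewrite wtE ger0_norm ?(ltW z0)// expRD -mulNr expRM_natl e1.
    by apply: ler_wpM2r; [exact: expR_ge0|rewrite ler_pXn2r ?nnegrE ?(ltW z0) ?(ltW z1)// lerDr].
  rewrite RintegralZl// Rintegral_pow_head ?(ltW y10)//.
  have h2 : 0 < (2 - b)^-1 by rewrite invr_gt0; clra.
  have e4 : expR ((2 - b) * ln (1 + y1)) <= 4 * expR ((2 - b) * ln y1).
    have -> : 4 = expR (2%:R * ln 2) :> R.
      by rewrite expRM_natl lnK ?posrE//; ring.
    rewrite -expRD ler_expR.
    have ln20 : 0 <= ln 2 :> R by rewrite ln_ge0//; clra.
    by move: (ln (1 + y1)) (ln y1) (ln 2) l1 ln20 => p q r *; nra.
  rewrite mulrA ler_pM2r//.
  have -> : 2 * u ^+ 2 * K * expR ((2 - b) * ln y1) = u ^+ 2 / 2 * K * (4 * expR ((2 - b) * ln y1)) by field.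
  apply: ler_wpM2l; first by rewrite mulr_ge0// divr_ge0// sqr_ge0.
  by rewrite (le_trans _ e4)// lerBlDr lerDl.
have I2 : \int[mu]_(z in `]y1, +oo[) f z <= 16 * n * expR (- (b * ln y1)) / b.
  have jw : mu.-integrable `]y1, +oo[ (EFin \o wt (1 + b)).
    by have jw := @integrable_wt R (1 + b) ltac:(clra); apply: integrableS jw.
  apply: (@le_trans _ _ (\int[mu]_(z in `]y1, +oo[) (16 * n * wt (1 + b) z))).
    apply: le_Rintegral => //; [by apply: integrableS jf|exact: RintegrableZ|].
    move=> z; rewrite /= in_itv/= andbT => z1; have z0 : 0 < z by clra.
    have -> : 16 * n * wt (1 + b) z = 2 * (n * (8 * wt (1 + b) z)) by ring.
    rewrite /f; apply: ler_pM; [by rewrite subr_ge0 cos_le1|exact: s0| |].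
      by have := cos_geN1 (u * z); clra.
    rewrite (le_trans (sn z (ltW z1)))// ler_wpM2l//.
    have -> : 8 = expR (3%:R * ln 2) :> R.
      by rewrite expRM_natl lnK ?posrE//; ring.
    rewrite wtE -expRD ler_expR ger0_norm ?(ltW z0)//.
    have lz : ln (1 + z) <= ln 2 + ln z.
      by rewrite -lnM ?posrE// ler_ln ?posrE ?mulr_gt0//; clra.
    have ln20 : 0 <= ln 2 :> R by rewrite ln_ge0//; clra.
    by move: (ln (1 + z)) (ln z) (ln 2) lz ln20 => p q r *; nra.
  rewrite RintegralZl// Rintegral_wt_tail ?(ltW y10)// mulrA ler_pM2r ?invr_gt0//.
  apply: ler_wpM2l; first by rewrite mulr_ge0.
  by rewrite wtE ger0_norm ?(ltW y10)// ler_expR mulNr lerN2 ler_pM2l.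
rewrite mulrDr lerD//.
  by apply: (le_trans (ler_wpM2l _ I1)) => //; rewrite -!mulrA; clra.
by apply: (le_trans (ler_wpM2l _ I2)) => //; rewrite -!mulrA; clra.
Qed.

(* If the tail of [stab b] were too thin, [1 - sym b u] would be too small near [u = 0]
   by [cos_tail_ub]. *)
Lemma tail_coeff_lb (K n b b0 b1 t y1 : R) : 0 < b0 -> b0 <= b -> b <= b1 -> b1 < 2 ->
  0 <= K -> 1 <= y1 -> 0 <= n -> t <= 0 -> 16 * K * expR ((2 - b1) * t) <= 2 - b1 ->
  (forall y, 0 <= stab b y) -> (forall y, `|stab b y| <= K * wt (1 + b) y) ->
  (forall y, y1 <= y -> stab b y <= n * expR (- ((1 + b) * ln y))) ->
  (forall u, \int[mu]_z (cos (u * z) * stab b z) = sym b u) ->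
  b0 * expR (2 * t) / 128 <= n.
Proof.
move=> b00 hb hb1 b12 K0 y11 n0 t0 ht s0 sK sn cf.
have bp : 0 < b by clra.
have b2 : b < 2 by clra.
have l0 : 0 <= ln y1 by rewrite ln_ge0.
(* The frequency is e^t / y1. With v = u^b <= 1 the left side of [cos_tail_ub] is at least v / 2,
   and the choice of [t] makes the head at most v / 4. The tail must supply the other v / 4, whence
   128 = 4 * 32. *)
have := cos_tail_ub (expR (t - ln y1)) bp b2 K0 y11 n0 s0 sK sn cf.
have -> : sym b (expR (t - ln y1)) = expR (- expR (b * (t - ln y1))).
  by rewrite /sym ger0_norm ?expR_ge0// -expRM mulrC.
move: (ln y1) l0 => l l0.
set v := expR (b * (t - l)).
have v0 : 0 < v := expR_gt0 _.
have v1 : v <= 1 by rewrite /v expR_le1; nra.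
have hv : expR (- v) <= (1 + v)^-1.
  by rewrite expRN lef_pV2 ?posrE ?expR_gt0 ?expR_ge1Dx//; clra.
have hv2 : v / 2 <= 1 - (1 + v)^-1.
  have p0 : 0 < 1 + v by clra.
  have n1 : 1 + v != 0 by rewrite gt_eqF.
  have -> : 1 - (1 + v)^-1 = v / (1 + v) by field.
  by rewrite ler_pM2l// lef_pV2 ?posrE//; clra.
move=> h.
have {hv hv2 h} := le_trans hv2 (le_trans (lerB (lexx 1) hv) h).
have -> : expR (t - l) ^+ 2 = expR (2 * t) * expR (- (2 * l)).
  by rewrite -expRM_natl -expRD; congr expR; ring.
have -> : 4 * (expR (2 * t) * expR (- (2 * l))) * K * expR ((2 - b) * l) / (2 - b) =
    4 * (expR ((2 - b) * t) * K / (2 - b)) * v.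
  rewrite /v; have -> : b * (t - l) = 2 * t - (2 - b) * t + (- (2 * l) + (2 - b) * l) by ring.
  rewrite !expRD !expRN; field.
  by rewrite !gt_eqF ?expR_gt0//; clra.
have -> : 32 * n * expR (- (b * l)) / b = 32 * n / (b * expR (b * t)) * v.
  by rewrite /v mulrBr expRD; field; rewrite !gt_eqF// ?expR_gt0.
rewrite -mulrDl mulrC ler_pM2r// => h.
have h1 : expR ((2 - b) * t) * K / (2 - b) <= 16^-1.
  rewrite ler_pdivrMr ?subr_gt0//.
  have e1 : expR ((2 - b) * t) <= expR ((2 - b1) * t) by rewrite ler_expR; nra.
  have := ler_wpM2r K0 e1; clra.
have {h h1} : 4^-1 <= 32 * n / (b * expR (b * t)) by clra.
rewrite ler_pdivlMr ?mulr_gt0 ?expR_gt0// => h.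
have e2 : expR (2 * t) <= expR (b * t) by rewrite ler_expR; nra.
have := ler_pM (ltW b00) (expR_ge0 _) hb e2; clra.
Qed.

(* Far from [0] the tail coefficient is bounded below; near [0], [stab_conv] writes the
   density as an integral over regions where it is already known to be positive. *)
Lemma stab_lower_bound (b0 b1 : R) : 0 < b0 -> b0 <= b1 -> b1 < 2 ->
  (forall b, 0 < b < 2 -> forall y, 0 <= stab b y) ->
  (forall b, 0 < b < 2 -> forall u, \int[mu]_z (cos (u * z) * stab b z) = sym b u) ->
  exists2 c, 0 < c & forall b y, b0 <= b -> b <= b1 -> c * wt (1 + b) y <= stab b y.
Proof.
move=> b00 b01 b12 s0 cf.
have [K K0 hK] := stab_bound b00 b01 b12.
have [K3 K30 [e e0 hK3]] := stab_tail_bound b00 b01 b12.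
have in02 b : b0 <= b -> b <= b1 -> 0 < b < 2 by move=> h h1; apply/andP; split; clra.
have [t t0 ht] : exists2 t, t <= 0 & 16 * K * expR ((2 - b1) * t) <= 2 - b1.
  have d0 : 0 < 2 - b1 by clra.
  have n0 : 2 - b1 != 0 by rewrite gt_eqF.
  pose x := 16 * K / (2 - b1); have x0 : 0 <= x by rewrite divr_ge0 ?(ltW d0)// mulr_ge0.
  exists (- (x / (2 - b1))); first by rewrite oppr_le0 divr_ge0// ltW.
  have -> : (2 - b1) * - (x / (2 - b1)) = - x by field.
  have -> : 16 * K = x * (2 - b1) by rewrite /x; field.
  rewrite expRN ler_pdivrMr ?expR_gt0// mulrC ler_pM2l//.
  by have := expR_ge1Dx x; clra.
pose c1 := b0 * expR (2 * t) / 128.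
have c10 : 0 < c1 by rewrite divr_gt0// mulr_gt0// expR_gt0.
(* Beyond Y = e^L the correction K3 / e e^(-e ln y) in the tail coefficient is at most c1 / 2, since
   e^(e L) >= 1 + e L. At least c1 / 2 then remains for the density itself. *)
pose L := 2 * K3 / (e ^+ 2 * c1).
have L0 : 0 <= L by rewrite divr_ge0 ?mulr_ge0// ?sqr_ge0// ltW.
have hL : K3 / e * expR (- (e * L)) <= c1 / 2.
  have n1 : e != 0 by rewrite gt_eqF.
  have n2 : c1 != 0 by rewrite gt_eqF.
  rewrite expRN ler_pdivrMr ?expR_gt0//.
  apply: (@le_trans _ _ (c1 / 2 * (1 + e * L))); last by rewrite ler_pM2l ?expR_ge1Dx// divr_gt0.
  have -> : c1 / 2 * (1 + e * L) = c1 / 2 + K3 / e by rewrite /L; field; rewrite n1 n2.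
  by rewrite lerDr ltW// divr_gt0.
pose Y := expR L; have Y1 : 1 <= Y by rewrite -expR0 ler_expR.
have far0 b y : b0 <= b -> b <= b1 -> Y <= y -> c1 / 2 * wt (1 + b) y <= stab b y.
  move=> h h1 Yy; have y1 : 1 <= y by clra.
  have y0 : 0 < y by clra.
  have /andP[bp b2] := in02 b h h1.
  have hb := in02 b h h1.
  pose n := expR ((1 + b) * ln y) * stab b y + K3 / e * expR (- (e * ln y)).
  have n0 : 0 <= n.
    apply: addr_ge0; apply: mulr_ge0; rewrite ?expR_ge0// ?s0//.
    by rewrite divr_ge0// ltW.
  have := tail_coeff_lb b00 h h1 b12 K0 y1 n0 t0 ht (s0 b hb) (fun z => hK b z h h1)
    (fun z yz => stab_tail_dom e0 bp b2 (fun z => hK3 b z h h1) y0 yz) (cf b hb).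
  rewrite -/c1 /n => hn.
  have Ly : L <= ln y by rewrite -[leLHS]expRK ler_ln ?posrE// expR_gt0.
  have e1 : K3 / e * expR (- (e * ln y)) <= K3 / e * expR (- (e * L)).
    rewrite ler_wpM2l//; first by rewrite divr_ge0// ltW.
    by rewrite ler_expR lerN2 ler_pM2l.
  have {e1 hn} : c1 / 2 <= expR ((1 + b) * ln y) * stab b y by clra.
  move=> /(ler_wpM2r (expR_ge0 (- ((1 + b) * ln y)))) hn.
  apply: (le_trans _ (le_trans hn _)); last by rewrite mulrAC -expRD subrr expR0 mul1r.
  apply: ler_wpM2l; first by rewrite divr_ge0// ltW.
  rewrite wtE ler_expR ger0_norm ?(ltW y0)// mulNr lerN2 ler_pM2l; last by clra.
  by rewrite ler_ln ?posrE//; clra.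
have far b y : b0 <= b -> b <= b1 -> Y <= `|y| -> c1 / 2 * wt (1 + b) y <= stab b y.
  move=> h h1; have [y0|y0] := leP 0 y; first by rewrite ger0_norm//; exact: far0.
  by rewrite ltr0_norm// => /(far0 _ _ h h1); rewrite wtN stab_even.
pose k1 : R := expR (ln 2 / b0).
have k11 : 1 <= k1 by rewrite -expR0 ler_expR divr_ge0 ?(ltW b00)// ln_ge0//; clra.
(* A window for the convolution variable: if |z - A| <= 1 and |y| <= Y, then z and k y - z both have
   absolute value between Y and Q, where the far bound applies. A triangle centred at A, of mass 1,
   carries the lower estimate. *)
pose A := (k1 + 1) * Y + 1; pose Q := A + 1 + k1 * Y.
have kY : 1 <= k1 * Y by rewrite -[leLHS]mulr1 ler_pM.
pose c2 := (c1 / 2 * wt 3 Q) ^+ 2.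
have c20 : 0 < c2 by rewrite exprn_gt0// mulr_gt0 ?wt_gt0// divr_gt0.
have wtQ b z : b0 <= b -> b <= b1 -> Y <= `|z| -> `|z| <= Q -> c1 / 2 * wt 3 Q <= stab b z.
  move=> h h1 Yz zQ; apply: (le_trans _ (far b z h h1 Yz)).
  apply: ler_wpM2l; first by rewrite divr_ge0// ltW.
  apply: (@le_trans _ _ (wt 3 z)); last by apply: wt_le; clra.
  rewrite !wtE ler_expR !mulNr lerN2 ler_pM2l// ler_ln ?posrE ?ltr_pwDl//.
  by rewrite lerD2l (le_trans zQ)// ler_norm.
have near b y : b0 <= b -> b <= b1 -> `|y| <= Y -> c2 <= stab b y.
  move=> h h1 yY; have hb := in02 b h h1; have /andP[bp b2] := hb.
  rewrite (stab_conv y bp b2 (cf b hb)); set k := expR (ln 2 / b).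
  have ln20 : 0 <= ln 2 :> R by rewrite ln_ge0//; clra.
  have k_1 : 1 <= k by rewrite -expR0 ler_expR divr_ge0// ltW.
  have kk1 : k <= k1 by rewrite ler_expR ler_wpM2l// lef_pV2// posrE.
  have kyY : `|k * y| <= k1 * Y by rewrite normrM ger0_norm ?expR_ge0// ler_pM// expR_ge0.
  have js := integrable_stab bp b2; have ms := meas_stab bp b2.
  have jss : mu.-integrable setT (EFin \o (fun z => stab b z * stab b (k * y - z))).
    have [M M0 hM] := stab_bound bp (lexx b) b2.
    apply: (leb_le (g := fun z => M * `|stab b z|)).
    - have mw := meas_comp ms (measD (measurable_cst (k * y)) (measN (@measurable_id _ R setT))).
      exact: measM ms mw.
    - move=> z; rewrite normrM mulrC ler_wpM2r// (le_trans (hM b (k * y - z) (lexx _) (lexx _)))//.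
      by rewrite ler_piMr// wt_le1//; clra.
    - by apply: RintegrableZ => //; exact: Rintegrable_norm.
  have jh := integrable_affine (- A) ltr01 (@integrable_hat R).
  have one : \int[mu]_z hat (1 * z - A) = 1.
    have := Rintegral_affine (- A) ltr01 (@integrable_hat R); rewrite mul1r => <-.
    have := hat_fourier_cos (0 : R); rewrite /hat_hat eqxx => <-.
    by apply: eq_Rintegral => z _; rewrite mul0r cos0 mul1r.
  have le : c2 * \int[mu]_z hat (1 * z - A) <= \int[mu]_z (stab b z * stab b (k * y - z)).
    rewrite -RintegralZl//; apply: le_Rintegral => //; first exact: RintegrableZ.
    move=> z' _; move: (z' : R) => z {z'}; have [h2|h2] := leP 1 `|1 * z - A|.
      by rewrite hat_eq0// mulr0 mulr_ge0 ?s0.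
    move: h2; rewrite mul1r ltr_norml => /andP[? ?].
    move: kyY; rewrite ler_norml => /andP[? ?].
    apply: (@le_trans _ _ c2); first by rewrite ler_piMr ?hat_le1// ltW.
    have AE : A = k1 * Y + Y + 1 by rewrite /A; ring.
    have QE : Q = A + 1 + k1 * Y by [].
    have c3 : 0 <= c1 / 2 * wt 3 Q by rewrite mulr_ge0 ?wt_ge0// divr_ge0// ltW.
    rewrite /c2 expr2; apply: ler_pM => //; apply: wtQ => //.
    - by rewrite ger0_norm; clra.
    - by rewrite ger0_norm; clra.
    - by rewrite ler0_norm; clra.
    - by rewrite ler0_norm; clra.
  rewrite one mulr1 in le.
  by apply: (le_trans le); rewrite ler_peMl// (le_trans (ltW c20) le).
exists (Num.min (c1 / 2) c2); first by rewrite lt_min c20 divr_gt0.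
move=> b y h h1; have [Yy|Yy] := leP Y `|y|.
  by apply: (le_trans _ (far b y h h1 Yy)); rewrite ler_wpM2r ?wt_ge0// ge_min lexx.
apply: (le_trans _ (near b y h h1 (ltW Yy))).
apply: (@le_trans _ _ (c2 * wt (1 + b) y)); first by rewrite ler_wpM2r ?wt_ge0// ge_min lexx orbT.
by rewrite ler_piMr ?(ltW c20)// wt_le1//; clra.
Qed.

End stable_lower_bound.

(** * Laws with a density *)

Section transfer.
Context d (T : measurableType d) (R : realType) (m : {measure set T -> \bar R}).
Variables (Z Y : T -> R) (Q : probability (measurableTypeR R) R) (c : R).
Hypotheses (iZ : m.-integrable setT (EFin \o Z)) (mY : measurable_fun setT Y).
Hypothesis H : forall B : set R, measurable B ->
  \int[m]_w (Z w * \1_B (Y w)) = c * fine (Q B).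

Let mZ : measurable_fun setT Z. Proof. exact: Rintegrable_meas iZ. Qed.

Lemma integrable_mul_bounded (G : T -> R) (M : R) : measurable_fun setT G ->
  (forall w, `|G w| <= M) -> m.-integrable setT (EFin \o (fun w => Z w * G w)).
Proof.
move=> mG GM; apply: (Rintegrable_le (g := fun w => M * `|Z w|)) => //.
- exact: measM.
- by move=> w _; rewrite normrM mulrC ler_wpM2r.
- by apply: RintegrableZ => //; exact: Rintegrable_norm.
Qed.

(** This is floor(n F) / n where F < n and 0 elsewhere; n F < n^2 there, which explains the n * n
    levels. *)
Let step (F : R -> R) (n : nat) (y : R) : R :=
  \sum_(k < n * n) k%:R / n%:R * \1_[set z | Num.truncn (n%:R * F z) = k :> nat] y.

Let meas_level (F : R -> R) (n k : nat) : measurable_fun setT F -> (forall y, 0 <= F y) ->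
  measurable ([set z | Num.truncn (n%:R * F z) = k :> nat] : set (measurableTypeR R)).
Proof.
move=> mF F0; have m1 : measurable_fun setT (fun y => n%:R * F y) by meas.
have -> : [set z | Num.truncn (n%:R * F z) = k :> nat] =
    setT `&` (fun y => n%:R * F y) @^-1` `[k%:R, k.+1%:R[%classic.
  rewrite setTI; apply/seteqP; split => z /=; rewrite in_itv/= => h.
    have := truncn_le (n%:R * F z); rewrite mulr_ge0// h => ->.
    by rewrite -h truncnS_gt.
  by apply/eqP; rewrite truncn_eq// mulr_ge0.
exact: m1.
Qed.

Let stepE (F : R -> R) (n : nat) y : (0 < n)%N -> (forall y, 0 <= F y) -> F y < n%:R ->
  step F n y = (Num.truncn (n%:R * F y))%:R / n%:R.
Proof.
move=> n0 F0 Fn; have n0' : 0 < n%:R :> R by rewrite ltr0n.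
have kn : (Num.truncn (n%:R * F y) < n * n)%N.
  by rewrite truncn_lt_nat ?mulr_ge0// natrM ltr_pM2l.
rewrite /step (bigD1 (Ordinal kn))//= big1 ?addr0.
  by rewrite indicE mem_set// mulr1.
move=> k /eqP kk; rewrite indicE memNset ?mulr0//= => e.
by apply: kk; apply: val_inj.
Qed.

Let step_bound (F : R -> R) (n : nat) y : (0 < n)%N -> (forall y, 0 <= F y) ->
  0 <= step F n y /\ step F n y <= F y.
Proof.
move=> n0 F0; have n0' : 0 < n%:R :> R by rewrite ltr0n.
split; first by apply: sumr_ge0 => k _; rewrite mulr_ge0 ?divr_ge0// indicE.
have [Fn|nF] := ltP (F y) n%:R.
  have := truncn_le (n%:R * F y); rewrite mulr_ge0// => h.
  by rewrite stepE// ler_pdivrMr// (mulrC (F y)).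
rewrite /step big1// => k _; rewrite indicE memNset ?mulr0//= => e.
have := ltn_ord k; rewrite -e truncn_lt_nat ?mulr_ge0// natrM ltr_pM2l//.
by rewrite ltNge nF.
Qed.

Let transfer_ge0 (F : R -> R) (M : R) : measurable_fun setT F -> (forall y, 0 <= F y) ->
  (forall y, F y <= M) -> \int[m]_w (Z w * F (Y w)) = c * \int[Q]_y F y.
Proof.
move=> mF F0 FM.
have mst n : measurable_fun setT (step F n).
  apply: measurable_sum => k; apply: measM; first exact: measurable_cst.
  by apply: measurable_indic; exact: meas_level.
have stepm n : \int[m]_w (Z w * step F n (Y w)) = c * \int[Q]_y step F n y.
  have mi k : measurable_fun setT (\1_[set z | Num.truncn (n%:R * F z) = k :> nat] : R -> R).
    by apply: measurable_indic; exact: meas_level.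
  have bi (B : set R) y : `|\1_B y| <= 1 :> R.
    by rewrite indicE; case: (_ \in _); rewrite ?normr1 ?normr0.
  rewrite /step.
  under eq_Rintegral do rewrite mulr_sumr.
  rewrite Rintegral_sum//; last first.
    move=> k; apply: (integrable_mul_bounded (M := `|k%:R / n%:R|)).
      by apply: measM; [exact: measurable_cst|exact: measurableT_comp (mi k) mY].
    by move=> w; rewrite normrM ler_piMr.
  rewrite Rintegral_sum//; last first.
    move=> k; apply: (@bounded_integrable _ _ _ Q _ `|k%:R / n%:R|).
      by apply: measM; [exact: measurable_cst|exact: mi].
    by move=> w; rewrite normrM ler_piMr.
  rewrite mulr_sumr; apply: eq_bigr => k _.
  under eq_Rintegral do rewrite mulrCA.
  rewrite RintegralZl//; last first.
    apply: (integrable_mul_bounded (M := 1)); first exact: measurableT_comp (mi k) mY.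
    by move=> w; exact: bi.
  rewrite H; last exact: meas_level.
  rewrite RintegralZl//; last by apply: (@bounded_integrable _ _ _ Q _ 1); [exact: mi|move=> y; exact: bi].
  rewrite mulrCA; congr (_ * (_ * _)).
  by rewrite /Rintegral integral_indic ?setIT//; exact: meas_level.
have close n y : M < n.+1%:R -> `|step F n.+1 y - F y| <= n.+1%:R^-1.
  move=> Mn; rewrite stepE//; last exact: le_lt_trans (FM y) Mn.
  have n0 : 0 < n.+1%:R :> R by rewrite ltr0n.
  have := truncn_le (n.+1%:R * F y); rewrite mulr_ge0//.
  have := truncnS_gt (n.+1%:R * F y).
  move: (Num.truncn _) => k h1 h2.
  have -> : k%:R / n.+1%:R - F y = (k%:R - n.+1%:R * F y) / n.+1%:R.
    by rewrite mulrBl (mulrC _ (F y)) mulfK// gt_eqF.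
  rewrite normrM (gtr0_norm (x := n.+1%:R^-1)) ?invr_gt0// -[leRHS]mul1r ler_pM2r ?invr_gt0//.
  rewrite -natr1 in h1.
  by rewrite ler_norml; apply/andP; split; lra.
have cvg_step y : step F n.+1 y @[n --> \oo] --> F y.
  apply/cvgrPdist_le => e e0; near=> n.
  have Mn : M < n.+1%:R.
    apply: (@lt_le_trans _ _ (n%:R)); last by rewrite ler_nat.
    by near: n; exact: nbhs_infty_gtr.
  rewrite distrC (le_trans (close n y Mn))//.
  rewrite -[leRHS]invrK lef_pV2 ?posrE ?invr_gt0//.
  apply: (@le_trans _ _ (n%:R)); last by rewrite ler_nat.
  by near: n; exact: nbhs_infty_ger.
have sb n y : `|step F n.+1 y| <= M.
  by have [h1 h2] := step_bound y (ltn0Sn n) F0; rewrite ger0_norm// (le_trans h2).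
have c1 : \int[m]_w (Z w * step F n.+1 (Y w)) @[n --> \oo] --> \int[m]_w (Z w * F (Y w)).
  apply: (@Rintegral_dominated_cvg _ _ _ m setT _ _ (fun w => M * `|Z w|)) => //.
  - by move=> n; apply: measM => //; exact: measurableT_comp (mst _) mY.
  - by move=> w _; apply: cvgM; [exact: cvg_cst|exact: cvg_step].
  - by apply: RintegrableZ => //; exact: Rintegrable_norm.
  - by move=> n w _; rewrite normrM mulrC ler_wpM2r.
have c2 : c * \int[Q]_y step F n.+1 y @[n --> \oo] --> c * \int[Q]_y F y.
  apply: cvgM; first exact: cvg_cst.
  apply: (@Rintegral_dominated_cvg _ _ _ Q setT _ _ (fun=> M)) => //.
  - by move=> n; exact: mst.
  - exact: (finite_measure_integrable_cst Q M).
have e : (fun n => \int[m]_w (Z w * step F n.+1 (Y w))) = (fun n => c * \int[Q]_y step F n.+1 y).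
  by apply/funext => n; exact: stepm.
by rewrite e in c1; exact: cvg_unique c1 c2.
Unshelve. all: by end_near. Qed.

(** [F] is approximated by finitely many levels of mesh 1 / n. The factor [Z] is signed, and
    dominated convergence with M |Z| replaces positivity. With [Z] a density this gives integrals
    against a law with density; with [Z] a function of other variables it turns independence on sets
    into independence of expectations. *)
Lemma Rintegral_transfer (F : R -> R) (M : R) : measurable_fun setT F ->
  (forall y, `|F y| <= M) -> \int[m]_w (Z w * F (Y w)) = c * \int[Q]_y F y.
Proof.
move=> mF FM.
have mFM : measurable_fun setT (fun y => F y + M) by meas.
have M0 : 0 <= M := le_trans (normr_ge0 _) (FM 0).
have h y : 0 <= F y + M /\ F y + M <= 2 * M.
  by move: (FM y); rewrite ler_norml => /andP[? ?]; lra.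
have := transfer_ge0 mFM (fun y => (h y).1) (fun y => (h y).2).
have h1 := transfer_ge0 (measurable_cst M) (fun=> M0) (fun=> lexx M).
have jF : m.-integrable setT (EFin \o (fun w => Z w * F (Y w))).
  by apply: (integrable_mul_bounded (M := M)) => //; exact: measurableT_comp mF mY.
have jM : m.-integrable setT (EFin \o (fun w => Z w * M)).
  by apply: (integrable_mul_bounded (M := M)) => // w; rewrite ger0_norm.
under [X in X = _ -> _]eq_Rintegral do rewrite mulrDr.
rewrite (RintegralD measurableT jF jM) RintegralD//; last 2 first.
- exact: (@bounded_integrable _ _ _ Q _ M).
- by apply: (@bounded_integrable _ _ _ Q _ M) => // w; rewrite ger0_norm.
by rewrite mulrDr h1 => /addIr.
Qed.

End transfer.

Lemma cvg_monotone_Rintegral d (T : measurableType d) (R : realType) (m : {measure set T -> \bar R})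
  (g : nat -> T -> R) (G : T -> R) : (forall n, measurable_fun setT (g n)) ->
  (forall n x, 0 <= g n x) -> (forall x, {homo (fun n => g n x) : n m / (n <= m)%N >-> n <= m}) ->
  (forall x, g n x @[n --> \oo] --> G x) ->
  (\int[m]_x (g n x)%:E)%E @[n --> \oo] --> (\int[m]_x (G x)%:E)%E.
Proof.
move=> mg g0 ndg gG.
have -> : (\int[m]_x (G x)%:E = \int[m]_x limn (fun n => (g n x)%:E))%E.
  apply: eq_integral => x _; apply/esym/cvg_lim => //.
  by apply: cvg_EFin; [exact: nearW|exact: gG].
apply: (cvg_monotone_convergence measurableT (g' := fun n x => (g n x)%:E)).
- by move=> n; exact/measurable_EFinP.
- by move=> n x _; rewrite lee_fin.
- by move=> x _ n k nk; rewrite lee_fin ndg.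
Qed.

Section density.
Context (R : realType).
Notation mu := (@lebesgue_measure R).
Variables (f : R -> R) (Q : probability (measurableTypeR R) R).
Hypotheses (f0 : forall y, 0 <= f y) (mf : measurable_fun setT f)
  (Qf : forall A : set R, measurable A -> Q A = (\int[mu]_(y in A) (f y)%:E)%E).

Lemma integrable_density : mu.-integrable setT (EFin \o f).
Proof.
apply/integrableP; split; first exact/measurable_EFinP.
have -> : (\int[mu]_x `|(EFin \o f) x| = Q setT)%E.
  by rewrite Qf//; apply: eq_integral => y _ /=; rewrite ger0_norm.
by rewrite probability_setT ltry.
Qed.

Lemma Rintegral_density_bounded (F : R -> R) (M : R) : measurable_fun setT F ->
  (forall y, `|F y| <= M) -> \int[mu]_y (f y * F y) = \int[Q]_y F y.
Proof.
move=> mF FM.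
rewrite (@Rintegral_transfer _ _ _ mu f id Q 1 integrable_density _ _ F M)// ?mul1r//.
move=> B mB; rewrite mul1r (Qf mB) -/(Rintegral mu B f).
rewrite [RHS]Rintegral_mkcond; apply: eq_Rintegral => y _.
by rewrite patchE indicE; case: (y \in B); rewrite ?mulr1 ?mulr0.
Qed.

Let cut (F : R -> R) (n : nat) (y : R) : R := Num.min (F y) n%:R.

Lemma ge0_integral_density (F : R -> R) : measurable_fun setT F -> (forall y, 0 <= F y) ->
  (\int[Q]_y (F y)%:E = \int[mu]_y (f y * F y)%:E)%E.
Proof.
move=> mF F0.
have mc n : measurable_fun setT (cut F n) by apply: measurable_minr.
have c0 n y : 0 <= cut F n y by rewrite le_min F0/=.
have cn n y : `|cut F n y| <= n%:R by rewrite ger0_norm// ge_min lexx orbT.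
have cM y : {homo (fun n => cut F n y) : n m / (n <= m)%N >-> n <= m}.
  move=> n m nm; rewrite /cut le_min ge_min lexx/=.
  by rewrite ge_min ler_nat nm orbT.
have clim y : cut F n y @[n --> \oo] --> F y.
  apply: cvg_near_cst; near=> n; apply/min_idPl.
  by near: n; exact: nbhs_infty_ger.
have E n : (\int[Q]_y (cut F n y)%:E = \int[mu]_y (f y * cut F n y)%:E)%E.
  have := Rintegral_density_bounded (mc n) (cn n); rewrite /Rintegral => e.
  have i1 : Q.-integrable setT (EFin \o cut F n) by apply: (@bounded_integrable _ _ _ Q _ n%:R); [exact: mc|exact: cn].
  have i2 : mu.-integrable setT (EFin \o (fun y => f y * cut F n y)).
    exact: (integrable_mul_bounded integrable_density (mc n) (cn n)).
  rewrite -(fineK (integrable_fin_num _ i1))// -[RHS](fineK (integrable_fin_num _ i2))//.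
  by rewrite -e.
have l1 : (\int[Q]_y (cut F n y)%:E)%E @[n --> \oo] --> (\int[Q]_y (F y)%:E)%E.
  exact: (@cvg_monotone_Rintegral _ (measurableTypeR R) R Q (cut F) F mc c0 cM clim).
have l2 : (\int[mu]_y (f y * cut F n y)%:E)%E @[n --> \oo] --> (\int[mu]_y (f y * F y)%:E)%E.
  apply: (@cvg_monotone_Rintegral _ (measurableTypeR R) R mu (fun n y => f y * cut F n y)
    (fun y => f y * F y)).
  - by move=> n; have := measM mf (mc n).
  - by move=> n y; exact: mulr_ge0.
  - by move=> y n m nm; rewrite ler_wpM2l// cM.
  - by move=> y; apply: cvgM; [exact: cvg_cst|exact: clim].
have e : (fun n => (\int[Q]_y (cut F n y)%:E)%E) = (fun n => (\int[mu]_y (f y * cut F n y)%:E)%E).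
  by apply/funext.
by rewrite e in l1; exact: cvg_unique l1 l2.
Unshelve. all: by end_near. Qed.

Lemma integrable_density_iff (F : R -> R) : measurable_fun setT F ->
  mu.-integrable setT (EFin \o (fun y => f y * F y)) -> Q.-integrable setT (EFin \o F).
Proof.
move=> mF /integrableP[_ h]; apply/integrableP; split; first exact/measurable_EFinP.
have -> : (\int[Q]_y `|(EFin \o F) y| = \int[Q]_y (`|F y|)%:E)%E by [].
rewrite ge0_integral_density//; last exact: measurableT_comp.
move: h; congr (_ < _)%E; apply: eq_integral => y _ /=.
by rewrite normrM ger0_norm.
Qed.

Lemma Rintegral_density (F : R -> R) : measurable_fun setT F ->
  mu.-integrable setT (EFin \o (fun y => f y * F y)) -> \int[Q]_y F y = \int[mu]_y (f y * F y).
Proof.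
move=> mF jf; have jQ := integrable_density_iff mF jf.
have ge0 (G : R -> R) : measurable_fun setT G -> (forall y, 0 <= G y) ->
    \int[Q]_y G y = \int[mu]_y (f y * G y).
  by move=> mG G0; rewrite /Rintegral ge0_integral_density.
have mn : measurable_fun setT (fun y => `|F y|) by exact: measurableT_comp.
have jn := Rintegrable_norm measurableT jQ.
have jfn : mu.-integrable setT (EFin \o (fun y => f y * `|F y|)).
  have := Rintegrable_norm measurableT jf; apply: eq_integrable => // y _ /=.
  by rewrite normrM ger0_norm.
transitivity (\int[Q]_y (F y + `|F y|) - \int[Q]_y `|F y|); first by rewrite RintegralD// addrK.
rewrite ge0; last 2 first.
- exact: measD.
- by move=> y; have := ler_norm (- F y); rewrite normrN; lra.
rewrite (ge0 (fun y => `|F y|))//.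
under eq_Rintegral do rewrite mulrDr.
by rewrite RintegralD// addrK.
Qed.

End density.

Section stable_law.
Context (R : realType).
Notation mu := (@lebesgue_measure R).
Implicit Types b : R.

Definition has_density (Q : probability (measurableTypeR R) R) (f : R -> R) : Prop :=
  forall A : set R, measurable A -> Q A = (\int[mu]_(y in A) (f y)%:E)%E.

Lemma charfunE d (T : measurableType d) (P : probability T R) (Y : T -> R) (u a b : R) :
  charfun P Y u = expc a b ->
  \int[P]_w cos (u * Y w) = expR a * cos b /\ \int[P]_w sin (u * Y w) = expR a * sin b.
Proof. by rewrite /charfun /expc => -[-> ->]. Qed.

Lemma stable_densityP b (f : R -> R) : 0 < b -> b < 2 -> stable_density b f ->
  f = stab b /\ exists2 Q : probability (measurableTypeR R) R, has_density Q f &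
    forall u, \int[Q]_y cos (u * y) = sym b u /\ \int[Q]_y sin (u * y) = 0.
Proof.
move=> b0 b2 [cf f0 [Q [Qf Qc]]].
have QE u : \int[Q]_y cos (u * y) = sym b u /\ \int[Q]_y sin (u * y) = 0.
  by have [-> ->] := charfunE (Qc u); rewrite cos0 sin0 mulr0 mulr1.
split; last by exists Q.
have mf : measurable_fun setT f by exact: continuous_measurable_fun.
have jf := integrable_density f0 mf Qf.
have C u : \int[mu]_y (cos (u * y) * f y) = sym b u.
  rewrite -(QE u).1 -(Rintegral_density_bounded f0 mf Qf (F := fun y => cos (u * y)) (M := 1)).
  - by apply: eq_Rintegral => y _; rewrite mulrC.
  - by meas.
  - by move=> y; exact: norm_cos_le1.
have S u : \int[mu]_y (sin (u * y) * f y) = 0.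
  rewrite -(QE u).2 -(Rintegral_density_bounded f0 mf Qf (F := fun y => sin (u * y)) (M := 1)).
  - by apply: eq_Rintegral => y _; rewrite mulrC.
  - by meas.
  - by move=> y; exact: norm_sin_le1.
apply/funext => x; rewrite stab_sym// (cos_inversion cf jf S).
  by congr (_ * _); apply: eq_Rintegral => u _; rewrite C.
by have := integrable_sym b0 b2; apply: eq_integrable => // u _; rewrite /= C.
Qed.

Lemma law_of_charfun d (T : measurableType d) (P : probability T R) (Y : T -> R)
    (Q : probability (measurableTypeR R) R) :
  measurable_fun setT Y ->
  (forall u, \int[P]_w cos (u * Y w) = \int[Q]_y cos (u * y)) ->
  (forall u, \int[P]_w sin (u * Y w) = \int[Q]_y sin (u * y)) ->
  forall B : set R, measurable B -> P (Y @^-1` B) = Q B.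
Proof.
move=> mY Ec Es B mB.
pose Y' : T -> measurableTypeR R := Y.
have mY' : measurable_fun setT Y' by [].
pose X : {mfun T >-> measurableTypeR R} := mfun_Sub (mem_set mY').
pose D : probability (measurableTypeR R) R := distribution P X.
have DE (F : measurableTypeR R -> R) : measurable_fun setT F -> (forall y, `|F y| <= 1) ->
    \int[D]_y F y = \int[P]_w F (Y w).
  move=> mF F1; rewrite /Rintegral integral_distribution//.
    exact/measurable_EFinP.
  apply: (@bounded_integrable _ _ _ P _ 1) => [|w]; last exact: F1.
  exact: measurableT_comp mF mY'.
apply: (@law_unique R D Q _ _ B mB) => u.
  by rewrite DE ?Ec// => [|y]; [meas|exact: norm_cos_le1].
by rewrite DE ?Es// => [|y]; [meas|exact: norm_sin_le1].
Qed.

End stable_law.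

(** * Independent identically distributed variables *)

(** Independence and common law are stated together on rectangles in the first [n] variables, which
    is the form that independent increments provide. *)
Definition iid d (T : measurableType d) (R : realType) (P : probability T R)
    (Q : probability (measurableTypeR R) R) (n : nat) (xi : nat -> T -> R) : Prop :=
  (forall i, measurable_fun setT (xi i)) /\
  forall B : nat -> set R, (forall i, measurable (B i)) ->
    P [set w | forall i, (i < n)%N -> B i (xi i w)] = (\prod_(0 <= i < n) fine (Q (B i)))%:E.

Section iid_theory.
Context d (T : measurableType d) (R : realType) (P : probability T R).
Variables (Q : probability (measurableTypeR R) R) (n : nat) (xi : nat -> T -> R).
Hypothesis H : iid P Q n xi.

Let mxi i : measurable_fun setT (xi i). Proof. exact: H.1. Qed.

Let meas_prod_indic (a b : nat) (B : nat -> set R) : (forall i, measurable (B i)) ->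
  measurable_fun setT (fun w => \prod_(a <= i < b) \1_(B i) (xi i w) : R).
Proof.
move=> mB; apply: measurable_prod => i _.
by apply: measurableT_comp (mxi i); apply: measurable_indic.
Qed.

Let prod_indic_bound (a b : nat) (B : nat -> set R) w :
  0 <= (\prod_(a <= i < b) \1_(B i) (xi i w) : R) <= 1.
Proof.
apply: (@big_ind _ (fun x : R => 0 <= x <= 1)) => [|x y|i _].
- by rewrite ler01 lexx.
- by move=> /andP[x0 x1] /andP[y0 y1]; rewrite mulr_ge0// mulr_ile1.
- by rewrite indicE; case: (_ \in _); rewrite ?lexx ?ler01.
Qed.

Lemma iid_prod_indic (B : nat -> set R) : (forall i, measurable (B i)) ->
  \int[P]_w (\prod_(0 <= i < n) \1_(B i) (xi i w)) = \prod_(0 <= i < n) fine (Q (B i)).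
Proof.
move=> mB; have := H.2 B mB => PE.
set S := [set w | _] in PE.
have SE w : \prod_(0 <= i < n) \1_(B i) (xi i w) = \1_S w :> R.
  rewrite indicE; case: (boolP (w \in S)) => [|wS].
    rewrite inE => wS; apply: big1_seq => i /=; rewrite mem_index_iota => /andP[_ ilt].
    by rewrite indicE mem_set//; exact: wS.
  move: wS; rewrite notin_setE => /existsNP[i] /not_implyP[ilt nB].
  rewrite (big_rem i) ?mem_index_iota//= indicE memNset// mul0r//.
have mS : measurable S.
  have -> : S = \bigcap_(i in [set i | (i < n)%N]) (xi i @^-1` B i).
    by apply/seteqP; split => w /= h i; exact: h.
  apply: bigcap_measurableType => i _.
  by rewrite -[X in measurable X]setTI; exact: mxi.
under eq_Rintegral do rewrite SE.
rewrite /Rintegral integral_indic// setIT.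
exact: (congr1 fine PE).
Qed.

Variable g : R -> R.
Hypothesis mg : measurable_fun setT g.
Let al := \int[Q]_y cos (g y).
Let be := \int[Q]_y sin (g y).

(* The real and imaginary parts of [(al + i be)^k]. *)
Fixpoint cspow (al be : R) (k : nat) : R * R :=
  if k is k'.+1 then let: (a, b) := cspow al be k' in (a * al - b * be, a * be + b * al)
  else (1, 0).

Let S k w : R := \sum_(0 <= i < k) g (xi i w).

Let mS k : measurable_fun setT (S k).
Proof. by apply: measurable_sum => i; exact: measurableT_comp mg (mxi i). Qed.

(** The induction moves one variable at a time from the indicators into the cosine. Arbitrary sets
    for the remaining variables are kept, so that the induction hypothesis is exactly the premise of
    [Rintegral_transfer]. The phase [x] lets the sine be treated as a cosine shifted by pi / 2. *)
Lemma iid_cos_aux (k : nat) : (k <= n)%N -> forall (x : R) (B : nat -> set R),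
  (forall i, measurable (B i)) ->
  \int[P]_w (cos (x + S k w) * \prod_(k <= i < n) \1_(B i) (xi i w)) =
  (cos x * (cspow al be k).1 - sin x * (cspow al be k).2) * \prod_(k <= i < n) fine (Q (B i)).
Proof.
elim: k => [|k IH] kn x B mB.
  rewrite /= mulr1 mulr0 subr0 -iid_prod_indic//.
  rewrite -RintegralZl//.
    apply: eq_Rintegral => w _; have -> : S 0 w = 0 by rewrite /S big_geq.
    by rewrite addr0.
  apply: (@bounded_integrable _ _ _ P _ 1); first exact: meas_prod_indic.
  by move=> w; have /andP[h1 h2] := prod_indic_bound 0 n B w; rewrite ger0_norm.
pose Z x w := cos (x + S k w) * \prod_(k.+1 <= i < n) \1_(B i) (xi i w).
have mZ x' : measurable_fun setT (Z x').
  apply: measM; last exact: meas_prod_indic.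
  by have m := mS k; meas.
have Z1 x' w : `|Z x' w| <= 1.
  have /andP[h1 h2] := prod_indic_bound k.+1 n B w.
  by rewrite normrM mulr_ile1// ?norm_cos_le1// ger0_norm.
have iZ x' : P.-integrable setT (EFin \o Z x') := bounded_integrable P (mZ x') (Z1 x').
pose c x' := (cos x' * (cspow al be k).1 - sin x' * (cspow al be k).2) *
  \prod_(k.+1 <= i < n) fine (Q (B i)).
have HZ x' (C : set R) : measurable C ->
    \int[P]_w (Z x' w * \1_C (xi k w)) = c x' * fine (Q C).
  move=> mC; pose B' i := if i == k then C else B i.
  have mB' i : measurable (B' i) by rewrite /B'; case: ifP.
  have := IH (ltnW kn) x' B' mB'; rewrite big_ltn// {2}/B' eqxx.
  have -> : \prod_(k.+1 <= i < n) fine (Q (B' i)) = \prod_(k.+1 <= i < n) fine (Q (B i)).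
    by apply: eq_big_nat => i /andP[ki _]; rewrite /B' gtn_eqF.
  rewrite mulrCA mulrC => <-; apply: eq_Rintegral => w _.
  rewrite big_ltn// {1}/B' eqxx /Z mulrAC -mulrA; congr (_ * (_ * _)).
  by apply: eq_big_nat => i /andP[ki _]; rewrite /B' gtn_eqF.
have tr x' (F : R -> R) : measurable_fun setT F -> (forall y, `|F y| <= 1) ->
    \int[P]_w (Z x' w * F (xi k w)) = c x' * \int[Q]_y F y.
  by move=> mF F1; exact: (Rintegral_transfer (iZ x') (mxi k) (HZ x') mF F1).
have mc : measurable_fun setT (fun y => cos (g y)) by meas.
have ms : measurable_fun setT (fun y => sin (g y)) by meas.
have E w : cos (x + S k.+1 w) * \prod_(k.+1 <= i < n) \1_(B i) (xi i w) =
    Z x w * cos (g (xi k w)) - Z (x - pi / 2) w * sin (g (xi k w)).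
  have SE : S k.+1 w = S k w + g (xi k w) by rewrite /S big_nat_recr.
  have xE : x - pi / 2 + S k w = (x + S k w) - pi / 2 by ring.
  rewrite /Z SE addrA xE; move: (x + S k w) => z.
  by rewrite (cosD z (g _)) (cosB z) cos_pihalf sin_pihalf; ring.
under eq_Rintegral do rewrite E.
rewrite RintegralB//; last 2 first.
- apply: (@integrable_mul_bounded _ _ _ _ _ (iZ x) _ 1); last by move=> w; exact: norm_cos_le1.
  exact: measurableT_comp mc (mxi k).
- apply: (@integrable_mul_bounded _ _ _ _ _ (iZ _) _ 1); last by move=> w; exact: norm_sin_le1.
  exact: measurableT_comp ms (mxi k).
rewrite (tr x (fun y => cos (g y)))//; last by move=> y; exact: norm_cos_le1.
rewrite (tr _ (fun y => sin (g y)))//; last by move=> y; exact: norm_sin_le1.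
rewrite -/al -/be /c cosB sinB cos_pihalf sin_pihalf /=.
case: (cspow al be k) => a b /=; ring.
Qed.

Lemma iid_cos (k : nat) (x : R) : (k <= n)%N ->
  \int[P]_w cos (x + \sum_(0 <= i < k) g (xi i w)) =
  cos x * (cspow al be k).1 - sin x * (cspow al be k).2.
Proof.
move=> kn; have := iid_cos_aux kn x (B := fun=> setT) (fun=> measurableT).
have -> : \prod_(k <= i < n) fine (Q setT) = 1 :> R.
  by apply: big1 => i _; rewrite probability_setT.
rewrite mulr1 => <-; apply: eq_Rintegral => w _.
have -> : \prod_(k <= i < n) \1_[set: R] (xi i w) = 1 :> R.
  by apply: big1 => i _; rewrite indicT.
by rewrite mulr1.
Qed.

(** By [iid_cos] at the phases 0 and pi / 2, both components are, up to sign, expectations of a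
    cosine. *)
Lemma cspow_le1 (k : nat) : (k <= n)%N ->
  `|(cspow al be k).1| <= 1 /\ `|(cspow al be k).2| <= 1.
Proof.
move=> kn; have h x : `|cos x * (cspow al be k).1 - sin x * (cspow al be k).2| <= 1.
  rewrite -iid_cos//; apply: norm_Rintegral_le => [|w]; last exact: norm_cos_le1.
  by have m := mS k; rewrite /S in m; meas.
split; first by have := h 0; rewrite cos0 sin0 mul1r mul0r subr0.
by have := h (pi / 2); rewrite cos_pihalf sin_pihalf mul0r mul1r sub0r normrN.
Qed.

(** A telescoping estimate for (al + i be)^k - w^k in real terms: each factor adds at most |al - w|
    + |be| to each of the two components. *)
Lemma cspow_dist (w : R) (k : nat) : 0 <= w -> w <= 1 -> (k <= n)%N ->
  `|(cspow al be k).1 - w ^+ k| + `|(cspow al be k).2| <= k%:R * (2 * (`|al - w| + `|be|)).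
Proof.
move=> w0 w1; elim: k => [|k IH] kn; first by rewrite /= expr0 subrr normr0 addr0 mul0r.
have [a1 b1] := cspow_le1 (ltnW kn).
have {IH} := IH (ltnW kn); rewrite /=; case: (cspow al be k) a1 b1 => a b /= a1 b1 IH.
have -> : a * al - b * be - w ^+ k.+1 = a * (al - w) + w * (a - w ^+ k) - b * be.
  by rewrite exprS; ring.
have -> : a * be + b * al = a * be + b * (al - w) + w * b by ring.
set e1 := al - w; set p := a - w ^+ k in IH *.
have n1 : `|a * e1 + w * p - b * be| <= `|e1| + w * `|p| + `|be|.
  rewrite (le_trans (ler_normB _ _))// lerD//; last by rewrite norm_trig_le.
  rewrite (le_trans (ler_normD _ _))// lerD//; first by rewrite norm_trig_le.
  by rewrite normrM (ger0_norm w0).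
have n2 : `|a * be + b * e1 + w * b| <= `|be| + `|e1| + w * `|b|.
  rewrite (le_trans (ler_normD _ _))// lerD//; last by rewrite normrM (ger0_norm w0).
  by rewrite (le_trans (ler_normD _ _))// lerD// norm_trig_le.
have n3 : w * (`|p| + `|b|) <= `|p| + `|b| by rewrite ler_piMl// addr_ge0.
rewrite -natr1 mulrDl mul1r; lra.
Qed.

End iid_theory.

Lemma cos_taylor (R : realType) (x : R) : `|cos x - (1 - x ^+ 2 / 2)| <= x ^+ 4 / 24.
Proof. by have := cos_le x; have := one_sub_cos_le x; rewrite ler_norml => ? ?; apply/andP; split; lra. Qed.

Lemma sin_taylor (R : realType) (x : R) : `|sin x - x| <= `|x| ^+ 3 / 6.
Proof.
wlog x0 : x / 0 <= x.
  move=> H; have [/H//|/ltW x0] := leP 0 x.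
  by have := H (- x); rewrite oppr_ge0 sinN normrN -opprD normrN => /(_ x0).
rewrite (ger0_norm x0); have := sin_le x0; have := sin_ge x0.
by rewrite ler_norml => ? ?; apply/andP; split; lra.
Qed.

Lemma expRN_taylor (R : realType) (x : R) : 0 <= x -> `|expR (- x) - (1 - x)| <= x ^+ 2.
Proof.
move=> x0; have h1 := expR_ge1Dx (- x).
have h2 : expR (- x) <= 1 - x + x ^+ 2.
  rewrite expRN -[leLHS]mul1r ler_pdivrMr ?expR_gt0//.
  have h3 := expR_ge1Dx x.
  apply: (@le_trans _ _ ((1 - x + x ^+ 2) * (1 + x))).
    have -> : (1 - x + x ^+ 2) * (1 + x) = 1 + x ^+ 3 by ring.
    by rewrite lerDl exprn_ge0.
  by rewrite ler_wpM2l//; have := sqr_ge0 (x - 1); have := sqr_ge0 x; rewrite !expr2; nra.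
by rewrite ler_norml; apply/andP; split; [have := sqr_ge0 x|]; lra.
Qed.

Lemma cvg_sqrtn_inv (R : realType) : (Num.sqrt n%:R)^-1 @[n --> \oo] --> (0 : R).
Proof.
apply/cvgrPdist_le => e e0; near=> n.
have n0 : 0 < n%:R :> R by rewrite ltr0n; near: n; exact: nbhs_infty_gt.
rewrite sub0r normrN ger0_norm ?invr_ge0 ?sqrtr_ge0//.
rewrite -[leRHS]invrK lef_pV2 ?posrE ?invr_gt0 ?sqrtr_gt0//.
have -> : e^-1 = Num.sqrt (e^-1 ^+ 2) by rewrite sqrtr_sqr ger0_norm// invr_ge0 ltW.
rewrite ler_sqrt//.
by near: n; exact: nbhs_infty_ger.
Unshelve. all: by end_near. Qed.

(** * Central limit theorem for bounded centred functions of independent variables *)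

Section clt.
Context d (T : measurableType d) (R : realType) (P : probability T R).
Variables (Q : probability (measurableTypeR R) R) (xi : nat -> nat -> T -> R).
Hypothesis H : forall n, iid P Q n (xi n).
Variables (g : R -> R) (M : R).
Hypotheses (mg : measurable_fun setT g) (gM : forall y, `|g y| <= M) (g0 : \int[Q]_y g y = 0).

Let M0 : 0 <= M := le_trans (normr_ge0 _) (gM 0).
Let v := \int[Q]_y (g y ^+ 2).

Let bint (F : R -> R) (K : R) : measurable_fun setT F -> (forall y, `|F y| <= K) ->
  Q.-integrable setT (EFin \o F).
Proof. by move=> mF FK; exact: (@bounded_integrable _ _ _ Q F K). Qed.

Let v0 : 0 <= v. Proof. by apply: Rintegral_ge0 => y _; exact: sqr_ge0. Qed.

Let char_one (n : nat) (r : R) : (0 < n)%N -> r = (Num.sqrt n%:R)^-1 ->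
  `|\int[Q]_y cos (g y * r) - expR (- (v / 2 * r ^+ 2))| <= (M ^+ 4 + v ^+ 2) * r ^+ 4 /\
  `|\int[Q]_y sin (g y * r)| <= M ^+ 3 * r ^+ 3.
Proof.
move=> n0 rE; have r0 : 0 <= r by rewrite rE invr_ge0 sqrtr_ge0.
have mcos : measurable_fun setT (fun y => cos (g y * r)) by meas.
have msin : measurable_fun setT (fun y => sin (g y * r)) by meas.
have mg2 : measurable_fun setT (fun y => g y ^+ 2) by meas.
have jg : Q.-integrable setT (EFin \o g) := bint mg gM.
have jg2 : Q.-integrable setT (EFin \o (fun y => g y ^+ 2)).
  apply: (bint (K := M ^+ 2)) => // y; rewrite normrX ler_pXn2r ?nnegrE//.
have jcos : Q.-integrable setT (EFin \o (fun y => cos (g y * r))).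
  by apply: (bint (K := 1)) => // y; exact: norm_cos_le1.
have jsin : Q.-integrable setT (EFin \o (fun y => sin (g y * r))).
  by apply: (bint (K := 1)) => // y; exact: norm_sin_le1.
have j1 : Q.-integrable setT (EFin \o (fun _ : R => 1 : R)).
  by apply: (bint (K := 1)) => // y; rewrite normr1.
have gr y : `|g y * r| <= M * r by rewrite normrM (ger0_norm r0) ler_wpM2r.
split.
  have E : \int[Q]_y cos (g y * r) - (1 - v / 2 * r ^+ 2) =
      \int[Q]_y (cos (g y * r) - (1 - (r ^+ 2 / 2) * g y ^+ 2)).
    have jz : Q.-integrable setT (EFin \o (fun y => r ^+ 2 / 2 * g y ^+ 2)) by exact: RintegrableZ.
    rewrite RintegralB//; last exact: (RintegrableB measurableT j1 jz).
    by rewrite RintegralB// RintegralZl// Rintegral_cst1 -/v; ring.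
  have h1 : `|\int[Q]_y cos (g y * r) - (1 - v / 2 * r ^+ 2)| <= (M * r) ^+ 4 / 24.
    rewrite E; apply: norm_Rintegral_le; first by meas.
    move=> y; have -> : r ^+ 2 / 2 * g y ^+ 2 = (g y * r) ^+ 2 / 2 by ring.
    rewrite (le_trans (cos_taylor _))// ler_pM2r//.
    have -> : (g y * r) ^+ 4 = `|g y * r| ^+ 4.
      by rewrite -normrX ger0_norm// (exprM _ 2 2) sqr_ge0.
    by rewrite ler_pXn2r// nnegrE mulr_ge0.
  have x0 : 0 <= v / 2 * r ^+ 2 by rewrite mulr_ge0 ?sqr_ge0// divr_ge0.
  have h2 := expRN_taylor x0.
  have h3 : 0 <= M ^+ 4 * r ^+ 4 by rewrite mulr_ge0// exprn_ge0.
  have h4 : 0 <= v ^+ 2 * r ^+ 4 by rewrite mulr_ge0// exprn_ge0.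
  rewrite [leRHS]mulrDl; move: h1 h2; rewrite exprMn (_ : (v / 2 * r ^+ 2) ^+ 2 = v ^+ 2 * r ^+ 4 / 4); last by field.
  move: (M ^+ 4 * r ^+ 4) (v ^+ 2 * r ^+ 4) h3 h4 => p q p0 q0.
  rewrite !ler_norml => /andP[? ?] /andP[? ?]; apply/andP; split; lra.
have -> : \int[Q]_y sin (g y * r) = \int[Q]_y (sin (g y * r) - r * g y).
  by rewrite RintegralB// ?RintegralZl// ?g0 ?mulr0 ?subr0//; exact: RintegrableZ.
apply: (@le_trans _ _ ((M * r) ^+ 3 / 6)); last first.
  rewrite exprMn ler_piMr ?mulr_ge0 ?exprn_ge0// invf_le1//; lra.
apply: norm_Rintegral_le; first by meas.
move=> y; rewrite (mulrC r) (le_trans (sin_taylor _))// ler_pM2r//.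
by rewrite ler_pXn2r// nnegrE mulr_ge0.
Qed.

(** One factor differs from the Gaussian one by O(n^-2) in its real part and O(n^(-3/2)) in its
    imaginary part, the latter because [g] is centred. By [cspow_dist] the n-th powers differ by at
    most O(n^(-1/2)). *)
Lemma clt_cos (x : R) :
  \int[P]_w cos (x + \sum_(0 <= i < n) (g (xi n i w) * (Num.sqrt n%:R)^-1)) @[n --> \oo] -->
  cos x * expR (- (v / 2)).
Proof.
set L := cos x * _.
apply/subr_cvg0.
pose C := 2 * (M ^+ 4 + v ^+ 2 + M ^+ 3).
apply: (cvg0_le (g := fun n => C * (Num.sqrt n%:R)^-1)); last first.
  by rewrite -(mulr0 C); apply: cvgM; [exact: cvg_cst|exact: cvg_sqrtn_inv].
near=> n; have n0 : (0 < n)%N by near: n; exact: nbhs_infty_gt.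
set r := (Num.sqrt n%:R)^-1.
have nr : n%:R * r ^+ 2 = 1 by rewrite exprVn sqr_sqrtr ?divff// gt_eqF// ltr0n.
have r0 : 0 <= r by rewrite invr_ge0 sqrtr_ge0.
have r1 : r <= 1.
  by rewrite invf_le1 ?sqrtr_gt0 ?ltr0n// -[leLHS]sqrtr1 ler_sqrt ?ler1n ?ltr0n.
have [h1 h2] := char_one n0 erefl; rewrite -/r in h1 h2.
have mgr : measurable_fun setT (fun y => g y * r) by meas.
have := iid_cos (H n) mgr x (leqnn n); rewrite /= => ->.
set al := \int[Q]_y cos _ in h1 *; set be := \int[Q]_y sin _ in h2 *.
have w0 : 0 <= expR (- (v / 2 * r ^+ 2)) := expR_ge0 _.
have w1 : expR (- (v / 2 * r ^+ 2)) <= 1.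
  by rewrite expR_le1 oppr_le0 mulr_ge0 ?sqr_ge0// divr_ge0.
have := cspow_dist (H n) mgr w0 w1 (leqnn n); rewrite -/al -/be.
have -> : expR (- (v / 2 * r ^+ 2)) ^+ n = expR (- (v / 2)).
  by rewrite -expRM_natl; congr expR; rewrite mulrN mulrCA nr mulr1.
case: (cspow al be n) => a b /= hd.
have hC : n%:R * (2 * (`|al - expR (- (v / 2 * r ^+ 2))| + `|be|)) <= C * r.
  apply: (@le_trans _ _ (n%:R * (2 * ((M ^+ 4 + v ^+ 2) * r ^+ 4 + M ^+ 3 * r ^+ 3)))).
    by rewrite ler_wpM2l// ler_wpM2l// lerD.
  have -> : n%:R * (2 * ((M ^+ 4 + v ^+ 2) * r ^+ 4 + M ^+ 3 * r ^+ 3)) =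
      (n%:R * r ^+ 2) * (2 * ((M ^+ 4 + v ^+ 2) * r + M ^+ 3) * r) by ring.
  rewrite nr mul1r ler_wpM2r// ler_wpM2l// lerD2r ler_piMr// addr_ge0 ?exprn_ge0//.
apply: le_trans hC; apply: le_trans hd.
have -> : cos x * a - sin x * b - L = cos x * (a - expR (- (v / 2))) - sin x * b.
  by rewrite /L; ring.
rewrite (le_trans (ler_normB _ _))// lerD// norm_trig_le ?norm_cos_le1//.
exact: norm_sin_le1.
Unshelve. all: by end_near. Qed.

End clt.

Section law.
Context d (T : measurableType d) (R : realType) (P : probability T R).
Variables (Q : probability (measurableTypeR R) R).

Lemma Rintegral_law (Y : T -> R) (F : R -> R) : measurable_fun setT Y ->
  (forall B : set R, measurable B -> P (Y @^-1` B) = Q B) -> measurable_fun setT F ->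
  Q.-integrable setT (EFin \o F) ->
  P.-integrable setT (EFin \o (fun w => F (Y w))) /\ \int[P]_w F (Y w) = \int[Q]_y F y.
Proof.
move=> mY law mF jF.
pose Y' : T -> measurableTypeR R := Y.
have mY' : measurable_fun setT Y' by [].
pose X : {mfun T >-> measurableTypeR R} := mfun_Sub (mem_set mY').
pose D : probability (measurableTypeR R) R := distribution P X.
have ge0 (G : measurableTypeR R -> \bar R) : measurable_fun setT G -> (forall y, 0 <= G y)%E ->
    (\int[Q]_y G y = \int[P]_w G (Y w))%E.
  move=> mG G0; transitivity (\int[D]_y G y)%E.
    by apply: eq_measure_integral => B mB _; first [exact: law|exact/esym/law].
  by rewrite /D/= /distribution ge0_integral_pushforward.
have mF' : measurable_fun [set: measurableTypeR R] (EFin \o F) by exact/measurable_EFinP.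
have jP : P.-integrable setT (EFin \o (fun w => F (Y w))).
  apply/integrableP; split; first by apply/measurable_EFinP; exact: measurableT_comp mF mY.
  have /integrableP[_ fin] := jF; move: fin; rewrite (ge0 (fun y => `|(EFin \o F) y|%E))//.
  exact: measurableT_comp mF'.
split => //; rewrite /Rintegral; congr fine.
rewrite [LHS]integralE [RHS]integralE.
rewrite (ge0 ((EFin \o F)^\+)%E)//; last exact: measurable_funepos.
rewrite (ge0 ((EFin \o F)^\-)%E)//; last exact: measurable_funeneg.
by congr (_ - _)%E; apply: eq_integral => x _; rewrite ?funeposE ?funenegE.
Qed.

Lemma markov_abs (Z : T -> R) (e : R) : measurable_fun setT Z -> 0 < e ->
  P.-integrable setT (EFin \o Z) ->
  (P [set w | e < `|Z w|]%R <= (e^-1 * \int[P]_w `|Z w|)%:E)%E.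
Proof.
move=> mZ e0 jZ; set A := [set w | _].
have mn : measurable_fun setT (fun w => `|Z w|) by exact: measurableT_comp.
have mA : measurable A.
  rewrite (_ : A = (fun w => `|Z w|) @^-1` `]e, +oo[%classic); last first.
    by apply/seteqP; split => w; rewrite /A /= in_itv/= andbT.
  by rewrite -[X in measurable X]setTI; exact: mn.
have jn := Rintegrable_norm measurableT jZ.
rewrite -(fineK (fin_num_measure P _ mA)) lee_fin mulrC ler_pdivlMr//.
have -> : fine (P A) = \int[P]_w \1_A w by rewrite /Rintegral integral_indic// setIT.
have jA : P.-integrable setT (EFin \o (\1_A : T -> R)).
  apply: (@bounded_integrable _ _ _ P _ 1); first exact: measurable_indic.
  by move=> w; rewrite indicE; case: (_ \in _); rewrite ?normr1 ?normr0.
rewrite mulrC -RintegralZl//; apply: le_Rintegral => //; first exact: RintegrableZ.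
move=> w _; rewrite indicE; case: (boolP (w \in A)) => [|_]; last by rewrite mulr0.
by rewrite inE /A/= mulr1 => /ltW.
Qed.

End law.

(** * Convergence in probability to zero *)

Section op1.
Context d (T : measurableType d) (R : realType) (P : probability T R).
Implicit Types (Z : nat -> T -> R).

Lemma meas_gt (Z : T -> R) (e : R) : measurable_fun setT Z -> measurable [set w | e < `|Z w|].
Proof.
move=> mZ; have mn : measurable_fun setT (fun w => `|Z w|) by exact: measurableT_comp.
rewrite (_ : [set w | _] = (fun w => `|Z w|) @^-1` `]e, +oo[%classic); last first.
  by apply/seteqP; split => w; rewrite /= in_itv/= andbT.
by rewrite -[X in measurable X]setTI; exact: mn.
Qed.

Lemma op1_squeeze Z : (\forall n \near \oo, measurable_fun setT (Z n)) ->
  (forall e : R, 0 < e -> forall d : R, 0 < d -> \forall n \near \oo,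
    (P [set w | e < `|Z n w|]%R <= d%:E)%E) -> little_op1 P Z.
Proof.
move=> mZ h; split=> // e e0.
apply/fine_cvgP; split.
  by near=> n; rewrite fin_num_measure//; apply: meas_gt; near: n.
apply/cvgrPdist_le => k k0; near=> n.
have mn : measurable_fun setT (Z n) by near: n.
rewrite sub0r normrN ger0_norm ?fine_ge0//.
rewrite -lee_fin fineK ?fin_num_measure//; last exact: meas_gt.
by near: n; exact: h.
Unshelve. all: by end_near. Qed.

Lemma op1_le Z (e k : R) : little_op1 P Z -> 0 < e -> 0 < k ->
  \forall n \near \oo, (P [set w | e < `|Z n w|]%R <= k%:E)%E.
Proof.
move=> [mZ h] e0 k0; have /fine_cvgP[fin] := h e e0.
move/cvgrPdist_le => /(_ k k0) h1; near=> n.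
have mn : measurable_fun setT (Z n) by near: n.
rewrite -(fineK (fin_num_measure P _ (meas_gt e mn))) lee_fin.
have : `|0 - fine (P [set w | e < `|Z n w|])| <= k by near: n.
by rewrite sub0r normrN; apply: le_trans; exact: ler_norm.
Unshelve. all: by end_near. Qed.

Lemma op1D Z Z' : little_op1 P Z -> little_op1 P Z' -> little_op1 P (fun n w => Z n w + Z' n w).
Proof.
move=> oZ oZ'; apply: op1_squeeze => [|e e0 k k0].
  by near=> n; apply: measD; near: n; [exact: oZ.1|exact: oZ'.1].
have e2 : 0 < e / 2 by lra.
have k2 : 0 < k / 2 by lra.
have h1 := op1_le oZ e2 k2; have h2 := op1_le oZ' e2 k2.
have m1 := oZ.1; have m2 := oZ'.1; near=> n.
have m1n : measurable_fun setT (Z n) by near: n.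
have m2n : measurable_fun setT (Z' n) by near: n.
have sub : [set w | e < `|Z n w + Z' n w|] `<=` [set w | e / 2 < `|Z n w|] `|` [set w | e / 2 < `|Z' n w|].
  move=> w /= h; have [h3|h3] := ltP (e / 2) `|Z n w|; [by left|right].
  by have := ler_normD (Z n w) (Z' n w); lra.
have mU : measurable ([set w | e / 2 < `|Z n w|] `|` [set w | e / 2 < `|Z' n w|]).
  by apply: measurableU; exact: meas_gt.
apply: (le_trans (le_measure P _ _ sub)); rewrite ?inE//; first by apply: meas_gt; exact: measD.
have u2 := measureU2 P (meas_gt (e / 2) m1n) (meas_gt (e / 2) m2n).
apply: (le_trans u2).
have -> : k%:E = ((k / 2)%:E + (k / 2)%:E)%E by rewrite -EFinD; congr EFin; lra.
by apply: leeD; near: n.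
Unshelve. all: by end_near. Qed.

Lemma op1_near Z Z' : (\forall n \near \oo, Z n = Z' n) -> little_op1 P Z -> little_op1 P Z'.
Proof.
move=> h oZ; have m := oZ.1; apply: op1_squeeze => [|e e0 k k0].
  by near=> n; have <- : Z n = Z' n by [near: n]; near: n.
have h1 := op1_le oZ e0 k0; near=> n.
by have <- : Z n = Z' n by [near: n]; near: n.
Unshelve. all: by end_near. Qed.

Lemma op1_L1 Z : (forall n, measurable_fun setT (Z n)) ->
  (\forall n \near \oo, P.-integrable setT (EFin \o Z n)) ->
  (\int[P]_w `|Z n w| @[n --> \oo] --> 0) -> little_op1 P Z.
Proof.
move=> mZ jZ h; apply: op1_squeeze => [|e e0 k k0]; first exact: nearW.
have ke : 0 < e * k by rewrite mulr_gt0.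
move/cvgrPdist_le : h => /(_ _ ke) h; near=> n.
have jn : P.-integrable setT (EFin \o Z n) by near: n.
apply: (le_trans (markov_abs (mZ n) e0 jn)); rewrite lee_fin mulrC ler_pdivrMr// mulrC.
have : `|0 - \int[P]_w `|Z n w| | <= e * k by near: n.
by rewrite sub0r normrN; apply: le_trans; exact: ler_norm.
Unshelve. all: by end_near. Qed.

Lemma op1_L2 Z : (forall n, measurable_fun setT (Z n)) ->
  (\forall n \near \oo, P.-integrable setT (EFin \o (fun w => Z n w ^+ 2))) ->
  (\int[P]_w (Z n w ^+ 2) @[n --> \oo] --> 0) -> little_op1 P Z.
Proof.
move=> mZ jZ h.
have o2 : little_op1 P (fun n w => Z n w ^+ 2).
  apply: op1_L1 => //; first by move=> n; have m := mZ n; meas.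
  apply: cvg_trans h; apply: near_eq_cvg; apply: nearW => n.
  by apply: eq_Rintegral => w _; rewrite ger0_norm// sqr_ge0.
apply: op1_squeeze => [|e e0 k k0]; first exact: nearW.
have e2 : 0 < e ^+ 2 by rewrite exprn_gt0.
apply: filterS (op1_le o2 e2 k0) => n; congr (P _ <= _)%E.
apply/seteqP; split => w /=; rewrite normrX ltr_pXn2r ?nnegrE ?(ltW e0)//.
Qed.

Lemma op1_cst (c : nat -> R) : c n @[n --> \oo] --> 0 -> little_op1 P (fun n _ => c n).
Proof.
move=> c0; apply: op1_squeeze => [|e e0 k k0]; first exact: nearW.
move/cvgrPdist_lt : c0 => /(_ _ e0) h; near=> n.
rewrite (_ : [set w | _] = set0) ?measure0 ?lee_fin ?ltW//.
apply/seteqP; split => w //=.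
have : `|0 - c n| < e by near: n.
by rewrite sub0r normrN => /lt_trans h' /h'; rewrite ltxx.
Unshelve. all: by end_near. Qed.

End op1.

(** * Second moments of sums of independent variables *)

Section iid_pairs.
Context d (T : measurableType d) (R : realType) (P : probability T R).
Variables (Q : probability (measurableTypeR R) R) (n : nat) (xi : nat -> T -> R).
Hypothesis H : iid P Q n xi.

Let mxi i : measurable_fun setT (xi i). Proof. exact: H.1. Qed.

Let big_one (f : nat -> R) i : (i < n)%N -> (forall k, k != i -> f k = 1) ->
  \prod_(0 <= k < n) f k = f i.
Proof.
move=> ilt f1; rewrite (bigD1_seq i) ?mem_index_iota ?iota_uniq//=.
by rewrite big1 ?mulr1// => k /f1.
Qed.

Let big_two (f : nat -> R) i j : (i < n)%N -> (j < n)%N -> i != j ->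
  (forall k, k != i -> k != j -> f k = 1) -> \prod_(0 <= k < n) f k = f i * f j.
Proof.
move=> ilt jlt ij f1; rewrite (bigD1_seq i) ?mem_index_iota ?iota_uniq//=.
congr (_ * _); rewrite -big_filter (bigD1_seq j) ?filter_uniq ?iota_uniq//=; last first.
  by rewrite mem_filter eq_sym ij mem_index_iota.
rewrite big_filter_cond big1 ?mulr1// => k /andP[ki kj]; exact: f1.
Qed.

Lemma iid_law i : (i < n)%N -> forall B : set R, measurable B -> P (xi i @^-1` B) = Q B.
Proof.
move=> ilt B mB; pose B' k : set R := if k == i then B else setT.
have mB' k : measurable (B' k) by rewrite /B'; case: ifP.
have := H.2 B' mB'; rewrite (big_one ilt); last first.
  by move=> k ki; rewrite /B' (negbTE ki) probability_setT.
rewrite /B' eqxx fineK ?fin_num_measure// => <-; congr (P _).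
apply/seteqP; split => w /= h; last by have := h i ilt; rewrite eqxx.
by move=> k _; case: eqP => // ->.
Qed.

Lemma iid_pair_indic i j (A B : set R) : (i < n)%N -> (j < n)%N -> i != j ->
  measurable A -> measurable B ->
  \int[P]_w (\1_A (xi i w) * \1_B (xi j w)) = fine (Q A) * fine (Q B).
Proof.
move=> ilt jlt ij mA mB.
pose B' k : set R := if k == i then A else if k == j then B else setT.
have mB' k : measurable (B' k) by rewrite /B'; do 2 case: ifP => //.
have := iid_prod_indic H mB'; rewrite (big_two ilt jlt ij); last first.
  by move=> k ki kj; rewrite /B' (negbTE ki) (negbTE kj) probability_setT.
rewrite /B' eqxx eq_sym (negbTE ij) eqxx => <-; apply: eq_Rintegral => w _.
rewrite (big_two ilt jlt ij); last by move=> k ki kj; rewrite (negbTE ki) (negbTE kj) indicT.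
by rewrite eqxx eq_sym (negbTE ij) eqxx.
Qed.

Lemma iid_pair_bounded i j (F G : R -> R) (M N : R) : (i < n)%N -> (j < n)%N -> i != j ->
  measurable_fun setT F -> (forall y, `|F y| <= M) ->
  measurable_fun setT G -> (forall y, `|G y| <= N) ->
  \int[P]_w (F (xi i w) * G (xi j w)) = \int[Q]_y F y * \int[Q]_y G y.
Proof.
move=> ilt jlt ij mF FM mG GN.
have bi (C : set R) y : `|\1_C y| <= 1 :> R.
  by rewrite indicE; case: (_ \in _); rewrite ?normr1 ?normr0.
have iA (C : set R) k : measurable C -> P.-integrable setT (EFin \o (fun w => \1_C (xi k w) : R)).
  move=> mC; apply: (@bounded_integrable _ _ _ P _ 1) => [|w]; last exact: bi.
  by apply: measurableT_comp (mxi k); apply: measurable_indic.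
have step (A : set R) : measurable A ->
    \int[P]_w (\1_A (xi i w) * G (xi j w)) = fine (Q A) * \int[Q]_y G y.
  move=> mA; apply: (Rintegral_transfer (iA A i mA) (mxi j) _ mG GN) => B mB.
  exact: iid_pair_indic.
have iG : P.-integrable setT (EFin \o (fun w => G (xi j w))).
  apply: (@bounded_integrable _ _ _ P _ N) => [|w]; last exact: GN.
  exact: measurableT_comp mG (mxi j).
under eq_Rintegral do rewrite mulrC.
rewrite mulrC; apply: (Rintegral_transfer iG (mxi i) _ mF FM) => B mB.
by rewrite [RHS]mulrC -step//; apply: eq_Rintegral => w _; rewrite mulrC.
Qed.

Let clip (m : nat) (x : R) : R := Num.max (- m%:R) (Num.min x m%:R).

Let clip_le m x : `|clip m x| <= `|x| /\ `|clip m x| <= m%:R.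
Proof.
have m0 : 0 <= m%:R :> R by [].
rewrite /clip; have [h1|h1] := leP x m%:R.
  have [h2|h2] := leP (- m%:R) x; first by split => //; rewrite ler_norml h2 h1.
  by rewrite normrN (ger0_norm m0); split => //; rewrite ltr0_norm; lra.
rewrite max_r; last lra.
by rewrite (ger0_norm m0); split => //; rewrite gtr0_norm; lra.
Qed.

Let clip_cvg x : clip m x @[m --> \oo] --> x.
Proof.
apply: cvg_near_cst; near=> m.
have : `|x| <= m%:R by near: m; exact: nbhs_infty_ger.
by rewrite ler_norml /clip => /andP[h1 h2]; rewrite (min_l h2) (max_r h1).
Unshelve. all: by end_near. Qed.

(** Clipping [D] at height m reduces to the bounded case; the products are dominated by the sum of
    the two squares as m grows. *)
Lemma iid_pair_L2 i j (D : R -> R) : (i < n)%N -> (j < n)%N -> i != j ->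
  measurable_fun setT D -> Q.-integrable setT (EFin \o (fun y => D y ^+ 2)) ->
  P.-integrable setT (EFin \o (fun w => D (xi i w) * D (xi j w))) /\
  \int[P]_w (D (xi i w) * D (xi j w)) = (\int[Q]_y D y) ^+ 2.
Proof.
move=> ilt jlt ij mD jD2.
have mD2 : measurable_fun setT (fun y => D y ^+ 2) by meas.
have [ji _] := Rintegral_law (mxi i) (iid_law ilt) mD2 jD2.
have [jj _] := Rintegral_law (mxi j) (iid_law jlt) mD2 jD2.
have jsum : P.-integrable setT (EFin \o (fun w => D (xi i w) ^+ 2 + D (xi j w) ^+ 2)).
  by have := RintegrableD measurableT ji jj.
have mi k : measurable_fun setT (fun w => D (xi k w)) by exact: measurableT_comp mD (mxi k).
have dom (a b c e : R) : `|a| <= `|c| -> `|b| <= `|e| -> `|a * b| <= c ^+ 2 + e ^+ 2.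
  move=> ac be; rewrite normrM (le_trans (ler_pM _ _ ac be))// -(real_normK (num_real c)) -(real_normK (num_real e)).
  move: (normr_ge0 c) (normr_ge0 e); set p := `|c|; set q := `|e| => p0 q0.
  by have := sqr_ge0 (p - q); rewrite !expr2; nra.
have jD : Q.-integrable setT (EFin \o D).
  apply: (@Rintegrable_le _ (measurableTypeR R) _ Q setT D (fun y => D y ^+ 2 + 1)) => //.
    move=> y _; rewrite -(real_normK (num_real (D y))).
    by have := sqr_ge0 (`|D y| - 1); have := normr_ge0 (D y); rewrite !expr2; nra.
  by apply: RintegrableD => //; exact: (finite_measure_integrable_cst Q 1).
split.
  apply: (Rintegrable_le (g := fun w => D (xi i w) ^+ 2 + D (xi j w) ^+ 2)) => //.
    by apply: measM; exact: mi.
  by move=> w _; exact: dom.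
have mclip m : measurable_fun setT (fun y => clip m (D y)).
  apply: measurable_maxr; first exact: measurable_cst.
  by apply: measurable_minr => //; exact: measurable_cst.
have c1 : \int[P]_w (clip m (D (xi i w)) * clip m (D (xi j w))) @[m --> \oo] -->
    \int[P]_w (D (xi i w) * D (xi j w)).
  apply: (@Rintegral_dominated_cvg _ _ _ P setT _ _ (fun w => D (xi i w) ^+ 2 + D (xi j w) ^+ 2)) => //.
  - by move=> m; apply: measM; [exact: measurableT_comp (mclip m) (mxi i)|exact: measurableT_comp (mclip m) (mxi j)].
  - by move=> w _; apply: cvgM; exact: clip_cvg.
  - by move=> m w _; apply: dom; [exact: (clip_le m _).1|exact: (clip_le m _).1].
have c2 : (\int[Q]_y clip m (D y)) ^+ 2 @[m --> \oo] --> (\int[Q]_y D y) ^+ 2.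
  rewrite [X in _ --> X]expr2; under eq_fun do rewrite expr2.
  have h : \int[Q]_y clip m (D y) @[m --> \oo] --> \int[Q]_y D y.
    apply: (@Rintegral_dominated_cvg _ _ _ Q setT _ _ (fun y => `|D y|)) => //.
    - exact: Rintegrable_norm.
    - by move=> m y _; exact: (clip_le m _).1.
  by apply: cvgM.
have e : (fun m => \int[P]_w (clip m (D (xi i w)) * clip m (D (xi j w)))) =
    (fun m => (\int[Q]_y clip m (D y)) ^+ 2).
  apply/funext => m; rewrite expr2.
  apply: (iid_pair_bounded ilt jlt ij (mclip m) _ (mclip m)); move=> y; exact: (clip_le m _).2.
by rewrite e in c1; exact: cvg_unique c1 c2.
Qed.

Lemma iid_sum_sq (D : R -> R) : measurable_fun setT D ->
  Q.-integrable setT (EFin \o (fun y => D y ^+ 2)) -> \int[Q]_y D y = 0 ->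
  P.-integrable setT (EFin \o (fun w => (\sum_(0 <= i < n) D (xi i w)) ^+ 2)) /\
  \int[P]_w (\sum_(0 <= i < n) D (xi i w)) ^+ 2 = n%:R * \int[Q]_y (D y ^+ 2).
Proof.
move=> mD jD2 D0.
have mD2 : measurable_fun setT (fun y => D y ^+ 2) by meas.
have jij (i j : 'I_n) : P.-integrable setT (EFin \o (fun w => D (xi i w) * D (xi j w))).
  have [<-|ij] := eqVneq i j.
    have [ji _] := Rintegral_law (mxi i) (iid_law (ltn_ord i)) mD2 jD2.
    by have := ji; apply: eq_integrable => // w _ /=; rewrite expr2.
  by have [] := iid_pair_L2 (ltn_ord i) (ltn_ord j) ij mD jD2.
have E w : (\sum_(0 <= i < n) D (xi i w)) ^+ 2 = \sum_(i < n) \sum_(j < n) D (xi i w) * D (xi j w).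
  rewrite big_mkord expr2 mulr_suml; apply: eq_bigr => i _.
  by rewrite mulr_sumr.
have jsum (i : 'I_n) : P.-integrable setT (EFin \o (fun w => \sum_(j < n) D (xi i w) * D (xi j w))).
  by apply: Rintegrable_sum => // j; exact: jij.
split.
  have := @Rintegrable_sum _ _ _ P _ (index_enum 'I_n) setT _ measurableT jsum.
  by apply: eq_integrable => // w _ /=; rewrite E.
under eq_Rintegral do rewrite E.
rewrite Rintegral_sum//.
transitivity (\sum_(i < n) \int[Q]_y (D y ^+ 2)); last first.
  by rewrite sumr_const card_ord mulr_natl.
apply: eq_bigr => i _; rewrite Rintegral_sum; [|by []|by move=> j; exact: jij].
rewrite (bigD1 i)//= big1 ?addr0.
  have [_ <-] := Rintegral_law (mxi i) (iid_law (ltn_ord i)) mD2 jD2.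
  by apply: eq_Rintegral => w _; rewrite expr2.
move=> j ji; have [_ ->] := iid_pair_L2 (ltn_ord i) (ltn_ord j) (ltac:(by rewrite eq_sym)) mD jD2.
by rewrite D0 expr0n.
Qed.

End iid_pairs.

(** The inequality is the nonnegativity of the integral of (|D| - m)^2, with m the mean of |D|. *)
Lemma integrable_of_sq (R : realType) (Q : probability (measurableTypeR R) R) (D : R -> R) :
  measurable_fun setT D -> Q.-integrable setT (EFin \o (fun y => D y ^+ 2)) ->
  Q.-integrable setT (EFin \o D) /\ (\int[Q]_y `|D y|) ^+ 2 <= \int[Q]_y (D y ^+ 2).
Proof.
move=> mD jD2.
have jD : Q.-integrable setT (EFin \o D).
  apply: (@Rintegrable_le _ (measurableTypeR R) _ Q setT D (fun y => D y ^+ 2 + 1)) => //.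
    move=> y _; rewrite -(real_normK (num_real (D y))).
    by have := sqr_ge0 (`|D y| - 1); have := normr_ge0 (D y); rewrite !expr2; nra.
  by apply: RintegrableD => //; exact: (finite_measure_integrable_cst Q 1).
split => //; set m := \int[Q]_y `|D y|.
have jn := Rintegrable_norm measurableT jD.
have j1 : Q.-integrable setT (EFin \o (fun _ : R => m ^+ 2 : R)) by exact: (finite_measure_integrable_cst Q (m ^+ 2)).
have j2 : Q.-integrable setT (EFin \o (fun y => 2 * m * `|D y|)) by exact: RintegrableZ.
have j3 : Q.-integrable setT (EFin \o (fun y => D y ^+ 2 - 2 * m * `|D y|)) by exact: RintegrableB.
have : 0 <= \int[Q]_y (D y ^+ 2 - 2 * m * `|D y| + m ^+ 2).
  apply: Rintegral_ge0 => y _; rewrite -(real_normK (num_real (D y))).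
  by have -> : `|D y| ^+ 2 - 2 * m * `|D y| + m ^+ 2 = (`|D y| - m) ^+ 2 by [ring]; exact: sqr_ge0.
rewrite RintegralD// RintegralB// RintegralZl// -/m Rintegral_cst1 -subr_ge0.
by congr (_ <= _); ring.
Qed.

(** With v = 2 (sqrt(r) - 1), the quantity 2 ln(1 + v / 2) is the logarithm of a likelihood ratio r.
    The left side vanishes at 0 and has derivative (v^2 / 4) / (1 + v / 2). *)
Lemma log_taylor (R : realType) (v : R) : `|v| <= 1 ->
  `|2 * ln (1 + v / 2) - v + v ^+ 2 / 4| <= `|v| ^+ 3.
Proof.
move=> v1.
pose f (x : R) := 2 * ln (1 + x / 2) - x + x ^+ 2 / 4.
pose f' (x : R) := x ^+ 2 / 4 / (1 + x / 2).
have df (x : R) : `|x| <= 1 -> is_derive x 1 f (f' x).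
  rewrite ler_norml => /andP[h1 h2]; have x1 : 0 < 1 + x / 2 by lra.
  have n1 : 1 + x / 2 != 0 by rewrite gt_eqF.
  have n2 : 2 + x != 0 by rewrite gt_eqF//; lra.
  by rewrite /f /f'; der; field; rewrite ?n1 ?n2.
have bound (x : R) : `|x| <= `|v| -> `|f' x| <= `|v| ^+ 2.
  move=> xv; have x1 : `|x| <= 1 := le_trans xv v1.
  have h : 2^-1 <= 1 + x / 2 by move: x1; rewrite ler_norml => /andP[? ?]; lra.
  have h0 : 0 < 1 + x / 2 by lra.
  rewrite /f' normrM normfV (gtr0_norm h0) ger0_norm; last by rewrite divr_ge0 ?sqr_ge0.
  rewrite ler_pdivrMr//.
  have xx : x ^+ 2 <= `|v| ^+ 2 by rewrite -(real_normK (num_real x)) ler_pXn2r ?nnegrE.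
  apply: (@le_trans _ _ (`|v| ^+ 2 * 2^-1)); last by rewrite ler_wpM2l// sqr_ge0.
  by have := sqr_ge0 `|v|; lra.
have f0 : f 0 = 0 by rewrite /f mul0r addr0 ln1 mulr0 expr0n/= mul0r; ring.
rewrite -/(f v).
have [v0|v0] := leP 0 v.
  have [||c cin E] := @MVT_segment _ f f' 0 v v0.
  - move=> x; rewrite in_itv/= => /andP[x0 xv]; apply: df.
    by rewrite gtr0_norm// (le_trans (ltW xv))// (le_trans (ler_norm v)).
  - apply: continuous_in_subspaceT => x; rewrite inE/= in_itv/= => /andP[x0 xv].
    by apply: der_continuous (df x _); rewrite ger0_norm// (le_trans xv)// (le_trans (ler_norm v)).
  rewrite f0 !subr0 in E; rewrite E normrM exprSr ler_wpM2r//; apply: bound.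
  by move: cin; rewrite in_itv/= => /andP[c0 cv]; rewrite !ger0_norm.
have [||c cin E] := @MVT_segment _ f f' v 0 (ltW v0).
- move=> x; rewrite in_itv/= => /andP[vx x0]; apply: df.
  by rewrite ltr0_norm// (le_trans _ v1)// ltr0_norm// lerN2 ltW.
- apply: continuous_in_subspaceT => x; rewrite inE/= in_itv/= => /andP[vx x0].
  by apply: der_continuous (df x _); rewrite ler0_norm// (le_trans _ v1)// ltr0_norm// lerN2.
rewrite f0 sub0r in E; have -> : f v = - (f' c * (0 - v)) by rewrite -E opprK.
rewrite normrN normrM sub0r normrN exprSr ler_wpM2r//; apply: bound.
by move: cin; rewrite in_itv/= => /andP[vc c0]; rewrite !ler0_norm ?lerN2// ltW.
Qed.

(** * The quadratic expansion of the log-likelihood ratio from differentiability in quadratic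
    mean *)

Section lan.
Context d (T : measurableType d) (R : realType) (P : probability T R).
Variables (Q : probability (measurableTypeR R) R) (xi : nat -> nat -> T -> R).
Hypothesis H : forall n, iid P Q n (xi n).

Let mxi n i : measurable_fun setT (xi n i). Proof. exact: (H n).1. Qed.

Lemma iid_mean_op1 (D : nat -> R -> R) (a : nat -> R) : (forall n, measurable_fun setT (D n)) ->
  (forall n, Q.-integrable setT (EFin \o (fun y => D n y ^+ 2))) ->
  (forall n, \int[Q]_y D n y = 0) ->
  a n ^+ 2 * (n%:R * \int[Q]_y (D n y ^+ 2)) @[n --> \oo] --> 0 ->
  little_op1 P (fun n w => a n * \sum_(0 <= i < n) D n (xi n i w)).
Proof.
move=> mD jD2 D0 h.
have mS n : measurable_fun setT (fun w => \sum_(0 <= i < n) D n (xi n i w)).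
  by apply: measurable_sum => i; exact: measurableT_comp (mD n) (mxi n i).
have sq n := iid_sum_sq (H n) (mD n) (jD2 n) (D0 n).
have E n w : (a n * \sum_(0 <= i < n) D n (xi n i w)) ^+ 2 =
    a n ^+ 2 * (\sum_(0 <= i < n) D n (xi n i w)) ^+ 2 by rewrite exprMn.
apply: op1_L2.
- by move=> n; have m := mS n; meas.
- apply: nearW => n; have := RintegrableZ (a n ^+ 2) measurableT (sq n).1.
  by apply: eq_integrable => // w _ /=; rewrite exprMn.
- apply: cvg_trans h; apply: near_eq_cvg; apply: nearW => n.
  rewrite -(sq n).2 -RintegralZl//; last exact: (sq n).1.
  by apply: eq_Rintegral => w _; rewrite exprMn.
Qed.

Lemma iid_mean_L1_op1 (D : nat -> R -> R) (a : nat -> R) : (forall n, measurable_fun setT (D n)) ->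
  (forall n, Q.-integrable setT (EFin \o D n)) ->
  `|a n| * (n%:R * \int[Q]_y `|D n y|) @[n --> \oo] --> 0 ->
  little_op1 P (fun n w => a n * \sum_(0 <= i < n) D n (xi n i w)).
Proof.
move=> mD jD h.
have mDi n i : measurable_fun setT (fun w => D n (xi n i w)).
  exact: measurableT_comp (mD n) (mxi n i).
have mS n : measurable_fun setT (fun w => \sum_(0 <= i < n) D n (xi n i w)).
  exact: measurable_sum.
have mn n : measurable_fun setT (fun y => `|D n y|).
  by have m := mD n; meas.
have jn n := Rintegrable_norm measurableT (jD n).
have ji n (i : 'I_n) := Rintegral_law (mxi n i) (iid_law (H n) (ltn_ord i)) (mn n) (jn n).
have dom n w : `|a n * \sum_(0 <= i < n) D n (xi n i w)| <=
    `|a n| * \sum_(i < n) `|D n (xi n i w)|.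
  by rewrite normrM ler_wpM2l// big_mkord ler_norm_sum.
have js n : P.-integrable setT (EFin \o (fun w => \sum_(i < n) `|D n (xi n i w)|)).
  by apply: Rintegrable_sum => // i; exact: (ji n i).1.
have jas n : P.-integrable setT (EFin \o (fun w => `|a n| * \sum_(i < n) `|D n (xi n i w)|)).
  exact: RintegrableZ.
have jZ n : P.-integrable setT (EFin \o (fun w => a n * \sum_(0 <= i < n) D n (xi n i w))).
  apply: (Rintegrable_le (g := fun w => `|a n| * \sum_(i < n) `|D n (xi n i w)|)) => //.
  by have m := mS n; meas.
apply: op1_L1.
- by move=> n; have m := mS n; meas.
- exact: nearW.
apply: (cvg0_le _ h); apply: nearW => n.
rewrite ger0_norm; last by apply: Rintegral_ge0.
have -> : `|a n| * (n%:R * \int[Q]_y `|D n y|) =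
    \int[P]_w (`|a n| * \sum_(i < n) `|D n (xi n i w)|).
  rewrite RintegralZl// Rintegral_sum//; last by move=> i; exact: (ji n i).1.
  congr (_ * _); under eq_bigr do rewrite (ji n _).2.
  by rewrite sumr_const card_ord mulr_natl.
apply: le_Rintegral => //; exact: Rintegrable_norm.
Qed.

(* Here [W n] stands for [2 (sqrt (f_n / f) - 1)], with [f] the density of [Q]; [EW] says
   that the [f_n] have the same mass as [f], and [D2] is differentiability in quadratic
   mean. *)
Variables (W : nat -> R -> R) (g : R -> R) (M : R).
Hypotheses (mW : forall n, measurable_fun setT (W n)) (mg : measurable_fun setT g)
  (gM : forall y, `|g y| <= M) (jW2 : forall n, Q.-integrable setT (EFin \o (fun y => W n y ^+ 2)))
  (EW : forall n, \int[Q]_y W n y = - (4^-1 * \int[Q]_y (W n y ^+ 2))).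
Let D n y := Num.sqrt n%:R * W n y - g y.
Hypothesis D2 : \int[Q]_y (D n y ^+ 2) @[n --> \oo] --> 0.

Let v := \int[Q]_y (g y ^+ 2).
Let M0 : 0 <= M := le_trans (normr_ge0 _) (gM 0).
Let mD n : measurable_fun setT (D n). Proof. by have m := mW n; rewrite /D; meas. Qed.
Let mg2 : measurable_fun setT (fun y => g y ^+ 2). Proof. by meas. Qed.
Let g2M y : `|g y ^+ 2| <= M ^+ 2. Proof. by rewrite normrX ler_pXn2r ?nnegrE. Qed.
Let jg : Q.-integrable setT (EFin \o g). Proof. exact: (@bounded_integrable _ _ _ Q g M). Qed.
Let jg2 : Q.-integrable setT (EFin \o (fun y => g y ^+ 2)).
Proof. exact: (@bounded_integrable _ _ _ Q _ (M ^+ 2)). Qed.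

Let jD2 n : Q.-integrable setT (EFin \o (fun y => D n y ^+ 2)).
Proof.
apply: (@Rintegrable_le _ (measurableTypeR R) _ Q setT _
  (fun y => 2 * n%:R * W n y ^+ 2 + 2 * g y ^+ 2)) => //.
- by have m := mD n; have := measX 2 m.
- move=> y _; rewrite ger0_norm ?sqr_ge0//.
  have -> : 2 * n%:R * W n y ^+ 2 = 2 * (Num.sqrt n%:R * W n y) ^+ 2.
    by rewrite exprMn sqr_sqrtr ?mulrA// ler0n.
  by rewrite /D; set a := Num.sqrt _ * _; have := sqr_ge0 (a + g y); rewrite !expr2; nra.
- by apply: RintegrableD => //; [apply: RintegrableZ|apply: RintegrableZ].
Qed.

Let jD n := (integrable_of_sq (mD n) (jD2 n)).1.

Let jW n := (integrable_of_sq (mW n) (jW2 n)).1.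

Let ED1 : \int[Q]_y `|D n y| @[n --> \oo] --> 0.
Proof.
apply: (cvg0_le (g := fun n => Num.sqrt (\int[Q]_y (D n y ^+ 2)))).
  apply: nearW => n; have h := (integrable_of_sq (mD n) (jD2 n)).2.
  have i0 : 0 <= \int[Q]_y `|D n y| by exact: Rintegral_ge0.
  rewrite ger0_norm// -[leLHS](ger0_norm i0) -sqrtr_sqr ler_sqrt//.
  by apply: Rintegral_ge0 => y _; exact: sqr_ge0.
have := D2; rewrite -{2}(@sqrtr0 R) => h.
exact: (@continuous_cvg _ _ _ _ _ _ (@Num.sqrt R) 0 (@sqrt_continuous R 0) h).
Qed.

Let gDn n : \int[Q]_y `|2 * g y * D n y + D n y ^+ 2| <=
  2 * M * \int[Q]_y `|D n y| + \int[Q]_y (D n y ^+ 2).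
Proof.
have jn := Rintegrable_norm measurableT (jD n).
have jz : Q.-integrable setT (EFin \o (fun y => 2 * M * `|D n y|)) by exact: RintegrableZ.
have js : Q.-integrable setT (EFin \o (fun y => 2 * M * `|D n y| + D n y ^+ 2)) := RintegrableD measurableT jz (jD2 n).
have b y : `|2 * g y * D n y + D n y ^+ 2| <= 2 * M * `|D n y| + D n y ^+ 2.
  rewrite (le_trans (ler_normD _ _))// (ger0_norm (sqr_ge0 _)) lerD2r !normrM normr_nat.
  by rewrite ler_wpM2r// ler_wpM2l.
rewrite -RintegralZl// -RintegralD//; apply: le_Rintegral => //.
apply: (@Rintegrable_le _ (measurableTypeR R) _ Q setT _
  (fun y => 2 * M * `|D n y| + D n y ^+ 2)) => //; last by move=> y _; rewrite normr_id.
by have m := mD n; have := meas_norm (measD (measM (measM (measurable_cst (2 : R)) mg) m) (measX 2 m)).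
Qed.

Let EgD : \int[Q]_y `|2 * g y * D n y + D n y ^+ 2| @[n --> \oo] --> 0.
Proof.
apply: (cvg0_le (g := fun n => 2 * M * \int[Q]_y `|D n y| + \int[Q]_y (D n y ^+ 2))).
  by apply: nearW => n; rewrite ger0_norm ?gDn//; exact: Rintegral_ge0.
rewrite -[X in _ --> X]addr0 -{1}(mulr0 (2 * M)); apply: cvgD => //.
by apply: cvgM => //; exact: cvg_cst.
Qed.

Let jA n : Q.-integrable setT (EFin \o (fun y => 2 * g y * D n y + D n y ^+ 2)).
Proof.
have j1 : Q.-integrable setT (EFin \o (fun y => 2 * (D n y * g y))).
  apply: RintegrableZ => //; exact: (integrable_mul_bounded (jD n) mg gM).
have := RintegrableD measurableT j1 (jD2 n); apply: eq_integrable => // y _ /=.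
by rewrite -mulrA (mulrC (g y)).
Qed.

Let sqE n y : n%:R * W n y ^+ 2 = g y ^+ 2 + (2 * g y * D n y + D n y ^+ 2).
Proof.
rewrite -(sqr_sqrtr (ler0n R n)) -exprMn /D; set a := Num.sqrt _ * _; ring.
Qed.

(** n W^2 is g^2 plus a term that tends to 0 in L1, by [sqE] and [EgD]. *)
Let EW2 : n%:R * \int[Q]_y (W n y ^+ 2) @[n --> \oo] --> v.
Proof.
have E n : n%:R * \int[Q]_y (W n y ^+ 2) = v + \int[Q]_y (2 * g y * D n y + D n y ^+ 2).
  have -> : n%:R * \int[Q]_y (W n y ^+ 2) = \int[Q]_y (n%:R * W n y ^+ 2) by rewrite RintegralZl.
  rewrite -(RintegralD measurableT jg2 (jA n)).
  by apply: eq_Rintegral => y _; rewrite sqE.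
rewrite (_ : (fun n => n%:R * \int[Q]_y (W n y ^+ 2)) =
  (fun n => v + \int[Q]_y (2 * g y * D n y + D n y ^+ 2))); last exact/funext.
rewrite -[X in _ --> X]addr0; apply: cvgD; first exact: cvg_cst.
apply: (cvg0_le _ EgD); apply: nearW => n; exact: le_normr_Rintegral.
Qed.

Let m n := \int[Q]_y D n y.

Let m0 : m n @[n --> \oo] --> 0.
Proof. by apply: (cvg0_le _ ED1); apply: nearW => n; apply: le_normr_Rintegral => //; exact: jD. Qed.

Let mE n : m n = Num.sqrt n%:R * \int[Q]_y W n y - \int[Q]_y g y.
Proof.
have -> : Num.sqrt n%:R * \int[Q]_y W n y = \int[Q]_y (Num.sqrt n%:R * W n y).
  by rewrite RintegralZl//; exact: jW.
by rewrite /m /D RintegralB//; apply: RintegrableZ => //; exact: jW.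
Qed.

Let sqrtn n : (0 < n)%N -> Num.sqrt n%:R = n%:R * (Num.sqrt n%:R)^-1 :> R.
Proof.
move=> n0; have s0 : Num.sqrt n%:R != 0 :> R by rewrite gt_eqF// sqrtr_gt0 ltr0n.
by rewrite -{2}(sqr_sqrtr (ler0n R n)) expr2 mulfK.
Qed.

(** The mean of sqrt(n) W tends to that of [g] because D tends to 0 in L1. By [EW] it is also -
    sqrt(n) / 4 times the second moment of W, which is of order 1 / n. *)
Lemma lan_centered : \int[Q]_y g y = 0.
Proof.
have c1 : m n + \int[Q]_y g y @[n --> \oo] --> \int[Q]_y g y.
  by rewrite -[X in _ --> X]add0r; apply: cvgD => //; exact: cvg_cst.
have c2 : - (4^-1 * ((Num.sqrt n%:R)^-1 * (n%:R * \int[Q]_y (W n y ^+ 2)))) @[n --> \oo] --> (0 : R).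
  rewrite [X in _ --> X](_ : 0 = - (4^-1 * (0 * v))); last by rewrite mul0r mulr0 oppr0.
  by apply: cvgN; apply: cvgM; [exact: cvg_cst|apply: cvgM => //; exact: cvg_sqrtn_inv].
apply: (cvg_unique _ c1) => //; apply: cvg_trans c2; apply: near_eq_cvg; near=> n.
have n0 : (0 < n)%N by near: n; exact: nbhs_infty_gt.
by rewrite mE subrK EW [in RHS](sqrtn n0); ring.
Unshelve. all: by end_near. Qed.

(** The sum of the W has a drift tending to -v / 4, and the quadratic term of the logarithm
    contributes another -v / 4. Together they give the -v / 2 of the expansion. *)
Let bias : Num.sqrt n%:R * m n + v / 4 @[n --> \oo] --> 0.
Proof.
have E n : Num.sqrt n%:R * m n + v / 4 = v / 4 - 4^-1 * (n%:R * \int[Q]_y (W n y ^+ 2)).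
  rewrite mE lan_centered subr0 EW mulrA -expr2 sqr_sqrtr ?ler0n//; ring.
rewrite (_ : (fun n => Num.sqrt n%:R * m n + v / 4) =
  (fun n => v / 4 - 4^-1 * (n%:R * \int[Q]_y (W n y ^+ 2)))); last exact/funext.
rewrite -(subrr (v / 4)); apply: cvgB; first exact: cvg_cst.
by rewrite [v / 4]mulrC; apply: cvgM => //; exact: cvg_cst.
Qed.

Let op1_D : little_op1 P (fun n w => (Num.sqrt n%:R)^-1 * \sum_(0 <= i < n) (D n (xi n i w) - m n)).
Proof.
have jc n : Q.-integrable setT (EFin \o (fun _ : R => m n ^+ 2 : R)).
  exact: (finite_measure_integrable_cst Q (m n ^+ 2)).
have E n y : (D n y - m n) ^+ 2 = D n y ^+ 2 - 2 * m n * D n y + m n ^+ 2 by ring.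
have jz n : Q.-integrable setT (EFin \o (fun y => 2 * m n * D n y)).
  by apply: RintegrableZ => //; exact: jD.
have jb n : Q.-integrable setT (EFin \o (fun y => D n y ^+ 2 - 2 * m n * D n y)).
  by apply: RintegrableB.
have jq n : Q.-integrable setT (EFin \o (fun y => (D n y - m n) ^+ 2)).
  have := RintegrableD measurableT (jb n) (jc n).
  by apply: eq_integrable => // y _ /=; rewrite E.
apply: (@iid_mean_op1 (fun n y => D n y - m n)) => //.
- by move=> n; have := measD (mD n) (measN (measurable_cst (m n))).
- move=> n; have jm : Q.-integrable setT (EFin \o (fun _ : R => m n : R)).
    exact: (finite_measure_integrable_cst Q (m n)).
  by rewrite (RintegralB measurableT (jD n) jm) Rintegral_cst1 subrr.
- apply: (cvg0_le _ D2); near=> n.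
  have n0 : (0 < n)%N by near: n; exact: nbhs_infty_gt.
  rewrite exprVn sqr_sqrtr ?ler0n// mulKf ?pnatr_eq0 -?lt0n//.
  rewrite ger0_norm; last by apply: Rintegral_ge0 => y _; exact: sqr_ge0.
  under eq_Rintegral do rewrite E.
  rewrite (RintegralD measurableT (jb n) (jc n)) (RintegralB measurableT (jD2 n) (jz n)) Rintegral_cst1.
  have -> : \int[Q]_y (2 * m n * D n y) = 2 * m n * m n by rewrite RintegralZl//; exact: jD.
  by have := sqr_ge0 (m n); rewrite !expr2; lra.
Unshelve. all: by end_near. Qed.

Let op1_A : little_op1 P (fun n w => - (4 * n%:R)^-1 *
  \sum_(0 <= i < n) (2 * g (xi n i w) * D n (xi n i w) + D n (xi n i w) ^+ 2)).
Proof.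
apply: (@iid_mean_L1_op1 (fun n y => 2 * g y * D n y + D n y ^+ 2)) => //.
- by move=> n; have md := mD n; have := measD (measM (measM (measurable_cst (2 : R)) mg) md) (measX 2 md).
- apply: (cvg0_le _ EgD); near=> n.
  have n0 : (0 < n)%N by near: n; exact: nbhs_infty_gt.
  have n1 : 0 < n%:R :> R by rewrite ltr0n.
  have i0 : 0 <= \int[Q]_y `|2 * g y * D n y + D n y ^+ 2| by exact: Rintegral_ge0.
  rewrite normrN ger0_norm ?invr_ge0 ?mulr_ge0// ger0_norm ?mulr_ge0 ?invr_ge0 ?mulr_ge0//.
  by rewrite invfM mulrA -(mulrA 4^-1) mulVf ?gt_eqF// mulr1 ler_piMl// invf_le1; lra.
Unshelve. all: by end_near. Qed.

Let op1_B : little_op1 P (fun n w => - (4 * n%:R)^-1 * \sum_(0 <= i < n) (g (xi n i w) ^+ 2 - v)).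
Proof.
have mB : measurable_fun setT (fun y => g y ^+ 2 - v) by meas.
have bB y : `|(g y ^+ 2 - v) ^+ 2| <= (M ^+ 2 + `|v|) ^+ 2.
  by rewrite normrX ler_pXn2r ?nnegrE ?addr_ge0 ?sqr_ge0// (le_trans (ler_normB _ _))// lerD2r.
apply: (@iid_mean_op1 (fun n y => g y ^+ 2 - v)) => //.
- move=> n; apply: (@bounded_integrable _ _ _ Q _ ((M ^+ 2 + `|v|) ^+ 2)) => //.
  by have := measX 2 mB.
- move=> n; rewrite RintegralB// ?Rintegral_cst1 ?subrr//.
  exact: (finite_measure_integrable_cst Q v).
- set I := \int[Q]_y _.
  have I0 : 0 <= I by apply: Rintegral_ge0 => y _; exact: sqr_ge0.
  apply: (cvg0_le (g := fun n => I * (Num.sqrt n%:R)^-1)); last first.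
    by rewrite -(mulr0 I); apply: cvgM; [exact: cvg_cst|exact: cvg_sqrtn_inv].
  near=> n; have n0 : (0 < n)%N by near: n; exact: nbhs_infty_gt.
  have n1 : 1 <= n%:R :> R by rewrite ler1n.
  have n2 : n%:R != 0 :> R by rewrite gt_eqF// ltr0n.
  have -> : (- (4 * n%:R)^-1) ^+ 2 * (n%:R * I) = I * (16 * n%:R)^-1 by field.
  rewrite ger0_norm; last by rewrite mulr_ge0// invr_ge0; lra.
  rewrite ler_wpM2l// lef_pV2 ?posrE ?sqrtr_gt0; [|lra|lra].
  apply: (@le_trans _ _ n%:R); last lra.
  by rewrite -{2}(sqr_sqrtr (ler0n R n)) expr2 ler_peMr ?sqrtr_ge0// -[leLHS]sqrtr1 ler_sqrt; lra.
Unshelve. all: by end_near. Qed.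

(** With probability tending to 1 no |W| exceeds [e]. Since |g| <= M, for large n an exceedance
    forces D^2 >= e^2 n / 4, and the expected number of exceedances is at most 4 / e^2 times the
    second moment of D. *)
Let op1_count (e : R) : 0 < e -> little_op1 P (fun n w =>
  1 * \sum_(0 <= i < n) \1_[set y | e < `|W n y|] (xi n i w)).
Proof.
move=> e0.
have mA n : measurable ([set y | e < `|W n y|] : set (measurableTypeR R)).
  exact: (@meas_gt _ (measurableTypeR R) R (W n) e (mW n)).
have mI n : measurable_fun setT (\1_[set y | e < `|W n y|] : R -> R).
  by apply: measurable_indic; exact: mA.
have bI n y : `|\1_[set y | e < `|W n y|] y : R| <= 1.
  by rewrite indicE; case: (_ \in _); rewrite ?normr1 ?normr0.
have jI n : Q.-integrable setT (EFin \o (\1_[set y | e < `|W n y|] : R -> R)).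
  by apply: (@bounded_integrable _ _ _ Q _ 1); [exact: mI|exact: bI].
apply: (@iid_mean_L1_op1 (fun n y => \1_[set y | e < `|W n y|] y) (fun=> 1)) => //.
apply: (cvg0_le (g := fun n => 4 / e ^+ 2 * \int[Q]_y (D n y ^+ 2))); last first.
  by rewrite -(mulr0 (4 / e ^+ 2)); apply: cvgM => //; exact: cvg_cst.
near=> n; have n0 : (0 < n)%N by near: n; exact: nbhs_infty_gt.
have n1 : 0 < n%:R :> R by rewrite ltr0n.
have e2 : 0 < e ^+ 2 by rewrite exprn_gt0.
have big : 4 * M ^+ 2 / e ^+ 2 <= n%:R by near: n; exact: nbhs_infty_ger.
have i0 : 0 <= \int[Q]_y `|\1_[set y | e < `|W n y|] y| by exact: Rintegral_ge0.
rewrite normr1 mul1r ger0_norm ?mulr_ge0// mulrC -ler_pdivlMr//.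
have -> : 4 / e ^+ 2 * \int[Q]_y (D n y ^+ 2) / n%:R = \int[Q]_y (4 / (e ^+ 2 * n%:R) * D n y ^+ 2).
  rewrite RintegralZl//; field; rewrite !gt_eqF//.
apply: le_Rintegral => //; first by apply: Rintegrable_norm.
  exact: RintegrableZ.
move=> y _; rewrite indicE; case: (boolP (y \in _)) => [|_]; last first.
  by rewrite normr0 mulr_ge0 ?sqr_ge0// divr_ge0// mulr_ge0// ltW.
rewrite inE/= normr1 => eW.
rewrite mulrAC ler_pdivlMr ?mulr_gt0// mul1r.
have h1 : e ^+ 2 * n%:R <= n%:R * W n y ^+ 2.
  by rewrite mulrC ler_pM2l// -(real_normK (num_real (W n y))) ler_pXn2r ?nnegrE ?(ltW e0)// ltW.
have h2 : 4 * M ^+ 2 <= e ^+ 2 * n%:R by move: big; rewrite ler_pdivrMr// (mulrC n%:R).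
have h3 : g y ^+ 2 <= M ^+ 2 by rewrite (le_trans (ler_norm _)).
have {}h1 : e ^+ 2 * n%:R <= (Num.sqrt n%:R * W n y) ^+ 2 by rewrite exprMn sqr_sqrtr ?ler0n.
rewrite /D; move: (Num.sqrt n%:R * W n y) (e ^+ 2 * n%:R) h2 h1 => a q h2 h1.
by have := sqr_ge0 (a - 2 * g y); rewrite !expr2 in h1 h3 *; nra.
Unshelve. all: by end_near. Qed.

Let r (x : R) := 2 * ln (1 + x / 2) - x + x ^+ 2 / 4.

Let mr n : measurable_fun setT (fun y => r (W n y)).
Proof.
by have m1 := mW n; have h : measurable_fun setT (fun y => ln (1 + W n y / 2)) by [meas]; rewrite /r; meas.
Qed.

Let op1_r : little_op1 P (fun n w => \sum_(0 <= i < n) r (W n (xi n i w))).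
Proof.
have v0 : 0 <= v by apply: Rintegral_ge0 => y _; exact: sqr_ge0.
have mS n : measurable_fun setT (fun w => \sum_(0 <= i < n) r (W n (xi n i w))).
  by apply: measurable_sum => i; exact: measurableT_comp (mr n) (mxi n i).
apply: op1_squeeze; first by apply: nearW => n; exact: mS.
move=> e e0 k k0.
(* q <= 1 permits [log_taylor]. When all |W| are at most q, the remainder is at most q times the sum
   of the W^2, whose mean is eventually below v + 1; the second bound on q then gives k / 2 in
   Markov's inequality. *)
pose q := Num.min 1 (k / 2 * e / (v + 1)).
have q0 : 0 < q by rewrite lt_min ltr01/= divr_gt0 ?mulr_gt0//; lra.
have q1 : q <= 1 by rewrite ge_min lexx.
have qk : q * (v + 1) <= k / 2 * e by rewrite -ler_pdivlMr ?ge_min ?lexx ?orbT//; lra.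
have k2 : 0 < k / 2 by lra.
have half : 0 < 2^-1 :> R by lra.
have oc := op1_le (op1_count q0) half k2.
have EWb : \forall n \near \oo, n%:R * \int[Q]_y (W n y ^+ 2) <= v + 1.
  move/cvgrPdist_le : EW2 => /(_ 1 ltr01); apply: filterS => n.
  by rewrite ler_norml => /andP[? ?]; lra.
have mc := (op1_count q0).1.
near=> n.
have mU : measurable_fun setT (fun w => 1 * \sum_(0 <= i < n) \1_[set y | q < `|W n y|] (xi n i w) : R).
  by near: n; exact: mc.
have hU : (P [set w | 2^-1 < `|1 * \sum_(0 <= i < n) \1_[set y | q < `|W n y|] (xi n i w) : R|]%R <= (k / 2)%:E)%E.
  by near: n; exact: oc.
have hW : n%:R * \int[Q]_y (W n y ^+ 2) <= v + 1 by near: n; exact: EWb.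
have mW2 : measurable_fun setT (fun y => W n y ^+ 2) by have m1 := mW n; meas.
have ji (i : 'I_n) := Rintegral_law (mxi n i) (iid_law (H n) (ltn_ord i)) mW2 (jW2 n).
pose V w := q * \sum_(i < n) W n (xi n i w) ^+ 2.
have js : P.-integrable setT (EFin \o (fun w => \sum_(i < n) W n (xi n i w) ^+ 2)).
  by apply: Rintegrable_sum => // i; exact: (ji i).1.
have jV : P.-integrable setT (EFin \o V) by exact: RintegrableZ.
have mV : measurable_fun setT V by exact: Rintegrable_meas jV.
have V0 w : 0 <= V w by rewrite mulr_ge0 ?(ltW q0)// sumr_ge0// => i _; exact: sqr_ge0.
have EV : \int[P]_w `|V w| = q * (n%:R * \int[Q]_y (W n y ^+ 2)).
  under eq_Rintegral do rewrite ger0_norm//.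
  rewrite RintegralZl// Rintegral_sum//; last by move=> i; exact: (ji i).1.
  by congr (_ * _); under eq_bigr do rewrite (ji _).2; rewrite sumr_const card_ord mulr_natl.
pose U w : R := 1 * \sum_(0 <= i < n) \1_[set y | q < `|W n y|] (xi n i w).
have sub : [set w | e < `|\sum_(0 <= i < n) r (W n (xi n i w))|] `<=`
    [set w | 2^-1 < `|U w|] `|` [set w | e < `|V w|].
  move=> w /= h; have [hw|hw] := ltP 2^-1 `|U w|; [by left|right].
  have Wq (i : 'I_n) : `|W n (xi n i w)| <= q.
    rewrite leNgt; apply/negP => hi; move: hw; rewrite leNgt => /negP; apply.
    have U1 : 1 <= U w.
      rewrite /U mul1r big_mkord (bigD1 i)//= indicE mem_set//= lerDl.
      by apply: sumr_ge0 => j _; rewrite indicE.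
    by rewrite (lt_le_trans _ (ler_norm _))//; lra.
  rewrite ger0_norm// (lt_le_trans h)// big_mkord (le_trans (ler_norm_sum _ _ _))//.
  rewrite /V mulr_sumr; apply: ler_sum => i _.
  rewrite (le_trans (log_taylor (le_trans (Wq i) q1)))// exprS.
  by rewrite -(real_normK (num_real (W n _))) ler_wpM2r// exprn_ge0.
have mUV : measurable ([set w | 2^-1 < `|U w|] `|` [set w | e < `|V w|]).
  by apply: measurableU; exact: meas_gt.
apply: (le_trans (le_measure P _ _ sub)); rewrite ?inE//; first by apply: meas_gt; exact: mS.
have u2 := measureU2 P (meas_gt 2^-1 mU) (meas_gt e mV).
apply: (le_trans u2).
have -> : k%:E = ((k / 2)%:E + (k / 2)%:E)%E by rewrite -EFinD; congr EFin; lra.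
apply: leeD; first exact: hU.
apply: (le_trans (markov_abs mV e0 jV)); rewrite lee_fin EV mulrC ler_pdivrMr//.
by apply: (le_trans _ qk); rewrite ler_pM2l.
Unshelve. all: by end_near. Qed.

(** An exact algebraic identity, for n > 0, splits the log-ratio into the score sum, four negligible
    sums and the deterministic sequence of [bias]. *)
Lemma lan_expansion : little_op1 P (fun n w =>
  \sum_(0 <= i < n) 2 * ln (1 + W n (xi n i w) / 2)
  - (Num.sqrt n%:R)^-1 * \sum_(0 <= i < n) g (xi n i w) + v / 2).
Proof.
have := op1D (op1D (op1D (op1D op1_D op1_A) op1_B) op1_r) (op1_cst P bias).
apply: op1_near; near=> n; apply/funext => w.
have n0 : (0 < n)%N by near: n; exact: nbhs_infty_gt.
have n1 : n%:R != 0 :> R by rewrite gt_eqF// ltr0n.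
set s := (Num.sqrt n%:R)^-1.
have sn : s ^+ 2 = n%:R^-1 by rewrite exprVn sqr_sqrtr.
have s0 : Num.sqrt n%:R != 0 :> R by rewrite gt_eqF// sqrtr_gt0 ltr0n.
have WE y : W n y = s * (g y + D n y).
  by rewrite /D addrC subrK mulrA mulVf// mul1r.
have id i : 2 * ln (1 + W n (xi n i w) / 2) = r (W n (xi n i w)) + s * (D n (xi n i w) - m n) + s * m n
    + s * g (xi n i w) + (- (4 * n%:R)^-1) * (2 * g (xi n i w) * D n (xi n i w) + D n (xi n i w) ^+ 2)
    + (- (4 * n%:R)^-1) * (g (xi n i w) ^+ 2 - v) - (4 * n%:R)^-1 * v.
  rewrite invfM -sn /r; rewrite {3 4}WE; move: (ln _) (g _) (D _ _) (m n) => l a b c; by field.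
have -> : \sum_(0 <= i < n) 2 * ln (1 + W n (xi n i w) / 2) =
    \sum_(0 <= i < n) r (W n (xi n i w)) + s * \sum_(0 <= i < n) (D n (xi n i w) - m n)
    + n%:R * (s * m n) + s * \sum_(0 <= i < n) g (xi n i w)
    + (- (4 * n%:R)^-1) * \sum_(0 <= i < n) (2 * g (xi n i w) * D n (xi n i w) + D n (xi n i w) ^+ 2)
    + (- (4 * n%:R)^-1) * \sum_(0 <= i < n) (g (xi n i w) ^+ 2 - v) + n%:R * (- ((4 * n%:R)^-1 * v)).
  under eq_bigr do rewrite id.
  do 6 (rewrite big_split /=); by rewrite -!mulr_sumr !sumr_const_nat subn0 !mulr_natl mulrnAr.
rewrite (sqrtn n0) -/s.
move: (\sum_(0 <= i < n) r _) (\sum_(0 <= i < n) (D _ _ - _)) (\sum_(0 <= i < n) g _) => S1 S2 S3.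
move: (\sum_(0 <= i < n) (_ + _)) (\sum_(0 <= i < n) (_ - v)) (m n) => S4 S5 c.
by field.
Unshelve. all: by end_near. Qed.

End lan.

(** * Differentiability in quadratic mean *)

Lemma mvt_between (R : realType) (f df : R -> R) (u v : R) :
  (forall x, `|x - u| <= `|v - u| -> is_derive x 1 f (df x)) ->
  exists2 z, `|z - u| <= `|v - u| & f v - f u = df z * (v - u).
Proof.
move=> H; have [uv|vu] := leP u v.
- have dist x : u <= x <= v -> `|x - u| <= `|v - u|.
    by move=> /andP[h1 h2]; rewrite !ger0_norm ?subr_ge0// lerB.
  have [||z zin E] := @MVT_segment R f df u v uv.
  + by move=> x; rewrite in_itv/= => /andP[h1 h2]; apply: H; apply: dist; rewrite !ltW.
  + apply: continuous_in_subspaceT => x; rewrite inE/= in_itv/= => h.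
    exact: der_continuous (H x (dist x h)).
  + by exists z => //; apply: dist; move: zin; rewrite in_itv.
- have dist x : v <= x <= u -> `|x - u| <= `|v - u|.
    by move=> /andP[h1 h2]; rewrite !ler0_norm ?subr_le0 ?(ltW vu)// lerN2 lerB.
  have [||z zin E] := @MVT_segment R f df v u (ltW vu).
  + by move=> x; rewrite in_itv/= => /andP[h1 h2]; apply: H; apply: dist; rewrite !ltW.
  + apply: continuous_in_subspaceT => x; rewrite inE/= in_itv/= => h.
    exact: der_continuous (H x (dist x h)).
  + exists z; first by apply: dist; move: zin; rewrite in_itv.
    by rewrite -[LHS]opprB E -mulrN opprB.
Qed.

Section real_sequences.
Context (R : realType).
Implicit Types (u v : nat -> R) (l m : R).

Lemma seqM u v l m : u n @[n --> \oo] --> l -> v n @[n --> \oo] --> m ->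
  u n * v n @[n --> \oo] --> l * m.
Proof. exact: cvgM. Qed.

Lemma seqD u v l m : u n @[n --> \oo] --> l -> v n @[n --> \oo] --> m ->
  u n + v n @[n --> \oo] --> l + m.
Proof. exact: cvgD. Qed.

Lemma seqB u v l m : u n @[n --> \oo] --> l -> v n @[n --> \oo] --> m ->
  u n - v n @[n --> \oo] --> l - m.
Proof. exact: cvgB. Qed.

Lemma seqN u l : u n @[n --> \oo] --> l -> - u n @[n --> \oo] --> - l.
Proof. exact: cvgN. Qed.

Lemma seqV u l : l != 0 -> u n @[n --> \oo] --> l -> (u n)^-1 @[n --> \oo] --> l^-1.
Proof. exact: cvgV. Qed.

Lemma seqC l : (fun=> l : R) @ \oo --> l.
Proof. exact: cvg_cst. Qed.

Lemma seq_norm u l : u n @[n --> \oo] --> l -> `|u n| @[n --> \oo] --> `|l|.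
Proof. exact: cvg_norm. Qed.

Lemma seq_eq u v l : (\forall n \near \oo, u n = v n) -> u n @[n --> \oo] --> l ->
  v n @[n --> \oo] --> l.
Proof. by move=> h; apply: cvg_trans; apply: near_eq_cvg. Qed.

Lemma seq_to u l m : u n @[n --> \oo] --> l -> l = m -> u n @[n --> \oo] --> m.
Proof. by move=> h <-. Qed.

Lemma seq_le u l m : u n @[n --> \oo] --> l -> l < m -> \forall n \near \oo, u n <= m.
Proof. by move=> h lm; near=> n; near: n; exact: (cvgr_le _ h). Unshelve. all: by end_near. Qed.

End real_sequences.
Arguments seqC {R} l.

Lemma Rintegral_cst0 d (T : measurableType d) (R : realType) (m : {measure set T -> \bar R})
  (D : set T) : \int[m]_(x in D) (fun=> 0 : R) x = 0.
Proof. by rewrite /Rintegral integral0. Qed.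

Lemma measB d (T : measurableType d) (R : realType) (D : set T) (f g : T -> R) :
  measurable_fun D f -> measurable_fun D g -> measurable_fun D (fun x => f x - g x).
Proof. by move=> mf mg; meas. Qed.

Lemma ln_root_quotient (R : realType) (s v1 v2 : R) : 0 < v1 -> 0 < v2 ->
  2 * ln (1 + 2 * (expR (- s / 2) * Num.sqrt v1 / Num.sqrt v2 - 1) / 2) = - s + ln v1 - ln v2.
Proof.
move=> p1 p2; have q1 : 0 < Num.sqrt v1 by rewrite sqrtr_gt0.
have q2 : 0 < Num.sqrt v2 by rewrite sqrtr_gt0.
have lnsqrt (x : R) : 0 < x -> ln x = 2 * ln (Num.sqrt x).
  by move=> x00; rewrite -[in LHS](sqr_sqrtr (ltW x00)) lnXn ?sqrtr_gt0// mulr_natl.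
have q20 : Num.sqrt v2 != 0 by rewrite gt_eqF.
have -> : 1 + 2 * (expR (- s / 2) * Num.sqrt v1 / Num.sqrt v2 - 1) / 2 =
    expR (- s / 2) * Num.sqrt v1 / Num.sqrt v2 by field.
rewrite lnM ?posrE ?invr_gt0 ?mulr_gt0 ?expR_gt0// lnM ?posrE ?expR_gt0// lnV ?posrE// expRK.
by move: (lnsqrt _ p1) (lnsqrt _ p2) => -> ->; field.
Qed.

Lemma continuous_of_seq (R : realType) (f : R -> R) :
  (forall (y_ : nat -> R) y, y_ n @[n --> \oo] --> y -> f (y_ n) @[n --> \oo] --> f y) ->
  continuous f.
Proof. by move=> H x; apply/(@cvg_nbhsP _ R^o) => u ux; exact: H. Qed.

Lemma continuous_stab_y (R : realType) (b : R) : 0 < b -> b < 2 -> continuous (stab_y b).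
Proof.
move=> b0 b2; apply: continuous_of_seq => y_ y yy.
by apply: (cvg_stab_y b0 b2 (fun=> lexx b)) => //; exact: cvg_cst.
Qed.

Lemma continuous_stab_b (R : realType) (b : R) : 0 < b -> b < 2 -> continuous (stab_b b).
Proof.
move=> b0 b2; apply: continuous_of_seq => y_ y yy.
by apply: (cvg_stab_b b0 b2 (fun=> lexx b)) => //; exact: cvg_cst.
Qed.

Lemma meas_stab_y (R : realType) (b : R) : 0 < b -> b < 2 ->
  measurable_fun [set: R] (stab_y b).
Proof. by move=> b0 b2; apply: continuous_measurable_fun; exact: continuous_stab_y. Qed.

Lemma meas_stab_b (R : realType) (b : R) : 0 < b -> b < 2 ->
  measurable_fun [set: R] (stab_b b).
Proof. by move=> b0 b2; apply: continuous_measurable_fun; exact: continuous_stab_b. Qed.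

Lemma meas_stab_s (R : realType) (b : R) : 0 < b -> b < 2 ->
  measurable_fun [set: R] (stab_s b).
Proof.
move=> b0 b2; have h1 := meas_stab b0 b2; have h2 := meas_stab_y b0 b2.
rewrite (_ : stab_s b = fun y => stab b y + y * stab_y b y); first by meas.
by apply/funext => y; rewrite /stab_s.
Qed.

Section local_bounds.
Context (R : realType).
Notation mu := (@lebesgue_measure R).
Hypothesis Hnn : forall b : R, 0 < b < 2 -> forall y, 0 <= stab b y.
Hypothesis Hcos : forall b : R, 0 < b < 2 -> forall u, \int[mu]_z (cos (u * z) * stab b z) = sym b u.

(** All constants around a fixed exponent [b], valid for exponents within [dl]. The margins on [dl]
    allow several losses of size [dl] in an exponent without losing integrability. *)
Record stable_estimates (b dl K c : R) : Prop := StableEstimates {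
  se_dl : 0 < dl ; se_dlb : 8 * dl <= b ; se_b2 : b + dl < 2 ; se_K : 0 <= K ; se_c : 0 < c ;
  se_lb : forall x y, b - dl <= x -> x <= b + dl -> c * wt (1 + x) y <= stab x y ;
  se_ub : forall x y, b - dl <= x -> x <= b + dl -> stab x y <= K * wt (1 + x) y ;
  se_s : forall x y, b - dl <= x -> x <= b + dl -> `|stab_s x y| <= K * wt (1 + x) y ;
  se_y : forall x y, b - dl <= x -> x <= b + dl -> `|stab_y x y| <= K * wt (1 + x) y ;
  se_bb : forall x y, b - dl <= x -> x <= b + dl -> `|stab_b x y| <= K * wt (1 + x - dl) y }.

Lemma stable_estimatesP (b : R) : 0 < b -> b < 2 -> exists dl K c, stable_estimates b dl K c.
Proof.
move=> b0 b2; pose dl := b * (2 - b) / 16.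
have dl0 : 0 < dl by rewrite divr_gt0 ?mulr_gt0// subr_gt0.
have h1 : 8 * dl <= b by rewrite /dl; nra.
have h2 : b + dl < 2 by rewrite /dl; nra.
have p1 : 0 < b - dl by lra.
have p2 : b - dl <= b + dl by lra.
have [c c0 hc] := stab_lower_bound p1 p2 h2 Hnn Hcos.
have [K1 K10 hK1] := stab_bound p1 p2 h2.
have [K2 K20 hK2] := stab_s_bound p1 h2.
have [K3 K30 hK3] := stab_y_bound p1 p2 h2.
have [K4 K40 hK4] := stab_b_bound p1 h2 dl0 (ltac:(lra) : dl < b - dl).
pose K := K1 + K2 + K3 + K4.
have up k w : 0 <= k -> k <= K -> 0 <= w -> k * w <= K * w by move=> *; exact: ler_wpM2r.
exists dl, K, c; split => //.
- by rewrite !addr_ge0.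
- move=> x y hx hx'; apply: (le_trans (ler_norm _)); apply: (le_trans (hK1 x y hx hx')).
  by apply: up; rewrite ?wt_ge0// /K; lra.
- move=> x y hx hx'; apply: (le_trans (hK2 x y hx hx')); apply: up; rewrite ?wt_ge0// /K; lra.
- move=> x y hx hx'; apply: (le_trans (hK3 x y hx hx')); apply: up; rewrite ?wt_ge0// /K; lra.
- move=> x y hx hx'; apply: (le_trans (hK4 x y hx hx')); apply: up; rewrite ?wt_ge0// /K; lra.
Qed.

Lemma stab_gt0 (b y : R) : 0 < b -> b < 2 -> 0 < stab b y.
Proof.
move=> b0 b2; have [dl [K [c E]]] := stable_estimatesP b0 b2.
have d0 := se_dl E; have h1 : b - dl <= b by lra.
have h2 : b <= b + dl by lra.
by apply: lt_le_trans (se_lb E y h1 h2); rewrite mulr_gt0 ?wt_gt0// (se_c E).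
Qed.

Lemma Rintegral_stab (b : R) : 0 < b -> b < 2 -> \int[mu]_y stab b y = 1.
Proof.
move=> b0 b2; rewrite -(sym0 b0) -Hcos ?b0//.
by congr Rintegral; apply/funext => y; rewrite mul0r cos0 mul1r.
Qed.

(** The total mass is 1 for every exponent; differentiate it under the integral. *)
Lemma Rintegral_stab_b (b : R) : 0 < b -> b < 2 -> \int[mu]_y stab_b b y = 0.
Proof.
move=> b0 b2; have [dl [K [c E]]] := stable_estimatesP b0 b2.
have d0 := se_dl E; have db := se_dlb E; have bd := se_b2 E.
have range x : `|x - b| < dl -> 0 < x /\ x < 2.
  by rewrite ltr_norml => /andP[h1 h2]; lra.
have d1 : is_derive b 1 (fun x => \int[mu]_y stab x y) (\int[mu]_y stab_b b y).
  apply: (@der_under_integral _ _ R mu setT (fun x y => stab x y) (fun x y => stab_b x y)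
    (fun y => K * wt (1 + b - 2 * dl) y) b dl) => //.
  - by move=> x /range[h1 h2]; exact: integrable_stab.
  - by move=> x y /range[h1 h2] _; exact: der_stab_b.
  - by apply: RintegrableZ => //; apply: integrable_wt; lra.
  - move=> x y xb _; have [h1 h2] : b - dl <= x /\ x <= b + dl.
      by move: xb; rewrite ltr_norml => /andP[h1 h2]; lra.
    apply: (le_trans (se_bb E y h1 h2)); apply: ler_wpM2l; first exact: se_K E.
    by apply: wt_le; lra.
have d2 : is_derive b 1 (fun x => \int[mu]_y stab x y) 0.
  apply: near_eq_is_derive (der_cst b 1).
  near=> x; apply/esym; have [h1 h2] : 0 < x /\ x < 2; last exact: Rintegral_stab.
  apply: range; near: x; apply: cvgr_distC_lt d0; exact: cvg_id.
by have [_ <-] := d1; have [_ ->] := d2.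
Unshelve. all: by end_near. Qed.
End local_bounds.

(** * Square roots of shifted and rescaled stable densities *)

Section shifted_density.
Context (R : realType).
Notation mu := (@lebesgue_measure R).
Hypothesis Hnn : forall b : R, 0 < b < 2 -> forall y, 0 <= stab b y.
Hypothesis Hcos : forall b : R, 0 < b < 2 -> forall u, \int[mu]_z (cos (u * z) * stab b z) = sym b u.

(* Square root of the density of [c + e^s Z], where [Z] has density [stab b]. *)
Definition root_density (b s c y : R) : R :=
  expR (- s / 2) * Num.sqrt (stab b (expR (- s) * (y - c))).

(** The derivative at the origin, in the direction (t, k), of the log-density of c + e^s Z as a
    function of (s, c). *)
Definition stable_score (b t k y : R) : R :=
  - (t * stab_s b y + k * stab_y b y) / stab b y.

Variables (b dl K c0 : R).
Hypotheses (b0 : 0 < b) (b2 : b < 2) (E : stable_estimates b dl K c0).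

Let dl0 : 0 < dl := se_dl E.
Let dlb : 8 * dl <= b := se_dlb E.
Let bd : b + dl < 2 := se_b2 E.
Let K0 : 0 <= K := se_K E.
Let c00 : 0 < c0 := se_c E.
Let rangeb x : `|x - b| <= dl -> [/\ b - dl <= x, x <= b + dl, 0 < x & x < 2].
Proof.
have [h1 h2 h3] := And3 dl0 dlb bd.
by rewrite ler_norml => /andP[h4 h5]; split; lra.
Qed.
Let stab0 x y : 0 < x -> x < 2 -> 0 < stab x y := @stab_gt0 R Hnn Hcos x y.

(** A derivative decays with exponent at least 1 + x - dl and the root of the density with (1 + x) /
    2, for some x >= b - dl. The quotient keeps (1 + x) / 2 - dl >= a, and 2 a > 1 makes its square
    integrable. *)
Let a := (1 + b - 3 * dl) / 2.

Let a_gt : 1 < 2 * a.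
Proof. by have [h1 h2] := conj dl0 dlb; rewrite /a mulrC mulfVK//; lra. Qed.

Let a_ge0 : 0 <= a. Proof. by have h := a_gt; lra. Qed.

Let quot_bound x y v k : `|x - b| <= dl -> `|v| <= K * wt (1 + x - k) y -> k <= dl ->
  `|v / Num.sqrt (stab x y)| <= K / Num.sqrt c0 * wt a y.
Proof.
move=> xb hv hk; have [h1 h2 h3 h4] := rangeb xb.
have r0 : 0 < Num.sqrt (stab x y) by rewrite sqrtr_gt0 stab0.
have lb : Num.sqrt c0 * wt ((1 + x) / 2) y <= Num.sqrt (stab x y).
  by rewrite -wt_sqrt -sqrtrM ?(ltW c00)// ler_sqrt ?(ltW (stab0 _ _ _))// (se_lb E).
have cs0 : 0 < Num.sqrt c0 by rewrite sqrtr_gt0.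
rewrite normrM normfV (gtr0_norm r0) ler_pdivrMr//.
apply: (le_trans hv); rewrite -[leRHS]mulrA -[leRHS]mulrA; apply: ler_wpM2l => //.
rewrite ler_pdivlMl// [leRHS]mulrC.
have w1 : wt (1 + x - k) y <= wt ((1 + x) / 2) y * wt a y.
  by rewrite wtM; apply: wt_le; move: dl0 dlb hk h1; rewrite /a; lra.
apply: (le_trans (ler_wpM2l (ltW cs0) w1)); rewrite mulrA.
by apply: ler_wpM2r => //; exact: wt_ge0.
Qed.

(** A Lipschitz bound in the exponent with a square-integrable envelope is all that is asked of this
    direction, because sqrt(n) (be n - b) tends to 0. *)
Lemma root_stab_beta x y : `|x - b| <= dl ->
  `|Num.sqrt (stab x y) - Num.sqrt (stab b y)| <= K / Num.sqrt c0 * `|x - b| * wt a y.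
Proof.
move=> xb.
have [|z zb ->] := @mvt_between R (fun x => Num.sqrt (stab x y))
    (fun x => (2 * Num.sqrt (stab x y))^-1 * stab_b x y) b x.
  move=> z /le_trans/(_ xb)/rangeb[h1 h2 h3 h4].
  by apply: der_sqrt; [exact: stab0|exact: der_stab_b].
have zd := le_trans zb xb; have [h1 h2 h3 h4] := rangeb zd.
have q := quot_bound zd (se_bb E y h1 h2) (lexx dl).
rewrite normrM [leRHS]mulrAC; apply: ler_wpM2r => //; apply: le_trans q.
rewrite invfM -mulrA normrM ger0_norm ?invr_ge0// [in leRHS]mulrC.
by rewrite ler_piMl// invf_le1// ler1n.
Qed.

Lemma root_density_beta x s c y : `|x - b| <= dl -> `|s| <= 1 ->
  `|root_density x s c y - root_density b s c y| <=
  expR 1 * (K / Num.sqrt c0) * `|x - b| * wt a (expR (- s) * (y - c)).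
Proof.
move=> xb s1; rewrite /root_density -mulrBr normrM ger0_norm ?expR_ge0// -!mulrA.
apply: ler_pM; rewrite ?expR_ge0//.
  by rewrite ler_expR; move: s1; rewrite ler_norml => /andP[]; lra.
by rewrite !mulrA; exact: root_stab_beta.
Qed.

Lemma wt_shift s c y : `|s| <= 1 -> `|c| <= 1 ->
  wt a (expR (- s) * (y - c)) <= (1 + expR 1) `^ a * wt a y.
Proof.
move=> s1 c1; set z := expR (- s) * (y - c).
have yE : y = expR s * z + c by rewrite /z mulrA -expRD subrr expR0 mul1r subrK.
have es : expR s <= expR 1 by rewrite ler_expR; move: s1; rewrite ler_norml => /andP[].
have yz : 1 + `|y| <= (1 + expR 1) * (1 + `|z|).
  have h1 : `|y| <= expR s * `|z| + `|c|.
    by rewrite {1}yE; apply: (le_trans (ler_normD _ _)); rewrite normrM (ger0_norm (expR_ge0 s)).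
  have h2 : expR s * `|z| <= expR 1 * `|z| by exact: ler_wpM2r.
  have h3 : 1 <= expR 1 :> R by rewrite -[leLHS]expR0 ler_expR.
  by have h4 := normr_ge0 z; nra.
rewrite /wt !powRN ler_pdivlMr ?powR_gt0 ?ltr_pwDl// ler_pdivrMl ?powR_gt0 ?ltr_pwDl//.
rewrite mulrC -powRM ?addr_ge0 ?expR_ge0//.
by apply: ge0_ler_powR; rewrite // nnegrE ?addr_ge0// mulr_ge0 ?addr_ge0 ?expR_ge0.
Qed.

Let path_z (s c y t : R) : R := expR (- (t * s)) * (y - t * c).

(** The mean value theorem along the segment t -> (t s, t c). The intermediate t depends on y, which
    does no harm: the domination is uniform in t and convergence is needed for each y separately. *)
Lemma root_density_path s c y : exists2 t, 0 <= t <= 1 &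
  root_density b s c y - Num.sqrt (stab b y) =
  - 2^-1 * expR (- (t * s) / 2) *
    ((s * stab_s b (path_z s c y t) + c * expR (- (t * s)) * stab_y b (path_z s c y t))
     / Num.sqrt (stab b (path_z s c y t))).
Proof.
pose df t := - 2^-1 * expR (- (t * s) / 2) *
    ((s * stab_s b (path_z s c y t) + c * expR (- (t * s)) * stab_y b (path_z s c y t))
     / Num.sqrt (stab b (path_z s c y t))).
have D (t : R) : is_derive t 1 (fun t => root_density b (t * s) (t * c) y) (df t).
  have dz : is_derive t 1 (path_z s c y) (- s * path_z s c y t - c * expR (- (t * s))).
    rewrite /path_z; der; rewrite /=; ring.
  have ds := der_comp (der_stab_y (path_z s c y t) b0 b2) dz.
  have p0 := @stab0 b (path_z s c y t) b0 b2.
  have de : is_derive t 1 (fun t => expR (- (t * s) / 2)) (expR (- (t * s) / 2) * (- s / 2)).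
    by der; rewrite /=; ring.
  have dr := derM de (@der_sqrt R (fun t => stab b (path_z s c y t)) t _ p0 ds); apply: (der_eq dr).
  have r0 : Num.sqrt (stab b (path_z s c y t)) != 0 by rewrite gt_eqF// sqrtr_gt0.
  rewrite /df /stab_s /=.
  set w := Num.sqrt _ in r0 *; have -> : stab b (path_z s c y t) = w ^+ 2 by rewrite sqr_sqrtr// ltW.
  by field.
have [|t tin] := @MVT_segment R (fun t => root_density b (t * s) (t * c) y) df 0 1 ler01.
  by apply: continuous_in_subspaceT => x _; exact: der_continuous (D x).
rewrite !mul0r !mul1r subr0 mulr1 => Et; exists t; first by move: tin; rewrite in_itv.
rewrite -/(df t) -Et; congr (_ - _).
by rewrite /root_density oppr0 mul0r expR0 !mul1r addr0.
Qed.

Lemma root_densityE x s c y :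
  root_density x s c y = expR (- s / 2) * Num.sqrt (stab x (expR (- s) * (y - c))).
Proof. by []. Qed.

(* Otherwise unification compares these functions by unfolding their integrals. *)
Opaque root_density stab stab_y stab_b.

Section local_alternatives.
Variables (be s c : nat -> R) (tau kap : R).
Local Notation r n := (Num.sqrt (n%:R : R)).
Hypotheses (hb : r n * (be n - b) @[n --> \oo] --> 0)
  (hs : r n * s n @[n --> \oo] --> tau) (hc : r n * c n @[n --> \oo] --> kap).

Let scaled (u : nat -> R) (l : R) : r n * u n @[n --> \oo] --> l -> u n @[n --> \oo] --> 0.
Proof.
move=> h; have h1 := seqM (@cvg_sqrtn_inv R) h; rewrite mul0r in h1.
apply: seq_eq h1; near=> n.
have n0 : (0 < n)%N by near: n; exact: nbhs_infty_gt.
by rewrite mulKf// gt_eqF// sqrtr_gt0 ltr0n.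
Unshelve. all: by end_near. Qed.

Let q := K / Num.sqrt c0.
Let q0 : 0 <= q. Proof. by rewrite divr_ge0// sqrtr_ge0. Qed.
Let e1 : R := expR 1.
Let e10 : 0 <= e1. Proof. exact: expR_ge0. Qed.
Let dd : R := (1 + e1) `^ a.
Let dd0 : 0 <= dd. Proof. exact: powR_ge0. Qed.

(** The parameters lie where the estimates hold. A boolean, so that functions can be defined by
    cases and dominated convergence can be stated for all n. *)
Definition admissible n : bool := [&& `|be n - b| <= dl, `|s n| <= 1, `|c n| <= 1,
  r n * `|be n - b| <= 1, `|r n * s n| <= `|tau| + 1 & `|r n * c n| <= `|kap| + 1].

Lemma near_admissible : \forall n \near \oo, admissible n.
Proof.
have b1 := scaled hb; have s1 := scaled hs; have c1 := scaled hc.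
have nb := seq_norm b1; have ns := seq_norm s1; have nc := seq_norm c1.
have mb := seq_norm hb; have ms := seq_norm hs; have mc := seq_norm hc.
rewrite !normr0 in nb ns nc mb.
near=> n; apply/and5P; split; last (apply/andP; split).
- near: n; exact: (seq_le nb dl0).
- near: n; exact: (seq_le ns ltr01).
- near: n; exact: (seq_le nc ltr01).
- have -> : r n * `|be n - b| = `|r n * (be n - b)| by rewrite normrM ger0_norm ?sqrtr_ge0.
  near: n; exact: (seq_le mb ltr01).
- by near: n; apply: (seq_le ms); rewrite ltrDl.
- by near: n; apply: (seq_le mc); rewrite ltrDl.
Unshelve. all: by end_near. Qed.

Let root y := Num.sqrt (stab b y).
(** This is the error of the quadratic-mean derivative times the root of the density: the Lebesgue
    integral of its square is the squared L2 error under Q. *)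
Let F n y := r n * (2 * (root_density (be n) (s n) (c n) y - root y)) -
  stable_score b tau kap y * root y.

Let F_split n y : F n y =
    r n * (2 * (root_density (be n) (s n) (c n) y - root_density b (s n) (c n) y)) +
    r n * (2 * (root_density b (s n) (c n) y - root y)) - stable_score b tau kap y * root y.
Proof.
rewrite /F; move: (root_density (be n) (s n) (c n) y) (root_density b (s n) (c n) y) (root y)
  (stable_score b tau kap y) (r n) => A1 A2 A3 A4 A5; ring.
Qed.

Let step1 n y : admissible n ->
  `|r n * (2 * (root_density (be n) (s n) (c n) y - root_density b (s n) (c n) y))| <=
  2 * e1 * q * (r n * `|be n - b|) * wt a (expR (- s n) * (y - c n)).
Proof.
move=> /and5P[a1 a2 a3 a4 /andP[a5 a6]].
have h := root_density_beta (c n) y a1 a2.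
rewrite 2!normrM (ger0_norm (sqrtr_ge0 _)) (ger0_norm (ler0n _ 2)).
have h1 : 0 <= r n * 2 by rewrite mulr_ge0 ?sqrtr_ge0.
rewrite mulrA; apply: (le_trans (ler_wpM2l h1 h)).
by rewrite le_eqVlt; apply/orP; left; apply/eqP; rewrite /e1 /q; ring.
Qed.

Let score_root y : stable_score b tau kap y * root y =
  - ((tau * stab_s b y + kap * stab_y b y) / Num.sqrt (stab b y)).
Proof.
have p0 := stab0 y b0 b2.
have r0 : root y != 0 by rewrite gt_eqF// sqrtr_gt0.
rewrite /stable_score -/(root y).
have -> : stab b y = root y ^+ 2 by rewrite sqr_sqrtr// ltW.
by field.
Qed.

Let near_b : `|b - b| <= dl. Proof. by rewrite subrr normr0 ltW. Qed.

Let quot_s y : `|stab_s b y / Num.sqrt (stab b y)| <= q * wt a y.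
Proof.
have [h1 h2 _ _] := rangeb near_b; apply: quot_bound near_b _ (ltW dl0).
by rewrite subr0; exact: (se_s E).
Qed.

Let quot_y y : `|stab_y b y / Num.sqrt (stab b y)| <= q * wt a y.
Proof.
have [h1 h2 _ _] := rangeb near_b; apply: quot_bound near_b _ (ltW dl0).
by rewrite subr0; exact: (se_y E).
Qed.

Let quot_comb x1 x2 y : `|(x1 * stab_s b y + x2 * stab_y b y) / Num.sqrt (stab b y)| <=
  (`|x1| + `|x2|) * (q * wt a y).
Proof.
have -> : (x1 * stab_s b y + x2 * stab_y b y) / Num.sqrt (stab b y) =
  x1 * (stab_s b y / Num.sqrt (stab b y)) + x2 * (stab_y b y / Num.sqrt (stab b y)) by ring.
apply: (le_trans (ler_normD _ _)); rewrite [leRHS]mulrDl !(normrM x1) !(normrM x2).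
by apply: lerD; apply: ler_wpM2l.
Qed.

Let step2E n y : exists2 t, 0 <= t <= 1 &
  r n * (2 * (root_density b (s n) (c n) y - root y)) =
  - (expR (- (t * s n) / 2) *
    (((r n * s n) * stab_s b (path_z (s n) (c n) y t) +
      (r n * c n) * expR (- (t * s n)) * stab_y b (path_z (s n) (c n) y t))
     / Num.sqrt (stab b (path_z (s n) (c n) y t)))).
Proof.
have [t t01 ->] := root_density_path (s n) (c n) y; exists t => //.
have p0 := stab0 (path_z (s n) (c n) y t) b0 b2.
have r0 : Num.sqrt (stab b (path_z (s n) (c n) y t)) != 0 by rewrite gt_eqF// sqrtr_gt0.
by field.
Qed.

Let contract (t x : R) : 0 <= t <= 1 -> `|x| <= 1 -> `|t * x| <= 1.
Proof. by move=> /andP[t0 t1] x1; rewrite normrM (ger0_norm t0) mulr_ile1. Qed.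

Let exp_le (x : R) : `|x| <= 1 -> expR (- x) <= e1 /\ expR (- x / 2) <= e1.
Proof. by rewrite ler_norml !ler_expR => /andP[h1 h2]; split; lra. Qed.

Let step2 n y : admissible n ->
  `|r n * (2 * (root_density b (s n) (c n) y - root y))| <=
  e1 * ((`|tau| + 1) + (`|kap| + 1) * e1) * q * dd * wt a y.
Proof.
move=> /and5P[a1 a2 a3 a4 /andP[a5 a6]].
have [t t01 ->] := step2E n y.
have [x1 x2] := exp_le (contract t01 a2).
rewrite normrN normrM (ger0_norm (expR_ge0 _)) -3![leRHS]mulrA.
apply: ler_pM; [exact: expR_ge0|exact: normr_ge0|exact: x2|].
apply: (le_trans (quot_comb _ _ _)); apply: ler_pM.
- by rewrite addr_ge0.
- by rewrite mulr_ge0// wt_ge0.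
- by rewrite lerD// normrM (ger0_norm (expR_ge0 _)) ler_pM.
- rewrite ler_wpM2l//; have := wt_shift y (contract t01 a2) (contract t01 a3).
  by rewrite /path_z.
Qed.

Let dom n y : admissible n -> `|F n y| <=
  (2 * e1 * q * dd + e1 * ((`|tau| + 1) + (`|kap| + 1) * e1) * q * dd + (`|tau| + `|kap|) * q) * wt a y.
Proof.
move=> an; have h1 := step1 y an; have h2 := step2 y an.
have [a1 a2 a3 a4 _] := and5P an.
have h3 : `|stable_score b tau kap y * root y| <= (`|tau| + `|kap|) * q * wt a y.
  by rewrite score_root normrN -mulrA; exact: quot_comb.
have h1' : 2 * e1 * q * (r n * `|be n - b|) * wt a (expR (- s n) * (y - c n)) <=
    2 * e1 * q * dd * wt a y.
  rewrite -mulrA -[leRHS]mulrA; apply: ler_wpM2l; first by rewrite !mulr_ge0.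
  by apply: le_trans (wt_shift y a2 a3); rewrite ler_piMl ?wt_ge0.
rewrite F_split.
rewrite [leRHS]mulrDl [X in _ <= X + _]mulrDl.
apply: (le_trans (ler_normB _ _)); apply: lerD => //.
by apply: (le_trans (ler_normD _ _)); apply: lerD; [exact: le_trans h1 h1'|].
Qed.

Let step1_cvg y : r n * (2 * (root_density (be n) (s n) (c n) y -
  root_density b (s n) (c n) y)) @[n --> \oo] --> (0 : R).
Proof.
apply: (@cvg0_le _ _ _ _ _ (fun n => 2 * e1 * q * `|r n * (be n - b)|)).
  near=> n; apply: (le_trans (step1 _ _)); first by near: n; exact: near_admissible.
  rewrite normrM (ger0_norm (sqrtr_ge0 _)) ler_piMr ?wt_le1//.
  by rewrite !mulr_ge0 ?sqrtr_ge0.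
have h := seq_norm hb; rewrite normr0 in h.
by have h2 := seqM (seqC (2 * e1 * q)) h; rewrite mulr0 in h2; exact: h2.
Unshelve. all: by end_near. Qed.

(** For each n an intermediate point t n in [0, 1] is chosen. As s n and c n tend to 0, the argument
    [path_z] tends to y whatever these choices are. *)
Let step2_cvg y : r n * (2 * (root_density b (s n) (c n) y - root y)) @[n --> \oo] -->
  stable_score b tau kap y * root y.
Proof.
have H n : exists t, 0 <= t <= 1 /\
    r n * (2 * (root_density b (s n) (c n) y - root y)) =
    - (expR (- (t * s n) / 2) *
    (((r n * s n) * stab_s b (path_z (s n) (c n) y t) +
      (r n * c n) * expR (- (t * s n)) * stab_y b (path_z (s n) (c n) y t))
     / Num.sqrt (stab b (path_z (s n) (c n) y t)))).
  by have [t t01 h] := step2E n y; exists t.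
have [t ht] := choice H.
apply: seq_eq; first by near=> n; exact: esym (ht n).2.
have small (u : nat -> R) : u n @[n --> \oo] --> 0 -> t n * u n @[n --> \oo] --> 0.
  move=> u0; apply: (@cvg0_le _ _ _ _ _ (fun n => `|u n|)).
    near=> n; have [/andP[t0 t1] _] := ht n.
    by rewrite normrM (ger0_norm t0) ler_piMl.
  by have h := seq_norm u0; rewrite normr0 in h.
have ts := small _ (scaled hs); have tc := small _ (scaled hc).
have es : expR (- (t n * s n)) @[n --> \oo] --> (1 : R).
  have h := seqN ts; rewrite oppr0 in h; rewrite -[1]expR0.
  exact: (continuous_cvg _ (@continuous_expR R 0) h).
have es2 : expR (- (t n * s n) / 2) @[n --> \oo] --> (1 : R).
  have h := seqM (seqN ts) (seqC 2^-1); rewrite oppr0 mul0r in h; rewrite -[X in _ --> X]expR0.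
  exact: (continuous_cvg _ (@continuous_expR R 0) h).
have zz : path_z (s n) (c n) y (t n) @[n --> \oo] --> y.
  have h := seqM es (seqB (seqC y) tc); rewrite mul1r subr0 in h; exact: h.
have ls : stab b (path_z (s n) (c n) y (t n)) @[n --> \oo] --> stab b y.
  by apply: (cvg_stab b0 b2 (fun=> lexx b)) zz; exact: cvg_cst.
have ly : stab_y b (path_z (s n) (c n) y (t n)) @[n --> \oo] --> stab_y b y.
  by apply: (cvg_stab_y b0 b2 (fun=> lexx b)) zz; exact: cvg_cst.
have lss : stab_s b (path_z (s n) (c n) y (t n)) @[n --> \oo] --> stab_s b y.
  by rewrite /stab_s; apply: cvgD => //; exact: cvgM.
have p0 := stab0 y b0 b2.
have lr : Num.sqrt (stab b (path_z (s n) (c n) y (t n))) @[n --> \oo] --> Num.sqrt (stab b y).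
  exact: (continuous_cvg _ (@sqrt_continuous R _) ls).
have r0 : Num.sqrt (stab b y) != 0 by rewrite gt_eqF// sqrtr_gt0.
have l1 := seqD (seqM hs lss) (seqM (seqM hc es) ly).
have l2 := seqN (seqM es2 (seqM l1 (seqV r0 lr))).
by rewrite score_root; rewrite mulr1 mul1r in l2; exact: l2.
Unshelve. all: by end_near. Qed.

Let F_cvg y : F n y @[n --> \oo] --> 0.
Proof.
have h := seqB (seqD (@step1_cvg y) (@step2_cvg y)) (seqC (stable_score b tau kap y * root y)).
apply: (seq_to _ (_ : 0 + stable_score b tau kap y * root y - stable_score b tau kap y * root y = 0)).
  apply: seq_eq h; near=> n.
  by rewrite F_split.
by rewrite add0r subrr.
Unshelve. all: by end_near. Qed.

Let mstab := meas_stab b0 b2.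

Let mroot : measurable_fun setT root. Proof. by rewrite /root; meas. Qed.

Let mscore : measurable_fun setT (stable_score b tau kap).
Proof.
by have h1 := meas_stab_y b0 b2; have h2 := meas_stab_s b0 b2; rewrite /stable_score; meas.
Qed.

Let mroot_density n : admissible n -> measurable_fun setT (root_density (be n) (s n) (c n)).
Proof.
move=> /and5P[/rangeb[_ _ x0 x2] _ _ _ _].
have h : measurable_fun setT (fun y : R => stab (be n) (expR (- s n) * (y - c n))).
  by apply: meas_comp (meas_stab x0 x2) _; meas.
rewrite (_ : root_density _ _ _ = fun y => expR (- s n / 2) * Num.sqrt (stab (be n) (expR (- s n) * (y - c n)))).
  by apply: measM; [exact: meas_cst|apply: meas_sqrt].
by apply/funext => y; exact: root_densityE.
Qed.

Let F2_cvg : \int[mu]_y (if admissible n then F n y ^+ 2 else 0) @[n --> \oo] --> 0.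
Proof.
set C := 2 * e1 * q * dd + e1 * ((`|tau| + 1) + (`|kap| + 1) * e1) * q * dd + (`|tau| + `|kap|) * q.
apply: seq_to (@Rintegral_cst0 _ _ R mu setT).
apply: (@Rintegral_dominated_cvg _ _ R mu setT _ (fun=> 0) (fun y => C ^+ 2 * wt (2 * a) y)) => //.
- move=> n; have [an|an] := boolP (admissible n); last by meas.
  have h := mroot_density an.
  apply: measX; apply: measB.
    by apply: measM; [exact: meas_cst|apply: measM; [exact: meas_cst|exact: measB]].
  exact: measM.
- move=> y _; have h : F n y ^+ 2 @[n --> \oo] --> 0.
    by have := seqM (@F_cvg y) (@F_cvg y); rewrite mul0r.
  apply: seq_eq h; near=> n.
  by rewrite ifT//; near: n; exact: near_admissible.
- by apply: RintegrableZ => //; exact: integrable_wt.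
- move=> n y _; case: ifPn => an; last by rewrite normr0 mulr_ge0 ?sqr_ge0 ?wt_ge0.
  by rewrite normrX -wtX -exprMn; apply: lerXn2r; rewrite ?nnegrE//;
    [exact: le_trans (dom y an)|exact: dom].
Unshelve. all: by end_near. Qed.

Variable Q : probability (measurableTypeR R) R.
Hypothesis HQ : has_density Q (stab b).

(* The value [0] only concerns finitely many [n]. *)
Definition hellinger n (y : R) : R :=
  if admissible n then 2 * (root_density (be n) (s n) (c n) y / Num.sqrt (stab b y) - 1) else 0.

Let root_gt0 y : 0 < root y. Proof. by rewrite sqrtr_gt0 stab0. Qed.
Let root2 y : root y ^+ 2 = stab b y. Proof. by rewrite sqr_sqrtr// ltW// stab0. Qed.

Let stab_nn y : 0 <= stab b y. Proof. by rewrite ltW// stab0. Qed.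

Lemma meas_hellinger n : measurable_fun setT (hellinger n).
Proof.
have [an|an] := boolP (admissible n); rewrite /hellinger ?an ?(negbTE an); last by meas.
by have h1 := mroot_density an; have h2 := mstab; meas.
Qed.

Let rd2 n y : admissible n -> root_density (be n) (s n) (c n) y ^+ 2 =
  expR (- s n) * stab (be n) (expR (- s n) * y - expR (- s n) * c n).
Proof.
move=> /and5P[/rangeb[_ _ x0 x2] _ _ _ _].
rewrite root_densityE exprMn sqr_sqrtr ?ltW ?stab0//= mulrBr; congr (_ * _).
by rewrite expr2 -expRD; congr expR; lra.
Qed.

Let int_rd2 n : admissible n ->
  mu.-integrable setT (EFin \o (fun y => root_density (be n) (s n) (c n) y ^+ 2)) /\
  \int[mu]_y (root_density (be n) (s n) (c n) y ^+ 2) = 1.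
Proof.
move=> an; have [/rangeb[_ _ x0 x2] _ _ _ _] := and5P an.
have -> : (fun y => root_density (be n) (s n) (c n) y ^+ 2) =
    (fun y => expR (- s n) * stab (be n) (expR (- s n) * y - expR (- s n) * c n)).
  by apply/funext => y; exact: rd2.
have e0 := expR_gt0 (- s n).
have j := integrable_affine (- (expR (- s n) * c n)) e0 (integrable_stab x0 x2).
split; first exact: RintegrableZ.
rewrite RintegralZl// -(Rintegral_affine (- (expR (- s n) * c n)) e0 (integrable_stab x0 x2)).
exact: (Rintegral_stab Hcos).
Qed.

Let hell_root n y : admissible n -> hellinger n y * root y =
  2 * (root_density (be n) (s n) (c n) y - root y).
Proof. by move=> an; rewrite /hellinger an; have /gt_eqF/negbT r0 := root_gt0 y; move: r0; rewrite /root => r0; field. Qed.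

Let int_hell2 n : mu.-integrable setT (EFin \o (fun y => stab b y * hellinger n y ^+ 2)).
Proof.
have [an|an] := boolP (admissible n); last first.
  have -> : (fun y => stab b y * hellinger n y ^+ 2) = fun=> 0.
    by apply/funext => y; rewrite /hellinger (negbTE an) expr0n mulr0.
  exact: integrable0.
have [j _] := int_rd2 an.
have m1 := mroot_density an; have m2 := meas_hellinger n; have m3 := mstab.
apply: (@Rintegrable_le _ _ _ mu setT _
  (fun y => 8 * (root_density (be n) (s n) (c n) y ^+ 2) + 8 * stab b y)) => //.
- by meas.
- move=> y _; rewrite -root2 -exprMn mulrC hell_root// normrX real_normK ?num_real//.
  set u := root_density _ _ _ _; set w := root y.
    by have := sqr_ge0 (u + w); nra.
- exact: (RintegrableD measurableT (RintegrableZ 8 measurableT j)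
    (RintegrableZ 8 measurableT (integrable_stab b0 b2))).
Qed.

Lemma integrable_hellinger2 n : Q.-integrable setT (EFin \o (fun y => hellinger n y ^+ 2)).
Proof.
have m2 := meas_hellinger n.
by apply: (integrable_density_iff stab_nn mstab HQ); [meas|exact: int_hell2].
Qed.

(** With W = 2 (sqrt(f_n / f) - 1), the ratio f_n / f equals 1 + W + W^2 / 4, and f_n and f both
    have mass 1. *)
Lemma hellinger_mean n : \int[Q]_y hellinger n y = - (4^-1 * \int[Q]_y (hellinger n y ^+ 2)).
Proof.
have m2 := meas_hellinger n; have j2 := integrable_hellinger2 n.
have j1 := (integrable_of_sq m2 j2).1.
apply/eqP; rewrite -addr_eq0 -RintegralZl// -RintegralD//; last exact: RintegrableZ.
have [an|an] := boolP (admissible n); last first.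
  apply/eqP; rewrite -[RHS](@Rintegral_cst0 _ _ R Q setT); congr Rintegral; apply/funext => y.
  by rewrite /hellinger (negbTE an) expr0n mulr0 addr0.
have [jr er] := int_rd2 an.
have E0 : (fun y => stab b y * (hellinger n y + 4^-1 * hellinger n y ^+ 2)) =
    (fun y => root_density (be n) (s n) (c n) y ^+ 2 - stab b y).
  apply/funext => y; rewrite -root2 /hellinger an -/(root y).
  by have /gt_eqF/negbT r0 := root_gt0 y; move: r0; rewrite /root => r0; field.
rewrite (Rintegral_density stab_nn mstab HQ); [|by meas|rewrite E0].
- rewrite E0 RintegralB//; last exact: integrable_stab.
  by rewrite er (Rintegral_stab Hcos)// subrr.
- by apply: RintegrableB => //; exact: integrable_stab.
Qed.

Lemma hellinger_score : \int[Q]_y ((r n * hellinger n y - stable_score b tau kap y) ^+ 2)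
  @[n --> \oo] --> 0.
Proof.
apply: seq_eq F2_cvg; near=> n.
have an : admissible n by near: n; exact: near_admissible.
have E0 : (fun y => stab b y * (r n * hellinger n y - stable_score b tau kap y) ^+ 2) =
    (fun y => if admissible n then F n y ^+ 2 else 0).
  apply/funext => y; rewrite an -root2 -exprMn mulrC mulrBl -mulrA hell_root//.
have m2 := meas_hellinger n.
have mD : measurable_fun setT (fun y => (r n * hellinger n y - stable_score b tau kap y) ^+ 2).
  by apply: measX; apply: measB => //; apply: measM => //; exact: meas_cst.
rewrite -E0 (Rintegral_density stab_nn mstab HQ)// E0.
apply: (@Rintegrable_le _ _ _ mu setT _ (fun y => (2 * e1 * q * dd + e1 * ((`|tau| + 1) +
  (`|kap| + 1) * e1) * q * dd + (`|tau| + `|kap|) * q) ^+ 2 * wt (2 * a) y)) => //.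
- by rewrite -E0; exact: measM.
- move=> y _; rewrite an normrX -wtX -exprMn; apply: lerXn2r; rewrite ?nnegrE//;
    [exact: le_trans (dom y an)|exact: dom].
- by apply: RintegrableZ => //; exact: integrable_wt.
Unshelve. all: by end_near. Qed.

(** Numerator and density have the same tail order |y|^-(1 + b); this is where the lower bound on
    the density pays off. *)
Lemma stable_score_bound y : `|stable_score b tau kap y| <= (`|tau| + `|kap|) * (K / c0).
Proof.
have [h1 h2 _ _] := rangeb near_b; have p0 := stab_nn y.
have lb := se_lb E y h1 h2; have w0 := wt_gt0 (1 + b) y.
have cw : 0 < c0 * wt (1 + b) y by rewrite mulr_gt0.
have sp : 0 < stab b y := lt_le_trans cw lb.
rewrite /stable_score normrM normfV (gtr0_norm sp) ler_pdivrMr// normrN.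
have hs' := se_s E y h1 h2; have hy' := se_y E y h1 h2.
apply: (@le_trans _ _ ((`|tau| + `|kap|) * (K * wt (1 + b) y))).
  apply: (le_trans (ler_normD _ _)); rewrite [leRHS]mulrDl !normrM.
  by apply: lerD; apply: ler_wpM2l.
rewrite -mulrA; apply: ler_wpM2l; first by rewrite addr_ge0.
rewrite -mulrA; apply: ler_wpM2l => //.
by rewrite ler_pdivlMl.
Qed.

Context d (T : measurableType d) (P : probability T R) (xi : nat -> nat -> T -> R).
Hypothesis Hxi : forall n, iid P Q n (xi n).

Lemma stable_score_centered : \int[Q]_y stable_score b tau kap y = 0.
Proof.
exact: (lan_centered meas_hellinger mscore stable_score_bound integrable_hellinger2
  hellinger_mean hellinger_score).
Qed.

Lemma stable_lan : little_op1 P (fun n w =>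
  \sum_(0 <= i < n) (- s n + ln (stab (be n) (expR (- s n) * (xi n i w - c n))) - ln (stab b (xi n i w)))
  - (Num.sqrt n%:R)^-1 * \sum_(0 <= i < n) stable_score b tau kap (xi n i w)
  + (\int[Q]_y (stable_score b tau kap y ^+ 2)) / 2).
Proof.
have h := lan_expansion Hxi meas_hellinger mscore stable_score_bound integrable_hellinger2
  hellinger_mean hellinger_score.
apply: op1_near h; near=> n.
have an : admissible n by near: n; exact: near_admissible.
have [/rangeb[_ _ x0 x2] _ _ _ _] := and5P an.
apply/funext => w; congr (_ - _ + _); apply: eq_bigr => i _.
have p1 := @stab0 (be n) (expR (- s n) * (xi n i w - c n)) x0 x2.
have p2 := @stab0 b (xi n i w) b0 b2.
rewrite /hellinger an root_densityE.
move: p1 p2; set v1 := stab (be n) _; set v2 := stab b _; move: v1 v2 => v1 v2 p1 p2.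
exact: ln_root_quotient.
Unshelve. all: by end_near. Qed.

End local_alternatives.

(** * Moments of the scale, location and exponent scores *)

Section scores.
Variable Q : probability (measurableTypeR R) R.
Hypothesis HQ : has_density Q (stab b).

Let near_b : `|b - b| <= dl. Proof. by rewrite subrr normr0 ltW. Qed.
Let pos y : 0 < stab b y. Proof. exact: stab0. Qed.
Let nn y : 0 <= stab b y. Proof. exact: ltW. Qed.
Let mstab := meas_stab b0 b2.

Let quot_integrable (v w : R -> R) k l : k <= dl -> l <= dl -> measurable_fun setT v ->
  measurable_fun setT w -> (forall y, `|v y| <= K * wt (1 + b - k) y) ->
  (forall y, `|w y| <= K * wt (1 + b - l) y) ->
  mu.-integrable setT (EFin \o (fun y => v y * w y / stab b y)).
Proof.
move=> hk hl mv mw hv hw.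
apply: (@Rintegrable_le _ _ _ mu setT _ (fun y => (K / Num.sqrt c0) ^+ 2 * wt (2 * a) y)) => //.
- by apply: measM; [exact: measM|apply: measV].
- move=> y _; have -> : v y * w y / stab b y =
      (v y / Num.sqrt (stab b y)) * (w y / Num.sqrt (stab b y)).
    by rewrite mulrACA -invfM -expr2 sqr_sqrtr.
  rewrite normrM -wtX -exprMn expr2; apply: ler_pM => //.
    exact: (quot_bound near_b (hv y) hk).
  exact: (quot_bound near_b (hw y) hl).
- by apply: RintegrableZ => //; exact: integrable_wt.
Qed.

Let ds y : `|stab_s b y| <= K * wt (1 + b - 0) y.
Proof. by have [h1 h2 _ _] := rangeb near_b; rewrite subr0; exact: (se_s E). Qed.
Let dy y : `|stab_y b y| <= K * wt (1 + b - 0) y.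
Proof. by have [h1 h2 _ _] := rangeb near_b; rewrite subr0; exact: (se_y E). Qed.
Let db y : `|stab_b b y| <= K * wt (1 + b - dl) y.
Proof. by have [h1 h2 _ _] := rangeb near_b; exact: (se_bb E). Qed.

Lemma integrable_stab_s2 : mu.-integrable setT (EFin \o (fun y => stab_s b y ^+ 2 / stab b y)).
Proof.
by have m := meas_stab_s b0 b2; exact: (quot_integrable (ltW dl0) (ltW dl0) m m ds ds).
Qed.

Lemma integrable_stab_y2 : mu.-integrable setT (EFin \o (fun y => stab_y b y ^+ 2 / stab b y)).
Proof.
by have m := meas_stab_y b0 b2; exact: (quot_integrable (ltW dl0) (ltW dl0) m m dy dy).
Qed.

Let integrable_stab_sy : mu.-integrable setT (EFin \o (fun y => stab_s b y * stab_y b y / stab b y)).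
Proof.
by exact: (quot_integrable (ltW dl0) (ltW dl0) (meas_stab_s b0 b2) (meas_stab_y b0 b2) ds dy).
Qed.

(** An even function times an odd one: scale and location scores are orthogonal, which produces the
    zeros of the information matrix. *)
Let Rintegral_stab_sy : \int[mu]_y (stab_s b y * stab_y b y / stab b y) = 0.
Proof.
apply: Rintegral_odd integrable_stab_sy _ => y.
by rewrite /stab_s stab_y_odd// stab_even; ring.
Qed.

Lemma stable_score_sq t k : \int[Q]_y (stable_score b t k y ^+ 2) =
  t ^+ 2 * \int[mu]_y (stab_s b y ^+ 2 / stab b y) + k ^+ 2 * \int[mu]_y (stab_y b y ^+ 2 / stab b y).
Proof.
have E0 : (fun y => stab b y * stable_score b t k y ^+ 2) = (fun y =>
   t ^+ 2 * (stab_s b y ^+ 2 / stab b y) + k ^+ 2 * (stab_y b y ^+ 2 / stab b y) +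
   2 * t * k * (stab_s b y * stab_y b y / stab b y)).
  apply/funext => y; have /gt_eqF/negbT p0 := pos y; rewrite /stable_score.
  by move: (stab_s b y) (stab_y b y) (stab b y) p0 => x1 x2 x3 x30; field.
have i1 := RintegrableZ (t ^+ 2) measurableT integrable_stab_s2.
have i2 := RintegrableZ (k ^+ 2) measurableT integrable_stab_y2.
have i3 := RintegrableZ (2 * t * k) measurableT integrable_stab_sy.
have i12 := RintegrableD measurableT i1 i2.
have m : measurable_fun setT (stable_score b t k).
  have h1 := meas_stab_y b0 b2; have h2 := meas_stab_s b0 b2.
  by rewrite /stable_score; meas.
rewrite (Rintegral_density nn mstab HQ); [|exact: measX|by rewrite E0; exact: RintegrableD].
rewrite E0 RintegralD// RintegralD// (RintegralZl _ measurableT integrable_stab_s2).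
rewrite (RintegralZl _ measurableT integrable_stab_y2) (RintegralZl _ measurableT integrable_stab_sy).
by rewrite Rintegral_stab_sy mulr0 addr0.
Qed.

Let mscore_b : measurable_fun setT (fun y => stab_b b y / stab b y).
Proof. by apply: measM; [exact: meas_stab_b|exact: measV]. Qed.

(** The derivative in the exponent loses [dl] in its decay, so the quotient is not shown to be
    bounded; its square is still integrable under Q. *)
Lemma integrable_score_beta2 :
  Q.-integrable setT (EFin \o (fun y => (stab_b b y / stab b y) ^+ 2)).
Proof.
apply: (integrable_density_iff nn mstab HQ); first exact: measX.
rewrite (_ : (fun y => _) = fun y => stab_b b y * stab_b b y / stab b y).
  by have m := meas_stab_b b0 b2; exact: (quot_integrable (lexx dl) (lexx dl) m m db db).
apply/funext => y; have /gt_eqF/negbT p0 := pos y.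
by move: (stab_b b y) (stab b y) p0 => x1 x2 x20; field.
Qed.

Lemma score_beta_centered : \int[Q]_y (stab_b b y / stab b y) = 0.
Proof.
have E0 : (fun y => stab b y * (stab_b b y / stab b y)) = stab_b b.
  by apply/funext => y; rewrite mulrC divfK// gt_eqF.
rewrite (Rintegral_density nn mstab HQ) ?E0//; first exact: (Rintegral_stab_b Hnn Hcos).
apply: (@Rintegrable_le _ _ _ mu setT _ (fun y => K * wt (1 + b - dl) y)) => //.
- exact: meas_stab_b.
- by apply: RintegrableZ => //; apply: integrable_wt; move: dl0 dlb; lra.
Qed.

End scores.

End shifted_density.

(** * Levy's continuity theorem *)

Lemma seq_sum (R : realType) (I : Type) (r : seq I) (u : I -> nat -> R) (l : I -> R) :
  (forall i, u i n @[n --> \oo] --> l i) ->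
  \sum_(i <- r) u i n @[n --> \oo] --> \sum_(i <- r) l i.
Proof.
move=> h; elim: r => [|i r IH].
  by rewrite big_nil; apply: seq_eq (seqC 0); near=> n; rewrite big_nil.
rewrite big_cons; apply: seq_eq (seqD (h i) IH).
by near=> n; rewrite big_cons.
Unshelve. all: by end_near. Qed.

(** * Multilinear interpolation of continuous functions on grids *)

Section grid.
Context (R : realType) (m : nat).
Implicit Types (x y : 'cV[R]_m.+1) (f : 'cV[R]_m.+1 -> R).

Definition close_within f x (dl e : R) :=
  forall y, (forall i, `|x i 0 - y i 0| < dl) -> `|f x - f y| <= e.

Lemma close_within_le f x dl dl' e : dl' <= dl -> close_within f x dl e -> close_within f x dl' e.
Proof. by move=> h H y hy; apply: H => i; exact: lt_le_trans (hy i) h. Qed.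

Lemma continuous_close f x e : continuous f -> 0 < e -> exists2 dl, 0 < dl & close_within f x dl e.
Proof.
move=> cf e0; have /cvg_ballP/(_ _ e0) := cf x.
move=> /nbhs_ballP[r/= r0 hr]; exists r => // y hy.
by rewrite ltW//; apply: (hr y); split=> // i j; rewrite (ord1 j)/= /ball/=; exact: hy.
Qed.

(** Uniform continuity on the cube by compactness, in a form where the second point may leave the
    cube. *)
Lemma cube_close f (N e : R) : continuous f -> 0 < e -> exists2 dl, 0 < dl &
  forall x, (forall i, `|x i 0| <= N) -> close_within f x dl e.
Proof.
move=> cf e0; pose K := [set v : 'rV[R]_m.+1 | forall i, `[(- N), N]%classic (v ord0 i)].
have cK : compact K := @rV_compact R m.+1 (fun=> `[(- N), N]%classic) (fun=> @segment_compact R _ _).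
have := compact_near_coveringP K; move=> [/(_ cK) + _].
move=> /(_ R (at_right 0) (fun dl v => close_within f v^T dl e)) h.
have {}h : \forall dl \near at_right (0 : R), K `<=` (fun v => close_within f v^T dl e).
  apply: h => v Kv; have e20 : 0 < e / 2 by rewrite divr_gt0.
  have [r r0 hr] := continuous_close v^T cf e20.
  exists (ball v (r / 2), [set dl | dl < r / 2]) => /=.
    split; first by apply: nbhsx_ballx; rewrite divr_gt0.
    by apply: nbhs_right_lt; rewrite divr_gt0.
  move=> [v' dl]/= [hv' hdl] y hy.
  have hv i : `|v 0 i - v' 0 i| < r / 2 := hv'.2 0 i.
  have h1 : `|f v^T - f v'^T| <= e / 2.
    by apply: hr => i; rewrite !mxE; apply: lt_le_trans (hv i) _; lra.
  have h2 : `|f v^T - f y| <= e / 2.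
    apply: hr => i; have h3 := hy i; rewrite !mxE in h3 *.
    rewrite (_ : _ - _ = (v 0 i - v' 0 i) + (v' 0 i - y i 0)); last by ring.
    by apply: le_lt_trans (ler_normD _ _) _; have := hv i; lra.
  rewrite (_ : _ - _ = (f v^T - f y) - (f v^T - f v'^T)); last by ring.
  by apply: le_trans (ler_normB _ _) _; lra.
have [dl [/= dl0 hdl]] : exists dl, 0 < dl /\ K `<=` (fun v => close_within f v^T dl e).
  near (at_right (0:R)) => dl; exists dl; split; near: dl => //.
  exact: nbhs_right_gt.
exists dl => // x hx; rewrite -[x]trmxK; apply: hdl => i /=.
by rewrite mxE in_itv/= -ler_norml.
Unshelve. all: by end_near. Qed.

(* Piecewise multilinear interpolation of [f] on the grid of mesh [k^-1] filling
   the cube [-L/k, L/k]^(m+1). *)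
Definition grid_point (k L : nat) (ka : {ffun 'I_m.+1 -> 'I_L.*2.+1}) : 'cV[R]_m.+1 :=
  \col_i (((ka i)%:R - L%:R) / k%:R).

Definition grid_interpolation f (k L : nat) x : R :=
  \sum_(ka : {ffun 'I_m.+1 -> 'I_L.*2.+1})
    f (grid_point k ka) * \prod_i hat (k%:R * x i 0 + L%:R - (ka i)%:R).

(** The total weight of the interpolation: 1 inside the cube and 0 at distance more than one mesh
    outside. *)
Definition cutoff (k L : nat) x : R := \prod_i trapezoid L (k%:R * x i 0).

Lemma grid_interpolation1 k L x : grid_interpolation (fun=> 1) k L x = cutoff k L x.
Proof.
rewrite /cutoff /trapezoid bigA_distr_bigA /grid_interpolation.
by apply: eq_bigr => ka _; rewrite mul1r.
Qed.

Lemma cutoff_ge0 k L x : 0 <= cutoff k L x.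
Proof. by apply: prodr_ge0 => i _; exact: trapezoid_ge0. Qed.

Lemma cutoff_le1 k L x : cutoff k L x <= 1.
Proof. by apply: prodr_ile1 => i _; rewrite trapezoid_ge0 trapezoid_le1. Qed.

Lemma cutoff1 k L x : (forall i, `|k%:R * x i 0| <= L%:R) -> cutoff k L x = 1.
Proof. by move=> h; rewrite /cutoff big1// => i _; exact: trapezoid1. Qed.

(** Comparison with a cutoff of mesh 1: tightness can be fixed first and the mesh chosen
    afterwards. *)
Lemma cutoff_mono k N x : (0 < k)%N -> cutoff 1 N x <= cutoff k (N.+1 * k) x.
Proof.
move=> k0; have [h|] := boolP [forall i, `|x i 0| <= N.+1%:R].
  rewrite [leRHS]cutoff1 ?cutoff_le1// => i; have {}h := forallP h i.
  by rewrite natrM normrM normr_nat [leRHS]mulrC ler_wpM2l.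
rewrite negb_forall => /existsP[i]; rewrite -ltNge => hi.
rewrite {1}/cutoff (bigD1 i)//= trapezoid0 ?mul0r ?cutoff_ge0// mul1r.
by rewrite natr1 ltW.
Qed.

(** Only grid points within 1 / k of x in every coordinate carry weight, and the weights sum to at
    most 1. *)
Lemma interpolation_error f k L x e : (0 < k)%N -> 0 <= e ->
  ((forall i, `|k%:R * x i 0| <= L%:R + 1) -> close_within f x k%:R^-1 e) ->
  `|f x * cutoff k L x - grid_interpolation f k L x| <= e.
Proof.
move=> k0 e0 H; have kp : 0 < k%:R :> R by rewrite ltr0n.
rewrite -grid_interpolation1 /grid_interpolation big_distrr/= -sumrB.
apply: (@le_trans _ _ (e * cutoff k L x)); last by rewrite ler_piMr// cutoff_le1.
rewrite -grid_interpolation1 /grid_interpolation big_distrr/=.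
apply: (le_trans (ler_norm_sum _ _ _)); apply: ler_sum => ka _.
rewrite !mul1r -mulrBl normrM.
have p0 : 0 <= \prod_i hat (k%:R * x i 0 + L%:R - (ka i)%:R) :> R.
  by apply: prodr_ge0 => i _; exact: hat_ge0.
rewrite (ger0_norm p0).
have [h|] := boolP [forall i, `|k%:R * x i 0 + L%:R - (ka i)%:R| < 1]; last first.
  rewrite negb_forall => /existsP[i]; rewrite -leNgt => hi.
  by rewrite (bigD1 i)//= hat_eq0// mul0r !mulr0.
apply: ler_wpM2r => //; apply: H => i; have {}h := forallP h i.
  rewrite (_ : k%:R * x i 0 = (k%:R * x i 0 + L%:R - (ka i)%:R) + ((ka i)%:R - L%:R)); last by ring.
  apply: (le_trans (ler_normD _ _)).
  have h2 : `|(ka i)%:R - L%:R| <= L%:R :> R.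
    have : (ka i)%:R <= (L.*2)%:R :> R by rewrite ler_nat -ltnS.
    have -> : (L.*2)%:R = 2 * L%:R :> R by rewrite -muln2 natrM mulrC.
    by rewrite ler_norml; have : 0 <= (ka i)%:R :> R by []; lra.
  by lra.
rewrite mxE -(@ltr_pM2l _ k%:R)// mulfV ?gt_eqF//.
rewrite -[X in X * _](ger0_norm (ltW kp)) -normrM mulrBr mulrCA mulfV ?gt_eqF// mulr1.
by rewrite (_ : _ - _ = k%:R * x i 0 + L%:R - (ka i)%:R)//; ring.
Qed.

(** With k = n + 1 and L = (n + 1)^2 the mesh 1 / (n + 1) shrinks while the half-width n + 1 of the
    cube grows. *)
Lemma grid_interpolation_cvg f x : continuous f ->
  grid_interpolation f n.+1 (n.+1 * n.+1) x @[n --> \oo] --> f x.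
Proof.
move=> cf; apply/cvgrPdist_le => e e0.
have [dl dl0 hd] := continuous_close x cf e0.
near=> n; have -> : f x = f x * cutoff n.+1 (n.+1 * n.+1) x.
  rewrite cutoff1 ?mulr1// => i; rewrite natrM normrM normr_nat ler_wpM2l//.
  apply: le_trans (_ : (n%:R : R) <= _); last by rewrite ler_nat.
  apply: (@le_trans _ _ (\sum_i `|x i 0|)).
    by rewrite (bigD1 i)//= lerDl sumr_ge0.
  near: n; exact: nbhs_infty_ger.
apply: interpolation_error => //; first exact: ltW.
move=> _; apply: close_within_le hd; rewrite ltW//.
by near: n; exact: near_infty_natSinv_lt (PosNum dl0).
Unshelve. all: by end_near. Qed.

(** Measurability is given coordinatewise. Interpolations are sums of products of one-coordinate
    functions, and their pointwise limit inherits measurability. *)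
Lemma continuous_measurable_coord d (T : measurableType d) (S : T -> 'cV[R]_m.+1) f :
  (forall i, measurable_fun setT (fun w => S w i 0)) -> continuous f ->
  measurable_fun setT (fun w => f (S w)).
Proof.
move=> mS cf; apply: (@measurable_fun_cvg _ _ _ setT
  (fun n w => grid_interpolation f n.+1 (n.+1 * n.+1) (S w))) => //; last first.
  by move=> w _; exact: grid_interpolation_cvg.
move=> n; apply: measurable_sum => ka; apply: measM; first exact: meas_cst.
apply: measurable_prod => i _; apply: (meas_continuous (@hat_continuous R)).
by apply: measB; [apply: measD; [apply: measM|]|]; try exact: meas_cst.
Qed.

End grid.

Lemma dist_trans3 (R : realFieldType) (x y x' y' a b c : R) :
  `|x - x'| <= a -> `|x' - y'| <= b -> `|y - y'| <= c -> `|x - y| <= a + b + c.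
Proof. by rewrite !ler_norml => /andP[? ?] /andP[? ?] /andP[? ?]; apply/andP; split; lra. Qed.

(** * Convergence of characteristic functions implies convergence in law *)

Section levy_continuity.
Context d (T : measurableType d) d' (T' : measurableType d') (R : realType).
Variables (P : probability T R) (Q : probability T' R) (m : nat).
Variables (S : nat -> T -> 'cV[R]_m.+1) (Z : T' -> 'cV[R]_m.+1).
Notation mu := (@lebesgue_measure R).
Hypothesis mS : forall n i, measurable_fun setT (fun w => S n w i 0).
Hypothesis mZ : forall i, measurable_fun setT (fun w => Z w i 0).
Hypothesis cvg_char : forall u (x : R),
  \int[P]_w cos (x + dotv u (S n w)) @[n --> \oo] --> \int[Q]_z cos (x + dotv u (Z z)).

(** The trigonometric factor is there for the induction on the number of triangles: multiplying by a
    cosine or sine of one coordinate only changes [u] and [x], up to a linear combination. *)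
Definition hat_product (l : seq ('I_m.+1 * R * R)) (u : 'cV[R]_m.+1) (x : R) (v : 'cV[R]_m.+1) : R :=
  \prod_(p <- l) hat (p.1.2 * v p.1.1 0 + p.2) * cos (x + dotv u v).

Lemma hat_product_le1 l u x v : `|hat_product l u x v| <= 1.
Proof.
have h : (0 : R) <= \prod_(p <- l) hat (p.1.2 * v p.1.1 0 + p.2) <= 1.
  elim: l => [|p l /andP[h1 h2]]; first by rewrite big_nil ler01 lexx.
  by rewrite big_cons mulr_ge0 ?hat_ge0//= mulr_ile1 ?hat_ge0 ?hat_le1.
have /andP[h1 h2] := h; rewrite normrM (ger0_norm h1) mulr_ile1//.
exact: norm_cos_le1.
Qed.

Lemma meas_hat_product d0 (T0 : measurableType d0) (Y : T0 -> 'cV[R]_m.+1) l u x :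
  (forall i, measurable_fun setT (fun w => Y w i 0)) ->
  measurable_fun setT (fun w => hat_product l u x (Y w)).
Proof.
move=> mY; apply: measM.
  elim: l => [|p l IH]; first by under eq_fun do rewrite big_nil; exact: meas_cst.
  under eq_fun do rewrite big_cons; apply: measM => //.
  apply: (meas_continuous (@hat_continuous R)).
  by apply: measD; [apply: measM|]; try exact: meas_cst.
apply: meas_cos; apply: measD; first exact: meas_cst.
by apply: measurable_sum => i; apply: measM; [exact: meas_cst|].
Qed.

Let bint d0 (T0 : measurableType d0) (P0 : probability T0 R) (F : T0 -> R) (M : R) :
  measurable_fun setT F -> (forall w, `|F w| <= M) -> P0.-integrable setT (EFin \o F).
Proof. by move=> mF bF; exact: (@bounded_integrable _ _ _ P0 F M). Qed.

Lemma dotv_shift (u v : 'cV[R]_m.+1) i t : dotv (u + t *: delta_mx i 0) v = dotv u v + t * v i 0.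
Proof.
rewrite /dotv; under eq_bigr do rewrite !mxE mulrDl.
rewrite big_split/=; congr (_ + _); rewrite (bigD1 i)//= !eqxx mulr1 big1 ?addr0// => k ki.
by rewrite (negbTE ki) mulr0 mul0r.
Qed.

Lemma cos_mul_cos (a b : R) : cos a * cos b = 2^-1 * (cos (a + b) + cos (a - b)).
Proof. by rewrite cosD cosB; field. Qed.

Lemma cos_mul_sin (a b : R) : cos a * sin b = 2^-1 * (sin (a + b) - sin (a - b)).
Proof. by rewrite sinD sinB; field. Qed.

Lemma sin_shift (a : R) : sin a = cos (a - pi / 2).
Proof. by rewrite cosB cos_pihalf sin_pihalf mulr0 mulr1 add0r. Qed.

Lemma hat_product_cos l u x i t v : hat_product l u x v * cos (t * v i 0) =
  2^-1 * (hat_product l (u + t *: delta_mx i 0) x v + hat_product l (u - t *: delta_mx i 0) x v).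
Proof.
have e : u - t *: delta_mx i 0 = u + (- t) *: delta_mx i 0 by rewrite scaleNr.
rewrite /hat_product e !dotv_shift -mulrA cos_mul_cos.
rewrite (_ : x + dotv u v + t * v i 0 = x + (dotv u v + t * v i 0)); last by ring.
rewrite (_ : x + dotv u v - t * v i 0 = x + (dotv u v + - t * v i 0)); last by ring.
by ring.
Qed.

Lemma hat_product_sin l u x i t v : hat_product l u x v * sin (t * v i 0) =
  2^-1 * (hat_product l (u + t *: delta_mx i 0) (x - pi / 2) v
          - hat_product l (u - t *: delta_mx i 0) (x - pi / 2) v).
Proof.
have e : u - t *: delta_mx i 0 = u + (- t) *: delta_mx i 0 by rewrite scaleNr.
rewrite /hat_product e !dotv_shift -mulrA cos_mul_sin !sin_shift.
rewrite (_ : x + dotv u v + t * v i 0 - pi / 2 = x - pi / 2 + (dotv u v + t * v i 0)); last by ring.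
rewrite (_ : x + dotv u v - t * v i 0 - pi / 2 = x - pi / 2 + (dotv u v + - t * v i 0)); last by ring.
by ring.
Qed.

Let charint d0 (T0 : measurableType d0) (P0 : probability T0 R) (Y : T0 -> 'cV[R]_m.+1)
    l u x i (a b t : R) : R :=
  hat_hat t * (cos (t * b) * \int[P0]_w (hat_product l u x (Y w) * cos (t * a * Y w i 0))
   - sin (t * b) * \int[P0]_w (hat_product l u x (Y w) * sin (t * a * Y w i 0))).

Let charint_le d0 (T0 : measurableType d0) (P0 : probability T0 R) (Y : T0 -> 'cV[R]_m.+1)
    l u x i (a b t : R) : (forall i, measurable_fun setT (fun w => Y w i 0)) ->
  `|charint P0 Y l u x i a b t| <= 2 * hat_hat t.
Proof.
move=> mY; rewrite /charint normrM (ger0_norm (hat_hat_ge0 _)) mulrC; apply: ler_wpM2r.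
  exact: hat_hat_ge0.
have mh := meas_hat_product l u x mY.
have mi := mY i.
have c1 : `|\int[P0]_w (hat_product l u x (Y w) * cos (t * a * Y w i 0))| <= 1.
  apply: norm_Rintegral_le; first by meas.
  by move=> w; rewrite normrM mulr_ile1 ?hat_product_le1// norm_cos_le1.
have s1 : `|\int[P0]_w (hat_product l u x (Y w) * sin (t * a * Y w i 0))| <= 1.
  apply: norm_Rintegral_le; first by meas.
  by move=> w; rewrite normrM mulr_ile1 ?hat_product_le1// norm_sin_le1.
apply: (le_trans (ler_normB _ _)); rewrite -[leRHS]/(1 + 1 : R).
by apply: lerD; rewrite normrM mulr_ile1// ?norm_cos_le1 ?norm_sin_le1.
Qed.

Let trig_cont d0 (T0 : measurableType d0) (P0 : probability T0 R) (F Y : T0 -> R) (g : R -> R) :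
  measurable_fun setT F -> measurable_fun setT Y -> (forall w, `|F w| <= 1) ->
  continuous g -> (forall x, `|g x| <= 1) ->
  measurable_fun setT (fun t : R => \int[P0]_w (F w * g (t * Y w))).
Proof.
move=> mF mY bF cg bg; apply: continuous_measurable_fun; apply: continuous_of_seq => y_ y yy.
apply: (@Rintegral_dominated_cvg _ _ R P0 setT _ _ (fun=> 1)) => //.
- move=> n; apply: measM => //; apply: (meas_continuous cg).
  by apply: measM => //; exact: meas_cst.
- move=> w _; apply: seqM (seqC _) _.
  apply: (continuous_cvg _ (cg _)); exact: seqM yy (seqC _).
- exact: (finite_measure_integrable_cst P0 1).
- by move=> n w _; rewrite normrM mulr_ile1.
Qed.

(** Induction on the triangles. [hat_expectation] turns the first one into an integral over
    frequencies, whose integrand converges by the induction hypothesis at shifted [u] and [x] and is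
    dominated by 2 [hat_hat]. *)
Lemma hat_product_cvg l u x :
  \int[P]_w hat_product l u x (S n w) @[n --> \oo] --> \int[Q]_z hat_product l u x (Z z).
Proof.
elim: l u x => [|[[i a] b] l IH] u x.
  have E0 d0 (T0 : measurableType d0) (P0 : probability T0 R) (Y : T0 -> 'cV[R]_m.+1) :
      \int[P0]_w hat_product [::] u x (Y w) = \int[P0]_w cos (x + dotv u (Y w)).
    by apply: eq_Rintegral => w _; rewrite /hat_product big_nil mul1r.
  rewrite (E0 _ _ Q Z); apply: seq_eq; last exact: cvg_char.
  by near=> n; rewrite (E0 _ _ P (S n)).
have E1 d0 (T0 : measurableType d0) (P0 : probability T0 R) (Y : T0 -> 'cV[R]_m.+1) :
    (forall i, measurable_fun setT (fun w => Y w i 0)) ->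
    \int[P0]_w hat_product ((i, a, b) :: l) u x (Y w) =
    (2 * pi)^-1 * \int[mu]_t charint P0 Y l u x i a b t.
  move=> mY; rewrite -(hat_expectation P0 a b (meas_hat_product l u x mY) (mY i) (fun w => hat_product_le1 l u x (Y w))).
  by apply: eq_Rintegral => w _; rewrite /hat_product big_cons/=; ring.
rewrite E1//; apply: (@seq_eq _ (fun n => (2 * pi)^-1 * \int[mu]_t charint P (S n) l u x i a b t)).
  by near=> n; rewrite E1.
apply: seqM (seqC _) _.
have iP d0 (T0 : measurableType d0) (P0 : probability T0 R) (Y : T0 -> 'cV[R]_m.+1) u0 x0 :
    (forall i, measurable_fun setT (fun w => Y w i 0)) ->
    P0.-integrable setT (EFin \o (fun w => hat_product l u0 x0 (Y w))).
  move=> mY; apply: (@bint _ _ _ _ 1); [exact: meas_hat_product|by move=> w; exact: hat_product_le1].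
apply: (@Rintegral_dominated_cvg _ _ R mu setT _ _ (fun t => 2 * hat_hat t)) => //.
- move=> n; apply: measM; first exact: meas_hat_hat.
  have mh := meas_hat_product l u x (mS n).
  have mt (g : R -> R) : continuous g -> (forall x, `|g x| <= 1) ->
      measurable_fun setT (fun t : R => \int[P]_w (hat_product l u x (S n w) * g (t * a * S n w i 0))).
    move=> cg bg.
    have -> : (fun t : R => \int[P]_w (hat_product l u x (S n w) * g (t * a * S n w i 0))) =
        (fun t => \int[P]_w (hat_product l u x (S n w) * g (t * (a * S n w i 0)))).
      by apply/funext => t; apply: eq_Rintegral => w _; rewrite mulrA.
    have := @trig_cont _ _ P _ (fun w => a * S n w i 0) g mh _ (fun w => hat_product_le1 l u x _) cg bg.
    by apply; apply: measM => //; exact: meas_cst.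
  apply: measB; apply: measM.
  + by apply: meas_cos; apply: measM => //; exact: meas_cst.
  + exact: (mt cos (@continuous_cos R) (@norm_cos_le1 R)).
  + by apply: meas_sin; apply: measM => //; exact: meas_cst.
  + exact: (mt sin (@continuous_sin R) (@norm_sin_le1 R)).
- move=> t _; rewrite /charint.
  have C0 d0 (T0 : measurableType d0) (P0 : probability T0 R) (Y : T0 -> 'cV[R]_m.+1) :
      (forall i, measurable_fun setT (fun w => Y w i 0)) ->
      \int[P0]_w (hat_product l u x (Y w) * cos (t * a * Y w i 0)) =
      2^-1 * (\int[P0]_w hat_product l (u + (t * a) *: delta_mx i 0) x (Y w) +
              \int[P0]_w hat_product l (u - (t * a) *: delta_mx i 0) x (Y w)).
    move=> mY; under eq_Rintegral do rewrite hat_product_cos.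
    by rewrite RintegralZl ?RintegralD//; try exact: iP; apply: RintegrableD => //; exact: iP.
  have S0 d0 (T0 : measurableType d0) (P0 : probability T0 R) (Y : T0 -> 'cV[R]_m.+1) :
      (forall i, measurable_fun setT (fun w => Y w i 0)) ->
      \int[P0]_w (hat_product l u x (Y w) * sin (t * a * Y w i 0)) =
      2^-1 * (\int[P0]_w hat_product l (u + (t * a) *: delta_mx i 0) (x - pi / 2) (Y w) -
              \int[P0]_w hat_product l (u - (t * a) *: delta_mx i 0) (x - pi / 2) (Y w)).
    move=> mY; under eq_Rintegral do rewrite hat_product_sin.
    by rewrite RintegralZl ?RintegralB//; try exact: iP; apply: RintegrableB => //; exact: iP.
  rewrite (C0 _ _ Q Z mZ) (S0 _ _ Q Z mZ); apply: seq_eq.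
    by near=> n; rewrite (C0 _ _ P _ (mS n)) (S0 _ _ P _ (mS n)).
  apply: seqM (seqC _) _; apply: seqB; apply: seqM (seqC _) _; apply: seqM (seqC _) _.
    by apply: seqD; exact: IH.
  by apply: seqB; exact: IH.
- apply: RintegrableZ => //; exact: integrable_hat_hat.
- by move=> n t _; exact: charint_le.
Unshelve. all: by end_near. Qed.

Lemma hat_product_grid k L (ka : {ffun 'I_m.+1 -> 'I_L.*2.+1}) (v : 'cV[R]_m.+1) :
  \prod_i hat (k%:R * v i 0 + L%:R - (ka i)%:R) =
  hat_product [seq (i, k%:R, L%:R - (ka i)%:R) | i <- index_enum 'I_m.+1] 0 0 v.
Proof.
rewrite /hat_product /dotv add0r [X in cos X]big1 ?cos0 ?mulr1; last first.
  by move=> i _; rewrite mxE mul0r.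
by rewrite big_map; apply: eq_bigr => i _; rewrite addrA.
Qed.

Let hat_grid_le1 k L (ka : {ffun 'I_m.+1 -> 'I_L.*2.+1}) (v : 'cV[R]_m.+1) :
  `|\prod_i hat (k%:R * v i 0 + L%:R - (ka i)%:R)| <= 1.
Proof. by rewrite hat_product_grid hat_product_le1. Qed.

Let grid_sum d0 (T0 : measurableType d0) (P0 : probability T0 R) (Y : T0 -> 'cV[R]_m.+1)
    (f : 'cV[R]_m.+1 -> R) k L : (forall i, measurable_fun setT (fun w => Y w i 0)) ->
  P0.-integrable setT (EFin \o (fun w => grid_interpolation f k L (Y w))) /\
  \int[P0]_w grid_interpolation f k L (Y w) = \sum_(ka : {ffun 'I_m.+1 -> 'I_L.*2.+1})
    f (grid_point R k ka) * \int[P0]_w \prod_i hat (k%:R * Y w i 0 + L%:R - (ka i)%:R).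
Proof.
move=> mY; have i1 (ka : {ffun 'I_m.+1 -> 'I_L.*2.+1}) : P0.-integrable setT (EFin \o (fun w =>
    \prod_i hat (k%:R * Y w i 0 + L%:R - (ka i)%:R))).
  apply: (@bint _ _ _ _ 1) => [|w]; last exact: hat_grid_le1.
  under eq_fun do rewrite hat_product_grid; exact: meas_hat_product.
have i2 (ka : {ffun 'I_m.+1 -> 'I_L.*2.+1}) : P0.-integrable setT (EFin \o (fun w =>
    f (grid_point R k ka) * \prod_i hat (k%:R * Y w i 0 + L%:R - (ka i)%:R))).
  exact: RintegrableZ.
split; first exact: Rintegrable_sum.
rewrite Rintegral_sum//; apply: eq_bigr => ka _; exact: RintegralZl.
Qed.

Lemma grid_expectation_cvg (f : 'cV[R]_m.+1 -> R) k L :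
  \int[P]_w grid_interpolation f k L (S n w) @[n --> \oo] -->
  \int[Q]_z grid_interpolation f k L (Z z).
Proof.
rewrite (grid_sum Q f k L mZ).2; apply: seq_eq.
  by near=> n; rewrite (grid_sum P f k L (mS n)).2.
apply: seq_sum => ka; apply: seqM (seqC _) _.
under eq_Rintegral do rewrite hat_product_grid.
apply: seq_eq; last exact: hat_product_cvg.
by near=> n; apply: eq_Rintegral => w _; rewrite hat_product_grid.
Unshelve. all: by end_near. Qed.

Let meas_cutoff d0 (T0 : measurableType d0) (Y : T0 -> 'cV[R]_m.+1) k L :
  (forall i, measurable_fun setT (fun w => Y w i 0)) ->
  measurable_fun setT (fun w => cutoff k L (Y w)).
Proof.
move=> mY; apply: measurable_prod => i _.
by apply: meas_comp (@meas_trapezoid R L) _; apply: measM => //; exact: meas_cst.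
Qed.

Let norm_cutoff k L (x : 'cV[R]_m.+1) : `|cutoff k L x| <= 1.
Proof. by rewrite ger0_norm ?cutoff_ge0// cutoff_le1. Qed.

Lemma tight_limit (e : R) : 0 < e -> exists N, forall k, (0 < k)%N ->
  1 - e <= \int[Q]_z cutoff k (N.+1 * k) (Z z).
Proof.
move=> e0; have h : \int[Q]_z cutoff 1 N (Z z) @[N --> \oo] --> \int[Q]_z (fun=> 1 : R) z.
  apply: (@Rintegral_dominated_cvg _ _ R Q setT _ _ (fun=> 1)) => //.
  - by move=> N; exact: meas_cutoff.
  - move=> z _; apply: seq_eq (seqC 1); near=> N; rewrite cutoff1// => i; rewrite mul1r.
    apply: (@le_trans _ _ (\sum_i `|Z z i 0|)).
      by rewrite (bigD1 i)//= lerDl sumr_ge0.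
    near: N; exact: nbhs_infty_ger.
  - exact: (finite_measure_integrable_cst Q 1).
rewrite Rintegral_cst1 in h.
have [N hN] : exists N, 1 - e <= \int[Q]_z cutoff 1 N (Z z).
  near \oo => N; exists N; near: N.
  by apply: (cvgr_ge _ h); rewrite ltrBlDr ltrDl.
exists N => k k0; apply: (le_trans hN); apply: le_Rintegral => //.
- by apply: (@bint _ _ _ _ 1) => //; exact: meas_cutoff.
- by apply: (@bint _ _ _ _ 1) => //; exact: meas_cutoff.
- by move=> z _; exact: cutoff_mono.
Unshelve. all: by end_near. Qed.

Let approx d0 (T0 : measurableType d0) (P0 : probability T0 R) (Y : T0 -> 'cV[R]_m.+1)
    (f : 'cV[R]_m.+1 -> R) (C e : R) k L : (forall i, measurable_fun setT (fun w => Y w i 0)) ->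
  continuous f -> (forall x, `|f x| <= C) ->
  (forall x, `|f x * cutoff k L x - grid_interpolation f k L x| <= e) ->
  `|\int[P0]_w f (Y w) - \int[P0]_w grid_interpolation f k L (Y w)| <=
  C * (1 - \int[P0]_w cutoff k L (Y w)) + e.
Proof.
move=> mY cf fC he; have mf := continuous_measurable_coord mY cf.
have jf : P0.-integrable setT (EFin \o (fun w => f (Y w))) by exact: (@bint _ _ _ _ C).
have jg := (grid_sum P0 f k L mY).1.
have jc : P0.-integrable setT (EFin \o (fun w => cutoff k L (Y w))).
  by apply: (@bint _ _ _ _ 1) => //; exact: meas_cutoff.
have j1 : P0.-integrable setT (EFin \o (fun=> 1 : R)) by exact: (finite_measure_integrable_cst P0 1).
have je : P0.-integrable setT (EFin \o (fun=> e)) by exact: (finite_measure_integrable_cst P0 e).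
have jb : P0.-integrable setT (EFin \o (fun w => C * (1 - cutoff k L (Y w)) + e)).
  by apply: RintegrableD => //; apply: RintegrableZ => //; exact: RintegrableB.
have jd : P0.-integrable setT (EFin \o (fun w => f (Y w) - grid_interpolation f k L (Y w))).
  exact: RintegrableB.
rewrite -RintegralB//; apply: (le_trans (le_normr_Rintegral _ _)) => //.
apply: (@le_trans _ _ (\int[P0]_w (C * (1 - cutoff k L (Y w)) + e))).
  apply: le_Rintegral => //; first exact: Rintegrable_norm.
  move=> w _; rewrite (_ : f _ - _ = f (Y w) * (1 - cutoff k L (Y w)) +
    (f (Y w) * cutoff k L (Y w) - grid_interpolation f k L (Y w))); last by ring.
  apply: (le_trans (ler_normD _ _)); apply: lerD => //.
  rewrite normrM [X in _ * X]ger0_norm ?subr_ge0 ?cutoff_le1//.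
  by apply: ler_wpM2r; rewrite ?subr_ge0 ?cutoff_le1.
rewrite RintegralD//; last by apply: RintegrableZ => //; exact: RintegrableB.
rewrite RintegralZl//; last exact: RintegrableB.
by rewrite RintegralB// !Rintegral_cst1.
Qed.

(** Tightness transfers from the limit: the cutoff is itself the interpolation of the constant 1, so
    its expectations converge too and bound the mass outside the cube for large n. *)
Lemma levy_continuity (f : 'cV[R]_m.+1 -> R) (C : R) : continuous f -> (forall x, `|f x| <= C) ->
  \int[P]_w f (S n w) @[n --> \oo] --> \int[Q]_z f (Z z).
Proof.
move=> cf fC; have C0 : 0 <= C := le_trans (normr_ge0 _) (fC 0).
apply/cvgrPdist_le => e e0.
(* The error totals C eps and 2 C eps for the mass outside the cube and three times e / 8 for
   interpolation and grid convergence, hence at most 6 e / 8. *)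
pose eps := e / (8 * (C + 1)).
have eps0 : 0 < eps by rewrite divr_gt0// mulr_gt0// ltr_wpDl.
have [N hN] := tight_limit eps0.
have e40 : 0 < e / 8 by rewrite divr_gt0.
(* Interpolation at x matters when k |x_i| <= L + 1 with L = (N + 1) k, that is, |x_i| <= N + 1 + 1
   / k <= N + 2. *)
have [dl dl0 hd] := cube_close (N%:R + 2) cf e40.
have [k k0 hk] : exists2 k, (0 < k)%N & k%:R^-1 <= dl.
  exists (Num.truncn dl^-1).+1 => //.
  by rewrite -[leRHS]invrK lef_pV2 ?posrE ?invr_gt0 ?ltr0n//= ltW// truncnS_gt.
pose L := (N.+1 * k)%N.
have kp : 1 <= k%:R :> R by rewrite ler1n.
have hg x : `|f x * cutoff k L x - grid_interpolation f k L x| <= e / 8.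
  apply: interpolation_error => //; first exact: ltW.
  move=> hx; apply: close_within_le hk _; apply: hd => i.
  have := hx i; rewrite normrM normr_nat /L natrM -natr1 => h.
  have h2 : k%:R * `|x i 0| <= k%:R * (N%:R + 2).
    by apply: (le_trans h); move: (k%:R : R) (N%:R : R) kp => a b ?; nra.
  by move: h2; rewrite ler_pM2l// (lt_le_trans _ kp).
have aQ := approx Q mZ cf fC hg.
have cC := @grid_expectation_cvg (fun=> 1) k L.
have cF := @grid_expectation_cvg f k L.
have cutE d0 (T0 : measurableType d0) (P0 : probability T0 R) (Y : T0 -> 'cV[R]_m.+1) :
    \int[P0]_w grid_interpolation (fun=> 1) k L (Y w) = \int[P0]_w cutoff k L (Y w).
  by apply: eq_Rintegral => w _; rewrite grid_interpolation1.
rewrite (cutE _ _ Q Z) in cC.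
have tQ := hN k k0; rewrite -/L in tQ.
near=> n; have aP := approx P (mS n) cf fC hg.
have d1 : `|\int[Q]_z cutoff k L (Z z) - \int[P]_w cutoff k L (S n w)| <= eps.
  by rewrite -(cutE _ _ P (S n)); near: n; move/cvgrPdist_le: cC; apply.
have d2 : `|\int[Q]_z grid_interpolation f k L (Z z) -
    \int[P]_w grid_interpolation f k L (S n w)| <= e / 8.
  by near: n; move/cvgrPdist_le: cF; apply.
have tP : 1 - \int[P]_w cutoff k L (S n w) <= 2 * eps.
  by move: d1; rewrite ler_norml => /andP[_]; lra.
have tQ' : 1 - \int[Q]_z cutoff k L (Z z) <= eps by lra.
have cP := ler_wpM2l C0 tP; have cQ := ler_wpM2l C0 tQ'.
have eE : 8 * (C + 1) * eps = e by rewrite /eps mulrC divfK// gt_eqF// mulr_gt0// ltr_wpDl.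
apply: (le_trans (dist_trans3 (le_trans aQ (lerD cQ (lexx _))) d2 (le_trans aP (lerD cP (lexx _))))).
by clear aP aQ d1 d2 tP tQ tQ' cP cQ; lra.
Unshelve. all: by end_near. Qed.

End levy_continuity.

(** * Increments of a stable process *)

Opaque stab stab_y stab_b.

Section stable_family.
Context (R : realType).
Notation mu := (@lebesgue_measure R).

Lemma stable_family (phi : R -> R -> R) : (forall b, 0 < b < 2 -> stable_density b (phi b)) ->
  [/\ forall b, 0 < b < 2 -> phi b = stab b,
      forall b : R, 0 < b < 2 -> forall y, 0 <= stab b y &
      forall b : R, 0 < b < 2 -> forall u, \int[mu]_z (cos (u * z) * stab b z) = sym b u].
Proof.
move=> H; have E b : 0 < b < 2 -> phi b = stab b.
  by move=> b02; have /andP[b0 b2] := b02; have [] := stable_densityP b0 b2 (H b b02).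
have nn (b : R) : 0 < b < 2 -> forall y, 0 <= stab b y.
  by move=> b02 y; rewrite -E//; have [_ + _] := H b b02; apply.
split=> // b b02 u; have /andP[b0 b2] := b02.
have [_ [Q HQ HC]] := stable_densityP b0 b2 (H b b02).
rewrite -(HC u).1 -(Rintegral_density_bounded (nn b b02) (meas_stab b0 b2) _ (M := 1)
  (F := fun y => cos (u * y))).
- by apply: eq_Rintegral => y _; rewrite mulrC.
- by move=> A mA; rewrite HQ// E.
- by meas.
- by move=> y; exact: norm_cos_le1.
Qed.

Lemma sub_sub_self (x y : R) : x - (y - y) = x.
Proof. by rewrite subrr subr0. Qed.

(** The exponent enters the likelihood both as the index of the density and through the power of h
    in its argument. The increment is split: with z frozen at its new value, the mean value theorem
    in the exponent and joint sequential continuity of [stab_b] apply; the rest is a composition. *)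
Lemma der_stab_curve (z : R -> R) (b dz : R) : 0 < b -> b < 2 -> is_derive b 1 z dz ->
  is_derive b 1 (fun x => stab x (z x)) (stab_b b (z b) + stab_y b (z b) * dz).
Proof.
move=> b0 b2 hz.
have d2 := der_comp (der_stab_y (z b) b0 b2) hz.
have d1 : is_derive b 1 (fun x => stab x (z x) - stab b (z x)) (stab_b b (z b)).
  pose q x := if x == b then stab_b b (z b) else (stab x (z x) - stab b (z x)) / (x - b).
  apply/is_derive1_caratheodory; exists q; split; last by rewrite /q eqxx.
    move=> x; rewrite sub_sub_self; have [xb|xb] := boolP (x == b); last first.
      by rewrite /q (negbTE xb) divfK// subr_eq0.
    by rewrite (eqP xb) (subrr b) mulr0; exact: subrr.
  have zc := der_continuous hz.
  apply/(@cvg_nbhsP _ R^o) => u ub.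
  pose dl := Num.min (b / 2) ((2 - b) / 2).
  have dl0 : 0 < dl by rewrite /dl lt_min !divr_gt0 ?subr_gt0.
  have rng x : `|x - b| <= dl -> b / 2 <= x < 2.
    by rewrite /dl le_min !ler_norml => /andP[/andP[h1 h2] /andP[h3 h4]]; apply/andP; split; lra.
  have ex n : exists x : R, `|x - b| <= `|u n - b| /\
        (`|u n - b| <= dl -> q (u n) = stab_b x (z (u n))).
    have [udl|udl] := leP `|u n - b| dl; last by exists b; rewrite subrr normr0; split.
    have [|x hx hE] := @mvt_between R (fun x => stab x (z (u n))) (fun x => stab_b x (z (u n))) b (u n).
      move=> x hx; have /andP[h1 h2] := rng x (le_trans hx udl).
      by apply: der_stab_b => //; lra.
    have [/eqP ub0|ub0] := boolP (u n == b).
      by exists b; split=> [|_]; [rewrite subrr normr0|rewrite /q ub0 eqxx].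
    by exists x; split=> // _; rewrite /q (negbTE ub0) hE mulfK// subr_eq0.
  have [xi hxi] := choice ex.
  have xib : xi n @[n --> \oo] --> b.
    have h : `|u n - b| @[n --> \oo] --> 0.
      by have := seq_norm (seqB ub (seqC b)); rewrite subrr normr0.
    have h2 : xi n - b @[n --> \oo] --> 0.
      by apply: (@cvg0_le _ _ _ _ _ (fun n => `|u n - b|)) h; near=> n; exact: (hxi n).1.
    by have := seqD h2 (seqC b); rewrite add0r; apply: seq_eq; near=> n; rewrite subrK.
  (* Finitely many intermediate points are raised to b / 2, because [cvg_stab_b] asks for the lower
     bound at every n. *)
  pose xi' n := Num.max (b / 2) (xi n).
  have xi'b : xi' n @[n --> \oo] --> b.
    have nx : \forall n \near \oo, b / 2 <= xi n by apply: (cvgr_ge _ xib); lra.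
    by apply: (seq_eq _ xib); near=> n; rewrite /xi' max_r//; near: n.
  have zu : z (u n) @[n --> \oo] --> z b by apply: (continuous_cvg _ zc).
  have hb : 0 < b / 2 by lra.
  have hb2 : b / 2 < 2 by lra.
  have := cvg_stab_b hb hb2 (b_ := xi') (fun n => _) xi'b zu; rewrite /q eqxx.
  move=> /(_ ltac:(by move=> n; rewrite /xi' le_max lexx)); apply: seq_eq; near=> n.
  have un : `|u n - b| <= dl.
    near: n; have := seq_norm (seqB ub (seqC b)); rewrite subrr normr0 => /seq_le; exact.
  transitivity (stab_b (xi n) (z (u n))); last exact: esym ((hxi n).2 un).
  have /andP[h1 _] := rng (xi n) (le_trans (hxi n).1 un).
  by rewrite /xi' max_r.
rewrite (_ : (fun x => _) = fun x => (stab x (z x) - stab b (z x)) + stab b (z x)).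
  exact: derD d1 d2.
by apply/funext => x; rewrite subrK.
Unshelve. all: by end_near. Qed.

End stable_family.

Lemma directional_derivative (R : realType) (V : normedModType R) (f : V -> R) (a v : V) (l : R) :
  is_derive (0 : R) 1 (fun t => f (t *: v + a)) l -> 'D_v f a = l.
Proof.
move=> [_ <-]; rewrite /derive.
rewrite (_ : (fun h : R => h^-1 *: ((f \o shift a) (h *: v) - f a)) = (fun h : R =>
  h^-1 *: (((fun t : R => f (t *: v + a)) \o shift 0) (h *: 1) - f (0 *: v + a))))//.
apply/funext => t /=; by rewrite scale0r add0r addr0 [t *: 1]mulr1.
Qed.

Section increments.
Context d (T : measurableType d) (R : realType) (P : probability T R) (X : R -> T -> R).
Variables (b sg ga : R) (b0 : 0 < b) (b2 : b < 2) (sg0 : 0 < sg).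
Hypothesis HX : stable_levy_with_drift P b sg ga X.
Variable Q : probability (measurableTypeR R) R.
Hypothesis HQ : forall u, \int[Q]_y cos (u * y) = sym b u /\ \int[Q]_y sin (u * y) = 0.

Let scale (h : R) := sg^-1 * h `^ (- b^-1).

Let scale_pow h u : 0 < h -> h * sg `^ b * `|u * scale h| `^ b = `|u| `^ b.
Proof.
move=> h0; have s0 : 0 < scale h by rewrite mulr_gt0 ?invr_gt0 ?powR_gt0.
rewrite normrM (gtr0_norm s0) powRM ?(ltW s0)// /scale powRM ?invr_ge0 ?(ltW sg0) ?powR_ge0//.
rewrite -powRrM mulNr mulVf ?gt_eqF// powRN powRr1 ?(ltW h0)//.
rewrite -[sg^-1]powR_inv1 ?(ltW sg0)// -powRrM mulN1r powRN.
have p0 : sg `^ b != 0 by rewrite gt_eqF// powR_gt0.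
have h1 : h != 0 by rewrite gt_eqF.
by field; rewrite p0 h1.
Qed.

Definition scaled_increment (h : R) (i : nat) (w : T) : R :=
  scale h * (X (i.+1%:R * h) w - X (i%:R * h) w - ga * h).

(** The drift only rotates the characteristic function by the angle [A], which is undone by the
    addition formulas; [scale_pow] removes the scale. *)
Lemma scaled_increment_law h : 0 < h -> forall B : set R, measurable B ->
  P [set w | B (scale h * (X h w - ga * h))] = Q B.
Proof.
move=> h0 B mB; have [[mX _ _ _ _] HC] := HX.
have mXh : measurable_fun setT (X h) := mX h (ltW h0).
have mY : measurable_fun setT (fun w => scale h * (X h w - ga * h)).
  by apply: measM; [exact: meas_cst|apply: measB => //; exact: meas_cst].
have bi (F : T -> R) : measurable_fun setT F -> (forall w, `|F w| <= 1) ->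
    P.-integrable setT (EFin \o F) by move=> *; exact: (@bounded_integrable _ _ _ P F 1).
have key u : \int[P]_w cos (u * (scale h * (X h w - ga * h))) = sym b u /\
    \int[P]_w sin (u * (scale h * (X h w - ga * h))) = 0.
  have [hc hs] := charfunE (HC h (u * scale h) (ltW h0)).
  rewrite scale_pow// -/(sym b u) in hc hs.
  set A := h * ga * (u * scale h) in hc hs.
  have jc : P.-integrable setT (EFin \o (fun w => cos (u * scale h * X h w))).
    by apply: bi => [|w]; [apply: meas_cos; apply: measM => //; exact: meas_cst|exact: norm_cos_le1].
  have js : P.-integrable setT (EFin \o (fun w => sin (u * scale h * X h w))).
    by apply: bi => [|w]; [apply: meas_sin; apply: measM => //; exact: meas_cst|exact: norm_sin_le1].
  have arg w : u * (scale h * (X h w - ga * h)) = u * scale h * X h w - A by rewrite /A; ring.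
  split.
  - transitivity (\int[P]_w (cos A * cos (u * scale h * X h w) + sin A * sin (u * scale h * X h w))).
      by apply: eq_Rintegral => w _; rewrite arg cosB; ring.
    rewrite RintegralD//; try exact: RintegrableZ.
    rewrite !RintegralZl// hc hs.
    have := cos2Dsin2 A; rewrite !expr2 => e.
    by rewrite -[RHS]mulr1 -e; ring.
  - transitivity (\int[P]_w (cos A * sin (u * scale h * X h w) - sin A * cos (u * scale h * X h w))).
      by apply: eq_Rintegral => w _; rewrite arg sinB; ring.
    rewrite RintegralB//; try exact: RintegrableZ.
    by rewrite !RintegralZl// hc hs; ring.
apply: (law_of_charfun mY _ _ mB) => u; first by rewrite (key u).1 (HQ u).1.
by rewrite (key u).2 (HQ u).2.
Qed.

(** Stationarity gives the law of X h - X 0. As X 0 vanishes only almost surely, the two events are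
    compared up to a null set at the end. *)
Lemma scaled_increment_iid h n : 0 < h -> iid P Q n (scaled_increment h).
Proof.
move=> h0; have [[mX X0 IX SX _] HC] := HX.
have ih0 (i : nat) : 0 <= i%:R * h by rewrite mulr_ge0// ltW.
split.
  move=> i; apply: measM; first exact: meas_cst.
  by apply: measB; [apply: measB; exact: mX|exact: meas_cst].
move=> B mB.
pose F (x : R) := scale h * (x - ga * h).
have mF : measurable_fun [set: measurableTypeR R] (F : measurableTypeR R -> measurableTypeR R).
  by apply: measM; [exact: meas_cst|apply: measB; [exact: measurable_id|exact: meas_cst]].
have mB' i : measurable (F @^-1` B i).
  by rewrite -[X in measurable X]setTI; exact: (mF measurableT _ (mB i)).
have := IX n (fun i => i%:R * h) (fun i => F @^-1` B i) (ih0 0%N) _ mB'.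
rewrite /= => ->; last by move=> i _; rewrite ler_wpM2r ?ler_nat// ltW.
rewrite big_mkord; congr (_%:E); apply: eq_bigr => i _; congr fine.
have -> : [set w | B i (F (X (i.+1%:R * h) w - X (i%:R * h) w))] =
    [set w | (F @^-1` B i) (X (i%:R * h + h) w - X (i%:R * h) w)].
  by rewrite -natr1 mulrDl mul1r.
rewrite SX//; last exact: ltW.
rewrite -(scaled_increment_law h0 (mB i)).
have mh : measurable_fun [set: T] (X h : T -> measurableTypeR R) := mX h (ltW h0).
have m0 : measurable_fun [set: T] (X 0 : T -> measurableTypeR R) := mX 0 (lexx 0).
have mF' : measurable_fun [set: T] (fun w => X h w - X 0 w) by exact: measB.
have [N [mN PN0 hN]] := X0.
have le (A1 A2 : set T) : measurable A1 -> measurable A2 -> A1 `<=` A2 `|` N -> (P A1 <= P A2)%E.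
  move=> m1 m2 AN; have mU : measurable (A2 `|` N) by exact: measurableU.
  apply: (le_trans (le_measure P _ _ AN)); rewrite ?inE//.
  apply: (le_trans (measureU2 P m2 mN)).
  by rewrite -[leRHS]adde0; apply: leeD2l; rewrite [leLHS]PN0.
have ms (Y : T -> R) : measurable_fun setT Y -> measurable [set w | (F @^-1` B i) (Y w)].
  by move=> mY; rewrite -[X in measurable X]setTI; exact: (mY measurableT _ (mB' i)).
have sub w : ~ N w -> X 0 w = 0 by move=> nN; apply: contrapT => X0w; apply: nN; exact: hN.
apply/eqP; rewrite eq_le; apply/andP; split; apply: le; try exact: ms; move=> w /=;
  have [|/sub ->] := pselect (N w); rewrite ?subr0; by [right|left].
Qed.

End increments.

(** * Characteristic function of two independent standard normal variables *)

Section normal_limit.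
Context (R : realType).
Notation mu := (@lebesgue_measure R).
Let N01 : probability (measurableTypeR R) R := normal_prob (0 : R) 1.

Lemma std_normal_trig (p : R) : \int[N01]_y cos (p * y) = expR (- (p ^+ 2 / 2)) /\
  \int[N01]_y sin (p * y) = 0.
Proof.
have nn y : 0 <= normal_pdf (0 : R) 1 y by exact: normal_pdf_ge0.
have mp : measurable_fun setT (normal_pdf (0 : R) 1) by exact: measurable_normal_pdf.
have hd (A : set R) : measurable A -> N01 A = (\int[mu]_(y in A) (normal_pdf (0 : R) 1 y)%:E)%E by [].
split.
- rewrite -(Rintegral_density_bounded nn mp hd (F := fun y => cos (p * y)) (M := 1)).
  + transitivity (\int[mu]_y (cos (p * y) * normal_pdf (0 : R) 1 y)).
      by apply: eq_Rintegral => y _; rewrite mulrC.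
    by rewrite gau_cos// expr1n mul1r.
  + by meas.
  + by move=> y; exact: norm_cos_le1.
- rewrite -(Rintegral_density_bounded nn mp hd (F := fun y => sin (p * y)) (M := 1)).
  + apply: Rintegral_odd.
      have := integrable_sinM p (integrable_gau 1); apply: eq_integrable => // y _.
      by rewrite /= mulrC.
    by move=> y; rewrite gau_even// mulrN sinN mulrN.
  + by meas.
  + by move=> y; exact: norm_sin_le1.
Qed.

(** Two coordinates suffice for the three-dimensional limit: one drives exponent and scale together,
    the other the location. *)
Definition normal_pair : probability (measurableTypeR R * measurableTypeR R)%type R := (N01 \x N01)%E.

Let Rint_pair (f : measurableTypeR R * measurableTypeR R -> R) : measurable_fun setT f ->
  (forall z, `|f z| <= 1) -> \int[normal_pair]_z f z = \int[N01]_x \int[N01]_y f (x, y).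
Proof.
move=> mf f1; have jf : normal_pair.-integrable setT (EFin \o f).
  exact: (@bounded_integrable _ _ _ normal_pair f 1).
rewrite /Rintegral -(integral12_prod_meas1 jf) /fubini_F; congr fine.
apply: eq_integral => x _; rewrite fineK//; apply: (@integrable_fin_num _ _ _ N01 setT) => //.
apply: (@bounded_integrable _ _ _ N01 (fun y => f (x, y)) 1) => //.
exact: (measurableT_comp mf (pair1_measurable x)).
Qed.

Lemma normal_pair_trig (p q : R) :
  \int[normal_pair]_z cos (p * z.1 + q * z.2) = expR (- ((p ^+ 2 + q ^+ 2) / 2)) /\
  \int[normal_pair]_z sin (p * z.1 + q * z.2) = 0.
Proof.
have ms : measurable_fun setT (fun z : measurableTypeR R * measurableTypeR R => p * z.1 + q * z.2).
  by apply: measD; apply: measM; try exact: meas_cst; [exact: measurable_fst|exact: measurable_snd].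
have [c1 s1] := std_normal_trig p; have [c2 s2] := std_normal_trig q.
have bi (F : measurableTypeR R -> R) : measurable_fun setT F -> (forall w, `|F w| <= 1) ->
    N01.-integrable setT (EFin \o F) by move=> *; exact: (@bounded_integrable _ _ _ N01 F 1).
have jc (r : R) : N01.-integrable setT (EFin \o (fun y => cos (r * y))).
  by apply: bi => [|y]; [meas|exact: norm_cos_le1].
have js (r : R) : N01.-integrable setT (EFin \o (fun y => sin (r * y))).
  by apply: bi => [|y]; [meas|exact: norm_sin_le1].
split; rewrite Rint_pair /=.
- transitivity (\int[N01]_x (cos (p * x) * expR (- (q ^+ 2 / 2)))).
    apply: eq_Rintegral => x _; transitivity (\int[N01]_y (cos (p * x) * cos (q * y) - sin (p * x) * sin (q * y))).
      by apply: eq_Rintegral => y _; rewrite cosD.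
    by rewrite RintegralB ?RintegralZl ?c2 ?s2 ?mulr0 ?subr0//; exact: RintegrableZ.
  by rewrite RintegralZr// c1 -expRD; congr expR; field.
- exact: meas_cos.
- by move=> z; exact: norm_cos_le1.
- transitivity (\int[N01]_x (sin (p * x) * expR (- (q ^+ 2 / 2)))).
    apply: eq_Rintegral => x _; transitivity (\int[N01]_y (sin (p * x) * cos (q * y) + cos (p * x) * sin (q * y))).
      by apply: eq_Rintegral => y _; rewrite sinD.
    by rewrite RintegralD ?RintegralZl ?c2 ?s2 ?mulr0 ?addr0//; exact: RintegrableZ.
  by rewrite RintegralZr// s1 mul0r.
- exact: meas_sin.
- by move=> z; exact: norm_sin_le1.
Qed.

End normal_limit.

(** * The likelihood *)

Lemma sum3 (R : realType) (F : 'I_3 -> R) : \sum_(i < 3) F i = F 0 + F 1 + F 2%:R.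
Proof.
rewrite !big_ord_recl big_ord0 addr0 addrA.
by congr (F _ + F _ + F _); exact: val_inj.
Qed.

Lemma ord3P (i : 'I_3) : [\/ i = 0, i = 1 | i = 2%:R].
Proof.
by case: i => [[|[|[|//]]] hi]; [constructor 1|constructor 2|constructor 3]; exact: val_inj.
Qed.

Lemma mx3_mul (R : realType) (a b c d e f g k l : R) (v : 'cV[R]_3) :
  let M := mx3 [:: [:: a; b; c]; [:: d; e; f]; [:: g; k; l]] in
  [/\ (M *m v) 0 0 = a * v 0 0 + b * v 1 0 + c * v 2%:R 0,
      (M *m v) 1 0 = d * v 0 0 + e * v 1 0 + f * v 2%:R 0 &
      (M *m v) 2%:R 0 = g * v 0 0 + k * v 1 0 + l * v 2%:R 0].
Proof. by split; rewrite mxE sum3 !mxE. Qed.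

Lemma quadf_mx3 (R : realType) (a b c d e f g k l : R) (u v : 'cV[R]_3) :
  quadf (mx3 [:: [:: a; b; c]; [:: d; e; f]; [:: g; k; l]]) u v =
  u 0 0 * (a * v 0 0 + b * v 1 0 + c * v 2%:R 0) +
  u 1 0 * (d * v 0 0 + e * v 1 0 + f * v 2%:R 0) +
  u 2%:R 0 * (g * v 0 0 + k * v 1 0 + l * v 2%:R 0).
Proof. by rewrite /quadf !sum3 !mxE /=; ring. Qed.

Lemma der_sum (R : realType) (F : nat -> R -> R) (dF : nat -> R) (x : R) (n : nat) :
  (forall i, is_derive x 1 (F i) (dF i)) ->
  is_derive x 1 (fun t => \sum_(0 <= i < n) F i t) (\sum_(0 <= i < n) dF i).
Proof.
move=> h; elim: n => [|n IH].
  rewrite big_nil (_ : (fun t => _) = fun=> 0); first exact: der_cst.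
  by apply/funext => t; rewrite big_nil.
rewrite big_nat_recr//= (_ : (fun t => _) = fun t => \sum_(0 <= i < n) F i t + F n t).
  exact: derD.
by apply/funext => t; rewrite big_nat_recr.
Qed.

(** * Scale and location of the local alternatives *)

Section rates.
Context (R : realType).

Lemma scaled_ln (x : R) : Num.sqrt n%:R * ln (1 + x * (Num.sqrt n%:R)^-1) @[n --> \oo] --> x.
Proof.
have r0 := @cvg_sqrtn_inv R.
have h0 : 4 * x ^+ 2 * (Num.sqrt n%:R)^-1 @[n --> \oo] --> (0 : R).
  by have := seqM (seqC (4 * x ^+ 2)) r0; rewrite mulr0.
have hv : `|2 * x * (Num.sqrt n%:R)^-1| @[n --> \oo] --> (0 : R).
  by have := seq_norm (seqM (seqC (2 * x)) r0); rewrite mulr0 normr0.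
have h1 : Num.sqrt n%:R * ln (1 + x * (Num.sqrt n%:R)^-1) - x @[n --> \oo] --> (0 : R).
  apply: (@cvg0_le _ _ _ _ _ (fun n => 4 * x ^+ 2 * (Num.sqrt n%:R)^-1)) h0.
  near=> n; have n0 : (0 < n)%N by near: n; exact: nbhs_infty_gt.
  have v1 : `|2 * x * (Num.sqrt n%:R)^-1| <= 1 by near: n; exact: (seq_le hv ltr01).
  have s0 : 0 < Num.sqrt n%:R :> R by rewrite sqrtr_gt0 ltr0n.
  have := log_taylor v1; move: v1; set v := 2 * x * _ => v1.
  have -> : x * (Num.sqrt n%:R)^-1 = v / 2 by rewrite /v; field; rewrite gt_eqF.
  move=> lt.
  have xE : x = Num.sqrt n%:R * v / 2 by rewrite /v; field; rewrite gt_eqF.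
  have -> : Num.sqrt n%:R * ln (1 + v / 2) - x = Num.sqrt n%:R / 2 * (2 * ln (1 + v / 2) - v).
    by rewrite {1}xE; field.
  have -> : 4 * x ^+ 2 / Num.sqrt n%:R = Num.sqrt n%:R * v ^+ 2.
    by rewrite xE; field; rewrite gt_eqF.
  rewrite normrM ger0_norm ?divr_ge0 ?(ltW s0)// -mulrA; apply: ler_wpM2l; first exact: ltW.
  have v3 : `|v| ^+ 3 <= v ^+ 2.
    by rewrite exprSr -[leRHS]mulr1 -normrX ger0_norm ?sqr_ge0//; apply: ler_wpM2l => //; exact: sqr_ge0.
  have := sqr_ge0 v; move: lt v3; rewrite ler_norml; set a := v ^+ 2; set c := `|v| ^+ 3.
  move=> /andP[l1 l2] l3 l4.
  have : `|2 * ln (1 + v / 2) - v| <= 2 * a by rewrite ler_norml; apply/andP; split; lra.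
  by lra.
have := seqD h1 (seqC x); rewrite add0r; apply: seq_eq; near=> n; by rewrite subrK.
Unshelve. all: by end_near. Qed.

Variable h : nat -> R.
Hypotheses (h0 : forall n, 0 < h n) (hc : h n @[n --> \oo] --> 0).

Lemma near_ln_inv (M : R) : \forall n \near \oo, M < ln (1 / h n).
Proof.
have e0 : 0 < expR (- M) by exact: expR_gt0.
near=> n; rewrite div1r lnV ?posrE// ltrNr -[ltRHS]expRK ltr_ln ?posrE ?expR_gt0//.
near: n; have hlt := hc; exact: (cvgr_lt _ hlt).
Unshelve. all: by end_near. Qed.

Lemma cvg_inv_ln_inv : (ln (1 / h n))^-1 @[n --> \oo] --> 0.
Proof.
apply/cvgrPdist_le => e e0; near=> n.
have l : e^-1 < ln (1 / h n) by near: n; exact: near_ln_inv.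
have l0 : 0 < ln (1 / h n) by apply: lt_trans l; rewrite invr_gt0.
by rewrite sub0r normrN ger0_norm ?invr_ge0 ?(ltW l0)// invf_ple ?posrE// ltW.
Unshelve. all: by end_near. Qed.

Variables (b sg u0 u1 u2 : R) (b0 : 0 < b) (sg0 : 0 < sg).

Definition shift_beta n : R := b + u0 / (Num.sqrt n%:R * ln (1 / h n)).
Definition shift_sigma n : R := sg + u1 / Num.sqrt n%:R.
(** The logarithm of the ratio of the new increment scale, sigma_n h^(1 / beta_n), to the old one,
    sigma h^(1 / beta). The next definition is the shift of the drift over one step, in units of the
    old scale. *)
Definition shift_scale n : R := ln (shift_sigma n / sg) + ((shift_beta n)^-1 - b^-1) * ln (h n).
Definition shift_loc n : R := u2 / (sg * Num.sqrt n%:R).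

Lemma near_sqrtn : \forall n \near \oo, (0 : R) < Num.sqrt n%:R.
Proof. by near=> n; rewrite sqrtr_gt0 ltr0n; near: n; exact: nbhs_infty_gt.
Unshelve. all: by end_near. Qed.

Lemma rate_beta : Num.sqrt n%:R * (shift_beta n - b) @[n --> \oo] --> 0.
Proof.
have := seqM (seqC u0) cvg_inv_ln_inv; rewrite mulr0; apply: seq_eq; near=> n.
have s0 : (0 : R) < Num.sqrt n%:R by near: n; exact: near_sqrtn.
have l0 : 0 < ln (1 / h n) by near: n; exact: near_ln_inv.
by rewrite /shift_beta; field; rewrite !gt_eqF.
Unshelve. all: by end_near. Qed.

Lemma cvg_shift_beta : shift_beta n @[n --> \oo] --> b.
Proof.
have := seqD (seqC b) (seqM (seqM (@cvg_sqrtn_inv R) (seqC u0)) cvg_inv_ln_inv).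
rewrite mulr0 addr0; apply: seq_eq; near=> n.
by rewrite /shift_beta invfM mulrA [u0 / _]mulrC.
Unshelve. all: by end_near. Qed.

Lemma cvg_shift_sigma : shift_sigma n @[n --> \oo] --> sg.
Proof.
by have := seqD (seqC sg) (seqM (seqC u1) (@cvg_sqrtn_inv R)); rewrite mulr0 addr0.
Qed.

(** 1 / beta_n - 1 / b is close to - (beta_n - b) / b^2, and its product with ln h cancels the
    logarithm in the rate of [beta]. A change of exponent thus acts like a change of scale: the
    source of the singularity. *)
Lemma rate_scale : Num.sqrt n%:R * shift_scale n @[n --> \oo] --> u0 / b ^+ 2 + u1 / sg.
Proof.
have b_n : b != 0 by rewrite gt_eqF.
have s_n : sg != 0 by rewrite gt_eqF.
have c1 := @scaled_ln (u1 / sg).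
have c2 := seqM (seqC (u0 / b)) (seqV b_n cvg_shift_beta).
have := seqD c2 c1; rewrite (_ : u0 / b / b = u0 / b ^+ 2); last by field.
apply: seq_eq; near=> n.
have s0 : (0 : R) < Num.sqrt n%:R by near: n; exact: near_sqrtn.
have l0 : 0 < ln (1 / h n) by near: n; exact: near_ln_inv.
have bn : 0 < shift_beta n by near: n; exact: (cvgr_gt _ cvg_shift_beta).
have hE : ln (h n) = - ln (1 / h n) by rewrite div1r lnV ?posrE// opprK.
have sE : shift_sigma n / sg = 1 + u1 / sg * (Num.sqrt n%:R)^-1.
  by rewrite /shift_sigma; field; rewrite s_n gt_eqF.
rewrite /shift_scale sE hE mulrDr addrC; congr (_ + _).
have bE : shift_beta n - b = u0 / (Num.sqrt n%:R * ln (1 / h n)) by rewrite /shift_beta addrAC subrr add0r.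
rewrite (_ : (shift_beta n)^-1 - b^-1 = - (shift_beta n - b) / (b * shift_beta n)); last first.
  by field; rewrite b_n gt_eqF.
by rewrite bE; field; rewrite b_n !gt_eqF.
Unshelve. all: by end_near. Qed.

Lemma rate_loc : Num.sqrt n%:R * shift_loc n @[n --> \oo] --> u2 / sg.
Proof.
apply: seq_eq (seqC (u2 / sg)); near=> n.
have s0 : (0 : R) < Num.sqrt n%:R by near: n; exact: near_sqrtn.
by rewrite /shift_loc; field; rewrite !gt_eqF.
Unshelve. all: by end_near. Qed.

End rates.

Lemma norm_cos_sub (R : realType) (x y : R) : `|cos (x + y) - cos x| <= `|y|.
Proof.
have [z _ ->] := @mvt_between R cos (fun z => - sin z) x (x + y).
rewrite addrC addKr normrM normrN ler_piMl//; exact: norm_sin_le1.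
Qed.

(** |cos(Y + Z) - cos Y| <= |Z| <= e / 2 + Z^2 / (2 e), so the second moment of Z controls the
    difference. *)
Lemma cos_slutsky d (T : measurableType d) (R : realType) (P : probability T R)
    (Y Z : nat -> T -> R) (l : R) :
  (forall n, measurable_fun setT (Y n)) -> (forall n, measurable_fun setT (Z n)) ->
  (\forall n \near \oo, P.-integrable setT (EFin \o (fun w => Z n w ^+ 2))) ->
  \int[P]_w (Z n w ^+ 2) @[n --> \oo] --> 0 ->
  \int[P]_w cos (Y n w) @[n --> \oo] --> l ->
  \int[P]_w cos (Y n w + Z n w) @[n --> \oo] --> l.
Proof.
move=> mY mZ jZ cZ cY.
have jc (F : T -> R) : measurable_fun setT F -> P.-integrable setT (EFin \o (fun w => cos (F w))).
  move=> mF; apply: (@bounded_integrable _ _ _ P (fun w => cos (F w)) 1) => [|w]; first by meas.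
  exact: norm_cos_le1.
have h : \int[P]_w cos (Y n w + Z n w) - \int[P]_w cos (Y n w) @[n --> \oo] --> 0.
  apply/cvgrPdist_le => e e0; near=> n; rewrite sub0r normrN.
  have jn : P.-integrable setT (EFin \o (fun w => Z n w ^+ 2)) by near: n; exact: jZ.
  have zn : \int[P]_w (Z n w ^+ 2) <= e ^+ 2.
    near: n; apply: (seq_le cZ); exact: exprn_gt0.
  have mYZ : measurable_fun setT (fun w => Y n w + Z n w) by exact: measD.
  have jd : P.-integrable setT (EFin \o (fun w => cos (Y n w + Z n w) - cos (Y n w))).
    by apply: RintegrableB => //; exact: jc.
  have je : P.-integrable setT (EFin \o (fun=> e / 2)) by exact: (finite_measure_integrable_cst P (e / 2)).
  have jb := RintegrableZ (2 * e)^-1 measurableT jn.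
  rewrite -RintegralB//; [|exact: jc|exact: jc].
  apply: (le_trans (le_normr_Rintegral measurableT jd)).
  apply: (@le_trans _ _ (\int[P]_w (e / 2 + (2 * e)^-1 * Z n w ^+ 2))).
    apply: le_Rintegral => //; [exact: Rintegrable_norm|exact: RintegrableD|].
    move=> w _; apply: (le_trans (norm_cos_sub _ _)).
    rewrite -subr_ge0 (_ : _ - _ = (2 * e)^-1 * (e - `|Z n w|) ^+ 2).
      by rewrite mulr_ge0 ?sqr_ge0// invr_ge0 mulr_ge0// ltW.
    by rewrite -(real_normK (num_real (Z n w))); field; rewrite gt_eqF.
  rewrite RintegralD// Rintegral_cst1 RintegralZl//.
  have : (2 * e)^-1 * \int[P]_w Z n w ^+ 2 <= (2 * e)^-1 * e ^+ 2.
    by apply: ler_wpM2l => //; rewrite invr_ge0 mulr_ge0// ltW.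
  rewrite (_ : (2 * e)^-1 * e ^+ 2 = e / 2); first by lra.
  by field; rewrite gt_eqF.
have := seqD h cY; rewrite add0r; apply: seq_eq; near=> n; by rewrite subrK.
Unshelve. all: by end_near. Qed.

Section likelihood.
Context d (T : measurableType d) (R : realType).
Variables (P : probability T R) (X : R -> T -> R) (phi : R -> R -> R) (h : nat -> R).
Variable theta : 'cV[R]_3.
Notation b := (pbeta theta).
Notation sg := (psigma theta).
Notation ga := (pgamma theta).
Hypotheses (b0 : 0 < b) (b2 : b < 2) (sg0 : 0 < sg) (h0 : forall n, 0 < h n)
  (hc : h n @[n --> \oo] --> 0).
Hypothesis phiE : forall x : R, 0 < x < 2 -> phi x = stab x.
Hypothesis Hnn : forall x : R, 0 < x < 2 -> forall y, 0 <= stab x y.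
Hypothesis Hcos : forall x : R, 0 < x < 2 -> forall u,
  \int[@lebesgue_measure R]_z (cos (u * z) * stab x z) = sym x u.

Notation xi := (fun n => scaled_increment X b sg ga (h n)).
Notation lnh n := (ln (1 / h n)).

Let powE (x a : R) : 0 < x -> x `^ a = expR (a * ln x).
Proof. by move=> x0; rewrite /powR gt_eqF. Qed.

Let lnhE n : lnh n = - ln (h n). Proof. by rewrite div1r lnV ?posrE. Qed.

Let b_n : b != 0. Proof. by rewrite gt_eqF. Qed.
Let sg_n : sg != 0. Proof. by rewrite gt_eqF. Qed.

Let pos y : 0 < stab b y. Proof. exact: stab_gt0. Qed.

(** Increments are numbered from 1 in [loglik] and from 0 in [scaled_increment]. *)
Let loglikE n w th : loglik phi h X n w th = \sum_(0 <= i < n)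
  (- ln (psigma th) + (pbeta th)^-1 * lnh n + ln (phi (pbeta th)
    ((psigma th)^-1 * h n `^ (- (pbeta th)^-1) *
     (X (i.+1%:R * h n) w - X (i%:R * h n) w - pgamma th * h n)))).
Proof. by rewrite /loglik big_add1. Qed.

(** The derivative of the power of h gives a scale derivative, and with that of (1 / beta) ln(1 / h)
    it combines into [stab_s]; only [stab_b] comes without the factor ln(1 / h). *)
Lemma gradient_beta n w : gradient (loglik phi h X n w) theta 0 0 =
  \sum_(0 <= i < n) (- (lnh n / b ^+ 2) * (stab_s b (xi n i w) / stab b (xi n i w)) +
    stab_b b (xi n i w) / stab b (xi n i w)).
Proof.
rewrite mxE; apply: directional_derivative.
pose D i := X (i.+1%:R * h n) w - X (i%:R * h n) w - ga * h n.
pose z i x := sg^-1 * expR (- x^-1 * ln (h n)) * D i.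
have zE i : z i b = xi n i w by rewrite /z /scaled_increment /= powE.
have dz i : is_derive b 1 (z i) (z i b * (ln (h n) / b ^+ 2)).
  rewrite /z; der => //; rewrite /=.
  by field; rewrite b_n sg_n.
have ds i : is_derive b 1 (fun x => - ln sg + x^-1 * lnh n + ln (stab x (z i x)))
    (- (lnh n / b ^+ 2) * (stab_s b (xi n i w) / stab b (xi n i w)) +
    stab_b b (xi n i w) / stab b (xi n i w)).
  have d1 := @der_ln R (fun x => stab x (z i x)) b _ (pos _) (der_stab_curve b0 b2 (dz i)).
  have d2 : is_derive b 1 (fun x => - ln sg + x^-1 * lnh n) (- b ^- 2 * lnh n).
    by der => //; rewrite /=; field.
  apply: (der_eq (derD d2 d1)); rewrite lnhE -zE /stab_s.
  have := pos (z i b); move: (stab b (z i b)) (stab_b b (z i b)) (stab_y b (z i b)) (ln (h n)) (z i b)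
    => s1 s2 s3 s4 s5 s10.
  by field; rewrite b_n gt_eqF.
have dsum := der_sum n ds.
have dt : is_derive (0 : R) 1 (fun t => t + b) 1 by der; rewrite addr0.
rewrite -[X in is_derive _ _ _ X]mulr1.
have := @der_comp R (fun x => \sum_(0 <= i < n) (- ln sg + x^-1 * lnh n + ln (stab x (z i x))))
  (fun t => t + b) 0 _ _ _ dt.
rewrite add0r => /(_ _ dsum); apply: near_eq_is_derive.
have hb : (fun t : R => t + b) t @[t --> 0] --> b.
  by rewrite -[X in _ --> X](add0r b); exact: (der_continuous dt).
near=> t; rewrite loglikE; apply: eq_bigr => i _.
have -> : pbeta (t *: delta_mx 0 0 + theta) = t + b by rewrite /pbeta !mxE eqxx mulr1.
have -> : psigma (t *: delta_mx 0 0 + theta) = sg by rewrite /psigma !mxE mulr0 add0r.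
have -> : pgamma (t *: delta_mx 0 0 + theta) = ga by rewrite /pgamma !mxE mulr0 add0r.
have tb : 0 < t + b < 2.
  by apply/andP; split; near: t; [exact: (cvgr_gt _ hb)|exact: (cvgr_lt _ hb)].
by rewrite phiE// powE.
Unshelve. all: by end_near. Qed.

Lemma gradient_sigma n w : gradient (loglik phi h X n w) theta 1 0 =
  \sum_(0 <= i < n) (- sg^-1 * (stab_s b (xi n i w) / stab b (xi n i w))).
Proof.
rewrite mxE; apply: directional_derivative.
pose D i := h n `^ (- b^-1) * (X (i.+1%:R * h n) w - X (i%:R * h n) w - ga * h n).
have zE i : sg^-1 * D i = xi n i w by rewrite /D mulrA.
have ds i : is_derive sg 1 (fun x => - ln x + b^-1 * lnh n + ln (stab b (x^-1 * D i)))
    (- sg^-1 * (stab_s b (xi n i w) / stab b (xi n i w))).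
  have dz : is_derive sg 1 (fun x => x^-1 * D i) (- sg ^- 2 * D i).
    by der => //; rewrite /=; field.
  have d1 := @der_ln R (fun x => stab b (x^-1 * D i)) sg _ (pos _) (der_comp (der_stab_y _ b0 b2) dz).
  have d2 : is_derive sg 1 (fun x => - ln x + b^-1 * lnh n) (- sg^-1).
    by der => //; rewrite /=; field.
  apply: (der_eq (derD d2 d1)); rewrite -zE /stab_s.
  have := pos (sg^-1 * D i); move: (stab b (sg^-1 * D i)) (stab_y b (sg^-1 * D i)) (D i) => s1 s2 s3 s10.
  by field; rewrite sg_n gt_eqF.
have dsum := der_sum n ds.
have dt : is_derive (0 : R) 1 (fun t => t + sg) 1 by der; rewrite addr0.
rewrite -[X in is_derive _ _ _ X]mulr1.
have := @der_comp R (fun x => \sum_(0 <= i < n) (- ln x + b^-1 * lnh n + ln (stab b (x^-1 * D i))))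
  (fun t => t + sg) 0 _ _ _ dt.
rewrite add0r => /(_ _ dsum); apply: near_eq_is_derive.
near=> t; rewrite loglikE; apply: eq_bigr => i _.
have -> : pbeta (t *: delta_mx 1 0 + theta) = b by rewrite /pbeta !mxE mulr0 add0r.
have -> : psigma (t *: delta_mx 1 0 + theta) = t + sg by rewrite /psigma !mxE eqxx mulr1.
have -> : pgamma (t *: delta_mx 1 0 + theta) = ga by rewrite /pgamma !mxE mulr0 add0r.
by rewrite phiE ?b0// /D mulrA.
Unshelve. all: by end_near. Qed.

Lemma gradient_gamma n w : gradient (loglik phi h X n w) theta 2%:R 0 =
  \sum_(0 <= i < n) (- (sg^-1 * h n `^ (1 - b^-1)) * (stab_y b (xi n i w) / stab b (xi n i w))).
Proof.
rewrite mxE; apply: directional_derivative.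
pose k := sg^-1 * h n `^ (- b^-1).
pose D i := X (i.+1%:R * h n) w - X (i%:R * h n) w.
have kE : sg^-1 * h n `^ (1 - b^-1) = k * h n.
  by rewrite /k powRD ?powRr1 ?(ltW (h0 n)) ?(gt_eqF (h0 n)) ?implybT//; ring.
have zE i : k * (D i - ga * h n) = xi n i w by [].
have ds i : is_derive ga 1 (fun x => - ln sg + b^-1 * lnh n + ln (stab b (k * (D i - x * h n))))
    (- (sg^-1 * h n `^ (1 - b^-1)) * (stab_y b (xi n i w) / stab b (xi n i w))).
  have dz : is_derive ga 1 (fun x => k * (D i - x * h n)) (- (k * h n)).
    by der; rewrite /=; ring.
  have d1 := @der_ln R (fun x => stab b (k * (D i - x * h n))) ga _ (pos _)
    (der_comp (der_stab_y _ b0 b2) dz).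
  apply: (der_eq (derD (der_cst ga (- ln sg + b^-1 * lnh n)) d1)); rewrite -zE kE.
  have := pos (k * (D i - ga * h n)); move: (stab b (k * (D i - ga * h n))) (stab_y b (k * (D i - ga * h n))) => s1 s2 s10.
  by field; rewrite gt_eqF.
have dsum := der_sum n ds.
have dt : is_derive (0 : R) 1 (fun t => t + ga) 1 by der; rewrite addr0.
rewrite -[X in is_derive _ _ _ X]mulr1.
have := @der_comp R (fun x => \sum_(0 <= i < n) (- ln sg + b^-1 * lnh n + ln (stab b (k * (D i - x * h n)))))
  (fun t => t + ga) 0 _ _ _ dt.
rewrite add0r => /(_ _ dsum); apply: near_eq_is_derive.
near=> t; rewrite loglikE; apply: eq_bigr => i _.
have -> : pbeta (t *: delta_mx 2%:R 0 + theta) = b by rewrite /pbeta !mxE mulr0 add0r.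
have -> : psigma (t *: delta_mx 2%:R 0 + theta) = sg by rewrite /psigma !mxE mulr0 add0r.
have -> : pgamma (t *: delta_mx 2%:R 0 + theta) = t + ga by rewrite /pgamma !mxE eqxx mulr1.
by rewrite phiE ?b0.
Unshelve. all: by end_near. Qed.

Notation root n := (Num.sqrt (n%:R : R)).

Let sum_s n w := \sum_(0 <= i < n) (stab_s b (xi n i w) / stab b (xi n i w)).
Let sum_y n w := \sum_(0 <= i < n) (stab_y b (xi n i w) / stab b (xi n i w)).
Let sum_b n w := \sum_(0 <= i < n) (stab_b b (xi n i w) / stab b (xi n i w)).

(** Makes the diagonal entries of the rate matrix genuine inverses. *)
Definition regular_index n := (0 < n)%N && (0 < lnh n).

Let near_regular : \forall n \near \oo, regular_index n.
Proof.
near=> n; apply/andP; split; first by near: n; exact: nbhs_infty_gt.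
by near: n; exact: near_ln_inv.
Unshelve. all: by end_near. Qed.

Lemma score_coord n w : regular_index n ->
  [/\ score phi h X theta n w 0 0 = (root n)^-1 * (- b ^- 2 * sum_s n w + (lnh n)^-1 * sum_b n w),
      score phi h X theta n w 1 0 = (root n)^-1 * (- sg^-1 * sum_s n w) &
      score phi h X theta n w 2%:R 0 = (root n)^-1 * (- sg^-1 * sum_y n w)].
Proof.
move=> /andP[n0 l0]; have r0 : root n != 0 by rewrite gt_eqF// sqrtr_gt0 ltr0n.
have l_n : lnh n != 0 by rewrite gt_eqF.
have p_n : h n `^ (1 - b^-1) != 0 by rewrite gt_eqF// powR_gt0.
rewrite /score /rate; set v := gradient _ _.
have [-> -> ->] := mx3_mul (root n * lnh n)^-1 0 0 0 (root n)^-1 0 0 0 (root n * h n `^ (1 - b^-1))^-1 v.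
rewrite /v gradient_beta gradient_sigma gradient_gamma !mul0r !addr0 !add0r.
rewrite big_split/= -!mulr_sumr -/(sum_s n w) -/(sum_b n w) -/(sum_y n w).
by split=> //; field; rewrite ?b_n ?l_n ?r0 ?sg_n ?p_n.
Qed.

Definition score_scale (u : 'cV[R]_3) := u 0 0 / b ^+ 2 + u 1 0 / sg.
Definition score_loc (u : 'cV[R]_3) := u 2%:R 0 / sg.

(** The components for [beta] and [sigma] share the sum of the scale scores, so only [score_scale u]
    and [score_loc u] count, up to a term with an extra factor 1 / ln(1 / h). *)
Lemma dotv_score n w u : regular_index n -> dotv u (score phi h X theta n w) =
  (root n)^-1 * \sum_(0 <= i < n) stable_score b (score_scale u) (score_loc u) (xi n i w) +
  u 0 0 * (root n * lnh n)^-1 * sum_b n w.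
Proof.
move=> rn; have [e0 e1 e2] := score_coord w rn.
rewrite /dotv sum3 e0 e1 e2.
have -> : \sum_(0 <= i < n) stable_score b (score_scale u) (score_loc u) (xi n i w) =
    - score_scale u * sum_s n w - score_loc u * sum_y n w.
  rewrite /sum_s /sum_y !mulr_sumr -sumrB; apply: eq_bigr => i _; rewrite /stable_score.
  by rewrite opprD mulrDl; ring.
have /andP[n0 l0] := rn; have r0 : root n != 0 by rewrite gt_eqF// sqrtr_gt0 ltr0n.
have l_n : lnh n != 0 by rewrite gt_eqF.
by rewrite /score_scale /score_loc; field; rewrite b_n sg_n l_n r0.
Qed.

Let ms := meas_stab b0 b2.
Let mss := meas_stab_s b0 b2.
Let msy := meas_stab_y b0 b2.
Let msb := meas_stab_b b0 b2.

Hypothesis HX : stable_levy_with_drift P b sg ga X.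
Variable Q : probability (measurableTypeR R) R.
Hypothesis HQd : has_density Q (stab b).
Hypothesis HQ : forall u, \int[Q]_y cos (u * y) = sym b u /\ \int[Q]_y sin (u * y) = 0.

Let Hxi n : iid P Q n (xi n).
Proof. by exact: (scaled_increment_iid b0 sg0 HX HQ). Qed.

Let mxi n i : measurable_fun setT (xi n i). Proof. exact: (Hxi n).1. Qed.

Let meas_comp_sum n (g : R -> R) : measurable_fun setT g ->
  measurable_fun setT (fun w => \sum_(0 <= i < n) g (xi n i w)).
Proof. by move=> mg; apply: measurable_sum => i; exact: (meas_comp mg (mxi n i)). Qed.

Lemma meas_score n i : regular_index n ->
  measurable_fun setT (fun w => score phi h X theta n w i 0).
Proof.
move=> rn.
have m1 : measurable_fun setT (sum_s n).
  by apply: (@meas_comp_sum n (fun y => stab_s b y / stab b y)); apply: measM => //; exact: measV.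
have m2 : measurable_fun setT (sum_y n).
  by apply: (@meas_comp_sum n (fun y => stab_y b y / stab b y)); apply: measM => //; exact: measV.
have m3 : measurable_fun setT (sum_b n).
  by apply: (@meas_comp_sum n (fun y => stab_b b y / stab b y)); apply: measM => //; exact: measV.
have e w := score_coord w rn.
have [->|->|->] := ord3P i.
- rewrite (_ : (fun w => _) = fun w => (root n)^-1 * (- b ^- 2 * sum_s n w + (lnh n)^-1 * sum_b n w)).
    by apply: measM; [exact: meas_cst|apply: measD; apply: measM => //; exact: meas_cst].
  by apply/funext => w; have [] := e w.
- rewrite (_ : (fun w => _) = fun w => (root n)^-1 * (- sg^-1 * sum_s n w)).
    by apply: measM; [exact: meas_cst|apply: measM => //; exact: meas_cst].
  by apply/funext => w; have [] := e w.
- rewrite (_ : (fun w => _) = fun w => (root n)^-1 * (- sg^-1 * sum_y n w)).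
    by apply: measM; [exact: meas_cst|apply: measM => //; exact: meas_cst].
  by apply/funext => w; have [] := e w.
Qed.

Notation Hb := (\int[@lebesgue_measure R]_y (stab_s b y ^+ 2 / stab b y)).
Notation Mb := (\int[@lebesgue_measure R]_y (stab_y b y ^+ 2 / stab b y)).

Let HphiE y : (phi b y + y * derive1 (phi b) y) ^+ 2 / phi b y = stab_s b y ^+ 2 / stab b y.
Proof. by rewrite phiE ?b0// (der_derive1 (der_stab_y y b0 b2)). Qed.

Let MphiE y : derive1 (phi b) y ^+ 2 / phi b y = stab_y b y ^+ 2 / stab b y.
Proof. by rewrite phiE ?b0// (der_derive1 (der_stab_y y b0 b2)). Qed.

Lemma Hphi_fin : Hphi phi b \is a fin_num /\ fine (Hphi phi b) = Hb.
Proof.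
have [dl [K [c E]]] := stable_estimatesP Hnn Hcos b0 b2.
have j := integrable_stab_s2 Hnn Hcos b0 b2 E.
have -> : Hphi phi b = (\int[@lebesgue_measure R]_y (stab_s b y ^+ 2 / stab b y)%:E)%E.
  by apply: eq_integral => y _; rewrite HphiE.
by split=> //; exact: (integrable_fin_num _ j).
Qed.

Lemma Mphi_fin : Mphi phi b \is a fin_num /\ fine (Mphi phi b) = Mb.
Proof.
have [dl [K [c E]]] := stable_estimatesP Hnn Hcos b0 b2.
have j := integrable_stab_y2 Hnn Hcos b0 b2 E.
have -> : Mphi phi b = (\int[@lebesgue_measure R]_y (stab_y b y ^+ 2 / stab b y)%:E)%E.
  by apply: eq_integral => y _; rewrite MphiE.
by split=> //; exact: (integrable_fin_num _ j).
Qed.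

Lemma fisher_quadf u : quadf (fisher phi theta) u u =
  score_scale u ^+ 2 * Hb + score_loc u ^+ 2 * Mb.
Proof.
rewrite /fisher Hphi_fin.2 Mphi_fin.2 quadf_mx3 /score_scale /score_loc.
by field; rewrite b_n sg_n.
Qed.

Lemma fisher_singular : fisher phi theta \notin unitmx.
Proof.
(* The direction in which [score_scale] and [score_loc] both vanish. *)
apply/negP => U; pose v : 'cV[R]_3 := \col_i (if i == 0 then 1 else if i == 1 then - sg / b ^+ 2 else 0).
have v0 : v 0 0 = 1 by rewrite mxE.
have v1 : v 1 0 = - sg / b ^+ 2 by rewrite mxE.
have v2 : v 2%:R 0 = 0 by rewrite mxE.
have Fv : fisher phi theta *m v = 0.
  apply/colP => i; rewrite [RHS]mxE /fisher.
  have [e0 e1 e2] := mx3_mul (fine (Hphi phi b) / b ^+ 4) (fine (Hphi phi b) / (sg * b ^+ 2)) 0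
    (fine (Hphi phi b) / (sg * b ^+ 2)) (fine (Hphi phi b) / sg ^+ 2) 0 0 0 (fine (Mphi phi b) / sg ^+ 2) v.
  have [->|->|->] := ord3P i; [rewrite e0|rewrite e1|rewrite e2]; rewrite v0 v1 v2;
    by field; rewrite ?b_n ?sg_n.
have : v = 0 by rewrite -(mulKmx U v) Fv mulmx0.
by move=> /matrixP/(_ 0 0); rewrite v0 mxE => /eqP; rewrite oner_eq0.
Qed.

Section local_parameter.
Variable u : 'cV[R]_3.
Notation tau := (score_scale u).
Notation kap := (score_loc u).
Notation be := (shift_beta h b (u 0 0)).
Notation sc := (shift_scale h b sg (u 0 0) (u 1 0)).
Notation lo := (shift_loc sg (u 2%:R 0)).

Let rb := rate_beta h0 hc b (u 0 0).
Let rs := @rate_scale R h h0 hc b sg (u 0 0) (u 1 0) b0 sg0.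
Let rl := @rate_loc R sg (u 2%:R 0) sg0.

Lemma integral_score2 : \int[Q]_y (stable_score b tau kap y ^+ 2) = quadf (fisher phi theta) u u.
Proof.
have [dl [K [c E]]] := stable_estimatesP Hnn Hcos b0 b2.
by rewrite fisher_quadf (stable_score_sq Hnn Hcos b0 b2 E HQd).
Qed.

Lemma integral_score : \int[Q]_y stable_score b tau kap y = 0.
Proof.
have [dl [K [c E]]] := stable_estimatesP Hnn Hcos b0 b2.
exact: (stable_score_centered Hnn Hcos b0 b2 E rb rs rl HQd).
Qed.

Let rem n w := u 0 0 * (root n * lnh n)^-1 * sum_b n w.

Let msbq : measurable_fun setT (fun y => stab_b b y / stab b y).
Proof. by apply: measM => //; exact: measV. Qed.

(** Moving the parameter rescales and shifts the standardized increments, which brings the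
    likelihood ratio into the form of [stable_lan]. *)
Let loglik_shift n w : regular_index n -> 0 < be n -> be n < 2 -> 0 < shift_sigma sg (u 1 0) n ->
  loglik phi h X n w (theta + rate h b n *m u) - loglik phi h X n w theta =
  \sum_(0 <= i < n) (- sc n + ln (stab (be n) (expR (- sc n) * (xi n i w - lo n))) - ln (stab b (xi n i w))).
Proof.
move=> /andP[n0 l0] be0 be2 si0; have r0 : root n != 0 by rewrite gt_eqF// sqrtr_gt0 ltr0n.
have [e0 e1 e2] := mx3_mul (root n * lnh n)^-1 0 0 0 (root n)^-1 0 0 0 (root n * h n `^ (1 - b^-1))^-1 u.
have pb : pbeta (theta + rate h b n *m u) = be n.
  by rewrite /pbeta mxE e0 /shift_beta !mul0r !addr0 [u 0 0 / _]mulrC.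
have ps : psigma (theta + rate h b n *m u) = shift_sigma sg (u 1 0) n.
  by rewrite /psigma mxE e1 /shift_sigma !mul0r addr0 add0r [u 1 0 / _]mulrC.
have pg : pgamma (theta + rate h b n *m u) = ga + u 2%:R 0 / (root n * h n `^ (1 - b^-1)).
  by rewrite /pgamma mxE e2 !mul0r !add0r [u 2%:R 0 / _]mulrC.
rewrite !loglikE pb ps pg -sumrB; apply: eq_bigr => i _.
rewrite !phiE ?b0 ?be0//; set D := X _ w - X _ w.
have zE : (shift_sigma sg (u 1 0) n)^-1 * h n `^ (- (be n)^-1) *
    (D - (ga + u 2%:R 0 / (root n * h n `^ (1 - b^-1))) * h n) = expR (- sc n) * (xi n i w - lo n).
  rewrite /scaled_increment /= -/D !powE// /shift_scale opprD expRD expRN lnK ?posrE ?divr_gt0//.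
  have -> : expR ((1 - b^-1) * ln (h n)) = h n * expR (- b^-1 * ln (h n)).
    by rewrite mulrBl mul1r expRD lnK ?posrE// mulNr.
  have -> : expR (- (((be n)^-1 - b^-1) * ln (h n))) =
      expR (- (be n)^-1 * ln (h n)) / expR (- b^-1 * ln (h n)).
    by rewrite -expRN -expRD; congr expR; ring.
  have x0 : expR (- b^-1 * ln (h n)) != 0 by rewrite gt_eqF// expR_gt0.
  have h_n : h n != 0 by rewrite gt_eqF.
  have s_n : shift_sigma sg (u 1 0) n != 0 by rewrite gt_eqF.
  rewrite /shift_loc.
  move: (expR (- b^-1 * ln (h n))) (expR (- (be n)^-1 * ln (h n))) (shift_sigma sg (u 1 0) n) x0 s_n
    => x1 x2 x3 x10 x30.
  by field; rewrite sg_n r0 x10 h_n x30.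
rewrite zE [sg^-1 * _ * _](_ : _ = xi n i w)//.
have sE : - sc n = - ln (shift_sigma sg (u 1 0) n) + ln sg + ((be n)^-1 - b^-1) * lnh n.
  rewrite /shift_scale ln_div ?posrE// lnhE; ring.
have gen (A1 B1 C1 D1 y1 y2 s : R) : - s = A1 + B1 - C1 - D1 ->
    A1 + B1 + y1 - (C1 + D1 + y2) = - s + y1 - y2 by move=> ->; ring.
by apply: gen; rewrite sE; ring.
Qed.

Let near_range : \forall n \near \oo, [/\ regular_index n, 0 < be n, be n < 2 & 0 < shift_sigma sg (u 1 0) n].
Proof.
have cb := @cvg_shift_beta R h h0 hc b (u 0 0); have cs := @cvg_shift_sigma R sg (u 1 0).
near=> n; split; near: n; [exact: near_regular|exact: (cvgr_gt _ cb)|exact: (cvgr_lt _ cb)|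
  exact: (cvgr_gt _ cs)].
Unshelve. all: by end_near. Qed.

Lemma loglik_expansion : little_op1 P (fun n w =>
  loglik phi h X n w (theta + rate h b n *m u) - loglik phi h X n w theta
  - (dotv (score phi h X theta n w) u - 2^-1 * quadf (fisher phi theta) u u)).
Proof.
have [dl [K [c E]]] := stable_estimatesP Hnn Hcos b0 b2.
have lan := stable_lan Hnn Hcos b0 b2 E rb rs rl HQd Hxi.
(* The exact score contains the exponent term, which is absent from [stable_lan]; it is subtracted
   here as negligible. *)
have op : little_op1 P (fun n w => - (u 0 0 * (root n * lnh n)^-1) *
    \sum_(0 <= i < n) (stab_b b (xi n i w) / stab b (xi n i w))).
  have j := integrable_score_beta2 Hnn Hcos b0 b2 E HQd.
  apply: (iid_mean_op1 Hxi (D := fun=> fun y => stab_b b y / stab b y)) => //.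
    by move=> _; exact: (score_beta_centered Hnn Hcos b0 b2 E HQd).
  set v := \int[Q]_y _.
  have l := cvg_inv_ln_inv h0 hc.
  have := seqM (seqC (u 0 0 ^+ 2 * v)) (seqM l l); rewrite !mulr0; apply: seq_eq; near=> n.
  have /andP[n0 l0] : regular_index n by near: n; exact: near_regular.
  have l_n : lnh n != 0 by rewrite gt_eqF.
  have r0 : root n != 0 by rewrite gt_eqF// sqrtr_gt0 ltr0n.
  have nE : n%:R = root n ^+ 2 by rewrite sqr_sqrtr.
  move: r0 nE; set s := root n => r0 ->.
  by field; rewrite l_n r0.
apply: op1_near (op1D lan op); near=> n; apply/funext => w.
have [rn be0 be2 si0] : [/\ regular_index n, 0 < be n, be n < 2 & 0 < shift_sigma sg (u 1 0) n].
  by near: n; exact: near_range.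
rewrite loglik_shift// integral_score2.
have -> : dotv (score phi h X theta n w) u = dotv u (score phi h X theta n w).
  by rewrite /dotv; apply: eq_bigr => i _; rewrite mulrC.
rewrite dotv_score// /sum_b; ring.
Unshelve. all: by end_near. Qed.

Lemma score_charfun (x : R) :
  \int[P]_w cos (x + dotv u (if regular_index n then score phi h X theta n w else 0)) @[n --> \oo] -->
  cos x * expR (- (quadf (fisher phi theta) u u / 2)).
Proof.
have [dl [K [c E]]] := stable_estimatesP Hnn Hcos b0 b2.
have mg : measurable_fun setT (stable_score b tau kap).
  by rewrite /stable_score; apply: measM; [apply: measN; apply: measD; apply: measM => //; exact: meas_cst|exact: measV].
have clt := clt_cos (x := x) Hxi mg (stable_score_bound Hnn Hcos b0 b2 E tau kap) integral_score.
rewrite integral_score2 in clt.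
have jb := integrable_score_beta2 Hnn Hcos b0 b2 E HQd.
have sb n := iid_sum_sq (Hxi n) msbq jb (score_beta_centered Hnn Hcos b0 b2 E HQd).
have key := cos_slutsky (P := P)
  (Y := fun n w => x + \sum_(0 <= i < n) (stable_score b tau kap (xi n i w) * (root n)^-1))
  (Z := rem) _ _ _ _ clt.
apply: seq_eq (key _ _ _ _).
- near=> n; apply: eq_Rintegral => w _.
  have rn : regular_index n by near: n; exact: near_regular.
  by rewrite rn dotv_score// -mulr_suml [_ * (root n)^-1]mulrC addrA.
- move=> n; apply: measD; first exact: meas_cst.
  by apply: (@meas_comp_sum n (fun y => stable_score b tau kap y / root n)); apply: measM => //; exact: meas_cst.
- by move=> n; apply: measM; [exact: meas_cst|exact: (@meas_comp_sum n _ msbq)].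
- near=> n.
  rewrite (_ : (fun w => rem n w ^+ 2) = fun w => (u 0 0 * (root n * lnh n)^-1) ^+ 2 * sum_b n w ^+ 2).
    by apply: RintegrableZ => //; exact: (sb n).1.
  by apply/funext => w; rewrite exprMn.
- set v := \int[Q]_y ((stab_b b y / stab b y) ^+ 2).
  have l := cvg_inv_ln_inv h0 hc.
  have := seqM (seqC (u 0 0 ^+ 2 * v)) (seqM l l); rewrite !mulr0; apply: seq_eq; near=> n.
  have /andP[n0 l0] : regular_index n by near: n; exact: near_regular.
  have l_n : lnh n != 0 by rewrite gt_eqF.
  have r0 : root n != 0 by rewrite gt_eqF// sqrtr_gt0 ltr0n.
  transitivity ((u 0 0 * (root n * lnh n)^-1) ^+ 2 * (n%:R * v)).
    have nE : n%:R = root n ^+ 2 by rewrite sqr_sqrtr.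
    move: r0 nE; set s := root n => r0 ->.
    by field; rewrite l_n r0.
  rewrite -(sb n).2 -RintegralZl//; last exact: (sb n).1.
  by apply: eq_Rintegral => w _; rewrite [RHS]exprMn.
Unshelve. all: by end_near. Qed.

End local_parameter.

Let Hb0 : 0 <= Hb.
Proof. by apply: Rintegral_ge0 => y _; rewrite divr_ge0 ?sqr_ge0// ltW. Qed.

Let Mb0 : 0 <= Mb.
Proof. by apply: Rintegral_ge0 => y _; rewrite divr_ge0 ?sqr_ge0// ltW. Qed.

(** An explicit, degenerate realization of the normal limit: the first two coordinates are multiples
    of one normal variable. *)
Definition score_limit (z : measurableTypeR R * measurableTypeR R) : 'cV[R]_3 :=
  \col_i (if i == 0 then Num.sqrt Hb / b ^+ 2 * z.1 else
          if i == 1 then Num.sqrt Hb / sg * z.1 else Num.sqrt Mb / sg * z.2).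

Let limit_dotv (u : 'cV[R]_3) z : dotv u (score_limit z) =
  (score_scale u * Num.sqrt Hb) * z.1 + (score_loc u * Num.sqrt Mb) * z.2.
Proof.
rewrite /dotv sum3 !mxE /= /score_scale /score_loc; field; by rewrite b_n sg_n.
Qed.

Let limit_trig (u : 'cV[R]_3) :
  \int[normal_pair R]_z cos (dotv u (score_limit z)) = expR (- (quadf (fisher phi theta) u u / 2)) /\
  \int[normal_pair R]_z sin (dotv u (score_limit z)) = 0.
Proof.
have [c s] := normal_pair_trig (score_scale u * Num.sqrt Hb) (score_loc u * Num.sqrt Mb).
rewrite fisher_quadf; split.
- have e1 : (score_scale u * Num.sqrt Hb) ^+ 2 = score_scale u ^+ 2 * Hb.
    by rewrite exprMn sqr_sqrtr.
  have e2 : (score_loc u * Num.sqrt Mb) ^+ 2 = score_loc u ^+ 2 * Mb by rewrite exprMn sqr_sqrtr.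
  rewrite e1 e2 in c; rewrite -c.
  by apply: eq_Rintegral => z _; rewrite limit_dotv.
- by rewrite -s; apply: eq_Rintegral => z _; rewrite limit_dotv.
Qed.

Let meas_limit i : measurable_fun setT (fun z => score_limit z i 0).
Proof.
have m1 (k : R) : measurable_fun setT (fun z : measurableTypeR R * measurableTypeR R => k * z.1).
  by apply: measM; [exact: meas_cst|exact: measurable_fst].
have m2 (k : R) : measurable_fun setT (fun z : measurableTypeR R * measurableTypeR R => k * z.2).
  by apply: measM; [exact: meas_cst|exact: measurable_snd].
have [->|->|->] := ord3P i.
- by rewrite (_ : (fun z => _) = fun z => Num.sqrt Hb / b ^+ 2 * z.1)//; apply/funext => z; rewrite mxE.
- by rewrite (_ : (fun z => _) = fun z => Num.sqrt Hb / sg * z.1)//; apply/funext => z; rewrite mxE.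
- by rewrite (_ : (fun z => _) = fun z => Num.sqrt Mb / sg * z.2)//; apply/funext => z; rewrite mxE.
Qed.

Lemma score_cvg_in_law : cvg_in_law_normal P (score phi h X theta) 0 (fisher phi theta).
Proof.
exists _, _, (normal_pair R), score_limit; split.
  split; first exact: meas_limit.
  move=> u; have [c s] := limit_trig u.
  rewrite /charfun /expc; apply: f_equal2.
  - transitivity (\int[normal_pair R]_z cos (dotv u (score_limit z))).
      by apply: eq_Rintegral => z _; rewrite mul1r.
    rewrite c (_ : dotv 0 u = 0) ?cos0 ?mulr1; first by congr expR; rewrite mulrC.
    by rewrite /dotv big1// => i _; rewrite mxE mul0r.
  - transitivity (\int[normal_pair R]_z sin (dotv u (score_limit z))).
      by apply: eq_Rintegral => z _; rewrite mul1r.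
    rewrite s (_ : dotv 0 u = 0) ?sin0 ?mulr0//.
    by rewrite /dotv big1// => i _; rewrite mxE mul0r.
split; first by near=> n; move=> i; apply: meas_score; near: n; exact: near_regular.
move=> f cf [C fC].
(* The value 0 for the finitely many irregular n gives the measurability at every n that
   [levy_continuity] requires. *)
pose S n w := if regular_index n then score phi h X theta n w else 0.
have mS n i : measurable_fun setT (fun w => S n w i 0).
  rewrite /S; have [rn|rn] := boolP (regular_index n); first exact: meas_score.
  by rewrite (_ : (fun w => _) = fun=> 0); [exact: meas_cst|apply/funext => w; rewrite mxE].
have cc (u : 'cV[R]_3) (x : R) : \int[P]_w cos (x + dotv u (S n w)) @[n --> \oo] -->
    \int[normal_pair R]_z cos (x + dotv u (score_limit z)).
  have [c s] := limit_trig u.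
  rewrite (_ : \int[normal_pair R]_z _ = cos x * expR (- (quadf (fisher phi theta) u u / 2))).
    exact: score_charfun.
  have md : measurable_fun setT (fun z => dotv u (score_limit z)).
    by apply: measurable_sum => i; apply: measM; [exact: meas_cst|exact: meas_limit].
  transitivity (\int[normal_pair R]_z (cos x * cos (dotv u (score_limit z)) -
      sin x * sin (dotv u (score_limit z)))).
    by apply: eq_Rintegral => z _; rewrite cosD.
  have bi (F : measurableTypeR R * measurableTypeR R -> R) : measurable_fun setT F ->
      (forall z, `|F z| <= 1) -> (normal_pair R).-integrable setT (EFin \o F).
    by move=> *; exact: (@bounded_integrable _ _ _ (normal_pair R) F 1).
  have jc : (normal_pair R).-integrable setT (EFin \o (fun z => cos (dotv u (score_limit z)))).
    by apply: bi => [|z]; [exact: meas_cos|exact: norm_cos_le1].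
  have js : (normal_pair R).-integrable setT (EFin \o (fun z => sin (dotv u (score_limit z)))).
    by apply: bi => [|z]; [exact: meas_sin|exact: norm_sin_le1].
  rewrite RintegralB//; try exact: RintegrableZ.
  by rewrite !RintegralZl// c s mulr0 subr0.
apply: seq_eq (levy_continuity mS meas_limit cc cf fC).
near=> n; apply: eq_Rintegral => w _; rewrite /S.
by have -> : regular_index n by near: n; exact: near_regular.
Unshelve. all: by end_near. Qed.

End likelihood.

Unset Implicit Arguments.

Theorem theorem3p4 (R : realType) (d : measure_display) (T : measurableType d)
  (Theta : set 'cV[R]_3) (P : 'cV[R]_3 -> probability T R) (X : R -> T -> R)
  (phi : R -> R -> R) (h : nat -> R)
  (hTheta : parameter_space Theta)
  (hX : forall theta, Theta theta ->
     stable_levy_with_drift (P theta) (pbeta theta) (psigma theta)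
       (pgamma theta) X)
  (hphi : forall beta, 0 < beta < 2 -> stable_density beta (phi beta))
  (h_gt0 : forall n, 0 < h n)
  (h_cvg0 : h n @[n --> \oo] --> 0)
  (nh_liminf : (0 < limn_einf (fun n => (n%:R * h n)%:E))%E) :
  forall theta, Theta theta ->
  [/\ forall u : 'cV[R]_3,
        little_op1 (P theta) (fun n w =>
          loglik phi h X n w (theta + rate h (pbeta theta) n *m u)
          - loglik phi h X n w theta
          - (dotv (score phi h X theta n w) u
             - 2^-1 * quadf (fisher phi theta) u u)),
      cvg_in_law_normal (P theta) (score phi h X theta) 0 (fisher phi theta),
      Hphi phi (pbeta theta) \is a fin_num,
      Mphi phi (pbeta theta) \is a fin_num &
      fisher phi theta \notin unitmx].
Proof.
move=> theta hth; have [_ _ _ sub] := hTheta.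
have [b02 sg0] := sub _ (subset_closure hth); have /andP[b0 b2] := b02.
have [phiE Hnn Hcos] := stable_family hphi.
have [_ [Q HQd HQ]] := stable_densityP b0 b2 (hphi _ b02).
rewrite phiE// in HQd.
split.
- by move=> u; exact: (loglik_expansion b0 b2 sg0 h_gt0 h_cvg0 phiE Hnn Hcos (hX _ hth) HQd HQ).
- exact: (score_cvg_in_law b0 b2 sg0 h_gt0 h_cvg0 phiE Hnn Hcos (hX _ hth) HQd HQ).
- exact: (Hphi_fin b0 b2 phiE Hnn Hcos).1.
- exact: (Mphi_fin b0 b2 phiE Hnn Hcos).1.
- exact: fisher_singular.
Qed.
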